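(* Let $n\geqslant 2$ be an integer, $s\in(0,1)$, and $\alpha\in(\alpha_*,n)$, where $$\alpha_*=\alpha_*(n,s):=\max\left\{0,\frac{n(1-6s)+8s^2}{2n-1-2s}\right\},$$ and let $p_*=\frac{n+\alpha}{n-2s}$. There exists $T_0<\infty$ such that for every $T\geqslant T_0$ the equation $$(-\Delta)^s u=\big(\mathcal{R}_\alpha*u^{p_*}\big)u^{p_*-1}\quad\text{in }\mathbb{R}^n\setminus\{0\}$$ admits a positive solution of the form $$u(x)=|x|^{-\frac{n-2s}{2}}v(\ln|x|),\qquad v(t+T)=v(t)>0\ \text{ for all } t\in\mathbb{R}.$$ Moreover, for all sufficiently large $T$, these solutions are nonconstant Delaunay profiles, i.e. the $T$-periodic function $v$ is nonconstant.
   Context: Here $\mathcal{R}_\alpha(x)=|x|^{\alpha-n}$, so $(\mathcal{R}_\alpha*u^{p_*})(x)=\int_{\mathbb{R}^n}|x-y|^{\alpha-n}u(y)^{p_*}\,dy$. The fractional Laplacian is $$(-\Delta)^{s}u(x)=\kappa_{n,s}\,\mathrm{P.V.}\int_{\mathbb{R}^{n}}\frac{u(x)-u(x+y)}{|y|^{n+2s}}\,dy,\qquad \kappa_{n,s}=\pi^{-n/2}2^{2s}\frac{\Gamma(\frac{n+2s}{2})}{\Gamma(1-s)}s.$$ Solutions are understood as functions $u\in \mathcal{C}^{1,1}_{\mathrm{loc}}(\mathbb{R}^{n}\setminus\{0\})\cap L_{s}(\mathbb{R}^{n})\cap L^{1}_{\mathrm{loc}}(\mathbb{R}^{n})$ satisfying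 the equation pointwise in $\mathbb{R}^n\setminus\{0\}$, where $L_s(\mathbb{R}^n)=\{u:\int_{\mathbb{R}^n}\frac{|u(y)|}{1+|y|^{n+2s}}\,dy<+\infty\}$. *)

(* Defs.v *)
From HB Require Import structures.
From mathcomp Require Import all_boot all_order all_algebra.
From mathcomp Require Import all_classical all_reals all_analysis.

Set Implicit Arguments.
Unset Strict Implicit.
Unset Printing Implicit Defensive.

Import Order.TTheory GRing.Theory Num.Theory.
Import numFieldNormedType.Exports.

Local Open Scope classical_set_scope.
Local Open Scope ring_scope.

Section measurable_rV.
Context {R : realType}.

Definition coor_rV n (i : 'I_n) (x : 'rV[R]_n) : R := x ord0 i.

Let rV_set0 n : g_sigma_preimage (@coor_rV n) set0.
Proof. exact: sigma_algebra0. Qed.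

Let rV_setC n A :
  g_sigma_preimage (@coor_rV n) A -> g_sigma_preimage (@coor_rV n) (~` A).
Proof. exact: sigma_algebraC. Qed.

Let rV_bigcup n (F : (set 'rV[R]_n)^nat) :
  (forall i, g_sigma_preimage (@coor_rV n) (F i)) ->
  g_sigma_preimage (@coor_rV n) (\bigcup_i F i).
Proof. exact: sigma_algebra_bigcup. Qed.

(* The sigma-algebra generated by the coordinates, i.e. the Borel one. *)
HB.instance Definition _ n :=
  @isMeasurable.Build (measure_tuple_display default_measure_display) 'rV[R]_n
    (g_sigma_preimage (@coor_rV n)) (@rV_set0 n) (@rV_setC n) (@rV_bigcup n).

Lemma measurable_coor_rV n (i : 'I_n) : measurable_fun setT (@coor_rV n i).
Proof.
move=> _ Y mY; rewrite setTI; apply: sub_sigma_algebra => /=.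
rewrite -bigcup_seq/=; exists i => /=; first by rewrite mem_index_enum.
by exists Y => //; rewrite setTI.
Qed.

Lemma measurable_fun_rVP d (T : measurableType d) n (f : T -> 'rV[R]_n) :
  (forall i, measurable_fun setT (@coor_rV n i \o f)) -> measurable_fun setT f.
Proof.
move=> mf; suff H : preimage_set_system setT f (g_sigma_preimage (@coor_rV n))
    `<=` measurable by move=> _ A mA; apply: H; exists A.
rewrite -g_sigma_preimage_comp.
apply: smallest_sub; first exact: sigma_algebra_measurable.
move=> A; rewrite -bigcup_seq => -[i _ [B mB <-]].
exact: mf.
Qed.

End measurable_rV.

Section lebesgue_rV.
Context {R : realType}.

Definition cons_rV n (p : measurableTypeR R * 'rV[R]_n) : 'rV[R]_n.+1 :=
  row_mx (p.1 : R)%:M p.2 : 'rV[R]_(1 + n).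

Definition uncons_rV n (x : 'rV[R]_n.+1) : measurableTypeR R * 'rV[R]_n :=
  (x ord0 ord0, rsubmx (x : 'rV[R]_(1 + n))).

Lemma cons_rV0 n (p : measurableTypeR R * 'rV[R]_n) :
  cons_rV p ord0 ord0 = p.1.
Proof.
rewrite /cons_rV (_ : ord0 = lshift n (ord0 : 'I_1)); last exact/val_inj.
by rewrite (@row_mxEl _ 1 1 n) ord1 mxE eqxx mulr1n.
Qed.

Lemma cons_rVS n (p : measurableTypeR R * 'rV[R]_n) j :
  cons_rV p ord0 (lift ord0 j) = p.2 ord0 j.
Proof.
rewrite /cons_rV (_ : lift ord0 j = rshift 1 j); last exact/val_inj.
exact: (@row_mxEr _ 1 1 n).
Qed.

Lemma uncons_rVK n : cancel (@uncons_rV n) (@cons_rV n).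
Proof.
move=> x; apply/rowP => i; case: (unliftP ord0 i) => [j ->|->].
  by rewrite cons_rVS mxE; congr (x _ _); exact/val_inj.
by rewrite cons_rV0.
Qed.

Lemma cons_rVK n : cancel (@cons_rV n) (@uncons_rV n).
Proof.
move=> [a x]; rewrite /uncons_rV cons_rV0; congr pair.
exact: (@row_mxKr _ 1 1 n).
Qed.

Lemma measurable_cons_rV n : measurable_fun setT (@cons_rV n).
Proof.
apply: measurable_fun_rVP => i; case: (unliftP ord0 i) => [j ->|->].
  rewrite (_ : _ \o _ = coor_rV j \o snd).
    apply: measurableT_comp; first exact: measurable_coor_rV.
    exact: measurable_snd.
  by apply/funext => p; exact: cons_rVS.
rewrite (_ : _ \o _ = fst); first exact: measurable_fst.
by apply/funext => p; exact: cons_rV0.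
Qed.

Lemma measurable_uncons_rV n : measurable_fun setT (@uncons_rV n).
Proof.
apply: (@measurable_fun_pair _ _ _ _ (measurableTypeR R)).
  exact: (@measurable_coor_rV R n.+1 ord0).
apply: measurable_fun_rVP => j.
rewrite (_ : _ \o _ = @coor_rV R n.+1 (rshift 1 j)).
  exact: measurable_coor_rV.
by apply/funext => x; rewrite /= /coor_rV mxE.
Qed.

Section step.
Context n (mu : {sigma_finite_measure set 'rV[R]_n -> \bar R}).

Definition cons_measure : set 'rV[R]_n.+1 -> \bar R :=
  pushforward (lebesgue_measure \x mu)%E (@cons_rV n).

Let mcons : measurable_fun setT (@cons_rV n).
Proof. exact: measurable_cons_rV. Qed.

Let cons_measure0 : cons_measure set0 = 0%E.
Proof. exact: measure0. Qed.

Let cons_measure_ge0 A : (0 <= cons_measure A)%E.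
Proof. exact: measure_ge0. Qed.

Let cons_measure_sigma_additive : semi_sigma_additive cons_measure.
Proof. exact: measure_semi_sigma_additive. Qed.

HB.instance Definition _ := isMeasure.Build _ _ _ cons_measure
  cons_measure0 cons_measure_ge0 cons_measure_sigma_additive.

Let cons_measure_sigma_finite : sigma_finite setT cons_measure.
Proof.
have /sigma_finiteP[F [TF ndF Foo]] := sigma_finiteT (@lebesgue_measure R).
have /sigma_finiteP[G [TG ndG Goo]] := sigma_finiteT mu.
exists (fun k => @uncons_rV n @^-1` (F k `*` G k)).
  rewrite -preimage_bigcup (_ : \bigcup_k _ = setT) ?preimage_setT//.
  apply/seteqP; split => // -[a x] _.
  have [k _ Fka] : (\bigcup_k F k) a by rewrite -TF.
  have [l _ Glx] : (\bigcup_k G k) x by rewrite -TG.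
  exists (maxn k l) => //; split => /=.
    by move: a Fka; exact/subsetPset/ndF/leq_maxl.
  by move: x Glx; exact/subsetPset/ndG/leq_maxr.
move=> k; have [? ?] := Foo k; have [? ?] := Goo k; split.
  rewrite -[X in measurable X]setTI.
  by apply: measurable_uncons_rV => //; exact: measurableX.
rewrite /cons_measure /pushforward -comp_preimage.
rewrite (_ : _ \o _ = id); last exact/funext/cons_rVK.
by rewrite preimage_id product_measure1E// lte_mul_pinfty// ge0_fin_numE.
Qed.

HB.instance Definition _ := Measure_isSigmaFinite.Build _ _ _ cons_measure
  cons_measure_sigma_finite.

End step.

Fixpoint lebesgue_rV n : {sigma_finite_measure set 'rV[R]_n -> \bar R} :=
  if n is m.+1 then cons_measure (lebesgue_rV m) else \d_(0 : 'rV[R]_0).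

Lemma lebesgue_rV_box n (A : 'I_n -> set R) :
  (forall i, measurable (A i)) ->
  lebesgue_rV n [set x | forall i, A i (x ord0 i)] =
    (\prod_(i < n) lebesgue_measure (A i))%E.
Proof.
elim: n A => [|n IH] A mA.
  rewrite big_ord0 /= diracE mem_set//= => -[] //.
rewrite big_ord_recl -IH//= /cons_measure /pushforward -product_measure1E//.
  congr (_ _); apply/seteqP; split => [p /= H|p [/= H0 HS] i].
    split => [|i] /=; first by rewrite -cons_rV0.
    by rewrite -cons_rVS.
  by case: (unliftP ord0 i) => [j ->|->]; rewrite ?cons_rVS ?cons_rV0.
  exact: mA.
rewrite [X in measurable X](_ : _ = \bigcap_(i in [set: 'I_n])
    (@coor_rV R n i @^-1` A (lift ord0 i))).
  apply: fin_bigcap_measurable => // i _; rewrite -[X in measurable X]setTI.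
  exact: measurable_coor_rV.
by apply/seteqP; split => [x /= H i _|x /= H i]; exact: H.
Qed.

End lebesgue_rV.

Section equation.
Context {R : realType}.

(* The library norm on 'rV[R]_n is the sup norm; this is the Euclidean one. *)
Definition enorm n (x : 'rV[R]_n) : R :=
  Num.sqrt (\sum_(i < n) x ord0 i ^+ 2).

Definition Gamma (x : R) : R :=
  \int[lebesgue_measure]_(t in `]0, +oo[) (t `^ (x - 1) * expR (- t)).

Definition kappa n (s : R) : R :=
  pi `^ (- (n%:R / 2)) * 2 `^ (2 * s)
    * (Gamma ((n%:R + 2 * s) / 2) / Gamma (1 - s)) * s.

Definition frac_laplacian_trunc n (s : R) (u : 'rV[R]_n -> R) (x : 'rV[R]_n)
    (e : R) : \bar R :=
  ((kappa n s)%:E *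
   \int[lebesgue_rV n]_(y in [set y | (e < enorm y)%R])
     ((u x - u (x + y)) / enorm y `^ (n%:R + 2 * s))%:E)%E.

(* The principal value exists, and (-Delta)^s u (x) = l. *)
Definition is_frac_laplacian n (s : R) (u : 'rV[R]_n -> R) (x : 'rV[R]_n)
    (l : R) : Prop :=
  frac_laplacian_trunc s u x e @[e --> 0^'+] --> l%:E.

Definition riesz_potential n (alpha : R) (f : 'rV[R]_n -> R) (x : 'rV[R]_n)
    : \bar R :=
  (\int[lebesgue_rV n]_y (enorm (x - y) `^ (alpha - n%:R) * f y)%:E)%E.

Definition grad n (u : 'rV[R]_n -> R) (x : 'rV[R]_n) : 'rV[R]_n :=
  \row_i 'D_(delta_mx ord0 i) u x.

Definition C11_loc n (Omega : set 'rV[R]_n) (u : 'rV[R]_n -> R) : Prop :=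
  (forall x, Omega x -> differentiable u x) /\
  (forall x, Omega x ->
     exists2 U, nbhs x U & [lipschitz grad u y | y in U]).

Definition in_L n (s : R) (u : 'rV[R]_n -> R) : Prop :=
  (lebesgue_rV n).-integrable setT
    (fun y => (`|u y| / (1 + enorm y `^ (n%:R + 2 * s)))%:E).

Definition L1_loc n (u : 'rV[R]_n -> R) : Prop :=
  forall K : set 'rV[R]_n, compact K ->
    (lebesgue_rV n).-integrable K (EFin \o u).

Definition p_star n (s alpha : R) : R := (n%:R + alpha) / (n%:R - 2 * s).

Definition alpha_star n (s : R) : R :=
  Num.max 0 ((n%:R * (1 - 6 * s) + 8 * s ^+ 2) / (2 * n%:R - 1 - 2 * s)).

Definition hartree_solution n (s alpha : R) (u : 'rV[R]_n -> R) : Prop :=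
  [/\ C11_loc [set x | x != 0] u, in_L s u, L1_loc u &
    forall x : 'rV[R]_n, x != 0 ->
      let I := riesz_potential alpha (fun y => u y `^ p_star n s alpha) x in
      I \is a fin_num /\
      is_frac_laplacian s u x (fine I * u x `^ (p_star n s alpha - 1))].

End equation.

(* Main.v *)
(* In logarithmic polar coordinates u(x) = |x|^(-(n-2s)/2) v(ln |x|), the Riesz
   potentials of order alpha and 2s become convolutions with even kernels H and G
   on the line, and the equation becomes N v = G * F(v), F(v) = (H * v^p) v^(p-1),
   up to a constant N > 0 that is scaled away at the end.
   Both kernels are positive definite, being compositions of a kernel with itself.
   Hence the map psi -> F(G * psi), normalised to <psi, G * psi> = 1 over a period,
   increases the energy <v^p, H * v^p> of v = G * psi; Young's inequality with the
   subcritical singularities of H and G bounds the iterates above and below, and a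
   limit along an ultrafilter is a periodic solution whose N dominates the energy
   of a fixed bump, uniformly in T. For a constant v that normalisation forces N
   to tend to 0 as T grows, so v is nonconstant for large T.
   Back in R^n, the truncated fractional Laplacians of |x|^(2s-n) are approximate
   identities up to a constant c > 0, so their values on the Riesz potential of
   order 2s of f converge to c f wherever f is Lipschitz and u has bounded second
   difference quotients. *)
From HB Require Import structures.
Require Import Defs.
From mathcomp Require Import all_boot all_order all_algebra.
From mathcomp Require Import all_classical all_reals all_analysis.
From mathcomp Require Import measurable_realfun ring lra zify.

Set Implicit Arguments.
Unset Strict Implicit.
Unset Printing Implicit Defensive.

Import Order.TTheory GRing.Theory Num.Theory.
Import numFieldNormedType.Exports.

Local Open Scope classical_set_scope.
Local Open Scope ring_scope.

(** The iteration acts on psi and not on v = G * psi: the form <psi, G * psi> is defined by the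
    kernel alone, so no fractional Sobolev space enters. A square root g of G turns it into an L2
    product, hence Cauchy-Schwarz. If N is the norm of F(v), one step raises the energy E by at
    least 2p(N - E). As E is bounded, N - E tends to 0, and so does 1 - <psi', G * psi> = 1 - E/N.
    So consecutive iterates share their limit, which is what makes it a fixed point. Only the order
    of the singularity of a kernel at 0 is used. Exponents are split between an L^m bound and the
    sup norm, leaving a power less than one of the latter. Regularity comes from splitting a kernel
    into a smooth part and a part small in L1, whose contribution is absorbed. The constant c of the
    last step is never computed. It is the limit of the integral of a truncated Laplacian of
    |x|^(2s-n) over large balls. The limit exists because one potential with bounded second
    difference quotients is already known, and it is positive because the potential of a ball is
    largest at the centre. *)

Local Notation mfunT := (measurable_fun setT).

(** * Lebesgue measure on R^n *)

Section affine1.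
Context {R : realType}.
Local Notation mu := (@lebesgue_measure R).

Lemma measurable_affine (a b : R) :
  measurable_fun [set: measurableTypeR R] (fun x : measurableTypeR R => a * x + b : measurableTypeR R).
Proof.
apply: measurable_funD => //; apply: measurable_funM => //.
Qed.

Lemma lebesgue_affine (a b : R) (A : set (measurableTypeR R)) : 0 < a -> measurable A ->
  mu A = (a%:E * mu ((fun x : R => (a * x + b)%R) @^-1` A))%E.
Proof.
move=> a0 mA.
pose m := (fun x : measurableTypeR R => (a * x + b)%R : measurableTypeR R).
have mm : mfunT m := measurable_affine a b.
pose nu0 := (pushforward mu m : {measure set (measurableTypeR R) -> \bar R}).
pose nu : {measure set (measurableTypeR R) -> \bar R} := mscale (NngNum (ltW a0)) (nu0 mm).
change (mu A = nu A); apply: lebesgue_measure_unique => //.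
move=> X [[u v] /= uv <-].
have pre : m @^-1` `]u, v]%classic = `](u - b) / a, (v - b) / a]%classic.
  apply/seteqP; split => x /=; rewrite !in_itv/= /m/=.
    by rewrite ltr_pdivrMr// ler_pdivlMr// ltrBlDr lerBrDr (mulrC x).
  by rewrite ltr_pdivrMr// ler_pdivlMr// ltrBlDr lerBrDr (mulrC x).
rewrite /nu/= /mscale/= /pushforward/= pre.
rewrite !lebesgue_measure_itv/= !lte_fin ltr_pM2r ?invr_gt0// ltrD2r.
case: ifPn => _; last by rewrite mule0.
by rewrite -!EFinB -EFinM; congr (_%:E); field; rewrite gt_eqF.
Qed.

Lemma ge0_integral_affine (a b : R) (f : R -> \bar R) : 0 < a ->
  mfunT f -> (forall x, 0 <= f x)%E ->
  (\int[mu]_x f x = a%:E * \int[mu]_x f (a * x + b)%R)%E.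
Proof.
move=> a0 mf f0.
pose m := (fun x : measurableTypeR R => (a * x + b)%R : measurableTypeR R).
have mm : mfunT m := measurable_affine a b.
pose nu0 := (pushforward mu m : {measure set (measurableTypeR R) -> \bar R}).
pose nu : {measure set (measurableTypeR R) -> \bar R} := mscale (NngNum (ltW a0)) (nu0 mm).
transitivity (\int[nu]_x f x)%E.
  by apply: eq_measure_integral => A mA _; exact: lebesgue_affine.
rewrite ge0_integral_mscale//= ge0_integral_pushforward//=.
Qed.

Lemma ge0_integral_opp (f : R -> \bar R) :
  mfunT f -> (forall x, 0 <= f x)%E ->
  (\int[mu]_x f x = \int[mu]_x f (- x)%R)%E.
Proof.
move=> mf f0.
pose m := (fun x : measurableTypeR R => (- x)%R : measurableTypeR R).
have mm : mfunT m by exact: oppr_measurable.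
transitivity (\int[pushforward mu m]_x f x)%E; last first.
  by rewrite ge0_integral_pushforward.
apply: eq_measure_integral => A mA _.
rewrite -[LHS]lebesgue_measureN//; congr (mu _).
Qed.

Lemma ge0_integral_shift (b : R) (f : R -> \bar R) :
  mfunT f -> (forall x, 0 <= f x)%E ->
  (\int[mu]_x f (x + b)%R = \int[mu]_x f x)%E.
Proof.
move=> mf f0; rewrite [RHS](@ge0_integral_affine 1 b)// mul1e.
by apply: eq_integral => x _; rewrite mul1r.
Qed.

End affine1.

Section rV_integral.
Context {R : realType}.
Local Notation mu := (@lebesgue_measure R).
Local Notation Lb n := (@lebesgue_rV R n).

Lemma ge0_integral_cons n (f : 'rV[R]_n.+1 -> \bar R) :
  mfunT f -> (forall x, 0 <= f x)%E ->
  (\int[Lb n.+1]_x f x = \int[mu]_a \int[Lb n]_x f (cons_rV (a, x)))%E.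
Proof.
move=> mf f0; rewrite /= ge0_integral_pushforward//=; last exact: measurable_cons_rV.
rewrite fubini_tonelli1//.
by apply: measurableT_comp => //; exact: measurable_cons_rV.
Qed.

Lemma measurable_cons_slice n (f : 'rV[R]_n.+1 -> \bar R) (a : R) :
  mfunT f -> mfunT (fun x => f (cons_rV (a, x))).
Proof.
move=> mf; apply: (measurableT_comp (f := f)) => //.
apply: (measurableT_comp (@measurable_cons_rV R n)).
by apply: measurable_fun_pair => //; exact: measurable_cst.
Qed.

Lemma measurable_cons_int n (f : 'rV[R]_n.+1 -> \bar R) :
  mfunT f -> (forall x, 0 <= f x)%E ->
  measurable_fun [set: measurableTypeR R] (fun a : measurableTypeR R => \int[Lb n]_x f (cons_rV (a, x)))%E.
Proof.
move=> mf f0.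
apply: (measurable_fun_fubini_tonelli_F (fun p : measurableTypeR R * 'rV[R]_n => f (cons_rV p))) => //.
by apply: measurableT_comp => //; exact: measurable_cons_rV.
Qed.

Lemma measurable_coord n (i : 'I_n) : mfunT (fun x : 'rV[R]_n => x ord0 i).
Proof. exact: measurable_coor_rV. Qed.

Lemma measurable_rV d (T : measurableType d) n (f : T -> 'rV[R]_n) :
  (forall i, mfunT (fun x => f x ord0 i)) -> mfunT f.
Proof. by move=> H; apply: measurable_fun_rVP. Qed.

Lemma measurable_coord_comp d (T : measurableType d) n (f : T -> 'rV[R]_n) i :
  mfunT f -> mfunT (fun x => f x ord0 i).
Proof. by move=> mf; have := measurableT_comp (measurable_coor_rV i) mf; exact. Qed.

Lemma measurable_rVD d (T : measurableType d) n (f g : T -> 'rV[R]_n) :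
  mfunT f -> mfunT g -> mfunT (fun x => f x + g x).
Proof.
move=> mf mg; apply: measurable_rV => i; under eq_fun do rewrite mxE.
by apply: measurable_funD; exact: measurable_coord_comp.
Qed.

Lemma measurable_rVZ d (T : measurableType d) n (a : T -> R) (g : T -> 'rV[R]_n) :
  mfunT a -> mfunT g -> mfunT (fun x => a x *: g x).
Proof.
move=> mf mg; apply: measurable_rV => i; under eq_fun do rewrite mxE.
by apply: measurable_funM => //; exact: measurable_coord_comp.
Qed.

Lemma measurable_rVN d (T : measurableType d) n (g : T -> 'rV[R]_n) :
  mfunT g -> mfunT (fun x => - g x).
Proof.
move=> mg; under eq_fun do rewrite -scaleN1r.
exact: measurable_rVZ.
Qed.

Lemma measurable_rVB d (T : measurableType d) n (f g : T -> 'rV[R]_n) :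
  mfunT f -> mfunT g -> mfunT (fun x => f x - g x).
Proof. by move=> mf mg; apply: measurable_rVD => //; exact: measurable_rVN. Qed.

Lemma enorm_ge0 n (x : 'rV[R]_n) : 0 <= enorm x.
Proof. exact: sqrtr_ge0. Qed.

Lemma measurable_enorm n : mfunT (@enorm R n).
Proof.
rewrite /enorm; apply: (@measurableT_comp _ _ _ _ _ _ (@Num.sqrt R)).
  exact: continuous_measurable_fun (@sqrt_continuous R).
apply: measurable_sum => i; apply: measurable_funX; exact: measurable_coord.
Qed.

Lemma measurable_enorm_comp d (T : measurableType d) n (f : T -> 'rV[R]_n) :
  mfunT f -> mfunT (fun x => enorm (f x)).
Proof. by move=> mf; exact: (measurableT_comp (@measurable_enorm n)). Qed.

Lemma cons_rVD n (a b : R) (x y : 'rV[R]_n) :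
  cons_rV (a, x) + cons_rV (b, y) = cons_rV (a + b, x + y).
Proof.
apply/rowP => i; rewrite mxE; case: (unliftP ord0 i) => [j ->|->].
  by rewrite !cons_rVS/= mxE.
by rewrite !cons_rV0.
Qed.

Lemma cons_rVZ n (c a : R) (x : 'rV[R]_n) :
  c *: cons_rV (a, x) = cons_rV (c * a, c *: x).
Proof.
apply/rowP => i; rewrite mxE; case: (unliftP ord0 i) => [j ->|->].
  by rewrite !cons_rVS/= mxE.
by rewrite !cons_rV0.
Qed.

Lemma ge0_integral_rV0 (f : 'rV[R]_0 -> \bar R) : mfunT f ->
  (forall x, 0 <= f x)%E -> (\int[Lb 0]_x f x = f 0%R)%E.
Proof. by move=> mf f0; rewrite /= integral_dirac// diracT mul1e. Qed.

Lemma ge0_integral_rV_shift n (b : 'rV[R]_n) (f : 'rV[R]_n -> \bar R) :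
  mfunT f -> (forall x, 0 <= f x)%E ->
  (\int[Lb n]_x f (x + b)%R = \int[Lb n]_x f x)%E.
Proof.
elim: n b f => [b f mf f0|n IH b f mf f0].
  by apply: eq_integral => x _; congr f; apply/rowP; case.
have mg : mfunT (fun x : 'rV[R]_n.+1 => f (x + b)%R).
  apply: measurableT_comp => //; apply: measurable_rVD => //; exact: measurable_cst.
rewrite (ge0_integral_cons mg) => [|x]; last exact: f0.
rewrite (ge0_integral_cons mf f0).
pose F a := (\int[Lb n]_x f (cons_rV (a, x)))%E.
rewrite -[RHS](ge0_integral_shift (b ord0 ord0) (f := F)); first last.
- by move=> a; exact: integral_ge0.
- exact: (measurable_cons_int mf f0).
apply: eq_integral => a _; rewrite /F.
rewrite -(IH (uncons_rV b).2 (fun x => f (cons_rV ((a + b ord0 ord0)%R, x))))//; last exact: measurable_cons_slice.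
apply: eq_integral => x _; congr f.
rewrite -[X in _ + X = _](uncons_rVK b).
by rewrite cons_rVD.
Qed.

Lemma ge0_integral_rV_scale n (c : R) (f : 'rV[R]_n -> \bar R) : 0 < c ->
  mfunT f -> (forall x, 0 <= f x)%E ->
  (\int[Lb n]_x f x = (c ^+ n)%:E * \int[Lb n]_x f (c *: x))%E.
Proof.
move=> c0; elim: n f => [f mf f0|n IH f mf f0].
  by rewrite expr0 mul1e; apply: eq_integral => x _; congr f; apply/rowP; case.
have mg : mfunT (fun x : 'rV[R]_n.+1 => f (c *: x)%R).
  by apply: measurableT_comp => //; apply: measurable_rVZ => //; exact: measurable_cst.
rewrite (ge0_integral_cons mf f0) (ge0_integral_cons mg) => [|x]; last exact: f0.
rewrite [LHS](ge0_integral_affine 0 c0); last 2 first.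
- exact: (measurable_cons_int mf f0).
- by move=> a; exact: integral_ge0.
rewrite exprS EFinM -muleA; congr (_ * _)%E.
rewrite -ge0_integralZl; last 4 first.
- exact: measurableT.
- by apply: (measurable_cons_int mg) => x; exact: f0.
- by move=> a _; exact: integral_ge0.
- by rewrite lee_fin exprn_ge0// ltW.
apply: eq_integral => a _; rewrite addr0 IH//; last exact: measurable_cons_slice.
by congr (_ * _)%E; apply: eq_integral => x _; rewrite cons_rVZ.
Qed.

Lemma ge0_integral_rV_opp n (f : 'rV[R]_n -> \bar R) :
  mfunT f -> (forall x, 0 <= f x)%E ->
  (\int[Lb n]_x f (- x)%R = \int[Lb n]_x f x)%E.
Proof.
elim: n f => [f mf f0|n IH f mf f0].
  by apply: eq_integral => x _; congr f; apply/rowP; case.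
have mg : mfunT (fun x : 'rV[R]_n.+1 => f (- x)%R).
  by apply: measurableT_comp => //; exact: measurable_rVN.
rewrite (ge0_integral_cons mg) => [|x]; last exact: f0.
rewrite (ge0_integral_cons mf f0) [RHS]ge0_integral_opp; last 2 first.
- exact: (measurable_cons_int mf f0).
- by move=> a; exact: integral_ge0.
apply: eq_integral => a _; rewrite -(IH (fun x => f (cons_rV ((- a)%R, x))))//; last exact: measurable_cons_slice.
by apply: eq_integral => x _; rewrite -[X in f X]scaleN1r cons_rVZ mulN1r scaleN1r.
Qed.

(** A shear translates every line parallel to the first axis, so Tonelli and translation invariance
    suffice. Rotations are assembled from shears below, which avoids a change of variables with
    determinants. *)
Lemma ge0_integral_shear0 n (w : 'rV[R]_n -> R) (f : 'rV[R]_n.+1 -> \bar R) :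
  mfunT w ->
  mfunT f -> (forall x, 0 <= f x)%E ->
  (\int[Lb n.+1]_x f (x + cons_rV (w (uncons_rV x).2, 0))%R = \int[Lb n.+1]_x f x)%E.
Proof.
move=> mw mf f0.
have mc : mfunT (fun p : measurableTypeR R * 'rV[R]_n => f (cons_rV p)).
  by apply: measurableT_comp => //; exact: measurable_cons_rV.
have mwu : mfunT (fun x : 'rV[R]_n.+1 => w (uncons_rV x).2).
  apply: (measurableT_comp mw); apply: (measurableT_comp measurable_snd).
  exact: measurable_uncons_rV.
have ms : mfunT (fun x : 'rV[R]_n.+1 => x + cons_rV (w (uncons_rV x).2, 0%R)).
  apply: measurable_rVD => //.
  apply: (measurableT_comp (@measurable_cons_rV R n)).
  by apply: (@measurable_fun_pair _ _ _ _ (measurableTypeR R)) => //; exact: measurable_cst.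
have mg : mfunT (fun x : 'rV[R]_n.+1 => f (x + cons_rV (w (uncons_rV x).2, 0))%R).
  exact: measurableT_comp.
rewrite (ge0_integral_cons mg) => [|x]; last exact: f0.
rewrite (ge0_integral_cons mf f0) [RHS](fubini_tonelli _ mc); last by move=> p; exact: f0.
have mc2 : mfunT (fun p : measurableTypeR R * 'rV[R]_n => f (cons_rV p + cons_rV (w (uncons_rV (cons_rV p)).2, 0))%R).
  by apply: (measurableT_comp mg); exact: measurable_cons_rV.
rewrite [LHS](fubini_tonelli _ mc2); last by move=> p; exact: f0.
apply: eq_integral => x _.
rewrite -[RHS](ge0_integral_shift (w x) (f := fun a : R => f (cons_rV (a, x)))); last 2 first.
  apply: (measurableT_comp (f := f)) => //.
  apply: (measurableT_comp (@measurable_cons_rV R n)).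
  by apply: (@measurable_fun_pair _ _ _ _ (measurableTypeR R)) => //; exact: measurable_cst.
- by move=> a; exact: f0.
apply: eq_integral => a _.
by rewrite cons_rVK/= cons_rVD addr0.
Qed.

Lemma ge0_integral_shearS n (b : 'rV[R]_n) (f : 'rV[R]_n.+1 -> \bar R) :
  mfunT f -> (forall x, 0 <= f x)%E ->
  (\int[Lb n.+1]_x f (x + cons_rV (0, x ord0 ord0 *: b))%R = \int[Lb n.+1]_x f x)%E.
Proof.
move=> mf f0.
have ms : mfunT (fun x : 'rV[R]_n.+1 => x + cons_rV (0%R, x ord0 ord0 *: b)).
  apply: measurable_rVD => //.
  apply: (measurableT_comp (@measurable_cons_rV R n)).
  apply: (@measurable_fun_pair _ _ _ _ (measurableTypeR R)); first exact: measurable_cst.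
  by apply: measurable_rVZ; [exact: measurable_coord|exact: measurable_cst].
have mg : mfunT (fun x : 'rV[R]_n.+1 => f (x + cons_rV (0, x ord0 ord0 *: b))).
  exact: measurableT_comp.
rewrite (ge0_integral_cons mg) => [|x]; last exact: f0.
rewrite (ge0_integral_cons mf f0).
apply: eq_integral => a _.
rewrite -(ge0_integral_rV_shift (a *: b) (f := fun x => f (cons_rV (a, x)))); last 2 first.
- exact: measurable_cons_slice.
- by move=> x; exact: f0.
by apply: eq_integral => x _; rewrite cons_rV0 cons_rVD addr0.
Qed.

End rV_integral.

Create HintDb mfun.
Ltac mleaf := solve [assumption | auto 2 with mfun nocore].
Ltac mfun_step :=
  match goal with
  | |- measurable_fun _ _ => mleaf
  | |- measurable_fun _ (fun=> _) => exact: measurable_cst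
  | |- measurable_fun _ (fun x => x) => exact: measurable_id
  | |- measurable_fun _ (EFin \o _) => apply/measurable_EFinP
  | |- measurable_fun _ (fun x => EFin _) => apply/measurable_EFinP
  | |- measurable_fun _ (fun x => (_ + _)%E) => apply: emeasurable_funD
  | |- measurable_fun _ (fun x => (_ * _)%E) => apply: emeasurable_funM
  | |- measurable_fun _ (fun x => _ * _) => apply: measurable_funM
  | |- measurable_fun _ (fun x => - _) => apply: measurable_funN
  | |- measurable_fun _ (fun x => _ - _) => apply: measurable_funB
  | |- measurable_fun _ (fun x => _ + _) => apply: measurable_funD
  | |- measurable_fun _ (fun x => _ ^+ _) => apply: measurable_funX
  | |- measurable_fun _ (fun x => _ - _) => apply: measurable_rVB
  | |- measurable_fun _ (fun x => _ + _) => apply: measurable_rVD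
  | |- measurable_fun _ (fun x => - _) => apply: measurable_rVN
  | |- measurable_fun _ (fun x => _ *: _) => apply: measurable_rVZ
  | |- measurable_fun _ (fun x => Num.min _ _) => apply: measurable_minr
  | |- measurable_fun _ (fun x => Num.max _ _) => apply: measurable_maxr
  | |- measurable_fun _ (fun x => @powR ?R (@?f x) ?p) => apply: (measurableT_comp (@measurable_powR R p))
  | |- measurable_fun _ (fun x => ?h (@?g x)) => apply: (@measurableT_comp _ _ _ _ _ _ h _ g)
  end.
Ltac mfun := solve [repeat mfun_step].

Hint Extern 0 (measurable_fun _ fst) => exact: measurable_fst : mfun.
Hint Extern 0 (measurable_fun _ snd) => exact: measurable_snd : mfun.
Hint Extern 0 (measurable_fun _ Num.norm) => exact: normr_measurable : mfun.
Hint Extern 0 (measurable_fun _ expR) => exact: measurable_expR : mfun.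
Hint Extern 0 (measurable_fun _ (@ln _)) => exact: measurable_ln : mfun.

Hint Extern 0 (measurable_fun _ (@enorm _ _)) => exact: measurable_enorm : mfun.

Lemma measurable_le_set (R : realType) (r : R) : measurable [set x : R | x <= r].
Proof.
by rewrite (_ : [set x | _] = `]-oo, r]%classic)//; apply/seteqP; split => x /=; rewrite in_itv.
Qed.

Lemma measurable_ge_set (R : realType) (r : R) : measurable [set x : R | r <= x].
Proof.
by rewrite (_ : [set x | _] = `[r, +oo[%classic)//; apply/seteqP; split => x /=; rewrite in_itv/= andbT.
Qed.

Hint Extern 0 (measurable_fun _ (@indic _ _ _)) => apply: measurable_indic;
  first [exact: measurable_le_set|exact: measurable_ge_set] : mfun.
Hint Extern 0 (measurable_fun _ (cons_rV _)) => exact: measurable_cons_rV : mfun.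
Hint Extern 0 (measurable_fun _ (uncons_rV _)) => exact: measurable_uncons_rV : mfun.

(** * Euclidean norm and inner product *)

Section enorm_theory.
Context {R : realType}.
Implicit Types (n : nat).

Definition dotr n (x y : 'rV[R]_n) : R := \sum_(i < n) x ord0 i * y ord0 i.

Lemma dotrC n (x y : 'rV[R]_n) : dotr x y = dotr y x.
Proof. by apply: eq_bigr => i _; rewrite mulrC. Qed.

Lemma dotrDl n (x y z : 'rV[R]_n) : dotr (x + y) z = dotr x z + dotr y z.
Proof. by rewrite /dotr -big_split/=; apply: eq_bigr => i _; rewrite mxE mulrDl. Qed.

Lemma dotrZl n (a : R) (x z : 'rV[R]_n) : dotr (a *: x) z = a * dotr x z.
Proof. by rewrite /dotr mulr_sumr; apply: eq_bigr => i _; rewrite mxE mulrA. Qed.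

Lemma dotrDr n (x y z : 'rV[R]_n) : dotr z (x + y) = dotr z x + dotr z y.
Proof. by rewrite dotrC dotrDl !(dotrC z). Qed.

Lemma dotrZr n (a : R) (x z : 'rV[R]_n) : dotr z (a *: x) = a * dotr z x.
Proof. by rewrite dotrC dotrZl (dotrC z). Qed.

Lemma dotrNl n (x z : 'rV[R]_n) : dotr (- x) z = - dotr x z.
Proof. by rewrite -scaleN1r dotrZl mulN1r. Qed.

Lemma dotrNr n (x z : 'rV[R]_n) : dotr z (- x) = - dotr z x.
Proof. by rewrite -scaleN1r dotrZr mulN1r. Qed.

Lemma sqr_enorm n (x : 'rV[R]_n) : enorm x ^+ 2 = dotr x x.
Proof.
rewrite sqr_sqrtr; last by apply: sumr_ge0 => i _; exact: sqr_ge0.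
by apply: eq_bigr => i _; rewrite expr2.
Qed.

Lemma dotr_ge0 n (x : 'rV[R]_n) : 0 <= dotr x x.
Proof. by rewrite -sqr_enorm sqr_ge0. Qed.

Lemma enorm0 n : enorm (0 : 'rV[R]_n) = 0.
Proof. by apply/eqP; rewrite -sqrf_eq0 sqr_enorm -(scale0r 0) dotrZl mul0r. Qed.

Lemma enorm_eq0 n (x : 'rV[R]_n) : (enorm x == 0) = (x == 0).
Proof.
apply/eqP/eqP => [|->]; last exact: enorm0.
move=> /(congr1 (fun a => a ^+ 2)); rewrite sqr_enorm expr0n/= /dotr => /eqP.
rewrite psumr_eq0 => [/allP h|i _]; last by rewrite -expr2 sqr_ge0.
apply/rowP => i; rewrite mxE; apply/eqP.
by have := h i (mem_index_enum _); rewrite mulf_eq0 orbb.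
Qed.

Lemma enorm_gt0 n (x : 'rV[R]_n) : (0 < enorm x) = (x != 0).
Proof. by rewrite lt_def enorm_eq0 enorm_ge0 andbT. Qed.

Lemma enormZ n (a : R) (x : 'rV[R]_n) : enorm (a *: x) = `|a| * enorm x.
Proof.
apply/eqP; rewrite -(eqrXn2 (n := 2))// ?mulr_ge0 ?enorm_ge0//.
by rewrite exprMn !sqr_enorm dotrZl dotrZr mulrA real_normK ?num_real// expr2.
Qed.

Lemma enormN n (x : 'rV[R]_n) : enorm (- x) = enorm x.
Proof. by rewrite -scaleN1r enormZ normrN1 mul1r. Qed.

Lemma enormB n (x y : 'rV[R]_n) : enorm (x - y) = enorm (y - x).
Proof. by rewrite -enormN opprB. Qed.

Lemma sqr_enormD n (x y : 'rV[R]_n) :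
  enorm (x + y) ^+ 2 = enorm x ^+ 2 + enorm y ^+ 2 + 2 * dotr x y.
Proof. rewrite !sqr_enorm dotrDl !dotrDr (dotrC y x); ring. Qed.

Lemma sqr_enormB n (x y : 'rV[R]_n) :
  enorm (x - y) ^+ 2 = enorm x ^+ 2 + enorm y ^+ 2 - 2 * dotr x y.
Proof. by rewrite sqr_enormD enormN dotrNr mulrN. Qed.

Lemma cauchy_schwarz n (x y : 'rV[R]_n) : `|dotr x y| <= enorm x * enorm y.
Proof.
have [->|y0] := eqVneq y 0.
  by rewrite -(scale0r 0) dotrZr mul0r normr0 mulr_ge0// enorm_ge0.
rewrite -(ler_pXn2r (n := 2))// ?nnegrE ?mulr_ge0 ?enorm_ge0// exprMn real_normK ?num_real//.
have y2 : 0 < enorm y ^+ 2 by rewrite exprn_gt0// enorm_gt0.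
have := dotr_ge0 (enorm y ^+ 2 *: x - dotr x y *: y).
rewrite dotrDl !dotrDr !dotrNl !dotrNr !dotrZl !dotrZr -!sqr_enorm (dotrC y x).
set a := enorm x ^+ 2; set b := enorm y ^+ 2; set d := dotr x y.
move=> H; have : 0 <= b * (a * b - d ^+ 2) by lra.
by rewrite pmulr_rge0// subr_ge0.
Qed.

Lemma enormD n (x y : 'rV[R]_n) : enorm (x + y) <= enorm x + enorm y.
Proof.
rewrite -(ler_pXn2r (n := 2))// ?nnegrE ?addr_ge0 ?enorm_ge0// sqr_enormD sqrrD.
rewrite -addrA [X in _ <= X]addrAC -addrA [X in _ <= X]addrA addrA lerD2l.
by rewrite mulr_natl lerMn2r/= (le_trans (ler_norm _))// cauchy_schwarz.
Qed.

Lemma enorm_lb n (x y : 'rV[R]_n) : enorm x - enorm y <= enorm (x + y).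
Proof. by rewrite lerBlDr -[X in enorm X <= _](addrK y) (le_trans (enormD _ _))// enormN. Qed.

Lemma coord_le_enorm n (x : 'rV[R]_n) i : `|x ord0 i| <= enorm x.
Proof.
rewrite -(ler_pXn2r (n := 2))// ?nnegrE ?enorm_ge0// real_normK ?num_real//.
rewrite sqr_enorm /dotr (bigD1 i)//= -expr2 lerDl; apply: sumr_ge0 => j _.
by rewrite -expr2 sqr_ge0.
Qed.

Lemma dotr_cons n (a b : R) (x y : 'rV[R]_n) :
  dotr (cons_rV (a, x)) (cons_rV (b, y)) = a * b + dotr x y.
Proof.
rewrite /dotr big_ord_recl !cons_rV0; congr (_ + _).
by apply: eq_bigr => i _; rewrite !cons_rVS.
Qed.

Lemma sqr_enorm_cons n (a : R) (x : 'rV[R]_n) :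
  enorm (cons_rV (a, x)) ^+ 2 = a ^+ 2 + enorm x ^+ 2.
Proof. by rewrite !sqr_enorm dotr_cons expr2. Qed.

Lemma enorm_cons0 n (a : R) : enorm (cons_rV (a, 0 : 'rV[R]_n)) = `|a|.
Proof.
apply/eqP; rewrite -(eqrXn2 (n := 2))// ?enorm_ge0// sqr_enorm_cons enorm0 expr0n addr0.
by rewrite real_normK ?num_real.
Qed.

End enorm_theory.

(** * Rotations and alignment with the first axis *)

Section rotation.
Context {R : realType}.
Local Notation Lb n := (@lebesgue_rV R n).

Definition isometry_pres n (phi : 'rV[R]_n -> 'rV[R]_n) :=
  [/\ mfunT phi,
      forall x y, enorm (phi x - phi y) = enorm (x - y), phi 0 = 0 &
      forall f : 'rV[R]_n -> \bar R, mfunT f -> (forall x, (0 <= f x)%E) ->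
        (\int[Lb n]_x f (phi x) = \int[Lb n]_x f x)%E].

Lemma isometry_pres_comp n (phi psi : 'rV[R]_n -> 'rV[R]_n) :
  isometry_pres phi -> isometry_pres psi -> isometry_pres (phi \o psi).
Proof.
move=> [mp ip p0 pp] [mq iq q0 qq]; split => [|x y||f mf f0].
- exact: measurableT_comp.
- by rewrite /= ip iq.
- by rewrite /= q0 p0.
- rewrite -(pp f)// -(qq (fun x => f (phi x)))//.
  by mfun.
Qed.

Lemma isometry_pres_id n : isometry_pres (@id 'rV[R]_n).
Proof. by split. Qed.

Lemma isometry_pres_opp n : isometry_pres (fun x : 'rV[R]_n => - x).
Proof.
split => [|x y||f mf f0].
- by mfun.
- by rewrite -opprD enormN.
- by rewrite oppr0.
- exact: ge0_integral_rV_opp.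
Qed.

Definition rot n (c s : R) (j : 'I_n) (x : 'rV[R]_n.+1) : 'rV[R]_n.+1 :=
  let p := uncons_rV x in
  cons_rV (c * p.1 + s * p.2 ord0 j,
           p.2 + (- s * p.1 + (c - 1) * p.2 ord0 j) *: delta_mx ord0 j).

(** A plane rotation by an angle theta other than pi is a product of three shears with parameters
    tan(theta/2), -sin(theta), tan(theta/2); t = s / (1 + c) is the half-angle tangent. Invariance
    of the measure is inherited from the shears, and since [rot] is linear the isometry property is
    checked on the difference alone. *)
Lemma rot_isometry n (c s : R) (j : 'I_n) : c ^+ 2 + s ^+ 2 = 1 -> c != -1 ->
  isometry_pres (rot c s j).
Proof.
move=> cs c1.
pose t := s / (1 + c).
pose sh0 (x : 'rV[R]_n.+1) := x + cons_rV (t * (uncons_rV x).2 ord0 j, 0).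
pose sh1 (x : 'rV[R]_n.+1) := x + cons_rV (0, x ord0 ord0 *: (- s *: delta_mx ord0 j)).
have c1' : 1 + c != 0 by rewrite addrC -(opprK 1) subr_eq0.
have ts : t * (1 + c) = s by rewrite /t divfK.
have st : s * t = 1 - c.
  apply: (mulIf c1'); rewrite -mulrA ts; move: cs; lra.
have rotE x : rot c s j x = sh0 (sh1 (sh0 x)).
  rewrite -[x]uncons_rVK; move: (uncons_rV x) => [a y]; rewrite /rot cons_rVK/=.
  have s0 u w : sh0 (cons_rV (u, w)) = cons_rV (u + t * w ord0 j, w).
    by rewrite /sh0 cons_rVK cons_rVD addr0.
  have s1 u w : sh1 (cons_rV (u, w)) = cons_rV (u, w + u *: (- s *: delta_mx ord0 j)).
    by rewrite /sh1 cons_rV0 cons_rVD addr0.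
  rewrite s0 s1 s0.
  congr (cons_rV (_, _)).
    rewrite !mxE !eqxx/= ?mulr1.
    transitivity (a * (1 - s * t) + y ord0 j * (2 * t - t * (s * t))); last by ring.
    by rewrite st -ts; ring.
  rewrite scalerA; congr (_ + _ *: _).
  transitivity (- s * a - s * t * y ord0 j); last by ring.
  by rewrite st; ring.
have msh0 : mfunT sh0.
  apply: measurable_rVD => //; apply: (measurableT_comp (@measurable_cons_rV R n)).
  apply: (@measurable_fun_pair _ _ _ _ (measurableTypeR R)); last exact: measurable_cst.
  apply: measurable_funM => //; apply: measurable_coord_comp.
  apply: (measurableT_comp measurable_snd); exact: measurable_uncons_rV.
have msh1 : mfunT sh1.
  apply: measurable_rVD => //; apply: (measurableT_comp (@measurable_cons_rV R n)).
  apply: (@measurable_fun_pair _ _ _ _ (measurableTypeR R)); first exact: measurable_cst.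
  by apply: measurable_rVZ; [exact: measurable_coord|exact: measurable_cst].
split => [|x y||f mf f0].
- rewrite (_ : rot c s j = sh0 \o (sh1 \o sh0)); last exact/funext/rotE.
  by do 2 apply: measurableT_comp => //.
- have -> : rot c s j x - rot c s j y = rot c s j (x - y).
    rewrite -[x]uncons_rVK -[y]uncons_rVK.
    move: (uncons_rV x) (uncons_rV y) => [a u] [b w].
    rewrite -scaleN1r /rot !cons_rVK -[in RHS]scaleN1r !cons_rVZ !cons_rVD !cons_rVK/=.
    congr (cons_rV (_, _)); first by rewrite !mxE; ring.
    apply/rowP => i; rewrite !mxE; ring.
  rewrite -[x - y]uncons_rVK; move: (uncons_rV (x - y)) => [a u].
  apply/eqP; rewrite -(eqrXn2 (n := 2))// ?enorm_ge0// /rot cons_rVK/= !sqr_enorm_cons.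
  rewrite !sqr_enorm !dotrDl !dotrDr !dotrZl !dotrZr.
  have du w : dotr w (delta_mx ord0 j) = w ord0 j.
    rewrite /dotr (bigD1 j)//= big1 => [|i ij]; first by rewrite !mxE !eqxx/= mulr1 addr0.
    by rewrite !mxE (negbTE ij) andbF mulr0.
  rewrite (dotrC _ u) !du mxE !eqxx/=; apply/eqP.
  transitivity (dotr u u - u ord0 j ^+ 2 + (c ^+ 2 + s ^+ 2) * (a ^+ 2 + u ord0 j ^+ 2)); first by ring.
  by rewrite cs; ring.
- have z0 : cons_rV (0, 0 : 'rV[R]_n) = 0.
    by apply/eqP; rewrite -enorm_eq0 enorm_cons0 normr0.
  rewrite -[X in rot _ _ _ X]z0 /rot cons_rVK/= mxE !mulr0 addr0 scale0r addr0.
  by apply/eqP; rewrite -enorm_eq0 enorm_cons0 normr0.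
- under eq_integral do rewrite rotE.
  have H0 := @ge0_integral_shear0 R n (fun y => t * y ord0 j).
  have mw : mfunT (fun y : 'rV[R]_n => t * y ord0 j).
    by apply: measurable_funM => //; exact: measurable_coord.
  rewrite -[RHS](H0 f mw mf f0).
  rewrite -[RHS](ge0_integral_shearS (- s *: delta_mx ord0 j) (f := fun x => f (sh0 x))); last 2 first.
  + by mfun.
  + by move=> x; exact: f0.
  rewrite -[RHS](H0 (fun x => f (sh0 (sh1 x))) mw)//.
  by mfun.
Qed.

(** Rotations in the planes (0, j) kill the coordinates one after the other. A coordinate that
    already vanishes is left alone, which keeps the angle away from pi. The possible wrong sign of
    the remaining coordinate is repaired by x -> -x. *)
Lemma isometry_align n (x : 'rV[R]_n.+1) :
  exists2 phi, isometry_pres phi & phi x = cons_rV (enorm x, 0).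
Proof.
have [phi ip hp] : exists2 phi, isometry_pres phi & forall j : 'I_n, (uncons_rV (phi x)).2 ord0 j = 0.
  suff : forall k, exists2 phi, isometry_pres phi & forall j : 'I_n, (j < k)%N -> (uncons_rV (phi x)).2 ord0 j = 0.
    by move=> /(_ n)[phi ip hp]; exists phi => // j; exact: hp.
  elim=> [|k [phi ip hp]]; first by exists id => //; exact: isometry_pres_id.
  have [nk|kn] := leqP n k; first by exists phi => // j _; apply: hp; exact: leq_trans nk.
  pose j := Ordinal kn.
  have [b0|b0] := eqVneq ((uncons_rV (phi x)).2 ord0 j) 0.
    exists phi => // i; rewrite ltnS leq_eqVlt => /orP[/eqP ik|]; last exact: hp.
    by rewrite (_ : i = j)//; exact/val_inj.
  case E : (uncons_rV (phi x)) => [a y]; move: b0 hp; rewrite E/= => b0 hp.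
  set b := y ord0 j in b0.
  pose r := Num.sqrt (a ^+ 2 + b ^+ 2).
  have b2 : 0 < b ^+ 2 by rewrite lt_def sqrf_eq0 b0 sqr_ge0.
  have r20 : 0 < a ^+ 2 + b ^+ 2 by rewrite ltr_wpDl// sqr_ge0.
  have r0 : 0 < r by rewrite sqrtr_gt0.
  have r2 : r ^+ 2 = a ^+ 2 + b ^+ 2 by rewrite sqr_sqrtr// ltW.
  exists (rot (a / r) (b / r) j \o phi).
    apply: isometry_pres_comp => //; apply: rot_isometry.
      by rewrite !expr_div_n -mulrDl r2 divff// gt_eqF.
    apply/eqP => /(congr1 (fun z => z ^+ 2)); rewrite expr_div_n sqrrN expr1n => /divr1_eq.
    by rewrite r2; lra.
  change (forall i : 'I_n, (i < k.+1)%N -> (uncons_rV (rot (a / r) (b / r) j (phi x))).2 ord0 i = 0).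
  move=> i ik; rewrite /rot E cons_rVK/= -/b !mxE/=.
  have [->|ij] := eqVneq i j.
    by rewrite mulr1 -[y ord0 j]/b; ring.
  rewrite mulr0 addr0 hp// ltn_neqAle -ltnS ik andbT.
  by apply: contra ij => /eqP ik'; apply/eqP/val_inj.
have nx : enorm (phi x) = enorm x.
  by case: ip => _ H0 p0 _; have := H0 x 0; rewrite p0 !subr0.
have px : phi x = cons_rV ((uncons_rV (phi x)).1, 0).
  rewrite -[LHS]uncons_rVK; case: (uncons_rV (phi x)) hp => a y /= hp.
  by congr (cons_rV (_, _)); apply/rowP => j; rewrite hp mxE.
move: px nx; set a := (uncons_rV _).1 => px; rewrite px enorm_cons0.
have [a0|a0] := leP 0 a; [rewrite ger0_norm// | rewrite ltr0_norm//] => <-; first by exists phi.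
exists ((fun y => - y) \o phi); last by rewrite /= px -scaleN1r cons_rVZ scaler0 mulN1r.
by apply: isometry_pres_comp => //; exact: isometry_pres_opp.
Qed.

End rotation.

Definition annulus (R : realType) n : set 'rV[R]_n := [set z | 1 <= enorm z < expR 1].

Section nonneg_integral.
Local Open Scope ereal_scope.
Context d (T : measurableType d) (R : realType) (mu : {measure set T -> \bar R}).
Implicit Types f g : T -> \bar R.

Lemma gintZl f (k : R) : mfunT f -> (forall x, 0 <= f x) -> (0 <= k)%R ->
  \int[mu]_x (k%:E * f x) = k%:E * \int[mu]_x f x.
Proof. by move=> mf f0 k0; apply: ge0_integralZl => //; rewrite lee_fin. Qed.

Lemma gintZr f (k : R) : mfunT f -> (forall x, 0 <= f x) -> (0 <= k)%R ->
  \int[mu]_x (f x * k%:E) = \int[mu]_x f x * k%:E.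
Proof. by move=> mf f0 k0; rewrite muleC -gintZl//; apply: eq_integral => x _; rewrite muleC. Qed.

Lemma gintD f g : mfunT f -> (forall x, 0 <= f x) ->
  mfunT g -> (forall x, 0 <= g x) ->
  \int[mu]_x (f x + g x) = \int[mu]_x f x + \int[mu]_x g x.
Proof. by move=> mf f0 mg g0; apply: ge0_integralD. Qed.

Lemma gint_le f g : mfunT f -> (forall x, 0 <= f x) ->
  mfunT g -> (forall x, f x <= g x) ->
  \int[mu]_x f x <= \int[mu]_x g x.
Proof.
move=> mf f0 mg fg; apply: ge0_le_integral => //.
Qed.

End nonneg_integral.

(** * Polar coordinates *)

Section polar.
Context {R : realType}.
Local Notation mu := (@lebesgue_measure R).
Local Notation Lb n := (@lebesgue_rV R n).

Lemma measurable_annulus n : measurable (@annulus R n).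
Proof.
rewrite (_ : @annulus R n = (@enorm R n) @^-1` `[1, expR 1[%classic).
  by rewrite -[X in measurable X]setTI; apply: measurable_enorm.
by apply/seteqP; split => x /=; rewrite in_itv.
Qed.

Lemma lebesgue_rV_set0 n : (0 < n)%N -> Lb n [set 0] = 0%E.
Proof.
case: n => // n _.
rewrite (_ : [set 0] = [set x : 'rV[R]_n.+1 | forall i, [set 0%R] (x ord0 i)]); last first.
  apply/seteqP; split => x /= => [->|H]; first by move=> i; rewrite mxE.
  by apply/rowP => i; rewrite H mxE.
rewrite (lebesgue_rV_box (A := fun=> [set 0])); last by move=> i; exact: measurable_set1.
by rewrite big_ord_recl lebesgue_measure_set1 mul0e.
Qed.

Lemma measurable_rV_set1 n (x : 'rV[R]_n) : measurable [set x].
Proof.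
rewrite (_ : [set x] = (fun y => enorm (y - x)) @^-1` [set 0]); last first.
  apply/seteqP; split => y /= => [->|/eqP]; first by rewrite subrr enorm0.
  by rewrite enorm_eq0 subr_eq0 => /eqP.
rewrite -[X in measurable X]setTI.
by apply: (measurable_enorm_comp (measurable_rVB (@measurable_id _ _ _) (@measurable_cst _ _ _ _ _ x))).
Qed.

Lemma ae_neq0 n : (0 < n)%N -> {ae Lb n, forall x, x != 0}.
Proof.
move=> n0; exists [set 0]; split; first exact: measurable_rV_set1.
- exact: lebesgue_rV_set0.
- by move=> x /= /negP; rewrite negbK => /eqP.
Qed.

(** In the logarithm of the radius the annulus has length one on every ray. Its dilates therefore
    form a continuous partition of unity, which plays the role of the surface measure of the
    sphere. *)
Lemma integral_annulus_shift n (y : 'rV[R]_n) : y != 0 ->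
  (\int[mu]_t (\1_(@annulus R n) (expR (- t) *: y))%:E = 1)%E.
Proof.
move=> y0; have ny : 0 < enorm y by rewrite enorm_gt0.
transitivity (\int[mu]_t (\1_(`]ln (enorm y) - 1, ln (enorm y)]%classic) t)%:E)%E.
  apply: eq_integral => t _; congr EFin; rewrite !indicE; congr (nat_of_bool _)%:R.
  have e : expR (- t) * enorm y = expR (ln (enorm y) - t) by rewrite addrC expRD lnK.
  apply/idP/idP; rewrite !inE /annulus/= in_itv/= enormZ (gtr0_norm (expR_gt0 _)) e ltr_expR.
    by move=> /andP[]; rewrite -[X in X <= _ -> _]expR0 ler_expR; lra.
  by move=> h; rewrite -[X in X <= _]expR0 ler_expR; lra.
rewrite integral_indic// setIT.
rewrite [LHS](_ : _ = mu `]ln (enorm y) - 1, ln (enorm y)]%classic)//.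
rewrite lebesgue_measure_itv/= lte_fin ifT; last by lra.
by rewrite -EFinB; congr EFin; lra.
Qed.

Lemma measurable_indicT d (T : measurableType d) (A : set T) : measurable A ->
  mfunT (fun x => \1_A x : R).
Proof. by move=> mA; exact: measurable_indic. Qed.

(** Insert the partition of unity by dilates of the annulus, exchange the integrals, and dilate the
    inner one; the Jacobian of the dilation is the factor e^(n t). *)
Lemma ge0_integral_polar n (f : 'rV[R]_n -> \bar R) : (0 < n)%N ->
  mfunT f -> (forall x, (0 <= f x)%E) ->
  (\int[Lb n]_x f x = \int[Lb n]_z ((\1_(@annulus R n) z)%:E *
     \int[mu]_t ((expR (n%:R * t))%:E * f (expR t *: z))))%E.
Proof.
move=> n0 mf f0.
have mexp : measurable_fun [set: measurableTypeR R] (fun t : measurableTypeR R => expR t) by exact: measurable_expR.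
have mfst : mfunT (fun p : measurableTypeR R * 'rV[R]_n => p.1 : R) by exact: measurable_fst.
have msc : mfunT (fun p : measurableTypeR R * 'rV[R]_n => expR p.1 *: p.2) by mfun.
have mscN : mfunT (fun p : measurableTypeR R * 'rV[R]_n => expR (- p.1) *: p.2) by mfun.
have mchi : mfunT (fun z : 'rV[R]_n => (\1_(@annulus R n) z)%:E : \bar R).
  apply/measurable_EFinP; by apply: measurable_indic; exact: measurable_annulus.
have chi0 (z : 'rV[R]_n) : (0 <= (\1_(@annulus R n) z)%:E :> \bar R)%E by rewrite lee_fin.
have mexpn : mfunT (fun p : measurableTypeR R * 'rV[R]_n => (expR (n%:R * p.1))%:E) by mfun.
have mchif : mfunT (fun p : measurableTypeR R * 'rV[R]_n =>
      (\1_(@annulus R n) (expR (- p.1) *: p.2))%:E * f p.2)%E.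
  apply: emeasurable_funM; first exact: (measurableT_comp mchi mscN).
  by mfun.
transitivity (\int[Lb n]_x \int[mu]_t ((\1_(@annulus R n) (expR (- t) *: x))%:E * f x))%E.
  apply: ae_eq_integral => //.
  - apply: (measurable_fun_fubini_tonelli_G _ mchif) => p; exact: mule_ge0.
  - apply: filterS (ae_neq0 n0) => x x0 _.
    rewrite ge0_integralZr// ?integral_annulus_shift ?mul1e//.
    apply: (measurableT_comp mchi); apply: measurable_rVZ; last exact: measurable_cst.
    by mfun.
rewrite -(fubini_tonelli (m1 := mu) (m2 := Lb n) _ mchif); last by move=> p; exact: mule_ge0.
transitivity (\int[mu]_t \int[Lb n]_z ((\1_(@annulus R n) z)%:E * ((expR (n%:R * t))%:E * f (expR t *: z))))%E.
  apply: eq_integral => t _ /=.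
  rewrite (ge0_integral_rV_scale (c := expR t)) ?expR_gt0//; first last.
  - by move=> z; exact: mule_ge0.
  - apply: emeasurable_funM => //; apply: (measurableT_comp mchi).
    by apply: measurable_rVZ => //; exact: measurable_cst.
  rewrite -gintZl; first last.
  - by rewrite exprn_ge0// expR_ge0.
  - by move=> z; exact: mule_ge0.
  - apply: emeasurable_funM => //.
      apply: (measurableT_comp mchi); apply: measurable_rVZ; first exact: measurable_cst.
      by apply: measurable_rVZ => //; exact: measurable_cst.
    by mfun.
  apply: eq_integral => z _.
  rewrite scalerA -expRD addNr expR0 scale1r expRM_natl.
  by rewrite muleCA.
rewrite (fubini_tonelli (m1 := mu) (m2 := Lb n) (fun p : measurableTypeR R * 'rV[R]_n =>
      (\1_(@annulus R n) p.2)%:E * ((expR (n%:R * p.1))%:E * f (expR p.1 *: p.2)))%E); last 2 first.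
- apply: emeasurable_funM; first exact: (measurableT_comp mchi measurable_snd).
  by mfun.
- by move=> p; rewrite !mule_ge0// lee_fin expR_ge0.
apply: eq_integral => z _ /=; rewrite gintZl//.
- by mfun.
- by move=> t; rewrite mule_ge0// lee_fin expR_ge0.
Qed.

(* [sphw z dz] pushed forward by [udir] is the surface measure of the unit sphere. *)
Definition sphw n (z : 'rV[R]_n) : R := \1_(@annulus R n) z * expR (- n%:R * ln (enorm z)).
Definition udir n (z : 'rV[R]_n) : 'rV[R]_n := (enorm z)^-1 *: z.

Lemma sphw_ge0 n (z : 'rV[R]_n) : 0 <= sphw z.
Proof. by rewrite mulr_ge0// expR_ge0. Qed.

Lemma measurable_sphw n : mfunT (@sphw n).
Proof.
apply: measurable_funM; first by apply: measurable_indic; exact: measurable_annulus.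
by mfun.
Qed.

Lemma measurable_invr : mfunT (@GRing.inv R).
Proof.
rewrite (_ : [set: R] = [set 0] `|` ~` [set 0]); last by rewrite setUv.
apply/measurable_funU; [exact: measurable_set1|exact: measurableC|split].
  exact: measurable_fun_set1.
apply: open_continuous_measurable_fun; first exact: closed_openC.
by move=> x; rewrite inE/= => /eqP x0; exact: inv_continuous.
Qed.

Lemma measurable_udir n : mfunT (@udir n).
Proof.
apply: measurable_rVZ => //; apply: (measurableT_comp measurable_invr).
by mfun.
Qed.

Lemma enorm_udir n (z : 'rV[R]_n) : z != 0 -> enorm (udir z) = 1.
Proof.
move=> z0; rewrite /udir enormZ ger0_norm ?invr_ge0 ?enorm_ge0// mulVf//.
by rewrite gt_eqF// enorm_gt0.
Qed.

(** Translating t by ln |z| on each ray replaces z by its direction and costs the factor |z|^(-n)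
    contained in [sphw]. *)
Theorem ge0_integral_polar_udir n (f : 'rV[R]_n -> \bar R) : (0 < n)%N ->
  mfunT f -> (forall x, (0 <= f x)%E) ->
  (\int[Lb n]_x f x = \int[Lb n]_z ((sphw z)%:E *
     \int[mu]_t ((expR (n%:R * t))%:E * f (expR t *: udir z))))%E.
Proof.
move=> n0 mf f0; rewrite (ge0_integral_polar n0 mf f0); apply: eq_integral => z _.
rewrite /sphw indicE; have [|] := boolP (z \in @annulus R n); last by rewrite !mul0r !mul0e.
rewrite inE/= => /andP[z1 _]; rewrite mul1e mul1r.
have ez : 0 < enorm z by exact: lt_le_trans z1.
have mft : mfunT (fun t : R => (expR (n%:R * t))%:E * f (expR t *: z))%E by mfun.
have mft' : mfunT (fun t : R => (expR (n%:R * t))%:E * f (expR t *: udir z))%E by mfun.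
rewrite -(ge0_integral_shift (- ln (enorm z)) mft); last first.
  by move=> t; rewrite mule_ge0// lee_fin expR_ge0.
rewrite -gintZl; first last.
- by rewrite expR_ge0.
- by move=> t; rewrite mule_ge0// lee_fin expR_ge0.
- exact: mft'.
apply: eq_integral => t _; rewrite muleA -EFinM; congr (_%:E * f _)%E.
  by rewrite -expRD; congr expR; ring.
by rewrite /udir scalerA expRD expRN lnK.
Qed.

Lemma annulus_box n : @annulus R n `<=` [set x | forall i, `[- expR 1, expR 1]%classic (x ord0 i)].
Proof.
move=> x /= /andP[_ h] i; rewrite in_itv/= -ler_norml.
exact: le_trans (coord_le_enorm _ _) (ltW h).
Qed.

Lemma measurable_box n (A : 'I_n -> set R) : (forall i, measurable (A i)) ->
  measurable [set x : 'rV[R]_n | forall i, A i (x ord0 i)].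
Proof.
move=> mA; rewrite [X in measurable X](_ : _ = \bigcap_(i in [set: 'I_n])
    ((fun x : 'rV[R]_n => x ord0 i) @^-1` A i)).
  apply: fin_bigcap_measurable => // i _; rewrite -[X in measurable X]setTI.
  exact: (measurable_coord i).
by apply/seteqP; split => [x /= H i _|x /= H i]; exact: H.
Qed.

Lemma lebesgue_cube_lty n (a : R) :
  (Lb n [set x | forall i, `[(- a)%R, a]%classic (x ord0 i)] < +oo)%E.
Proof.
rewrite (lebesgue_rV_box (A := fun=> `[- a, a]%classic)) => [|i]; last exact: measurable_itv.
suff /andP[] : (0 <= \prod_(i < n) mu `[(- a)%R, a] < +oo)%E by [].
apply: (big_ind (fun x : \bar R => 0 <= x < +oo)%E).
- by rewrite lee01 ltry.
- by move=> x y /andP[x0 xy] /andP[y0 yy]; rewrite mule_ge0//= lte_mul_pinfty// ge0_fin_numE.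
- by move=> i _; rewrite measure_ge0/= lebesgue_measure_itv/=; case: ifPn => _; rewrite ltry.
Qed.

Lemma integral_sphw_lty n : (\int[Lb n]_z (sphw z)%:E < +oo)%E.
Proof.
have mB := @measurable_box n (fun=> `[- expR 1, expR 1]%classic) (fun=> measurable_itv _).
set B := [set x : 'rV[R]_n | _] in mB.
apply: le_lt_trans (lebesgue_cube_lty n (expR 1)).
rewrite [leRHS](_ : _ = \int[Lb n]_z (\1_B z)%:E)%E; last by rewrite integral_indic// setIT.
apply: ge0_le_integral => //.
- by move=> z _; rewrite lee_fin sphw_ge0.
- by apply/measurable_EFinP; exact: measurable_sphw.
- by apply/measurable_EFinP; exact: measurable_indicT.
move=> z _; rewrite lee_fin /sphw !indicE.
have [|] := boolP (z \in @annulus R n); last by rewrite mul0r.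
rewrite mul1r inE => zA; rewrite mem_set; last exact: annulus_box zA.
move: zA => /andP[z1 _].
by rewrite -expR0 ler_expR mulNr oppr_le0 mulr_ge0// ln_ge0.
Qed.

End polar.

Hint Extern 0 (measurable_fun _ (@sphw _ _)) => exact: measurable_sphw : mfun.
Hint Extern 0 (measurable_fun _ (@GRing.inv _)) => exact: measurable_invr : mfun.
Hint Extern 0 (measurable_fun _ (@udir _ _)) => exact: measurable_udir : mfun.

(** * Integrability of powers of the norm *)

Section radial.
Context {R : realType}.
Local Notation mu := (@lebesgue_measure R).
Local Notation Lb n := (@lebesgue_rV R n).

Lemma sphw_neq0 n (z : 'rV[R]_n) : sphw z != 0 -> z != 0.
Proof.
apply: contraNneq => ->; rewrite /sphw indicE memNset ?mul0r//.
by rewrite /annulus/= enorm0 => /andP[]; rewrite ler10.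
Qed.

Lemma ge0_integral_radial n (G : R -> \bar R) : (0 < n)%N ->
  mfunT G -> (forall x, (0 <= G x)%E) ->
  (\int[Lb n]_y G (enorm y) = \int[Lb n]_z (sphw z)%:E *
     \int[mu]_t ((expR (n%:R * t))%:E * G (expR t)))%E.
Proof.
move=> n0 mG G0.
have mGe : mfunT (fun y : 'rV[R]_n => G (enorm y)) by mfun.
rewrite (ge0_integral_polar_udir n0 mGe) => [|x]; last exact: G0.
rewrite -ge0_integralZr => [|//||z _|]; first last.
- by apply: integral_ge0 => t _; rewrite mule_ge0// lee_fin expR_ge0.
- by rewrite lee_fin sphw_ge0.
- by mfun.
apply: eq_integral => z _.
have [->|/sphw_neq0 z0] := eqVneq (sphw z) 0; first by rewrite !mul0e.
congr (_ * _)%E; apply: eq_integral => t _; congr (_ * G _)%E.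
by rewrite enormZ enorm_udir// mulr1 gtr0_norm// expR_gt0.
Qed.

Lemma integral_expRN_norm (l : R) : 0 < l ->
  (\int[mu]_t (expR (- l * `|t|))%:E < +oo)%E.
Proof.
move=> l0.
have mp := @measurable_exponential_pdf R l.
have mpN : mfunT (fun t : R => (exponential_pdf l (- t))%:E) by mfun.
have mpE : mfunT (fun t : R => (exponential_pdf l t)%:E) by exact/measurable_EFinP.
have p0 t : (0 <= (exponential_pdf l t)%:E)%E by rewrite lee_fin exponential_pdf_ge0// ltW.
have mabs : mfunT (fun t : R => (expR (- l * `|t|))%:E) by mfun.
have H : (\int[mu]_t ((exponential_pdf l t)%:E + (exponential_pdf l (- t))%:E) = (1 + 1)%E)%E.
  rewrite gintD//.
  rewrite integral_exponential_pdf// -(ge0_integral_opp mpE)// integral_exponential_pdf//.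
have : (\int[mu]_t ((l)%:E * (expR (- l * `|t|))%:E) <= (1 + 1)%E)%E.
  rewrite -H; apply: gint_le.
  - by mfun.
  - by move=> t; rewrite mule_ge0// lee_fin ?expR_ge0// ltW.
  - exact: emeasurable_funD.
  - move=> t; rewrite -EFinM -EFinD lee_fin.
    have [t0|t0] := leP 0 t.
      rewrite ger0_norm// (exponential_pdfE _ t0) lerDl.
      by rewrite exponential_pdf_ge0// ltW.
    rewrite ltr0_norm// (@exponential_pdfE _ _ (- t)); last by rewrite oppr_ge0 ltW.
    by rewrite lerDr exponential_pdf_ge0// ltW.
rewrite gintZl//; last exact: ltW.
move=> h.
rewrite ltNge leye_eq; apply/negP => /eqP e.
by move: h; rewrite e gt0_muley ?lte_fin// leye_eq.
Qed.

Lemma gint_le_lty (f : R -> R) (C l : R) : 0 < l -> mfunT f ->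
  (forall t, 0 <= f t) -> (forall t, f t <= C * expR (- l * `|t|)) ->
  (\int[mu]_t (f t)%:E < +oo)%E.
Proof.
move=> l0 mf f0 fC.
have C0 : 0 <= C.
  by have := le_trans (f0 0) (fC 0); rewrite normr0 mulr0 expR0 mulr1.
have mabs : mfunT (fun t : R => (expR (- l * `|t|))%:E) by mfun.
apply: (@le_lt_trans _ _ (\int[mu]_t (C%:E * (expR (- l * `|t|))%:E))%E).
  apply: gint_le.
  - by mfun.
  - by move=> t; rewrite lee_fin.
  - by mfun.
  - by move=> t; rewrite -EFinM lee_fin.
rewrite gintZl//.
by rewrite lte_mul_pinfty// integral_expRN_norm.
Qed.

Lemma expR_powR (t m : R) : expR t `^ m = expR (m * t).
Proof. by rewrite /powR gt_eqF ?expR_gt0// expRK. Qed.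

Lemma measurable_powR_comp d (T : measurableType d) (f : T -> R) (m : R) :
  mfunT f -> mfunT (fun x => f x `^ m).
Proof. by move=> mf; have := measurableT_comp (measurable_powR m) mf; exact. Qed.

Lemma integral_ball_powR n (m r : R) : (0 < n)%N -> m < n%:R -> 0 < r ->
  (\int[Lb n]_y (\1_[set x : R | x <= r] (enorm y) * enorm y `^ (- m))%:E < +oo)%E.
Proof.
move=> n0 mn r0.
pose G (x : R) := \1_[set x : R | x <= r] x * x `^ (- m).
have mG : mfunT G by rewrite /G; mfun.
have G0 x : 0 <= G x by rewrite mulr_ge0// powR_ge0.
rewrite (@ge0_integral_radial n (EFin \o G))//; first last.
- by mfun.
rewrite lte_mul_pinfty//.
- by apply: integral_ge0 => z _; rewrite lee_fin sphw_ge0.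
- rewrite ge0_fin_numE ?integral_sphw_lty//.
  by apply: integral_ge0 => z _; rewrite lee_fin sphw_ge0.
(* With l = n - m and t <= ln r, one has l t <= 2 l |ln r| - l |t|, so the integrand is at most a
   constant times an exponential decaying in |t|. *)
apply: (@gint_le_lty (fun t => expR (n%:R * t) * G (expR t)) (expR (2 * (n%:R - m) * `|ln r|)) (n%:R - m)).
- by rewrite subr_gt0.
- by mfun.
- by move=> t; rewrite mulr_ge0// expR_ge0.
move=> t; rewrite /G indicE; have [|] := boolP (_ \in _); last first.
  by rewrite mul0r mulr0 mulr_ge0// expR_ge0.
rewrite inE/= -{1}(lnK r0) ler_expR => tr.
rewrite mul1r expR_powR -!expRD ler_expR.
have l0 : 0 < n%:R - m by rewrite subr_gt0.
have [h1|h1] := leP 0 t; have := ler_norm (ln r); have := normr_ge0 (ln r).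
  rewrite (ger0_norm h1) => a0 a1.
  have a2 : 0 <= `|ln r| - t by lra.
  have := mulr_ge0 (ltW l0) a2; nra.
rewrite (ltr0_norm h1) => a0 a1; have := mulr_ge0 (ltW l0) a0; nra.
Qed.

Lemma integral_tail_powR n (m r : R) : (0 < n)%N -> n%:R < m -> 0 < r ->
  (\int[Lb n]_y (\1_[set x : R | r <= x] (enorm y) * enorm y `^ (- m))%:E < +oo)%E.
Proof.
move=> n0 mn r0.
pose G (x : R) := \1_[set x : R | r <= x] x * x `^ (- m).
have mG : mfunT G by rewrite /G; mfun.
have G0 x : 0 <= G x by rewrite mulr_ge0// powR_ge0.
rewrite (@ge0_integral_radial n (EFin \o G))//; first last.
- by mfun.
rewrite lte_mul_pinfty//.
- by apply: integral_ge0 => z _; rewrite lee_fin sphw_ge0.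
- rewrite ge0_fin_numE ?integral_sphw_lty//.
  by apply: integral_ge0 => z _; rewrite lee_fin sphw_ge0.
apply: (@gint_le_lty (fun t => expR (n%:R * t) * G (expR t)) (expR (2 * (m - n%:R) * `|ln r|)) (m - n%:R)).
- by rewrite subr_gt0.
- by mfun.
- by move=> t; rewrite mulr_ge0// expR_ge0.
move=> t; rewrite /G indicE; have [|] := boolP (_ \in _); last first.
  by rewrite mul0r mulr0 mulr_ge0// expR_ge0.
rewrite inE/= -{1}(lnK r0) ler_expR => tr.
rewrite mul1r expR_powR -!expRD ler_expR.
have l0 : 0 < m - n%:R by rewrite subr_gt0.
have [h1|h1] := leP 0 t; have := ler_norm (- ln r); have := normr_ge0 (ln r).
  rewrite normrN (ger0_norm h1) => a0 a1; have := mulr_ge0 (ltW l0) a0; nra.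
rewrite normrN (ltr0_norm h1) => a0 a1.
have a2 : 0 <= `|ln r| + t by lra.
have := mulr_ge0 (ltW l0) a2; nra.
Qed.

Lemma ge0_integral_rV1 (f : R -> \bar R) : mfunT f -> (forall x, (0 <= f x)%E) ->
  (\int[Lb 1]_y f (enorm y) = \int[mu]_t f `|t|%R)%E.
Proof.
move=> mf f0.
have me : mfunT (fun y : 'rV[R]_1 => f (enorm y)) by mfun.
rewrite (ge0_integral_cons me) => [|x]; last exact: f0.
apply: eq_integral => a _.
rewrite (@ge0_integral_rV0 R (fun x => f (enorm (cons_rV (a, x))))) => [||x]; last exact: f0.
  by rewrite enorm_cons0.
exact: (measurable_cons_slice _ me).
Qed.

Lemma integral_norm_powR (q : R) : q < 1 ->
  (\int[mu]_t (\1_[set x : R | x <= 1] `|t| * `|t| `^ (- q))%:E < +oo)%E.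
Proof.
move=> q1; have := @integral_ball_powR 1 q 1 isT q1 ltr01.
rewrite (@ge0_integral_rV1 (fun x => (\1_[set x : R | x <= 1] x * x `^ (- q))%:E))//.
- by mfun.
- by move=> x; rewrite lee_fin mulr_ge0// powR_ge0.
Qed.

Lemma integral_min_powR (q l : R) : 0 <= q -> q < 1 -> 0 < l ->
  (\int[mu]_t (expR (- l * `|t|) * (Num.min 1 `|t|) `^ (- q))%:E < +oo)%E.
Proof.
move=> q0 q1 l0.
have mn : mfunT (fun t : R => `|t|) by exact: normr_measurable.
have m1 : mfunT (fun t : R => (\1_[set x : R | x <= 1] `|t| * `|t| `^ (- q))%:E) by mfun.
have m2 : mfunT (fun t : R => (expR (- l * `|t|))%:E) by mfun.
apply: (@le_lt_trans _ _ (\int[mu]_t ((\1_[set x : R | x <= 1] `|t| * `|t| `^ (- q))%:E + (expR (- l * `|t|))%:E))%E).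
  apply: gint_le.
  - by mfun.
  - by move=> t; rewrite lee_fin mulr_ge0// ?powR_ge0// expR_ge0.
  - exact: emeasurable_funD.
  - move=> t; rewrite -EFinD lee_fin indicE.
    have [t1|t1] := leP `|t| 1.
      rewrite mem_set//= mul1r -[leLHS]addr0 lerD ?expR_ge0//.
      rewrite ler_piMl ?powR_ge0// -expR0 ler_expR.
      by rewrite mulNr oppr_le0 mulr_ge0// ltW.
    rewrite memNset/=; last by apply/negP; rewrite -ltNge.
    by rewrite mul0r add0r powR1 mulr1.
rewrite gintD//.
- by rewrite lte_add_pinfty// ?integral_norm_powR// integral_expRN_norm.
Qed.

(** The angular singularity of the kernels below sits on the first axis, which this discards. *)
Lemma ae_axis n : (0 < n)%N -> {ae Lb n.+1, forall z, (uncons_rV z).2 != 0}.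
Proof.
move=> n0.
have mA : measurable [set z : 'rV[R]_n.+1 | (uncons_rV z).2 = 0].
  rewrite -[X in measurable X]setTI.
  have := measurableT_comp (@measurable_snd _ _ _ _) (@measurable_uncons_rV R n).
  by move=> /(_ measurableT [set 0]); apply; exact: measurable_rV_set1.
exists [set z | (uncons_rV z).2 = 0]; split => //; last first.
  by move=> x /= /negP; rewrite negbK => /eqP.
set A := [set z | _] in mA *.
have mi : mfunT (fun z : 'rV[R]_n.+1 => (\1_A z)%:E : \bar R).
  by apply/measurable_EFinP; exact: measurable_indic.
have := @ge0_integral_cons R n _ mi (fun z => _).
rewrite integral_indic// setIT => -> => [|x]; last by rewrite lee_fin.
apply: integral0_eq => a _.
transitivity (\int[Lb n]_x (\1_[set 0] x)%:E)%E.
  apply: eq_integral => x _; congr EFin; rewrite !indicE; congr (nat_of_bool _)%:R.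
  by apply/idP/idP; rewrite !inE -[A _]/((uncons_rV (cons_rV (a, x))).2 = 0) cons_rVK.
by rewrite integral_indic; [rewrite setIT; exact: lebesgue_rV_set0| |exact: measurable_rV_set1].
Qed.

End radial.

Section powR_facts.
Context {R : realType}.

Lemma ler_powRN (a b p : R) : 0 < a -> a <= b -> 0 <= p -> b `^ (- p) <= a `^ (- p).
Proof.
move=> a0 ab p0; rewrite !powRN lef_pV2 ?posrE ?powR_gt0//; last exact: lt_le_trans ab.
by apply: ge0_ler_powR => //; rewrite nnegrE ltW// (lt_le_trans a0).
Qed.

Lemma enorm_powR2 n (x : 'rV[R]_n) (c : R) : enorm x `^ (- (2 * c)) = (enorm x ^+ 2) `^ (- c).
Proof. by rewrite -mulrN powRrM powR_mulrn// enorm_ge0. Qed.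

Lemma cosh_ge0 (t : R) : 0 <= expR t + expR (- t) - 2.
Proof.
have -> : expR t + expR (- t) - 2 = (expR (t / 2) - expR (- (t / 2))) ^+ 2.
  rewrite sqrrB -!expRM_natl -expRD subrr expR0.
  rewrite (_ : 2 * (t / 2) = t); last by field.
  rewrite (_ : 2 * - (t / 2) = - t); last by field.
  by ring.
exact: sqr_ge0.
Qed.

End powR_facts.

(** * Riesz kernels in logarithmic coordinates *)

Section kernel.
Context {R : realType} (n : nat).
Local Notation mu := (@lebesgue_measure R).
Local Notation Lb n := (@lebesgue_rV R n).
Implicit Types (z : 'rV[R]_n.+1) (t c d : R).

Definition om z : R := udir z ord0 ord0.

(** For |x| = e^r, |y| = e^s and t = r - s, the value at d = 0 is |x - y|^2 / (|x| |y|), where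
    [om z] is the cosine of the angle between x and y. A positive d removes the singularity at t =
    0. *)
Definition Qk d t z : R := expR t + expR (- t) - 2 * om z + d.

(** At d = 0 this is the integral over the directions of y of (|x| |y|)^c |x - y|^(-2c): the Riesz
    kernel seen by radial functions in logarithmic radius. *)
Definition kernE c d t : \bar R := (\int[Lb n.+1]_z (sphw z * Qk d t z `^ (- c))%:E)%E.

Definition kern c d t : R := fine (kernE c d t).

Lemma om_norm z : `|om z| <= 1.
Proof.
apply: le_trans (coord_le_enorm _ _) _.
have [->|z0] := eqVneq z 0; first by rewrite /udir scaler0 enorm0.
by rewrite enorm_udir.
Qed.

Lemma om_le1 z : om z <= 1.
Proof. exact: le_trans (ler_norm _) (om_norm z). Qed.

Lemma om_geN1 z : -1 <= om z.
Proof. by have := om_norm z; rewrite ler_norml => /andP[]. Qed.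

Lemma measurable_om : mfunT om.
Proof. by apply: measurable_coord_comp; exact: measurable_udir. Qed.

#[local] Hint Extern 0 (measurable_fun _ om) => exact: measurable_om : mfun.

Lemma Qk_ge d t z : expR t + expR (- t) - 2 + d <= Qk d t z.
Proof. by rewrite /Qk; have := om_le1 z; lra. Qed.

Lemma Qk_ge0 d t z : 0 <= d -> 0 <= Qk d t z.
Proof. by move=> d0; apply: le_trans (Qk_ge d t z); have := cosh_ge0 t; lra. Qed.

Lemma QkN d t z : Qk d (- t) z = Qk d t z.
Proof. by rewrite /Qk opprK (addrC (expR (- t))). Qed.

Lemma measurable_Qk dd (T : measurableType dd) (f : T -> R) (g : T -> 'rV[R]_n.+1) d :
  mfunT f -> mfunT g ->
  mfunT (fun x => Qk d (f x) (g x)).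
Proof. by move=> mf mg; rewrite /Qk; mfun. Qed.

Lemma kernE_ge0 c d t : (0 <= kernE c d t)%E.
Proof. by apply: integral_ge0 => z _; rewrite lee_fin mulr_ge0 ?sphw_ge0 ?powR_ge0. Qed.

Lemma kern_ge0 c d t : 0 <= kern c d t.
Proof. by rewrite fine_ge0// kernE_ge0. Qed.

Lemma kernEN c d t : kernE c d (- t) = kernE c d t.
Proof. by apply: eq_integral => z _; rewrite QkN. Qed.

Lemma measurable_kern_integrand c d : mfunT
  (fun p : measurableTypeR R * 'rV[R]_n.+1 => (sphw p.2 * Qk d (p.1 : R) p.2 `^ (- c))%:E).
Proof. by rewrite /Qk; mfun. Qed.

Lemma measurable_kernE c d : mfunT (fun t : R => kernE c d t).
Proof.
apply: (measurable_fun_fubini_tonelli_F _ (measurable_kern_integrand c d)) => p.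
by rewrite lee_fin mulr_ge0 ?sphw_ge0 ?powR_ge0.
Qed.

Lemma measurable_kern c d : mfunT (kern c d).
Proof.
by have := measurableT_comp (@fine_measurable R setT measurableT) (measurable_kernE c d); exact.
Qed.

Lemma measurable_kern_z c d t : mfunT (fun z => (sphw z * Qk d t z `^ (- c))%:E).
Proof. by rewrite /Qk; mfun. Qed.

(** The left side is the squared sine of the angle, 1 - w^2 = (1 - w)(1 + w) <= 2 - 2w. *)
Lemma chord_lower (z : 'rV[R]_n.+1) : z != 0 ->
  (enorm (uncons_rV z).2 / enorm z) ^+ 2 <= 2 - 2 * om z.
Proof.
move=> z0; have ez : 0 < enorm z by rewrite enorm_gt0.
rewrite expr_div_n ler_pdivrMr ?exprn_gt0//.
have e2 : enorm z ^+ 2 = z ord0 ord0 ^+ 2 + enorm (uncons_rV z).2 ^+ 2.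
  rewrite -[in LHS](uncons_rVK z) (_ : uncons_rV z = (z ord0 ord0, (uncons_rV z).2))//.
  by rewrite sqr_enorm_cons.
have zom : z ord0 ord0 = enorm z * om z.
  by rewrite /om /udir mxE mulrA divff ?mul1r// gt_eqF.
have := om_le1 z; have := om_geN1 z; move: e2; rewrite zom.
move: (om z) (enorm z) (enorm (uncons_rV z).2) ez => w e f e0 e2 w1 w2.
have -> : f ^+ 2 = (1 - w ^+ 2) * e ^+ 2 by move: e2; rewrite exprMn; lra.
rewrite ler_pM2r ?exprn_gt0//; nra.
Qed.

(** Near the axis the integrand behaves like |x'|^(-m) in the n transverse coordinates x', whence m
    < n. It is dominated by a product of a function of the first coordinate and one of x'; the
    factor e^m comes from |z| < e on the annulus. *)
Lemma integral_chord m : (0 < n)%N -> 0 <= m -> m < n%:R ->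
  (\int[Lb n.+1]_z (sphw z * (2 - 2 * om z) `^ (- (m / 2)))%:E < +oo)%E.
Proof.
move=> n0 m0 mn.
pose B1 (a : R) := (\1_(`[- expR 1, expR 1]%classic) a : R).
pose B2 (y : 'rV[R]_n) := \1_[set x : R | x <= expR 1] (enorm y) * enorm y `^ (- m).
pose B (z : 'rV[R]_n.+1) := expR m * (B1 (uncons_rV z).1 * B2 (uncons_rV z).2).
have mB1 : mfunT B1 by apply: measurable_indic; exact: measurable_itv.
have mB2 : mfunT B2 by rewrite /B2; mfun.
have mB : mfunT B.
  have mU := @measurable_uncons_rV R n; rewrite /B; do 2 apply: measurable_funM => //.
    exact: (measurableT_comp mB1 (measurableT_comp measurable_fst mU)).
  exact: (measurableT_comp mB2 (measurableT_comp measurable_snd mU)).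
have B10 a : 0 <= B1 a by [].
have B20 y : 0 <= B2 y by rewrite mulr_ge0// powR_ge0.
have B0 z : 0 <= B z by exact: (mulr_ge0 (expR_ge0 m) (mulr_ge0 (B10 _) (B20 _))).
apply: (@le_lt_trans _ _ (\int[Lb n.+1]_z (B z)%:E)%E).
  apply: ae_ge0_le_integral => //.
  - by move=> z _; rewrite lee_fin mulr_ge0 ?sphw_ge0 ?powR_ge0.
  - by mfun.
  - by move=> z _; rewrite lee_fin.
  - by mfun.
  apply: filterS (ae_axis n0) => z z' _; rewrite lee_fin.
  have [->|sz] := eqVneq (sphw z) 0; first by rewrite mul0r.
  have z0 := sphw_neq0 sz.
  have : z \in @annulus R n.+1.
    by apply: contraNT sz => h; rewrite /sphw indicE (negbTE h) mul0r.
  rewrite inE => zA; have /andP[z1 ze] := zA.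
  have ez : 0 < enorm z by exact: lt_le_trans z1.
  have ez' : 0 < enorm (uncons_rV z).2 by rewrite enorm_gt0.
  have s1 : sphw z <= 1.
    rewrite /sphw indicE mem_set// mul1r -expR0 ler_expR mulNr oppr_le0.
    by rewrite mulr_ge0// ln_ge0.
  have z'z : enorm (uncons_rV z).2 <= enorm z.
    rewrite -(ler_pXn2r (n := 2))// ?nnegrE ?enorm_ge0//.
    rewrite -[in leRHS](uncons_rVK z) (_ : uncons_rV z = ((uncons_rV z).1, (uncons_rV z).2))//.
    by rewrite sqr_enorm_cons lerDr sqr_ge0.
  rewrite /B /B1 /B2 !indicE mem_set ?mem_set; first last.
  - by rewrite /= in_itv/= -ler_norml (le_trans (coord_le_enorm _ _))// ltW.
  - by rewrite /= (le_trans z'z)// ltW.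
  rewrite !mul1r; apply: le_trans (ler_piMl (powR_ge0 _ _) s1) _.
  have h0 : 0 < enorm (uncons_rV z).2 / expR 1 by rewrite divr_gt0// expR_gt0.
  have h1 : (enorm (uncons_rV z).2 / expR 1) ^+ 2 <= 2 - 2 * om z.
    apply: le_trans (chord_lower z0).
    rewrite ler_pXn2r// ?nnegrE ?divr_ge0 ?enorm_ge0 ?expR_ge0//.
    by rewrite ler_pM2l// lef_pV2 ?posrE ?expR_gt0// ltW.
  apply: le_trans (ler_powRN _ h1 _) _; rewrite ?exprn_gt0 ?divr_ge0//.
  have -> : expR m = (expR 1)^-1 `^ (- m) by rewrite -expRN expR_powR mulNr mulrN1 opprK.
  rewrite -powRM ?invr_ge0 ?expR_ge0 ?enorm_ge0// mulrC -powR_mulrn; last by rewrite mulr_ge0 ?invr_ge0 ?enorm_ge0 ?expR_ge0.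
  by rewrite -powRrM (_ : 2%:R * - (m / 2) = - m)//; field.
have mcB : mfunT (fun z => (B z)%:E) by exact/measurable_EFinP.
rewrite (ge0_integral_cons mcB) => [|z]; last by rewrite lee_fin.
have fin2 : (\int[Lb n]_y (B2 y)%:E < +oo)%E by apply: integral_ball_powR => //; exact: expR_gt0.
have I2 : (\int[Lb n]_y (B2 y)%:E \is a fin_num)%E.
  by rewrite ge0_fin_numE//; apply: integral_ge0 => y _; rewrite lee_fin.
rewrite (_ : (fun a => _) = (fun a : R => (B1 a)%:E * (expR m * fine (\int[Lb n]_y (B2 y)%:E))%:E)%E); last first.
  apply/funext => a; rewrite EFinM fineK// muleA -EFinM -gintZl//.
  - by apply: eq_integral => y _; rewrite /B cons_rVK/= -EFinM; congr EFin; ring.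
  - by mfun.
  - by rewrite mulr_ge0// expR_ge0.
rewrite gintZr//.
- rewrite lte_mul_pinfty//.
  + by apply: integral_ge0 => a _; rewrite lee_fin.
  + rewrite integral_indic ?setIT; [|exact: measurableT|exact: measurable_itv].
    rewrite [X in X \is a fin_num](_ : _ = mu `[(- expR 1)%R, expR 1]%classic)//.
    by rewrite lebesgue_measure_itv/=; case: ifP.
  + exact: ltry.
- by mfun.
- by rewrite mulr_ge0 ?expR_ge0// fine_ge0//; apply: integral_ge0 => y _; rewrite lee_fin.
Qed.

(** For t >= 0 both bounds follow from Q = e^t ((1 - e^(-t))^2 + e^(-t) (2 - 2 om)), the first term
    measuring the radial and the second the angular distance. *)
Lemma Qk_lower t z (q := Num.min 1 `|t|) :
  expR `|t| * (q ^+ 2 / 16) <= Qk 0 t z /\ expR `|t| * ((2 - 2 * om z) / 16) <= Qk 0 t z.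
Proof.
wlog t0 : t @q / 0 <= t.
  move=> H; have [|/ltW t0] := leP 0 t; first exact: H.
  by rewrite /q -normrN -QkN; apply: H; rewrite oppr_ge0.
rewrite {}/q (ger0_norm t0).
have w1 := om_le1 z; have w2 := om_geN1 z; rewrite /Qk addr0.
move: (om z) w1 w2 => w w1 w2.
have e0 := expR_gt0 t; have eN0 := expR_gt0 (- t).
have ee : expR t * expR (- t) = 1 by rewrite -expRD subrr expR0.
have e1 : 1 + t <= expR t by exact: expR_ge1Dx.
have eN1 : 1 - t <= expR (- t) by exact: expR_ge1Dx.
have Qe : expR t + expR (- t) - 2 * w = expR t * ((1 - expR (- t)) ^+ 2 + expR (- t) * (2 - 2 * w)).
  transitivity (expR t + (expR t * expR (- t)) * expR (- t) - 2 * (expR t * expR (- t)) * w); last by ring.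
  by rewrite ee; ring.
have h : Num.min 1 t / 2 <= 1 - expR (- t).
  have : expR (- t) <= (1 + t)^-1.
    by rewrite expRN lef_pV2 ?posrE//; lra.
  have t1 : 0 < 1 + t by lra.
  have : Num.min 1 t / 2 <= 1 - (1 + t)^-1.
    rewrite (_ : 1 - (1 + t)^-1 = t / (1 + t)); last by field; lra.
    rewrite ler_pdivlMr//.
    by have [|] := leP 1 t; nra.
  lra.
have m0 : 0 <= Num.min 1 t by rewrite le_min ler01.
rewrite Qe !ler_pM2l//; split; first by nra.
have [t1|t1] := leP 1 t.
  move: h; rewrite (min_idPl t1) => h.
  by have := mulr_ge0 (ltW eN0) (_ : 0 <= 2 - 2 * w); nra.
have : 1 / 16 <= expR (- t).
  have := @expR_ge1Dx R (- t / 2); have -> : expR (- t) = expR (- t / 2) ^+ 2.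
    by rewrite -expRM_natl; congr expR; field.
  nra.
by have := sqr_ge0 (1 - expR (- t)); nra.
Qed.

Lemma Qk_gt0 d t z : 0 <= d -> t != 0 -> 0 < Qk d t z.
Proof.
move=> d0 t0; have [h _] := Qk_lower t z.
have : 0 < expR `|t| * (Num.min 1 `|t| ^+ 2 / 16).
  by rewrite mulr_gt0 ?expR_gt0// divr_gt0// exprn_gt0// lt_min ltr01 normr_gt0.
by rewrite /Qk in h *; lra.
Qed.

Lemma kernE_le_d c d t : 0 <= c -> 0 <= d -> t != 0 -> (kernE c d t <= kernE c 0 t)%E.
Proof.
move=> c0 d0 t0; apply: gint_le; try exact: measurable_kern_z.
  by move=> z; rewrite lee_fin mulr_ge0 ?sphw_ge0 ?powR_ge0.
move=> z; rewrite lee_fin ler_wpM2l ?sphw_ge0//; apply: ler_powRN => //.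
  exact: Qk_gt0.
by rewrite /Qk; lra.
Qed.

(** The exponent c is divided as k/2 + (2c - k)/2. The first part is spent on the radial lower bound
    of Q and gives the singularity |t|^(-k); the second is spent on the angular one, whose integral
    over directions converges because 2c - k < n. *)
Lemma kernE_bound c k : (0 < n)%N -> 0 <= k -> k <= 2 * c -> 2 * c - k < n%:R ->
  exists C, 0 <= C /\ forall t, t != 0 ->
    (kernE c 0 t <= (C * (expR (- c * `|t|) * (Num.min 1 `|t|) `^ (- k)))%:E)%E.
Proof.
move=> n0 k0 kc kn.
have m0 : 0 <= 2 * c - k by lra.
have J := integral_chord n0 m0 kn.
set I := (\int[Lb n.+1]_z (sphw z * (2 - 2 * om z) `^ (- ((2 * c - k) / 2)))%:E)%E in J.
have I0 : (0 <= I)%E by apply: integral_ge0 => z _; rewrite lee_fin mulr_ge0 ?sphw_ge0 ?powR_ge0.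
have If : I \is a fin_num by rewrite ge0_fin_numE// J.
exists (16 `^ c * fine I); split; first by rewrite mulr_ge0 ?powR_ge0 ?fine_ge0.
move=> t t0; set q := Num.min 1 `|t|.
have q0 : 0 < q by rewrite /q lt_min ltr01 normr_gt0.
rewrite (_ : (_ * _)%:E = (16 `^ c * (expR (- c * `|t|) * q `^ (- k)))%:E * I)%E; last first.
  by rewrite -[in RHS](fineK If) -EFinM; congr EFin; ring.
rewrite -gintZl; first last.
- by rewrite !mulr_ge0 ?powR_ge0 ?expR_ge0.
- by move=> z; rewrite lee_fin mulr_ge0 ?sphw_ge0 ?powR_ge0.
- by mfun.
have mm : mfunT (fun z : 'rV[R]_n.+1 => ((16 `^ c * (expR (- c * `|t|) * q `^ (- k)))%:E * (sphw z * (2 - 2 * om z) `^ (- ((2 * c - k) / 2)))%:E)%E) by mfun.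
apply: ae_ge0_le_integral => //.
- by move=> z _; rewrite lee_fin mulr_ge0 ?sphw_ge0 ?powR_ge0.
- exact: measurable_kern_z.
- by move=> z _; rewrite -EFinM lee_fin !mulr_ge0 ?sphw_ge0 ?powR_ge0 ?expR_ge0.
apply: filterS (ae_axis n0) => z z' _; rewrite -EFinM lee_fin.
have [->|sz] := eqVneq (sphw z) 0; first by rewrite !mul0r mulr0.
have z0 := sphw_neq0 sz.
rewrite mulrCA ler_wpM2l ?sphw_ge0//.
set D := 2 - 2 * om z.
have D0 : 0 < D.
  apply: lt_le_trans (chord_lower z0).
  by rewrite exprn_gt0// divr_gt0 ?enorm_gt0.
have [h1 h2] := Qk_lower t z; rewrite -/q -/D in h1 h2.
have et := expR_gt0 `|t|.
have Q0 : 0 < Qk 0 t z by apply: Qk_gt0.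
pose P := Qk 0 t z / expR `|t|.
have P0 : 0 < P by rewrite divr_gt0.
have hP1 : q ^+ 2 / 16 <= P by rewrite ler_pdivlMr// mulrC.
have hP2 : D / 16 <= P by rewrite ler_pdivlMr// mulrC.
have -> : Qk 0 t z = expR `|t| * P by rewrite mulrC divfK// gt_eqF.
rewrite (powRM _ (expR_ge0 _) (ltW P0)) expR_powR.
rewrite [leRHS](_ : _ = expR (- c * `|t|) * (16 `^ c * q `^ (- k) * D `^ (- ((2 * c - k) / 2)))); last by ring.
rewrite ler_wpM2l ?expR_ge0//.
have p16 (x m : R) : 0 <= x -> (x / 16) `^ (- m) = 16 `^ m * x `^ (- m).
  move=> x0; rewrite powRM ?invr_ge0// mulrC; congr (_ * _).
  by rewrite -powR_inv1// -powRrM mulN1r opprK.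
have m20 : 0 <= (2 * c - k) / 2 by rewrite divr_ge0.
have k20 : 0 <= k / 2 by rewrite divr_ge0.
rewrite (_ : - c = - (k / 2) + - ((2 * c - k) / 2)); last by field.
rewrite powRD; last by rewrite (gt_eqF P0) implybT.
have q2 : 0 < q ^+ 2 / 16 by rewrite divr_gt0// exprn_gt0.
have D16 : 0 < D / 16 by rewrite divr_gt0.
apply: le_trans (ler_pM (powR_ge0 _ _) (powR_ge0 _ _) (ler_powRN q2 hP1 k20) (ler_powRN D16 hP2 m20)) _.
rewrite (p16 _ _ (sqr_ge0 q)) (p16 _ _ (ltW D0)) -powR_mulrn ?(ltW q0)// -powRrM.
rewrite (_ : 2%:R * - (k / 2) = - k); last by field.
rewrite mulrACA -powRD; last by rewrite pnatr_eq0 implybT.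
rewrite (_ : k / 2 + (2 * c - k) / 2 = c); last by field.
by rewrite mulrA.
Qed.

End kernel.

Hint Extern 0 (measurable_fun _ (@om _ _)) => exact: measurable_om : mfun.
Hint Extern 0 (measurable_fun _ (@kernE _ _ _ _)) => exact: measurable_kernE : mfun.
Hint Extern 0 (measurable_fun _ (@kern _ _ _ _)) => exact: measurable_kern : mfun.

Lemma sphwE (R : realType) n (z : 'rV[R]_n) :
  sphw z = \1_(@annulus R n) z * expR (- n%:R * ln (enorm z)).
Proof. by []. Qed.

Lemma powR_mul_EFin_ge0 (R : realType) (a b p q : R) : (0 <= (a `^ p * b `^ q)%:E)%E.
Proof. by rewrite lee_fin mulr_ge0// powR_ge0. Qed.

Lemma sphw_mul_EFin_ge0 (R : realType) n (z : 'rV[R]_n) (b q : R) : (0 <= (sphw z * b `^ q)%:E)%E.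
Proof. by rewrite lee_fin mulr_ge0 ?sphw_ge0 ?powR_ge0. Qed.

Lemma measurable_EFinZ d (T : measurableType d) (R : realType) (c : R) (f : T -> R) :
  mfunT f -> mfunT (fun x => (c * f x)%:E).
Proof. by move=> mf; apply/measurable_EFinP; exact: measurable_funM. Qed.

Lemma measurable_to_EFin d (T : measurableType d) (R : realType) (f : T -> R) :
  mfunT f -> mfunT (fun x => (f x)%:E).
Proof. by move=> mf; exact/measurable_EFinP. Qed.

Lemma gint_ae_eq d (T : measurableType d) (R : realType) (nu : {measure set T -> \bar R})
    (f g : T -> \bar R) : mfunT f -> mfunT g ->
  {ae nu, forall x, f x = g x} -> (\int[nu]_x f x = \int[nu]_x g x)%E.
Proof.
move=> mf mg fg; apply: ae_eq_integral => //.
by apply: filterS fg => x fgx _.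
Qed.

(* Unification diverges when it unfolds integrals and their kernels. *)
Opaque enorm lebesgue_rV expR powR ln sphw.

(** * Riesz potentials of radial functions and composition of kernels *)

Section riesz_kernel.
Context {R : realType} (n : nat).
Local Notation mu := (@lebesgue_measure R).
Local Notation Lb n := (@lebesgue_rV R n).
Local Notation V := 'rV[R]_n.+1.
Implicit Types (c d t : R).

Definition axis (r : R) : V := cons_rV (r, 0).

Lemma enorm_axis r : enorm (axis r) = `|r|.
Proof. exact: enorm_cons0. Qed.

Lemma axisM (a b : R) : axis (a * b) = a *: axis b.
Proof. by rewrite /axis cons_rVZ scaler0. Qed.

Lemma gintZle dd (T : measurableType dd) (nu : {measure set T -> \bar R}) (f : T -> \bar R) (k : \bar R) :
  mfunT f -> (forall x, (0 <= f x)%E) -> (0 <= k)%E ->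
  (\int[nu]_x (k * f x) = k * \int[nu]_x f x)%E.
Proof. by move=> mf f0 k0; apply: ge0_integralZl. Qed.

Lemma lebesgue_rV_set1 (x : V) : Lb n.+1 [set x] = 0%E.
Proof.
rewrite (_ : [set x] = [set y : V | forall i, [set x ord0 i] (y ord0 i)]); last first.
  by apply/seteqP; split => y /= => [->//|H]; apply/rowP => i; rewrite H.
rewrite (lebesgue_rV_box (A := fun i => [set x ord0 i])); last by move=> i; exact: measurable_set1.
by rewrite big_ord_recl lebesgue_measure_set1 mul0e.
Qed.

Lemma ae_neq (x : V) : {ae Lb n.+1, forall y, y != x}.
Proof.
exists [set x]; split; first exact: measurable_rV_set1.
- exact: lebesgue_rV_set1.
- by move=> y /= /negP; rewrite negbK => /eqP.
Qed.

Lemma ae_rV_absurd : {ae Lb n.+1, forall y, False} -> False.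
Proof.
move=> [N [mN N0 sN]].
have /eqP : Lb n.+1 [set x : V | forall i, `[0%R, 1%R]%classic (x ord0 i)] = 0%E.
  apply/eqP; rewrite eq_le measure_ge0 andbT -N0; apply: le_measure; rewrite ?inE//.
    by apply: (@measurable_box R n.+1 (fun=> `[0%R, 1%R]%classic)) => i; exact: measurable_itv.
  by move=> x _; apply: sN.
rewrite (lebesgue_rV_box (A := fun=> `[0%R, 1%R]%classic)); last by move=> i; exact: measurable_itv.
rewrite big1 => [|i _]; first by rewrite onee_eq0.
by rewrite lebesgue_measure_itv/= lte_fin ltr01 oppr0 adde0.
Qed.

Lemma enorm_axis_sub (r s : R) (z : V) : z != 0 ->
  enorm (axis (expR r) - expR s *: udir z) ^+ 2 = expR (r + s) * Qk 0 (r - s) z.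
Proof.
move=> z0; rewrite sqr_enormB enorm_axis enormZ enorm_udir// !gtr0_norm ?expR_gt0// mulr1.
have -> : dotr (axis (expR r)) (expR s *: udir z) = expR (r + s) * om z.
  rewrite dotrZr -[udir z]uncons_rVK (_ : uncons_rV (udir z) = (om z, (uncons_rV (udir z)).2))//.
  by rewrite /axis dotr_cons -(scale0r 0) dotrZl mul0r addr0 expRD; ring.
rewrite /Qk opprB addr0 !mulrDr !expRD expRN expRN.
have h1 : expR r != 0 by rewrite gt_eqF ?expR_gt0.
have h2 : expR s != 0 by rewrite gt_eqF ?expR_gt0.
by field; rewrite h1 h2.
Qed.

Lemma udirE (z : V) : udir z = (enorm z)^-1 *: z.
Proof. by []. Qed.

Opaque axis udir.

Lemma ge0_integral_align (x : V) (F : R -> R -> \bar R) :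
  (forall a b, (0 <= F a b)%E) ->
  mfunT (fun y : V => F (enorm (axis (enorm x) - y)) (enorm y)) ->
  (\int[Lb n.+1]_y F (enorm (x - y)) (enorm y) =
   \int[Lb n.+1]_y F (enorm (axis (enorm x) - y)) (enorm y))%E.
Proof.
move=> F0 mF; have [phi [mp ip p0 pp] px] := isometry_align x.
rewrite -[RHS]pp//; apply: eq_integral => y _.
by rewrite -[axis _]px ip -[phi y]subr0 -p0 ip subr0.
Qed.

(** An isometry puts x on the first axis; in polar coordinates |x - y|^(-2c) is then e^(-c(s + ln
    |x|)) times a power of [Qk], and the integral over directions is the kernel. *)
Theorem riesz_radial c (x : V) (f : R -> \bar R) : x != 0 ->
  mfunT f -> (forall t, (0 <= f t)%E) ->
  (\int[Lb n.+1]_y ((enorm (x - y) `^ (- (2 * c)))%:E * f (ln (enorm y))) =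
   \int[mu]_s ((expR (n.+1%:R * s - c * (s + ln (enorm x))))%:E * f s *
     kernE n c 0 (ln (enorm x) - s)))%E.
Proof.
move=> x0 mf f0; pose t := ln (enorm x).
have et : enorm x = expR t by rewrite /t lnK// posrE enorm_gt0.
have mF : mfunT (fun y : V =>
    (enorm (axis (enorm x) - y) `^ (- (2 * c)))%:E * f (ln (enorm y)))%E.
  by mfun.
rewrite (@ge0_integral_align x (fun a b => (a `^ (- (2 * c)))%:E * f (ln b))%E)//; last first.
  by move=> a b; rewrite mule_ge0// lee_fin powR_ge0.
rewrite (ge0_integral_polar_udir _ mF)//; last first.
  by move=> y; rewrite mule_ge0// lee_fin powR_ge0.
pose W (s : R) := ((expR (n.+1%:R * s - c * (s + t)))%:E * f s)%E.
have W0 s : (0 <= W s)%E by rewrite mule_ge0// lee_fin expR_ge0.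
have mW : mfunT W.
  apply: emeasurable_funM => //; apply/measurable_EFinP.
  apply: (measurableT_comp (@measurable_expR R)); apply: measurable_funB.
    by apply: measurable_funM.
  by mfun.
pose J (p : measurableTypeR R * V) :=
  (W p.1 * (sphw p.2 * Qk 0 (t - p.1) p.2 `^ (- c))%:E)%E.
have mJ : mfunT J.
  apply: emeasurable_funM; first exact: (measurableT_comp mW measurable_fst).
  apply/measurable_EFinP; apply: measurable_funM.
    by mfun.
  apply: measurable_powR_comp; apply: measurable_Qk; last exact: measurable_snd.
  by mfun.
have J0 p : (0 <= J p)%E by rewrite mule_ge0// lee_fin mulr_ge0 ?sphw_ge0 ?powR_ge0.
transitivity (\int[Lb n.+1]_z \int[mu]_s J (s, z))%E.
  apply: eq_integral => z _.
  rewrite -gintZl ?sphw_ge0//; first last.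
  - by move=> s; rewrite !mule_ge0// lee_fin ?expR_ge0// powR_ge0.
  - by mfun.
  apply: eq_integral => s _; rewrite /J/=.
  have [->|/sphw_neq0 z0] := eqVneq (sphw z) 0; first by rewrite mul0e mul0r mule0.
  rewrite et enorm_powR2 enorm_axis_sub// powRM ?expR_ge0 ?Qk_ge0// expR_powR.
  rewrite enormZ enorm_udir// mulr1 gtr0_norm ?expR_gt0// expRK /W.
  rewrite [(n.+1%:R * s - _)](_ : _ = n.+1%:R * s + (- c * (t + s))); last by ring.
  by rewrite expRD !muleA -!EFinM [RHS]muleAC -EFinM; congr (_%:E * _)%E; ring.
rewrite -(fubini_tonelli _ mJ)//; apply: eq_integral => s _.
rewrite /J/= gintZle; first by rewrite -/t.
- exact: measurable_kern_z.
- by move=> z; rewrite lee_fin mulr_ge0 ?sphw_ge0 ?powR_ge0.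
- exact: W0.
Qed.

Lemma sphere_average c (s : R) (y : V) : y != 0 ->
  (\int[Lb n.+1]_z (sphw z * enorm (y - expR s *: udir z) `^ (- (2 * c)))%:E =
   (expR (- c * (ln (enorm y) + s)))%:E * kernE n c 0 (ln (enorm y) - s))%E.
Proof.
move=> y0; pose r := ln (enorm y).
have er : enorm y = expR r by rewrite /r lnK// posrE enorm_gt0.
(* Expressed through |w|, |z| and |w - z| only, the integrand becomes accessible to
   [ge0_integral_align], which lets y be moved to the first axis. *)
have dE (w : V) z : z != 0 -> enorm (w - expR s *: udir z) ^+ 2 =
    enorm w ^+ 2 + expR s ^+ 2 - expR s * (enorm z)^-1 * (enorm w ^+ 2 + enorm z ^+ 2 - enorm (w - z) ^+ 2).
  move=> z0; rewrite (sqr_enormB w (expR s *: udir z)) (sqr_enormB w z) enormZ enorm_udir// mulr1 gtr0_norm ?expR_gt0//.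
  rewrite dotrZr udirE dotrZr.
  have ez : enorm z != 0 by rewrite enorm_eq0.
  by field.
pose F (a b : R) : \bar R := ((\1_[set x : R | 1 <= x < expR 1] b * expR (- n.+1%:R * ln b)) *
  (enorm y ^+ 2 + expR s ^+ 2 - expR s * b^-1 * (enorm y ^+ 2 + b ^+ 2 - a ^+ 2)) `^ (- c))%:E.
have sF (z : V) : sphw z = \1_[set x : R | 1 <= x < expR 1] (enorm z) * expR (- n.+1%:R * ln (enorm z)).
  by rewrite sphwE !indicE; congr ((nat_of_bool _)%:R * _); apply/idP/idP; rewrite !inE.
have F0 a b : (0 <= F a b)%E by rewrite lee_fin !mulr_ge0// ?expR_ge0 ?powR_ge0.
have mF (w : V) : mfunT (fun z : V => F (enorm (w - z)) (enorm z)).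
  apply/measurable_EFinP; apply: measurable_funM.
    rewrite (_ : (fun x => _) = @sphw R n.+1); last by apply/funext => z; rewrite sF.
    by mfun.
  have me := @measurable_enorm R n.+1.
  by mfun.
transitivity (\int[Lb n.+1]_z F (enorm (y - z)) (enorm z))%E.
  apply: eq_integral => z _; rewrite /F -sF; congr EFin.
  have [->|/sphw_neq0 z0] := eqVneq (sphw z) 0; first by rewrite !mul0r.
  by rewrite enorm_powR2 dE.
rewrite ge0_integral_align// -gintZl; first last.
- exact: expR_ge0.
- by move=> z; rewrite lee_fin mulr_ge0 ?sphw_ge0 ?powR_ge0.
- exact: measurable_kern_z.
apply: eq_integral => z _; rewrite -EFinM /F -sF; congr EFin.
have [->|/sphw_neq0 z0] := eqVneq (sphw z) 0; first by rewrite !mul0r mulr0.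
rewrite mulrCA; congr (_ * _).
have := dE (axis (enorm y)) z z0; rewrite enorm_axis (ger0_norm (enorm_ge0 y)) => <-.
rewrite er (enorm_axis_sub r s z0) (powRM _ (expR_ge0 _) (Qk_ge0 _ _ (lexx 0))).
by rewrite expR_powR expRK.
Qed.

(** Here b and d stand for the distances of z to the origin and to a unit vector. Near one of the
    two points the other factor is bounded. Away from both, b <= 1 + d <= 3d, so the product is at
    most a power b^(-2p), integrable at infinity for large p. *)
Lemma riesz_comp_bound (b d p : R) : 0 <= b -> 0 <= d -> 0 <= p -> 1 <= b + d -> b <= 1 + d ->
  d `^ (- p) * b `^ (- p) <= 2 `^ p * (\1_[set x : R | x <= 2^-1] b * b `^ (- p)) +
    (2 `^ p * (\1_[set x : R | x <= 2^-1] d * d `^ (- p)) +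
     3 `^ p * (\1_[set x : R | 2^-1 <= x] b * b `^ (- (p + p)))).
Proof.
move=> b0 d0 p0 tri tri2.
have h2 : 0 < 2^-1 :> R by rewrite invr_gt0.
have q1 : 0 <= 2 `^ p * (\1_[set x : R | x <= 2^-1] b * b `^ (- p)) by rewrite !mulr_ge0// powR_ge0.
have q2 : 0 <= 2 `^ p * (\1_[set x : R | x <= 2^-1] d * d `^ (- p)) by rewrite !mulr_ge0// powR_ge0.
have q3 : 0 <= 3 `^ p * (\1_[set x : R | 2^-1 <= x] b * b `^ (- (p + p))) by rewrite !mulr_ge0// powR_ge0.
have i2 : 2 `^ p = 2^-1 `^ (- p) :> R by rewrite -powR_inv1// -powRrM mulN1r opprK.
have i3 : 3 `^ p = 3^-1 `^ (- p) :> R by rewrite -powR_inv1// -powRrM mulN1r opprK.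
have [z1|z1] := leP b 2^-1.
  suff : d `^ (- p) * b `^ (- p) <= 2 `^ p * (\1_[set x : R | x <= 2^-1] b * b `^ (- p)) by lra.
  rewrite indicE mem_set// mul1r ler_wpM2r ?powR_ge0// i2 ler_powRN//.
  by rewrite (splitr 1) in tri; lra.
have [z2|z2] := leP d 2^-1.
  suff : d `^ (- p) * b `^ (- p) <= 2 `^ p * (\1_[set x : R | x <= 2^-1] d * d `^ (- p)) by lra.
  rewrite [\1__ d]indicE mem_set// mul1r mulrC ler_wpM2r ?powR_ge0// i2 ler_powRN//.
  exact: ltW.
suff : d `^ (- p) * b `^ (- p) <= 3 `^ p * (\1_[set x : R | 2^-1 <= x] b * b `^ (- (p + p))) by lra.
have ez : 0 < b by exact: lt_trans z1.
rewrite indicE mem_set; last exact: ltW.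
rewrite mul1r opprD powRD; last by rewrite (gt_eqF ez) implybT.
rewrite mulrA ler_wpM2r ?powR_ge0// i3 -powRM ?invr_ge0//.
by apply: ler_powRN => //; [rewrite mulr_gt0// invr_gt0|lra].
Qed.

(* The constant in the composition of two Riesz kernels. *)
Definition riesz_comp a : \bar R :=
  (\int[Lb n.+1]_z (enorm (axis 1 - z) `^ (- (2 * a)) * enorm z `^ (- (2 * a)))%:E)%E.

Lemma riesz_comp_lty a : 0 < a -> 2 * a < n.+1%:R -> n.+1%:R < 4 * a -> (riesz_comp a < +oo)%E.
Proof.
move=> a0 an na.
set e := axis 1.
have e1 : enorm (e : V) = 1 by rewrite enorm_axis normr1.
pose S1 (y : V) : R := \1_[set x : R | x <= 2^-1] (enorm y) * enorm y `^ (- (2 * a)).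
pose S2 (y : V) : R := \1_[set x : R | 2^-1 <= x] (enorm y) * enorm y `^ (- (4 * a)).
have h2 : 0 < 2^-1 :> R by rewrite invr_gt0.
have f1 : (\int[Lb n.+1]_y (S1 y)%:E < +oo)%E by apply: integral_ball_powR.
have f2 : (\int[Lb n.+1]_y (S2 y)%:E < +oo)%E by apply: integral_tail_powR.
have mS1 : mfunT S1 by rewrite /S1; mfun.
have mS2 : mfunT S2 by rewrite /S2; mfun.
have S10 y : 0 <= S1 y by rewrite mulr_ge0// powR_ge0.
have S20 y : 0 <= S2 y by rewrite mulr_ge0// powR_ge0.
have mS1e : mfunT (fun z : V => S1 (z - e)).
  by apply: (measurableT_comp mS1); apply: measurable_rVB => //; exact: measurable_cst.
have f1e : (\int[Lb n.+1]_y (S1 (y - e))%:E < +oo)%E.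
  have mE1 := measurable_to_EFin mS1.
  by rewrite (@ge0_integral_rV_shift R n.+1 (- e) _ mE1) => [|y]; [exact: f1|rewrite lee_fin S10].
have bnd z : enorm (e - z) `^ (- (2 * a)) * enorm z `^ (- (2 * a)) <=
    2 `^ (2 * a) * S1 z + (2 `^ (2 * a) * S1 (z - e) + 3 `^ (2 * a) * S2 z).
  have a20 : 0 <= 2 * a by rewrite mulr_ge0// ltW.
  have tri : 1 <= enorm z + enorm (e - z).
    by have := enormD z (e - z); rewrite addrC subrK e1.
  have tri2 : enorm z <= 1 + enorm (e - z).
    by have := enormD e (z - e); rewrite addrC subrK e1 (enormB z).
  rewrite /S1 /S2 (enormB z e) (_ : 4 * a = 2 * a + 2 * a); last by ring.
  exact: (riesz_comp_bound (enorm_ge0 z) (enorm_ge0 _) a20 tri tri2).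
have m1 := measurable_EFinZ (2 `^ (2 * a)) mS1.
have m2 := measurable_EFinZ (2 `^ (2 * a)) mS1e.
have m3 := measurable_EFinZ (3 `^ (2 * a)) mS2.
have g0 (k x : R) : 0 <= x -> (0 <= (k `^ (2 * a) * x)%:E)%E.
  by move=> x0; rewrite lee_fin mulr_ge0// powR_ge0.
have zf (k : R) (S : V -> R) : mfunT S -> (forall y, 0 <= S y) ->
    (\int[Lb n.+1]_y (S y)%:E < +oo)%E -> (\int[Lb n.+1]_y (k `^ (2 * a) * S y)%:E < +oo)%E.
  move=> mS Sp fS; under eq_integral do rewrite EFinM.
  rewrite gintZl ?powR_ge0//; first by rewrite lte_mul_pinfty// lee_fin powR_ge0.
  by mfun.
apply: (@le_lt_trans _ _ (\int[Lb n.+1]_z ((2 `^ (2 * a) * S1 z)%:E +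
    ((2 `^ (2 * a) * S1 (z - e))%:E + (3 `^ (2 * a) * S2 z)%:E)))%E).
  apply: gint_le.
  - apply/measurable_EFinP; apply: measurable_funM; apply: measurable_powR_comp; last exact: measurable_enorm.
    by mfun.
  - by move=> z; exact: powR_mul_EFin_ge0.
  - exact: (emeasurable_funD m1 (emeasurable_funD m2 m3)).
  - by move=> z; rewrite -!EFinD lee_fin; exact: bnd.
have z1 := zf 2 _ mS1 S10 f1.
have z2 := zf 2 _ mS1e (fun z => S10 _) f1e.
have z3 := zf 3 _ mS2 S20 f2.
rewrite (gintD _ m1 _ (emeasurable_funD m2 m3)); last 2 first.
- by move=> z; exact: (g0 _ _ (S10 z)).
- by move=> z; exact: (adde_ge0 (g0 _ _ (S10 _)) (g0 _ _ (S20 _))).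
rewrite (gintD _ m2 _ m3); last 2 first.
- by move=> z; exact: (g0 _ _ (S10 _)).
- by move=> z; exact: (g0 _ _ (S20 _)).
exact: (lte_add_pinfty z1 (lte_add_pinfty z2 z3)).
Qed.

Lemma riesz_comp_gt0 a : (0 < riesz_comp a)%E.
Proof.
rewrite lt_def; apply/andP; split; last first.
  by apply: integral_ge0 => z _; rewrite lee_fin mulr_ge0// powR_ge0.
apply/eqP => C0.
have mf : mfunT (fun z : V =>
    (enorm (axis 1 - z) `^ (- (2 * a)) * enorm z `^ (- (2 * a)))%:E).
  by mfun.
have /(ae_eq_integral_abs (Lb n.+1) measurableT mf) ae0 :
    (\int[Lb n.+1]_z `|(enorm (axis 1 - z) `^ (- (2 * a)) * enorm z `^ (- (2 * a)))%:E| = 0)%E.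
  rewrite -C0; apply: eq_integral => z _; rewrite gee0_abs// lee_fin.
  by rewrite mulr_ge0// powR_ge0.
apply: ae_rV_absurd; apply: filterS3 (ae_neq 0) (ae_neq (axis 1)) ae0 => z z0 z1 /(_ I) [] /eqP.
rewrite mulf_eq0 !powR_eq0 !enorm_eq0 subr_eq0 [axis 1 == z]eq_sym.
by rewrite (negbTE z0) (negbTE z1).
Qed.

(** Translation, rotation and dilation reduce the integral to [riesz_comp]; homogeneity dictates the
    exponent n + 1 - 4a of |x - y|. *)
Lemma riesz_semigroup a (x y : V) : x != y ->
  (\int[Lb n.+1]_z (enorm (x - z) `^ (- (2 * a)) * enorm (z - y) `^ (- (2 * a)))%:E =
   riesz_comp a * (enorm (x - y) `^ (- (2 * (2 * a - n.+1%:R / 2))))%:E)%E.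
Proof.
move=> xy; pose w := x - y; have w0 : w != 0 by rewrite subr_eq0.
have ew : 0 < enorm w by rewrite enorm_gt0.
have mm (u v : V) : mfunT (fun z : V =>
    (enorm (u - z) `^ (- (2 * a)) * enorm (z - v) `^ (- (2 * a)))%:E).
  by mfun.
have pp (b d : R) : (0 <= (b `^ (- (2 * a)) * d `^ (- (2 * a)))%:E)%E.
  by rewrite lee_fin mulr_ge0// powR_ge0.
rewrite -(@ge0_integral_rV_shift R n.+1 y _ (mm x y))//.
transitivity (\int[Lb n.+1]_z (enorm (w - z) `^ (- (2 * a)) * enorm z `^ (- (2 * a)))%:E)%E.
  apply: eq_integral => z _; rewrite addrK (_ : x - (z + y) = w - z)//.
  by rewrite /w opprD addrA addrAC.
have mw : mfunT (fun z : V =>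
    (enorm (axis (enorm w) - z) `^ (- (2 * a)) * enorm z `^ (- (2 * a)))%:E).
  have := mm (axis (enorm w)) 0.
  by congr (measurable_fun _ _); apply/funext => z; rewrite subr0.
rewrite (@ge0_integral_align w (fun b d => (b `^ (- (2 * a)) * d `^ (- (2 * a)))%:E))//.
rewrite (@ge0_integral_rV_scale R n.+1 (enorm w) _ ew mw); last by move=> z; exact: pp.
rewrite (_ : (fun z => _) = (fun z : V => (enorm w `^ (- (4 * a)))%:E *
    (enorm (axis 1 - z) `^ (- (2 * a)) * enorm z `^ (- (2 * a)))%:E)%E); last first.
  apply/funext => z; rewrite -EFinM; congr EFin.
  have -> : axis (enorm w) = enorm w *: axis 1.
    by rewrite -axisM mulr1.
  rewrite -scalerBr (enormZ (enorm w) (axis 1 - z)) (enormZ (enorm w) z) (gtr0_norm ew).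
  rewrite (powRM _ (enorm_ge0 w) (enorm_ge0 _)) (powRM _ (enorm_ge0 w) (enorm_ge0 z)).
  rewrite (_ : - (4 * a) = - (2 * a) + - (2 * a)); last by ring.
  rewrite powRD; last by rewrite (gt_eqF ew) implybT.
  exact: mulrACA.
rewrite gintZl; last 3 first.
- have := mm (axis 1) 0.
  by congr (measurable_fun _ _); apply/funext => z; rewrite subr0.
- by move=> z; exact: pp.
- exact: powR_ge0.
rewrite muleA muleC; congr (_ * _)%E; rewrite -EFinM; congr EFin.
rewrite -powR_mulrn ?(ltW ew)// -powRD; last by rewrite (gt_eqF ew) implybT.
by congr (_ `^ _); field.
Qed.

(** The semigroup identity is integrated in y over the unit sphere. Taking the integral over the
    sphere last gives the left side, taking it first gives the right one by [sphere_average] and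
    [riesz_radial]. The result exhibits the kernel of parameter 2a - (n+1)/2 as the correlation with
    itself of e^((n+1)/2 - a) r) times the kernel of parameter a. *)
Lemma kern_composition a t : t != 0 ->
  (riesz_comp a * kernE n (2 * a - n.+1%:R / 2) 0 t =
   \int[mu]_r ((expR ((n.+1%:R / 2 - a) * r))%:E * kernE n a 0 r *
               ((expR ((n.+1%:R / 2 - a) * (r - t)))%:E * kernE n a 0 (r - t))))%E.
Proof.
move=> t0; set g := n.+1%:R / 2 - a; set c := 2 * a - _.
have [x ex] : exists x : V, enorm x = expR t.
  by exists (axis (expR t)); rewrite enorm_axis gtr0_norm// expR_gt0.
have x0 : x != 0 by rewrite -enorm_gt0 ex expR_gt0.
have Cge0 : (0 <= riesz_comp a)%E.
  by apply: integral_ge0 => z _; rewrite lee_fin mulr_ge0// powR_ge0.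
have mP : mfunT (fun p : V * V =>
   (sphw p.1 * (enorm (x - p.2) `^ (- (2 * a)) * enorm (p.2 - expR 0 *: udir p.1) `^ (- (2 * a))))%:E).
  by mfun.
have P0 p : (0 <= (sphw (p.1 : V) * (enorm (x - p.2) `^ (- (2 * a)) * enorm (p.2 - expR 0 *: udir p.1) `^ (- (2 * a))))%:E)%E.
  by rewrite lee_fin !mulr_ge0 ?sphw_ge0 ?powR_ge0.
have := fubini_tonelli (m1 := Lb n.+1) (m2 := Lb n.+1) _ mP P0.
set LL := (X in X = _ -> _); set RR := (X in _ = X -> _) => LR.
have LLE : LL = (riesz_comp a * ((expR (- c * t))%:E * kernE n c 0 t))%E.
  rewrite /LL -[in RHS](subr0 t).
  have := sphere_average c 0 x0; rewrite ex expRK !addr0 !subr0 => <-.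
  rewrite -gintZle; first last.
  - exact: Cge0.
  - by move=> z; exact: sphw_mul_EFin_ge0.
  - by mfun.
  apply: eq_integral => z _ /=.
  under eq_integral do rewrite EFinM.
  rewrite gintZl; first last.
  - exact: sphw_ge0.
  - by move=> y; exact: powR_mul_EFin_ge0.
  - by mfun.
  have [->|/sphw_neq0 z0] := eqVneq (sphw z) 0; first by rewrite mul0e mul0r mule0.
  rewrite riesz_semigroup; first by rewrite muleCA -EFinM.
  apply: contraNneq t0 => /(congr1 (@enorm R n.+1)).
  rewrite ex (enormZ (expR 0) (udir z)) (enorm_udir z0) mulr1 (gtr0_norm (expR_gt0 0)).
  by move=> /expR_inj ->; exact: eqxx.
have RRE : RR = (\int[Lb n.+1]_y ((enorm (x - y) `^ (- (2 * a)))%:E *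
    ((expR (- a * ln (enorm y)))%:E * kernE n a 0 (ln (enorm y)))))%E.
  apply: (gint_ae_eq (measurable_fun_fubini_tonelli_G _ mP P0)).
  - by mfun.
  apply: filterS (ae_neq0 (n := n.+1) isT) => y y0 /=.
  have := sphere_average a 0 y0; rewrite addr0 subr0 => <-.
  rewrite -gintZl; first last.
  - exact: powR_ge0.
  - by move=> z; exact: sphw_mul_EFin_ge0.
  - by mfun.
  by apply: eq_integral => z _; rewrite -EFinM; congr EFin; exact: mulrCA.
move: LR; rewrite LLE RRE.
have mk : mfunT (fun r : R => (expR (- a * r))%:E * kernE n a 0 r)%E by mfun.
rewrite (@riesz_radial a x (fun r => (expR (- a * r))%:E * kernE n a 0 r)%E)//; last first.
  by move=> r; rewrite mule_ge0 ?kernE_ge0// lee_fin expR_ge0.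
rewrite ex expRK => LR.
transitivity ((expR (c * t))%:E * (riesz_comp a * ((expR (- c * t))%:E * kernE n c 0 t)))%E.
  rewrite muleCA; congr (_ * _)%E; rewrite muleA -EFinM -expRD.
  by rewrite mulNr subrr expR0 mul1e.
rewrite LR -gintZl; first last.
- exact: expR_ge0.
- by move=> r; rewrite !mule_ge0 ?kernE_ge0// lee_fin expR_ge0.
- apply: emeasurable_funM; first apply: emeasurable_funM => //.
    apply/measurable_EFinP; apply: (measurableT_comp (@measurable_expR R)).
    apply: measurable_funB; first by apply: measurable_funM.
    by mfun.
  by mfun.
apply: eq_integral => r _; rewrite -(kernEN n a 0 (r - t)) opprB.
rewrite muleACA -EFinM [LHS](_ : _ = (expR (c * t) * expR (n.+1%:R * r - a * (r + t)) * expR (- a * r))%:E *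
  (kernE n a 0 r * kernE n a 0 (t - r)))%E; last first.
  by rewrite !EFinM !muleA.
congr (_%:E * _)%E; rewrite -!expRD; congr expR; rewrite /c /g; by field.
Qed.

End riesz_kernel.

(** * Second-order Taylor bounds for real powers *)

Section taylor_powR.
Context {R : realType}.
Implicit Types (a b c r x y p : R).

Lemma expR_taylor2 y : 0 <= expR y - 1 - y <= y ^+ 2 * expR `|y|.
Proof.
apply/andP; split; first by have := @expR_ge1Dx R y; lra.
have h (z : R) : 0 <= z -> expR z - 1 <= z * expR z.
  move=> z0; have := @expR_ge1Dx R (- z); rewrite expRN => h.
  have := expR_gt0 z => e0.
  have : (1 - z) * expR z <= 1 by rewrite -ler_pdivlMr// div1r; lra.
  lra.
have [y0|y0] := leP 0 y.
  rewrite (ger0_norm y0); have := h y y0; have := @expR_ge1Dx R y.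
  have := expR_gt0 y; move: (expR y) => e e0 e1 e2.
  by have : y * (e - 1) <= y * (y * e); [rewrite ler_wpM2l|nra].
rewrite (ltr0_norm y0).
have e1 : 1 <= expR (- y) by rewrite -expR0 ler_expR; lra.
have e2 := @expR_ge1Dx R y; have e3 : expR y <= 1 by rewrite -[leRHS]expR0 ler_expR ltW.
have e4 : expR y - 1 - y <= y * (expR y - 1).
  have e0 := expR_gt0 y.
  have : expR y * (1 - y) <= expR y * expR (- y).
    by rewrite ler_pM2l//; have := @expR_ge1Dx R (- y); lra.
  by rewrite -expRD subrr expR0; lra.
have e5 : y * (expR y - 1) <= y ^+ 2 by nra.
apply: le_trans e4 (le_trans e5 _); rewrite ler_peMr ?sqr_ge0//.
Qed.

Lemma ln_taylor2 r : 0 < r -> 0 <= r - 1 - ln r <= (r - 1) ^+ 2 / r.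
Proof.
move=> r0; have h1 : ln r <= r - 1.
  by have := @expR_ge1Dx R (ln r); rewrite lnK ?posrE//; lra.
have h2 : 1 - r^-1 <= ln r.
  by have := @expR_ge1Dx R (- ln r); rewrite expRN lnK ?posrE//; lra.
apply/andP; split; first by lra.
rewrite (_ : (r - 1) ^+ 2 / r = r - 1 - (1 - r^-1)); first by lra.
by field; rewrite gt_eqF.
Qed.

(** With r^p = e^y and y = p ln r, the error is the sum of those of [expR_taylor2] and [ln_taylor2];
    B bounds both |r - 1| and the ratio of |ln r| to |r - 1|. *)
Lemma powR_taylor1 p (rho : R) : 1 <= rho -> exists2 K, 0 <= K &
  forall r, rho^-1 <= r <= rho -> `|r `^ p - 1 - p * (r - 1)| <= K * (r - 1) ^+ 2.
Proof.
move=> rho1; pose B := (1 + rho).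
exists (p ^+ 2 * B ^+ 2 * expR (`|p| * B * B) + `|p| * rho).
  have r0 : 0 <= rho by lra.
  exact: addr_ge0 (mulr_ge0 (mulr_ge0 (sqr_ge0 _) (sqr_ge0 _)) (expR_ge0 _)) (mulr_ge0 (normr_ge0 _) r0).
move=> r /andP[r1 r2].
have rho0 : 0 < rho by lra.
have rhoV0 : 0 < rho^-1 by rewrite invr_gt0.
have r0 : 0 < r by exact: lt_le_trans r1.
have rV : r^-1 <= rho by rewrite -[leRHS]invrK lef_pV2 ?posrE ?invr_gt0.
have rV0 : 0 < r^-1 by rewrite invr_gt0.
set y := p * ln r.
have -> : r `^ p = expR y by rewrite /y -ln_powR lnK// posrE powR_gt0.
have /andP[l1 l2] := ln_taylor2 r0.
have /andP[e1 e2] := expR_taylor2 y.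
have rr : r * r^-1 = 1 by rewrite mulfV// gt_eqF.
have L2 : `|ln r| <= B * `|r - 1|.
  rewrite /B; have [q|q] := leP 1 r.
    have lr : 0 <= ln r by exact: ln_ge0.
    by rewrite (ger0_norm lr) ger0_norm; nra.
  have lr : ln r <= 0 by apply: ln_le0; exact: ltW.
  rewrite (ler0_norm lr) ltr0_norm; last by lra.
  have : (r - 1) ^+ 2 / r = (1 - r) * ((1 - r) * r^-1) by field; rewrite gt_eqF.
  move=> E; rewrite E in l2.
  have : (1 - r) * r^-1 <= rho by rewrite mulrBl mul1r rr; lra.
  move=> h; have : (1 - r) * ((1 - r) * r^-1) <= (1 - r) * rho by rewrite ler_wpM2l//; lra.
  lra.
have L3 : `|ln r| <= B * B.
  apply: le_trans L2 _; rewrite ler_wpM2l//; rewrite /B; first by lra.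
  by rewrite ler_norml; lra.
have B0 : 0 <= B by rewrite /B; lra.
have h1 : `|expR y - 1 - y| <= p ^+ 2 * B ^+ 2 * expR (`|p| * B * B) * (r - 1) ^+ 2.
  rewrite ger0_norm//; apply: le_trans e2 _.
  rewrite (_ : p ^+ 2 * B ^+ 2 * expR (`|p| * B * B) * (r - 1) ^+ 2 =
    (p ^+ 2 * (B * `|r - 1|) ^+ 2) * expR (`|p| * B * B)); last first.
    by rewrite exprMn -normrX (ger0_norm (sqr_ge0 (r - 1))); ring.
  apply: ler_pM; rewrite ?sqr_ge0 ?expR_ge0//.
    rewrite /y exprMn ler_wpM2l ?sqr_ge0//.
    rewrite -[ln r ^+ 2](ger0_norm (sqr_ge0 _)) normrX ler_pXn2r// nnegrE//.
    by rewrite mulr_ge0.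
  by rewrite ler_expR /y normrM -mulrA ler_wpM2l.
have h2 : `|p * (ln r - (r - 1))| <= `|p| * rho * (r - 1) ^+ 2.
  rewrite normrM -mulrA ler_wpM2l// distrC ger0_norm//.
  by apply: le_trans l2 _; rewrite mulrC ler_wpM2r ?sqr_ge0.
rewrite (_ : expR y - 1 - p * (r - 1) = (expR y - 1 - y) + p * (ln r - (r - 1))); last first.
  by rewrite /y; ring.
by apply: le_trans (ler_normD _ _) _; rewrite mulrDl lerD.
Qed.

Lemma powR_taylor p (m M : R) : 0 < m -> m <= M -> exists2 K, 0 <= K &
  forall a b, m <= a <= M -> m <= b <= M ->
  `|b `^ p - a `^ p - p * a `^ (p - 1) * (b - a)| <= K * (b - a) ^+ 2.
Proof.
move=> m0 mM; have M0 : 0 < M by exact: lt_le_trans mM.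
have rho1 : 1 <= M / m by rewrite ler_pdivlMr// mul1r.
have [K K0 HK] := powR_taylor1 p rho1.
exists (K * (M `^ p + m `^ p) / m ^+ 2); first by rewrite !mulr_ge0// ?addr_ge0 ?powR_ge0 ?invr_ge0 ?sqr_ge0.
move=> a b /andP[ma aM] /andP[mb bM].
have a0 : 0 < a by exact: lt_le_trans ma.
have b0 : 0 < b by exact: lt_le_trans mb.
have rab : (M / m)^-1 <= b / a <= M / m.
  rewrite invf_div; apply/andP; split.
    apply: ler_pM => //; rewrite ?invr_ge0; try exact: ltW.
    by rewrite lef_pV2 ?posrE.
  apply: ler_pM => //; rewrite ?invr_ge0; try exact: ltW.
  by rewrite lef_pV2 ?posrE.
have := HK _ rab.
have -> : b `^ p - a `^ p - p * a `^ (p - 1) * (b - a) =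
    a `^ p * ((b / a) `^ p - 1 - p * (b / a - 1)).
  have -> : (b / a) `^ p = b `^ p / a `^ p.
    by rewrite powRM ?invr_ge0 ?ltW// -powR_inv1 ?ltW// -powRrM mulN1r powRN.
  have -> : a `^ (p - 1) = a `^ p / a.
    by rewrite powRB ?powRr1 ?ltW//; rewrite (gt_eqF a0) implybT.
  have : a `^ p != 0 by rewrite gt_eqF// powR_gt0.
  have : a != 0 by rewrite gt_eqF.
  move: (a `^ p) (b `^ p) => A B' ? ?; field; by apply/andP.
rewrite normrM (ger0_norm (powR_ge0 _ _)).
have -> : (b / a - 1) ^+ 2 = (b - a) ^+ 2 / a ^+ 2 by field; rewrite gt_eqF.
move=> h; apply: le_trans (ler_wpM2l (powR_ge0 a p) h) _.
rewrite (_ : a `^ p * (K * ((b - a) ^+ 2 / a ^+ 2)) = K * (a `^ p / a ^+ 2) * (b - a) ^+ 2); last by ring.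
rewrite ler_wpM2r ?sqr_ge0// -mulrA ler_wpM2l//.
apply: ler_pM; rewrite ?powR_ge0 ?invr_ge0 ?sqr_ge0//.
  have [p0|/ltW p0] := leP 0 p.
    have : a `^ p <= M `^ p by apply: ge0_ler_powR => //; rewrite nnegrE; exact: ltW.
    by have := powR_ge0 m p; lra.
  have : a `^ p <= m `^ p by rewrite -[p]opprK ler_powRN// oppr_ge0.
  by have := powR_ge0 M p; lra.
rewrite lef_pV2 ?posrE ?exprn_gt0// ler_pXn2r//; rewrite nnegrE; exact: ltW.
Qed.

End taylor_powR.

Section good_kernel.
Context {R : realType}.
Local Notation mu := (@lebesgue_measure R).

Definition expd (c r : R) : R := expR (- c * `|r|).

(* The properties of the convolution kernels [kern] that the variational argument uses;
   [g * g(-.)] is a square root of [k], and [k2] is a regularisation close to [k] in L1. *)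
Record goodk (kap c : R) (k : R -> R) : Prop := Goodk {
  gk_meas : mfunT k;
  gk_ge0 : forall t, 0 <= k t;
  gk_even : forall t, k (- t) = k t;
  gk_int : forall A, 1 <= A -> A * kap < 1 ->
    (\int[mu]_t (k t `^ A * expd c t `^ (1 - A))%:E < +oo)%E;
  gk_root : exists (g : R -> R) (C : R), [/\ mfunT g, forall t, 0 <= g t,
    (\int[mu]_t (g t)%:E < +oo)%E, 0 < C &
    forall t, t != 0 -> (\int[mu]_r (g r * g (r - t))%:E = (C * k t)%:E)%E];
  gk_smooth : forall e, 0 < e -> exists (k2 : R -> R) (L : R), [/\ mfunT k2,
    forall t, 0 <= k2 t, forall t, t != 0 -> k2 t <= k t,
    (\int[mu]_t `|k t - k2 t|%:E <= e%:E)%E & 0 <= L /\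
    forall t h, `|h| <= 1 -> `|k2 (t + h) - k2 t| <= L * `|h| * k2 t /\
       `|k2 (t + h) + k2 (t - h) - 2 * k2 t| <= L * h ^+ 2 * k2 t];
  gk_low : forall A, exists2 del, 0 < del & forall t, t != 0 -> `|t| <= A -> del <= k t }.

Lemma ae_neqR (x : R) : {ae mu, forall t : R, t != x}.
Proof.
exists [set x]; split; first exact: measurable_set1.
- exact: lebesgue_measure_set1.
- by move=> y /= /negP; rewrite negbK => /eqP.
Qed.

Lemma aeR_imp2 (P Q S : R -> Prop) : (forall x, P x -> Q x -> S x) ->
  {ae mu, forall x, P x} -> {ae mu, forall x, Q x} -> {ae mu, forall x, S x}.
Proof. by move=> PQS [A [mA A0 sA]] [B [mB B0 sB]]; exists (A `|` B); split;
  [exact: measurableU|exact: etrans (measureU0 mA mB B0) A0|move=> x /= nS;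
   have [p|p] := pselect (P x); [right; apply: sB => q; apply: nS; exact: PQS|left; exact: sA]].
Qed.

Lemma aeR_imp (P S : R -> Prop) : (forall x, P x -> S x) ->
  {ae mu, forall x, P x} -> {ae mu, forall x, S x}.
Proof. by move=> PS hP; apply: (aeR_imp2 (P := P) (Q := P)) => // x /PS. Qed.

End good_kernel.

Section kern_good.
Context {R : realType} (n : nat).
Hypothesis n0 : (0 < n)%N.
Local Notation mu := (@lebesgue_measure R).
Local Notation Lb n := (@lebesgue_rV R n).
Implicit Types (z : 'rV[R]_n.+1) (t c d : R).

Lemma kernE_fin c k t : 0 <= k -> k <= 2 * c -> 2 * c - k < n%:R -> t != 0 ->
  kernE n c 0 t = (kern n c 0 t)%:E.
Proof.
move=> k0 kc ck t0; have [C [_ /(_ t t0) h]] := kernE_bound n0 k0 kc ck.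
by rewrite fineK// ge0_fin_numE ?kernE_ge0// (le_lt_trans h)// ltry.
Qed.

Lemma kern_bound c k : 0 <= k -> k <= 2 * c -> 2 * c - k < n%:R ->
  exists2 C, 0 <= C & forall t, t != 0 ->
    kern n c 0 t <= C * (expR (- c * `|t|) * (Num.min 1 `|t|) `^ (- k)).
Proof.
move=> k0 kc ck; have [C [C0 h]] := kernE_bound n0 k0 kc ck.
exists C => // t t0; rewrite -lee_fin -(kernE_fin k0 kc ck t0); exact: h.
Qed.

Lemma integral_neq0_lty (f g : R -> R) :
  mfunT f -> mfunT g ->
  (forall t, 0 <= f t) -> (forall t, 0 <= g t) ->
  (forall t, t != 0 -> f t <= g t) ->
  (\int[mu]_t (g t)%:E < +oo)%E -> (\int[mu]_t (f t)%:E < +oo)%E.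
Proof.
move=> mf mg f0 g0 fg gf; apply: le_lt_trans gf; apply: ae_ge0_le_integral => //.
- by move=> t _; rewrite lee_fin.
- by mfun.
- by move=> t _; rewrite lee_fin.
- by mfun.
exists [set 0]; split; first exact: measurable_set1.
- exact: lebesgue_measure_set1.
move=> t /=; apply: contra_notP => /eqP t0 _; rewrite lee_fin; exact: fg.
Qed.

Lemma measurable_expd c : mfunT (expd c : R -> R).
Proof.
apply: (measurableT_comp (@measurable_expR R)); apply: measurable_funM; first exact: measurable_cst.
exact: normr_measurable.
Qed.

Lemma kern_int c c1 k A : 0 <= k -> k <= 2 * c -> 2 * c - k < n%:R -> 0 < c1 -> c1 <= c ->
  1 <= A -> A * k < 1 ->
  (\int[mu]_t (kern n c 0 t `^ A * expd c1 t `^ (1 - A))%:E < +oo)%E.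
Proof.
move=> k0 kc ck c10 c1c A1 Ak.
have [C C0 h] := kern_bound k0 kc ck.
have A0 : 0 < A by lra.
have q0 : 0 <= A * k by rewrite mulr_ge0// ltW.
apply: (@integral_neq0_lty _ (fun t => C `^ A * (expR (- c1 * `|t|) * (Num.min 1 `|t|) `^ (- (A * k))))).
- apply: measurable_funM; apply: measurable_powR_comp; first exact: measurable_kern.
  exact: measurable_expd.
- by mfun.
- by move=> t; rewrite mulr_ge0 ?powR_ge0.
- by move=> t; rewrite !mulr_ge0 ?powR_ge0 ?expR_ge0.
- move=> t t0.
  have m0 : 0 <= Num.min 1 `|t| by rewrite le_min ler01 normr_ge0.
  have H : kern n c 0 t `^ A <= C `^ A * (expR (A * (- c1 * `|t|)) * (Num.min 1 `|t|) `^ (- (A * k))).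
    apply: (@le_trans _ _ ((C * (expR (- c1 * `|t|) * (Num.min 1 `|t|) `^ (- k))) `^ A)).
      apply: ge0_ler_powR; first exact: ltW.
      - by rewrite nnegrE kern_ge0.
      - by rewrite nnegrE !mulr_ge0 ?powR_ge0 ?expR_ge0.
      apply: le_trans (h t t0) _; apply: ler_wpM2l => //; apply: ler_wpM2r; first exact: powR_ge0.
      by rewrite ler_expR ler_wpM2r// lerN2.
    rewrite (powRM _ C0 (mulr_ge0 (expR_ge0 _) (powR_ge0 _ _))).
    rewrite (powRM _ (expR_ge0 _) (powR_ge0 _ _)) expR_powR -powRrM.
    by rewrite (_ : - k * A = - (A * k)) // mulNr mulrC.
  apply: le_trans (ler_wpM2r (powR_ge0 _ _) H) _.
  rewrite /expd expR_powR -mulrA ler_wpM2l ?powR_ge0// mulrAC -expRD.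
  by rewrite (_ : A * (- c1 * `|t|) + (1 - A) * (- c1 * `|t|) = - c1 * `|t|)//; ring.
- under eq_integral do rewrite EFinM.
  rewrite gintZl.
  + apply: lte_mul_pinfty => //; first by rewrite lee_fin powR_ge0.
    exact: integral_min_powR.
  + by mfun.
  + by move=> t; rewrite lee_fin mulr_ge0 ?expR_ge0 ?powR_ge0.
  + exact: powR_ge0.
Qed.

Lemma kern_integrable c k l : 0 <= k -> k <= 2 * c -> 2 * c - k < n%:R -> k < 1 -> `|l| < c ->
  (\int[mu]_t (expR (l * t) * kern n c 0 t)%:E < +oo)%E.
Proof.
move=> k0 kc ck k1 lc.
have [C C0 h] := kern_bound k0 kc ck.
apply: (@integral_neq0_lty _ (fun t => C * (expR (- (c - `|l|) * `|t|) * (Num.min 1 `|t|) `^ (- k)))).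
- by mfun.
- by mfun.
- by move=> t; rewrite mulr_ge0 ?expR_ge0 ?kern_ge0.
- by move=> t; rewrite !mulr_ge0 ?powR_ge0 ?expR_ge0.
- move=> t t0; apply: le_trans (ler_wpM2l (expR_ge0 _) (h t t0)) _.
  rewrite mulrCA ler_wpM2l// mulrA ler_wpM2r ?powR_ge0// -expRD ler_expR.
  by have : l * t <= `|l| * `|t|; [rewrite -normrM ler_norm|lra].
- under eq_integral do rewrite EFinM.
  rewrite gintZl.
  + apply: lte_mul_pinfty => //; apply: integral_min_powR => //; lra.
  + by mfun.
  + by move=> t; rewrite lee_fin mulr_ge0 ?expR_ge0 ?powR_ge0.
  + exact: C0.
Qed.

Lemma kern_root c k : 0 < c -> 2 * c < n.+1%:R -> 0 <= k -> k <= 2 * c -> 2 * c - k < n%:R -> k < 1 ->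
  exists (g : R -> R) (C : R), [/\ mfunT g, forall t, 0 <= g t,
    (\int[mu]_t (g t)%:E < +oo)%E, 0 < C &
    forall t, t != 0 -> (\int[mu]_r (g r * g (r - t))%:E = (C * kern n c 0 t)%:E)%E].
Proof.
move=> c0 cn k0 kc ck k1.
have nS : n.+1%:R = n%:R + 1 :> R by rewrite -natr1.
have n1 : 1 <= n%:R :> R by rewrite ler1n.
(* Chosen so that 2a - (n+1)/2 = c in [kern_composition]. The bounds 0 < c and 2c < n + 1 become n +
   1 < 4a and 2a < n + 1, under which the composition converges. *)
pose a : R := (c + n.+1%:R / 2) / 2.
(* The singularity exponent of the square root must exceed 2a - n and stay below 1: the midpoint of
   these two numbers, or 0 if it is negative. *)
pose k' : R := Num.max 0 ((2 * a - n%:R + 1) / 2).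
have k'P : [/\ 0 <= k', k' <= 2 * a, 2 * a - k' < n%:R & k' < 1].
  have aE : 2 * a = c + n.+1%:R / 2 by rewrite /a; field.
  rewrite nS in aE cn; rewrite /k' aE.
  by split; case: (leP 0 ((c + (n%:R + 1) / 2 - n%:R + 1) / 2)); lra.
have [k'0 k'a ak' k'1] := k'P.
have la : `|n.+1%:R / 2 - a| < a.
  by rewrite /a ger0_norm ?nS; lra.
have aE : 2 * a - n.+1%:R / 2 = c by rewrite /a; field.
have Cl : (riesz_comp n a < +oo)%E.
  by apply: riesz_comp_lty; rewrite /a ?nS; lra.
have C0 := riesz_comp_gt0 n a.
have Cf : riesz_comp n a \is a fin_num by rewrite ge0_fin_numE ?ltW.
exists (fun r => expR ((n.+1%:R / 2 - a) * r) * kern n a 0 r), (fine (riesz_comp n a)); split.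
- by mfun.
- by move=> t; rewrite mulr_ge0 ?expR_ge0 ?kern_ge0.
- exact: (kern_integrable k'0 k'a ak' k'1 la).
- by rewrite fine_gt0// C0 Cl.
- move=> t t0; transitivity (riesz_comp n a * kernE n (2 * a - n.+1%:R / 2) 0 t)%E; last first.
    rewrite aE (kernE_fin k0 kc ck t0) -{1}(fineK Cf) -EFinM; reflexivity.
  rewrite (kern_composition n a t0).
  apply: gint_ae_eq.
  + by mfun.
  + by mfun.
  + apply: aeR_imp2 (ae_neqR 0) (ae_neqR t) => r r0 rt.
    rewrite (kernE_fin k'0 k'a ak' r0) (kernE_fin k'0 k'a ak') ?subr_eq0//.
Qed.

Lemma sphw_total : 0 < fine (\int[Lb n.+1]_z (sphw z)%:E)%E /\ (\int[Lb n.+1]_z (sphw z)%:E < +oo)%E.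
Proof.
have l := @integral_sphw_lty R n.+1; split => //.
have I0 : (0 <= \int[Lb n.+1]_z (sphw z)%:E)%E by apply: integral_ge0 => z _; rewrite lee_fin sphw_ge0.
apply: fine_gt0; rewrite l andbT lt_def I0 andbT; apply/eqP => E.
apply: (@ae_rV_absurd R n).
have me : mfunT (fun z : 'rV[R]_n.+1 => (sphw z)%:E) by mfun.
have : (\int[Lb n.+1]_y (cst 1%E (enorm y)) = 0 :> \bar R)%E.
  rewrite (@ge0_integral_radial R n.+1 (cst 1%E))//.

  by rewrite E mul0e.
move=> E1; have m1 : measurable_fun [set: 'rV[R]_n.+1] (fun=> 1%E : \bar R) by exact: measurable_cst.
have /(ae_eq_integral_abs (Lb n.+1) measurableT m1) ae1 : (\int[Lb n.+1]_z `|1%E : \bar R| = 0)%E.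
  by rewrite -[RHS]E1; apply: eq_integral => z _; rewrite gee0_abs.
by apply: filterS ae1 => z /(_ I) /= /eqP; rewrite onee_eq0.
Qed.

(** Linear comparisons between kernels pass through this form, with nonnegative terms on both sides,
    so that no integral of a signed function occurs. *)
Lemma fine_integral_lin_le dd (T : measurableType dd) (nu : {measure set T -> \bar R})
    (f1 f2 g1 g2 : T -> R) (a1 a2 b1 b2 : R)
    (I := fun f : T -> R => fine (\int[nu]_z (f z)%:E)%E) :
  [/\ mfunT f1, mfunT f2, mfunT g1 & mfunT g2] ->
  [/\ forall x, 0 <= f1 x, forall x, 0 <= f2 x, forall x, 0 <= g1 x & forall x, 0 <= g2 x] ->
  [/\ (\int[nu]_z (f1 z)%:E < +oo)%E, (\int[nu]_z (f2 z)%:E < +oo)%E,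
      (\int[nu]_z (g1 z)%:E < +oo)%E & (\int[nu]_z (g2 z)%:E < +oo)%E] ->
  [/\ 0 <= a1, 0 <= a2, 0 <= b1 & 0 <= b2] ->
  (forall x, a1 * f1 x + a2 * f2 x <= b1 * g1 x + b2 * g2 x) ->
  a1 * I f1 + a2 * I f2 <= b1 * I g1 + b2 * I g2.
Proof.
move=> [mf1 mf2 mg1 mg2] [f10 f20 g10 g20] [if1 if2 ig1 ig2] [a10 a20 b10 b20] h.
have H (f g : T -> R) (a b : R) : mfunT f -> mfunT g ->
  (forall x, 0 <= f x) -> (forall x, 0 <= g x) ->
  (\int[nu]_z (f z)%:E < +oo)%E -> (\int[nu]_z (g z)%:E < +oo)%E -> 0 <= a -> 0 <= b ->
  (\int[nu]_z (a * f z + b * g z)%:E = (a * I f + b * I g)%:E)%E.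
  move=> mf mg f0 g0 i1 i2 a0 b0; under eq_integral do rewrite EFinD.
  have F (u : T -> R) (c : R) : mfunT u -> (forall x, 0 <= u x) ->
      (\int[nu]_z (u z)%:E < +oo)%E -> 0 <= c -> (\int[nu]_z (c * u z)%:E = (c * I u)%:E)%E.
    move=> mu' u0 iu c0; under eq_integral do rewrite EFinM.
    rewrite gintZl; [|exact/measurable_EFinP|by move=> z; rewrite lee_fin|exact: c0].
    by rewrite EFinM fineK// ge0_fin_numE//; apply: integral_ge0 => z _; rewrite lee_fin.
  rewrite gintD; first by rewrite !F.
  - by mfun.
  - by move=> z; rewrite lee_fin mulr_ge0.
  - by mfun.
  - by move=> z; rewrite lee_fin mulr_ge0.
rewrite -lee_fin -!H//; apply: gint_le.
- by mfun.
- by move=> z; rewrite lee_fin addr_ge0// mulr_ge0.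
- by mfun.
- by move=> z; rewrite lee_fin.
Qed.

Lemma kernE_d_lty c d t : 0 <= c -> 0 < d -> (kernE n c d t < +oo)%E.
Proof.
move=> c0 d0; have [_ I] := sphw_total.
apply: (@le_lt_trans _ _ (\int[Lb n.+1]_z ((d `^ (- c))%:E * (sphw z)%:E))%E); last first.
  rewrite gintZl.
  - by apply: lte_mul_pinfty => //; rewrite lee_fin powR_ge0.
  - by mfun.
  - by move=> z; rewrite lee_fin sphw_ge0.
  - exact: powR_ge0.
apply: gint_le; first exact: measurable_kern_z.
- by move=> z; exact: sphw_mul_EFin_ge0.
- by mfun.
move=> z; rewrite -EFinM lee_fin mulrC ler_wpM2r ?sphw_ge0//; apply: ler_powRN => //.
by have := @Qk_ge0 R n 0 t z (lexx 0); rewrite /Qk; lra.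
Qed.

Lemma kernE_lty c k t : 0 <= k -> k <= 2 * c -> 2 * c - k < n%:R -> t != 0 -> (kernE n c 0 t < +oo)%E.
Proof. by move=> k0 kc ck t0; rewrite (kernE_fin k0 kc ck t0) ltry. Qed.

Lemma kern_z_real c d t : mfunT (fun z => sphw z * Qk d t z `^ (- c)).
Proof. by apply/measurable_EFinP; exact: measurable_kern_z. Qed.

Lemma kern_z_ge0 c d t z : 0 <= sphw z * Qk d t z `^ (- c).
Proof. by rewrite mulr_ge0 ?sphw_ge0 ?powR_ge0. Qed.

Lemma kern_low c k (A : R) : 0 <= k -> k <= 2 * c -> 2 * c - k < n%:R -> 0 <= c ->
  exists2 del, 0 < del & forall t, t != 0 -> `|t| <= A -> del <= kern n c 0 t.
Proof.
move=> k0 kc ck c0; have [S0 Sl] := sphw_total.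
set S := fine _ in S0; set q : R := 2 * expR A + 2.
exists (q `^ (- c) * S).
  by rewrite mulr_gt0// powR_gt0// /q; have := expR_gt0 A; lra.
move=> t t0; rewrite ler_norml => /andP[t1 t2].
have kl := kernE_lty k0 kc ck t0.
have := @fine_integral_lin_le _ _ (Lb n.+1) (@sphw R n.+1) (@sphw R n.+1)
  (fun z => sphw z * Qk 0 t z `^ (- c)) (@sphw R n.+1) (q `^ (- c)) 0 1 0.
cbv zeta; rewrite !mul0r !addr0 mul1r; apply.
- by split; [exact: measurable_sphw|exact: measurable_sphw|exact: kern_z_real|exact: measurable_sphw].
- by split; move=> z; [exact: sphw_ge0|exact: sphw_ge0|exact: kern_z_ge0|exact: sphw_ge0].
- by split.
- by split; [exact: powR_ge0|exact: lexx|exact: ler01|exact: lexx].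
- move=> z; rewrite !mul0r !addr0 mul1r mulrC ler_wpM2l ?sphw_ge0//; apply: ler_powRN => //.
    exact: Qk_gt0.
  have : expR t <= expR A by rewrite ler_expR.
  have : expR (- t) <= expR A by rewrite ler_expR; lra.
  by rewrite /Qk /q; have := om_geN1 z; lra.
Qed.

(** Since Q >= d, the sum e^t + e^(-t) is at most (1 + 2/d) Q. The first and second differences of Q
    are therefore small relative to Q itself, uniformly in t, and not merely in absolute value. *)
Lemma Qk_ratio d t h z : 0 < d -> `|h| <= 1 ->
  let B := (1 + expR 1) * (1 + 2 / d) in
  `|Qk d (t + h) z - Qk d t z| <= B * `|h| * Qk d t z /\
  `|Qk d (t + h) z + Qk d (t - h) z - 2 * Qk d t z| <= 2 * B * h ^+ 2 * Qk d t z.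
Proof.
move=> d0 h1; set E1 := 1 + expR 1; set D := 1 + 2 / d => B.
have hh : expR `|h| <= expR 1 by rewrite ler_expR.
have e10 := expR_gt0 (1 : R).
have b h' : `|h'| = `|h| -> 0 <= expR h' - 1 - h' <= h ^+ 2 * expR 1.
  move=> e; have /andP[-> /= /le_trans] := expR_taylor2 h'; apply.
  by rewrite e -[h' ^+ 2]real_normK ?num_real// e real_normK ?num_real// ler_wpM2l ?sqr_ge0.
have /andP[p1 p2] := b h erefl; have /andP[q1 q2] := b (- h) (normrN h).
have hs : h ^+ 2 <= `|h|.
  by rewrite -[h ^+ 2]real_normK ?num_real// expr2 ler_piMl.
have PQ : expR t + expR (- t) <= D * Qk d t z.
  have : 2 <= 2 / d * Qk d t z.
    rewrite mulrAC ler_pdivlMr// ler_pM2l//.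
    by have := @Qk_ge0 R n 0 t z (lexx 0); rewrite /Qk; lra.
  by rewrite /D mulrDl mul1r /Qk; have := om_le1 z; lra.
have P0 := expR_gt0 t; have P'0 := expR_gt0 (- t).
have Q1 : Qk d (t + h) z - Qk d t z = expR t * (expR h - 1) + expR (- t) * (expR (- h) - 1).
  by rewrite /Qk opprD !expRD; ring.
have Q2 : Qk d (t + h) z + Qk d (t - h) z - 2 * Qk d t z =
    (expR t + expR (- t)) * (expR h + expR (- h) - 2).
  by rewrite /Qk !opprD !expRD opprK; ring.
have a1 : `|expR h - 1| <= E1 * `|h|.
  have : `|expR h - 1| <= `|expR h - 1 - h| + `|h|.
    by rewrite -[X in `|X| <= _](subrK h) ler_normD.
  rewrite (ger0_norm p1) /E1; move: hs p2 (normr_ge0 h); move: (h ^+ 2) `|h| => x y; nra.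
have a2 : `|expR (- h) - 1| <= E1 * `|h|.
  have : `|expR (- h) - 1| <= `|expR (- h) - 1 - - h| + `|- h|.
    by rewrite -[X in `|X| <= _](subrK (- h)) ler_normD.
  rewrite (ger0_norm q1) normrN /E1; move: hs q2 (normr_ge0 h); move: (h ^+ 2) `|h| => x y; nra.
have E10 : 0 <= E1 by rewrite /E1; lra.
split.
  rewrite Q1; apply: le_trans (ler_normD _ _) _; rewrite !normrM (gtr0_norm P0) (gtr0_norm P'0).
  apply: (@le_trans _ _ ((expR t + expR (- t)) * (E1 * `|h|))).
    by rewrite mulrDl lerD// ler_pM2l.
  rewrite (_ : B * `|h| * Qk d t z = (D * Qk d t z) * (E1 * `|h|)); last by rewrite /B; ring.
  by rewrite ler_wpM2r// mulr_ge0.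
rewrite Q2 normrM ger0_norm; last by lra.
rewrite ger0_norm; last by lra.
rewrite (_ : 2 * B * h ^+ 2 * Qk d t z = (D * Qk d t z) * (2 * E1 * h ^+ 2)); last by rewrite /B; ring.
have e2 : 0 <= expR h + expR (- h) - 2 by move: p1 q1; rewrite !opprK; lra.
apply: ler_pM e2 PQ _; first exact: ltW (addr_gt0 P0 P'0).
clear -p2 q2 E10.
have h20 := sqr_ge0 h; rewrite /E1; move: p2 q2 h20.
by move: (expR h) (expR (- h)) (expR 1) (h ^+ 2) => x y w q; lra.
Qed.

Lemma powR_quot (a b m : R) : 0 < a -> 0 < b -> b `^ m = a `^ m * (b / a) `^ m.
Proof.
move=> a0 b0; rewrite -powRM; [|exact: ltW|by apply: divr_ge0; exact: ltW].
by rewrite mulrC divfK// gt_eqF.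
Qed.

(** The ratio of two nearby values of Q stays in a fixed compact subset of the half-line, where
    [powR_taylor1] turns relative smoothness of Q into that of its powers. *)
Lemma Qk_powR_smooth c d : 0 <= c -> 0 < d -> exists2 L, 0 <= L & forall t h z, `|h| <= 1 ->
  `|Qk d (t + h) z `^ (- c) - Qk d t z `^ (- c)| <= L * `|h| * Qk d t z `^ (- c) /\
  `|Qk d (t + h) z `^ (- c) + Qk d (t - h) z `^ (- c) - 2 * Qk d t z `^ (- c)| <=
     L * h ^+ 2 * Qk d t z `^ (- c).
Proof.
move=> c0 d0; pose B := (1 + expR 1) * (1 + 2 / d).
have B0 : 0 <= B.
  by rewrite /B mulr_ge0// ?addr_ge0// ?expR_ge0// divr_ge0// ltW.
have rho1 : 1 <= 1 + B by lra.
have [K K0 HK] := powR_taylor1 (- c) rho1.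
exists (2 * c * B + 2 * K * B ^+ 2).
  exact: addr_ge0 (mulr_ge0 (mulr_ge0 (ler0n _ _) c0) B0) (mulr_ge0 (mulr_ge0 (ler0n _ _) K0) (sqr_ge0 _)).
move=> t h z h1.
have Qp s : 0 < Qk d s z.
  by have := @Qk_ge0 R n 0 s z (lexx 0); rewrite /Qk; lra.
have ratio s h' : `|h'| <= 1 -> `|Qk d (s + h') z / Qk d s z - 1| <= B * `|h'|.
  move=> h'1; have [+ _] := Qk_ratio s z d0 h'1; rewrite -/B.
  rewrite -ler_pdivrMr// -[X in `|_| / X]gtr0_norm// -normfV -normrM mulrBl divff//.
  by rewrite gt_eqF.
have rr s h' : `|h'| <= 1 -> Qk d (s + h') z / Qk d s z <= 1 + B.
  move=> h'1; have := ratio s h' h'1; rewrite ler_norml => /andP[_].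
  have : B * `|h'| <= B by rewrite ler_piMr.
  lra.
have rr' s h' : `|h'| <= 1 -> (1 + B)^-1 <= Qk d (s + h') z / Qk d s z <= 1 + B.
  move=> h'1; rewrite rr// andbT -[leRHS]invrK invf_div lef_pV2 ?posrE ?divr_gt0//; last by lra.
  by have := rr (s + h') (- h'); rewrite normrN addrK; apply.
have hs : h ^+ 2 <= `|h|.
  by rewrite -[h ^+ 2]real_normK ?num_real// expr2 ler_piMl.
have hN : `|- h| <= 1 by rewrite normrN.
have T1 := HK _ (rr' t h h1); have T2 := HK _ (rr' t (- h) hN).
have r1 := ratio t h h1; have r2 := ratio t (- h) hN; rewrite normrN in r2.
have [_ r3] := Qk_ratio t z d0 h1; rewrite -/B in r3.
have {}r3 : `|(Qk d (t + h) z / Qk d t z - 1) + (Qk d (t - h) z / Qk d t z - 1)| <= 2 * B * h ^+ 2.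
  move: r3; rewrite -ler_pdivrMr// -[X in `|_| / X]gtr0_norm// -normfV -normrM.
  have Q0 : Qk d t z != 0 by rewrite gt_eqF.
  by rewrite (_ : (_ + _ - _) / _ = (Qk d (t + h) z / Qk d t z - 1) + (Qk d (t - h) z / Qk d t z - 1))//; field.
rewrite (powR_quot (- c) (Qp t) (Qp (t + h))) (powR_quot (- c) (Qp t) (Qp (t - h))).
have P0 := powR_ge0 (Qk d t z) (- c).
move: T1 T2 r1 r2 r3 P0; move: (_ `^ _) (_ `^ _) (_ `^ _).
move: (_ / _) (_ / _) => y x.
have sq w : `|w - 1| <= B * `|h| -> K * (w - 1) ^+ 2 <= K * B ^+ 2 * h ^+ 2.
  move=> hw; rewrite -mulrA ler_wpM2l// -[(w - 1) ^+ 2]real_normK ?num_real//.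
  by rewrite -[h ^+ 2]real_normK ?num_real// -exprMn ler_pXn2r// nnegrE// mulr_ge0.
move=> P Y X T1 T2 r1 r2 r3 P0.
have {}T1 := le_trans T1 (sq _ r1); have {}T2 := le_trans T2 (sq _ r2).
split.
  rewrite -[P in _ - P]mulr1 -mulrBr normrM (ger0_norm P0) mulrC ler_wpM2r//.
  have : `|X - 1| <= `|X - 1 - - c * (x - 1)| + c * `|x - 1|.
    rewrite -[c in c * `|_|](ger0_norm c0) -normrM.
    by rewrite -[X in `|X| <= _](subrK (- c * (x - 1))) (le_trans (ler_normD _ _))// mulNr normrN.
  have : c * `|x - 1| <= c * (B * `|h|) by rewrite ler_wpM2l.
  have : K * B ^+ 2 * h ^+ 2 <= K * B ^+ 2 * `|h| by rewrite ler_wpM2l// mulr_ge0// sqr_ge0.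
  have : 0 <= K * B ^+ 2 * `|h| by exact: mulr_ge0 (mulr_ge0 K0 (sqr_ge0 B)) (normr_ge0 h).
  have : 0 <= c * (B * `|h|) by exact: mulr_ge0 c0 (mulr_ge0 B0 (normr_ge0 h)).
  by rewrite mulrDl; lra.
rewrite (_ : P * X + P * Y - 2 * P = P * (X + Y - 2)); last by ring.
rewrite normrM (ger0_norm P0) mulrC ler_wpM2r//.
have -> : X + Y - 2 = (X - 1 - - c * (x - 1)) + (Y - 1 - - c * (y - 1)) - c * ((x - 1) + (y - 1)).
  by ring.
have N1 : `|c * (x - 1 + (y - 1))| <= c * (2 * B * h ^+ 2).
  by rewrite normrM (ger0_norm c0) ler_wpM2l.
apply: le_trans (ler_normB _ _) _; have := ler_normD (X - 1 - - c * (x - 1)) (Y - 1 - - c * (y - 1)).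
by rewrite mulrDl; lra.
Qed.

Lemma kern_lin_le (c1 c2 c3 c4 d1 d2 d3 d4 t1 t2 t3 t4 a1 a2 b1 b2 : R) :
  [/\ (kernE n c1 d1 t1 < +oo)%E, (kernE n c2 d2 t2 < +oo)%E, (kernE n c3 d3 t3 < +oo)%E
    & (kernE n c4 d4 t4 < +oo)%E] ->
  [/\ 0 <= a1, 0 <= a2, 0 <= b1 & 0 <= b2] ->
  (forall z, a1 * Qk d1 t1 z `^ (- c1) + a2 * Qk d2 t2 z `^ (- c2) <=
             b1 * Qk d3 t3 z `^ (- c3) + b2 * Qk d4 t4 z `^ (- c4)) ->
  a1 * kern n c1 d1 t1 + a2 * kern n c2 d2 t2 <= b1 * kern n c3 d3 t3 + b2 * kern n c4 d4 t4.
Proof.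
move=> kl ab hz; rewrite /kern /kernE.
apply: (@fine_integral_lin_le _ _ (Lb n.+1) (fun z => sphw z * Qk d1 t1 z `^ (- c1))
  (fun z => sphw z * Qk d2 t2 z `^ (- c2)) (fun z => sphw z * Qk d3 t3 z `^ (- c3))
  (fun z => sphw z * Qk d4 t4 z `^ (- c4)) a1 a2 b1 b2 _ _ kl ab).
- by split; exact: kern_z_real.
- by split; move=> z; exact: kern_z_ge0.
- move=> z; move: (hz z) (sphw_ge0 z).
  move: (_ `^ _) (_ `^ _) (_ `^ _) (_ `^ _) (sphw z) => x y x' y' s h s0.
  have := ler_wpM2l s0 h; lra.
Qed.

Lemma QkE d t z : Qk d t z = Qk 0 t z + d.
Proof. by rewrite /Qk addr0. Qed.

Lemma kern_le_d c d k t : 0 <= k -> k <= 2 * c -> 2 * c - k < n%:R -> 0 < c -> 0 < d -> t != 0 ->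
  kern n c d t <= kern n c 0 t.
Proof.
move=> k0 kc ck c0 d0 t0; apply: fine_le.
- by rewrite ge0_fin_numE ?kernE_ge0//; exact: kernE_d_lty (ltW c0) d0.
- by rewrite ge0_fin_numE ?kernE_ge0//; exact: (kernE_lty k0 kc ck t0).
- exact: kernE_le_d (ltW c0) (ltW d0) t0.
Qed.

Lemma kernN c d t : kern n c d (- t) = kern n c d t.
Proof. by rewrite /kern kernEN. Qed.

Opaque kern kernE Qk.

Lemma kern_smooth_diff c d : 0 <= c -> 0 < d -> exists2 L, 0 <= L & forall t h, `|h| <= 1 ->
  `|kern n c d (t + h) - kern n c d t| <= L * `|h| * kern n c d t /\
  `|kern n c d (t + h) + kern n c d (t - h) - 2 * kern n c d t| <= L * h ^+ 2 * kern n c d t.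
Proof.
move=> c0 d0; have [L L0 HL] := Qk_powR_smooth c0 d0; exists L => // t h h1.
have F t1 t2 t3 t4 a1 a2 b1 b2 : [/\ 0 <= a1, 0 <= a2, 0 <= b1 & 0 <= b2] ->
   (forall z, a1 * Qk d t1 z `^ (- c) + a2 * Qk d t2 z `^ (- c) <=
              b1 * Qk d t3 z `^ (- c) + b2 * Qk d t4 z `^ (- c)) ->
   a1 * kern n c d t1 + a2 * kern n c d t2 <= b1 * kern n c d t3 + b2 * kern n c d t4.
  move=> ab hz; apply: kern_lin_le ab hz.
  by split; exact: kernE_d_lty.
have Lh : 0 <= L * `|h| by rewrite mulr_ge0.
have Lh2 : 0 <= L * h ^+ 2 by rewrite mulr_ge0 ?sqr_ge0.
have F1 : 1 * kern n c d t + 0 * kern n c d t <= 1 * kern n c d (t + h) + (L * `|h|) * kern n c d t.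
  apply: F; first by split.
  move=> z; have [+ _] := HL t h z h1; rewrite ler_norml => /andP[].
  by move: (Qk d (t + h) z `^ _) (Qk d t z `^ _) => x y; clear -x y L h; lra.
have F2 : 1 * kern n c d (t + h) + 0 * kern n c d t <= 1 * kern n c d t + (L * `|h|) * kern n c d t.
  apply: F; first by split.
  move=> z; have [+ _] := HL t h z h1; rewrite ler_norml => /andP[].
  by move: (Qk d (t + h) z `^ _) (Qk d t z `^ _) => x y; clear -x y L h; lra.
(* The coefficient 2 - L h^2 has to be nonnegative here. When it is negative the lower bound for the
   sum of two nonnegative values is trivial. *)
have F3 : L * h ^+ 2 <= 2 -> (2 - L * h ^+ 2) * kern n c d t + 0 * kern n c d t <= 1 * kern n c d (t + h) + 1 * kern n c d (t - h).
  move=> Lh'; apply: F; first by split => //; rewrite subr_ge0.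
  move=> z; have [_] := HL t h z h1; rewrite ler_norml => /andP[].
  by move: (Qk d (t + h) z `^ _) (Qk d (t - h) z `^ _) (Qk d t z `^ _) => x y w; clear -x y w L h; lra.
have F4 : 1 * kern n c d (t + h) + 1 * kern n c d (t - h) <= 2 * kern n c d t + (L * h ^+ 2) * kern n c d t.
  apply: F; first by split.
  move=> z; have [_] := HL t h z h1; rewrite ler_norml => /andP[].
  by move: (Qk d (t + h) z `^ _) (Qk d (t - h) z `^ _) (Qk d t z `^ _) => x y w; clear -x y w L h; lra.
clear HL F; move: (kern_ge0 n c d t) (kern_ge0 n c d (t + h)) (kern_ge0 n c d (t - h)) F1 F2 F3 F4.
move: (kern n c d t) (kern n c d (t + h)) (kern n c d (t - h)) (L * `|h|) (L * h ^+ 2) Lh Lh2.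
move=> x y w l q l0 q0 x0 y0 w0 F1 F2 F3 F4; rewrite !ler_norml.
split; apply/andP; split; [lra|lra| |lra].
by have [/F3|] := leP q 2; nra.
Qed.

(** With y = d / Q, the quantity 1 - (1 + y)^(-c) is at most min(1, c y), hence at most (c y)^th. A
    positive power of d is gained at the price of a singularity stronger by th. *)
Lemma powR_near c d (Q th : R) : 0 <= c -> 0 <= d -> 0 < Q -> 0 < th -> th <= 1 ->
  Q `^ (- c) <= (Q + d) `^ (- c) + (c * d) `^ th * Q `^ (- (c + th)).
Proof.
move=> c0 d0 Q0 th0 th1; have cd0 : 0 <= c * d by rewrite mulr_ge0.
rewrite (@powR_quot Q (Q + d))//; last by rewrite ltr_pwDl.
have -> : (Q + d) / Q = 1 + d / Q by rewrite mulrDl divff// gt_eqF.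
have -> : (c * d) `^ th * Q `^ (- (c + th)) = Q `^ (- c) * (c * (d / Q)) `^ th.
  have -> : c * (d / Q) = (c * d) * Q^-1 by rewrite mulrA.
  rewrite (powRM _ cd0) ?invr_ge0 ?(ltW Q0)//.
  have -> : Q^-1 `^ th = Q `^ (- th) by rewrite -powR_inv1 ?(ltW Q0)// -powRrM mulN1r.
  by rewrite mulrCA -powRD ?(gt_eqF Q0) ?implybT// opprD.
have y0 : 0 <= d / Q by rewrite divr_ge0// ltW.
rewrite -mulrDr ler_peMr ?powR_ge0//.
have y1 : 0 < 1 + d / Q by lra.
have B : 1 - c * (d / Q) <= (1 + d / Q) `^ (- c).
  have -> : (1 + d / Q) `^ (- c) = expR (- c * ln (1 + d / Q)).
    by rewrite -expR_powR lnK.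
  apply: le_trans (expR_ge1Dx _); rewrite mulNr lerD2l lerN2 ler_wpM2l//.
  by have := @expR_ge1Dx R (ln (1 + d / Q)); rewrite lnK ?posrE//; lra.
have [c1|c1] := leP 1 (c * (d / Q)).
  have : 1 <= (c * (d / Q)) `^ th.
    by have := @ge0_ler_powR R th (ltW th0) 1 _ ler01 (mulr_ge0 c0 y0) c1; rewrite powR1.
  by have := powR_ge0 (1 + d / Q) (- c); lra.
suff : c * (d / Q) <= (c * (d / Q)) `^ th by lra.
have [->|cn] := eqVneq (c * (d / Q)) 0; first exact: powR_ge0.
have cp : 0 < c * (d / Q) by rewrite lt_def cn mulr_ge0.
rewrite -[leLHS]powRr1 ?(ltW cp)//; apply: ger_powR => //; rewrite cp/=; exact: ltW.
Qed.

Lemma kern_near c d k th t : 0 < c -> 0 < d -> 0 < th -> th <= 1 ->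
  0 <= k -> k <= 2 * c -> 2 * (c + th) - k < n%:R -> t != 0 ->
  kern n c 0 t <= kern n c d t + (c * d) `^ th * kern n (c + th) 0 t.
Proof.
move=> c0 d0 th0 th1 k0 kc ck t0.
have := @kern_lin_le c c c (c + th) 0 d d 0 t t t t 1 0 1 ((c * d) `^ th).
set X := (_ `^ th) => H.
suff : 1 * kern n c 0 t + 0 * kern n c d t <= 1 * kern n c d t + X * kern n (c + th) 0 t.
  by clear H; move: (kern n c 0 t) (kern n c d t) (X * _) => x y w; lra.
apply: H.
- split.
  + by apply: (kernE_lty k0 _ _ t0); lra.
  + by apply: kernE_d_lty => //; exact: ltW.
  + by apply: kernE_d_lty => //; exact: ltW.
  + by apply: (kernE_lty k0 _ ck t0); lra.
- by split; [exact: ler01|exact: lexx|exact: ler01|exact: powR_ge0].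
- move=> z; rewrite (QkE d).
  have := powR_near (ltW c0) (ltW d0) (Qk_gt0 z (lexx 0) t0) th0 th1.
  by rewrite -/X; move: (Qk 0 t z `^ (- c)) (_ `^ (- c)) (X * _) => x y w; lra.
Qed.

Lemma kern_goodk c k c1 : 0 < c -> 2 * c < n.+1%:R -> 0 <= k -> k <= 2 * c -> 2 * c - k < n%:R -> k < 1 ->
  0 < c1 -> c1 <= c -> goodk k c1 (kern n c 0).
Proof.
move=> c0 cn k0 kc ck k1 c10 c1c; split.
- by mfun.
- exact: kern_ge0.
- exact: kernN.
- by move=> A A1 Ak; exact: (kern_int k0 kc ck c10 c1c A1 Ak).
- exact: (kern_root c0 cn k0 kc ck k1).
(* Raising c by th raises 2c by (1 - k)/2, which is exactly what k' - k absorbs: 2(c + th) - k' = 2c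
   - k, while k' remains below 1. *)
- move=> e e0; pose th := (1 - k) / 4; pose k' := (1 + k) / 2.
  have th0 : 0 < th by rewrite /th; lra.
  have th1 : th <= 1 by rewrite /th; lra.
  have ck' : 2 * (c + th) - k' < n%:R by rewrite /th /k'; lra.
  have k'0 : 0 <= k' by rewrite /k'; lra.
  have k'1 : k' < 1 by rewrite /k'; lra.
  have k'c : k' <= 2 * (c + th) by rewrite /k' /th; lra.
  have cth : `|0 : R| < c + th by rewrite normr0; lra.
  have := kern_integrable k'0 k'c ck' k'1 cth.
  under eq_integral do rewrite mul0r expR0 mul1r.
  set I := (\int[mu]_t _)%E => Il.
  have I0 : (0 <= I)%E by apply: integral_ge0 => t _; rewrite lee_fin kern_ge0.
  have If : I \is a fin_num by rewrite ge0_fin_numE.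
  set J := fine I; have J0 : 0 <= J by rewrite fine_ge0.
  (* This makes (c d)^th = e / (J + 1), J being the integral of the more singular kernel, so the L1
     error is at most e. *)
  pose d := (e / (J + 1)) `^ th^-1 / c.
  have eJ : 0 < e / (J + 1) by rewrite divr_gt0//; lra.
  have d0 : 0 < d by rewrite divr_gt0// powR_gt0.
  have cd : (c * d) `^ th = e / (J + 1).
    by rewrite /d mulrC divfK ?gt_eqF// -powRrM mulVf ?gt_eqF// powRr1// ltW.
  have [L L0 HL] := kern_smooth_diff (ltW c0) d0.
  have near t : t != 0 -> `|kern n c 0 t - kern n c d t| <= e / (J + 1) * kern n (c + th) 0 t.
    move=> t0; rewrite ger0_norm; last by rewrite subr_ge0; exact: (kern_le_d k0 kc ck c0 d0 t0).
    rewrite lerBlDl -cd.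
    (* [kern_near] asks for an exponent at most 2c. If k' is larger, 2c itself is used, since 2 th
       is at most 1/2 and so below n. *)
    have : k' <= 2 * c \/ 2 * c < k' by case: (leP k' (2 * c)); [left|right].
    move=> [k'c'|k'c']; first exact: (kern_near c0 d0 th0 th1 k'0 k'c' ck' t0).
    apply: (@kern_near c d (2 * c)) => //; [by lra|].
    by rewrite /th; have : 1 <= n%:R :> R by [rewrite ler1n]; lra.
  exists (kern n c d), L; split.
  + by mfun.
  + exact: kern_ge0.
  + by move=> t t0; exact: (kern_le_d k0 kc ck c0 d0 t0).
  + apply: (@le_trans _ _ (\int[mu]_t ((e / (J + 1))%:E * (kern n (c + th) 0 t)%:E))%E).
      have mk m d' : mfunT (fun t : R => (kern n m d' t)%:E) by mfun.
      apply: ae_ge0_le_integral => //.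
      * by mfun.
      * by move=> t _; rewrite -EFinM lee_fin mulr_ge0 ?kern_ge0 ?(ltW eJ).
      * by mfun.
      * by apply: aeR_imp (ae_neqR 0) => t t0 _; rewrite -EFinM lee_fin near.
    rewrite gintZl.
    * rewrite -/I -(fineK If) -EFinM lee_fin -/J -mulrA ler_piMr ?(ltW e0)//.
      by rewrite mulrC ler_pdivrMr; lra.
    * by mfun.
    * by move=> t; rewrite lee_fin kern_ge0.
    * exact: ltW.
  + by split => // t h h1; exact: HL.
- by move=> A; exact: (kern_low A k0 kc ck (ltW c0)).
Qed.

End kern_good.

Hint Extern 0 (measurable_fun _ (@expd _ _)) => exact: measurable_expd : mfun.

(** * Periodic convolution equations *)

Section weighted.
Context {R : realType}.
Local Notation mu := (@lebesgue_measure R).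
Local Notation RM := (measurableTypeR R).
Implicit Types (k g w : R -> R) (a b c t : R).

(** Nonnegative integrable kernels are paired only with nonnegative bounded functions. All integrals
    are then finite real numbers and Tonelli applies without further conditions. *)
Definition kerOK k := [/\ mfunT k, forall t, 0 <= k t &
  (\int[mu]_t (k t)%:E < +oo)%E].

Definition bfun w := [/\ mfunT w, forall t, 0 <= w t & exists M, forall t, w t <= M].

Definition bfun2 (f : R -> R -> R) := [/\ mfunT (fun p : RM * RM => f p.1 p.2),
  forall x y, 0 <= f x y & exists M, forall x y, f x y <= M].

Definition wint k w : R := fine (\int[mu]_r (k r * w r)%:E)%E.

Definition knorm k : R := fine (\int[mu]_r (k r)%:E)%E.

Lemma kerOK_norm k : kerOK k -> (\int[mu]_t (k t)%:E = (knorm k)%:E)%E.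
Proof.
move=> [mk k0 kl]; rewrite fineK// ge0_fin_numE//.
by apply: integral_ge0 => t _; rewrite lee_fin.
Qed.

Lemma knorm_ge0 k : kerOK k -> 0 <= knorm k.
Proof. by move=> [mk k0 kl]; apply: fine_ge0; apply: integral_ge0 => t _; rewrite lee_fin. Qed.

Lemma bfun_bound w : bfun w -> exists2 M, 0 <= M & forall t, w t <= M.
Proof. by move=> [mw w0 [M wM]]; exists M => //; exact: le_trans (w0 0) (wM 0). Qed.

Lemma measurable_kw k w : mfunT k -> mfunT w ->
  mfunT (fun r : R => (k r * w r)%:E).
Proof. by move=> mk mw; apply: measurable_to_EFin; exact: measurable_funM. Qed.

Lemma kw_lty k w : kerOK k -> bfun w -> (\int[mu]_r (k r * w r)%:E < +oo)%E.
Proof.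
move=> kok bw; have [M M0 wM] := bfun_bound bw; have [mk k0 kl] := kok; have [mw w0 _] := bw.
apply: (@le_lt_trans _ _ (\int[mu]_r ((k r)%:E * M%:E))%E); last first.
  rewrite gintZr; first by apply: lte_mul_pinfty => //; rewrite ?ltry// ?(kerOK_norm kok) ?lee_fin ?knorm_ge0.
  - by mfun.
  - by move=> r; rewrite lee_fin.
  - exact: M0.
apply: gint_le; first exact: measurable_kw.
- by move=> r; rewrite lee_fin mulr_ge0.
- by mfun.
- by move=> r; rewrite -EFinM lee_fin ler_wpM2l.
Qed.

Lemma wintE k w : kerOK k -> bfun w -> (\int[mu]_r (k r * w r)%:E = (wint k w)%:E)%E.
Proof.
move=> kok bw; have [mk k0 kl] := kok; have [mw w0 _] := bw; rewrite fineK// ge0_fin_numE ?kw_lty//.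
by apply: integral_ge0 => t _; rewrite lee_fin mulr_ge0.
Qed.

Lemma wint_ge0 k w : kerOK k -> bfun w -> 0 <= wint k w.
Proof.
move=> [mk k0 kl] [mw w0 _]; apply: fine_ge0; apply: integral_ge0 => t _.
by rewrite lee_fin mulr_ge0.
Qed.

Lemma bfun_cst a : 0 <= a -> bfun (cst a).
Proof. by move=> a0; split => //; exists a. Qed.

Lemma wint_gen_le k1 k2 w1 w2 (C : R) : kerOK k1 -> kerOK k2 -> bfun w1 -> bfun w2 -> 0 <= C ->
  (forall r, k1 r * w1 r <= C * (k2 r * w2 r)) -> wint k1 w1 <= C * wint k2 w2.
Proof.
move=> ok1 ok2 b1 b2 C0 h; have [m1 p1 _] := ok1; have [m2 p2 _] := ok2.
have [n1 q1 _] := b1; have [n2 q2 _] := b2.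
rewrite -lee_fin EFinM -(wintE ok1 b1) -(wintE ok2 b2) -gintZl.
- apply: gint_le; first exact: measurable_kw.
  + by move=> r; rewrite lee_fin mulr_ge0.
  + by mfun.
  + by move=> r; rewrite -EFinM lee_fin.
- by mfun.
- by move=> r; rewrite lee_fin mulr_ge0.
- exact: C0.
Qed.

Lemma wint_cst k a : kerOK k -> 0 <= a -> wint k (cst a) = knorm k * a.
Proof.
move=> kok a0; have [mk k0 kl] := kok; apply: EFin_inj; rewrite -wintE//; last exact: bfun_cst.
under eq_integral do rewrite EFinM.
rewrite gintZr; first by rewrite (kerOK_norm kok) -EFinM.
- by mfun.
- by move=> r; rewrite lee_fin.
- exact: a0.
Qed.

Lemma wint_lin_le k w1 w2 w3 w4 a1 a2 b1 b2 : kerOK k ->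
  [/\ bfun w1, bfun w2, bfun w3 & bfun w4] -> [/\ 0 <= a1, 0 <= a2, 0 <= b1 & 0 <= b2] ->
  (forall r, a1 * w1 r + a2 * w2 r <= b1 * w3 r + b2 * w4 r) ->
  a1 * wint k w1 + a2 * wint k w2 <= b1 * wint k w3 + b2 * wint k w4.
Proof.
move=> kok [h1 h2 h3 h4] ab h; have [mk k0 kl] := kok.
have [m1 p1 _] := h1; have [m2 p2 _] := h2; have [m3 p3 _] := h3; have [m4 p4 _] := h4.
apply: (@fine_integral_lin_le R _ _ mu (fun r => k r * w1 r) (fun r => k r * w2 r)
  (fun r => k r * w3 r) (fun r => k r * w4 r) a1 a2 b1 b2 _ _ _ ab).
- by split; exact: measurable_funM.
- by split => r; exact: mulr_ge0.
- by split; exact: kw_lty.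
- move=> r; move: (h r) (k0 r); move: (k r) (w1 r) (w2 r) (w3 r) (w4 r) => x y z y' z' hh x0.
  by have := ler_wpM2l x0 hh; clear; lra.
Qed.

Lemma bfunD w1 w2 : bfun w1 -> bfun w2 -> bfun (fun t => w1 t + w2 t).
Proof.
move=> [m1 p1 [M1 q1]] [m2 p2 [M2 q2]]; split.
- by mfun.
- by move=> t; exact: addr_ge0.
- by exists (M1 + M2) => t; exact: lerD.
Qed.

Lemma bfunZ a w : 0 <= a -> bfun w -> bfun (fun t => a * w t).
Proof.
move=> a0 [m1 p1 [M1 q1]]; split.
- by mfun.
- by move=> t; exact: mulr_ge0.
- by exists (a * M1) => t; exact: ler_wpM2l.
Qed.

Lemma bfunM w1 w2 : bfun w1 -> bfun w2 -> bfun (fun t => w1 t * w2 t).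
Proof.
move=> [m1 p1 [M1 q1]] [m2 p2 [M2 q2]]; split.
- by mfun.
- by move=> t; exact: mulr_ge0.
- by exists (M1 * M2) => t; exact: ler_pM.
Qed.

Lemma bfun_powR p w : 0 <= p -> bfun w -> bfun (fun t => w t `^ p).
Proof.
move=> p0 [m1 p1 [M1 q1]]; split.
- by mfun.
- by move=> t; exact: powR_ge0.
- exists (M1 `^ p) => t; apply: ge0_ler_powR => //; rewrite nnegrE//.
  exact: le_trans (p1 t) (q1 t).
Qed.

Lemma bfun_comp w (f : R -> R) : mfunT f -> bfun w -> bfun (w \o f).
Proof.
move=> mf [m1 p1 [M1 q1]]; split.
- by have := measurableT_comp m1 mf; exact.
- by move=> t; exact: p1.
- by exists M1 => t; exact: q1.
Qed.

Lemma bfun_shift w t : bfun w -> bfun (fun r => w (t + r)).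
Proof. by move=> bw; apply: (bfun_comp _ bw); apply: measurable_funD. Qed.

Lemma bfun_refl w t : bfun w -> bfun (fun r => w (t - r)).
Proof. by move=> bw; apply: (bfun_comp _ bw); apply: measurable_funB. Qed.

Lemma wint_le k w1 w2 : kerOK k -> bfun w1 -> bfun w2 -> (forall r, w1 r <= w2 r) ->
  wint k w1 <= wint k w2.
Proof.
move=> kok h1 h2 h.
have := @wint_lin_le k w1 w1 w2 w1 1 0 1 0 kok.
rewrite !mul1r !mul0r !addr0; apply; [by split|by split|].
by move=> r; rewrite !mul1r !mul0r !addr0.
Qed.

Lemma wintD k w1 w2 : kerOK k -> bfun w1 -> bfun w2 ->
  wint k (fun t => w1 t + w2 t) = wint k w1 + wint k w2.
Proof.
move=> kok h1 h2; have h := bfunD h1 h2.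
have A := @wint_lin_le k (fun t => w1 t + w2 t) w1 w1 w2 1 0 1 1 kok.
have B := @wint_lin_le k w1 w2 (fun t => w1 t + w2 t) w1 1 1 1 0 kok.
have {}A := A ltac:(by split) ltac:(by split) (fun r => ltac:(rewrite mul0r addr0 !mul1r//)).
have {}B := B ltac:(by split) ltac:(by split) (fun r => ltac:(rewrite mul0r addr0 !mul1r//)).
by apply/eqP; rewrite eq_le; move: A B; rewrite !mul1r !mul0r !addr0 => -> ->.
Qed.

Lemma wintZ k a w : kerOK k -> bfun w -> 0 <= a -> wint k (fun t => a * w t) = a * wint k w.
Proof.
move=> kok h1 a0; have h := bfunZ a0 h1.
have A := @wint_lin_le k (fun t => a * w t) w w w 1 0 a 0 kok.
have B := @wint_lin_le k w w (fun t => a * w t) w a 0 1 0 kok.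
have {}A := A ltac:(by split) ltac:(by split) (fun r => ltac:(rewrite !mul0r !addr0 !mul1r//)).
have {}B := B ltac:(by split) ltac:(by split) (fun r => ltac:(rewrite !mul0r !addr0 !mul1r//)).
by apply/eqP; rewrite eq_le; move: A B; rewrite !mul1r !mul0r !addr0 => -> ->.
Qed.

Lemma eq_wint k w1 w2 : (forall r, w1 r = w2 r) -> wint k w1 = wint k w2.
Proof. by move=> h; congr wint; exact/funext. Qed.

Lemma wint_dist k w1 w2 e : kerOK k -> bfun w1 -> bfun w2 -> (forall r, `|w1 r - w2 r| <= e) ->
  `|wint k w1 - wint k w2| <= knorm k * e.
Proof.
move=> kok h1 h2 h; have e0 : 0 <= e by exact: le_trans (h 0).
have he := bfun_cst e0.
have H w w' : bfun w -> bfun w' -> (forall r, w r <= w' r + e) -> wint k w <= wint k w' + knorm k * e.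
  move=> b b' hh; rewrite -(wint_cst kok e0) -wintD//; apply: wint_le => //; exact: bfunD.
rewrite ler_distl; apply/andP; split.
  rewrite lerBlDr; apply: H => // r; have := h r; rewrite ler_distl => /andP[]; lra.
by apply: H => // r; have := h r; rewrite ler_distl => /andP[]; lra.
Qed.

Lemma bfun2_slice f x : bfun2 f -> bfun (f x).
Proof.
move=> [mf f0 [M fM]]; split.
- by have := measurableT_comp mf (@measurable_pair1 _ _ RM RM x); exact.
- exact: f0.
- by exists M.
Qed.

Lemma bfun2_slice' f y : bfun2 f -> bfun (fun x => f x y).
Proof.
move=> [mf f0 [M fM]]; split.
- by have := measurableT_comp mf (@measurable_pair2 _ _ RM RM y); exact.
- by move=> x; exact: f0.
- by exists M => x; exact: fM.
Qed.

Lemma bfun2_swap f : bfun2 f -> bfun2 (fun x y => f y x).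
Proof.
move=> [mf f0 [M fM]]; split.
- by have := measurableT_comp mf (@measurable_swap _ _ RM RM); exact.
- by move=> x y; exact: f0.
- by exists M => x y; exact: fM.
Qed.

Lemma bfun_wint k f : kerOK k -> bfun2 f -> bfun (fun x => wint k (f x)).
Proof.
move=> kok bf; have [mf f0 [M fM]] := bf; have [mk k0 kl] := kok; split.
- have m2 : mfunT (fun p : RM * RM => (k p.2 * f p.1 p.2)%:E).
    by mfun.
  have p0 (p : RM * RM) : (0 <= (k p.2 * f p.1 p.2)%:E)%E by rewrite lee_fin mulr_ge0.
  have mF := measurable_fun_fubini_tonelli_F (m2 := mu) _ m2 p0.
  have := measurableT_comp (@fine_measurable R setT measurableT) mF; exact.
- by move=> x; apply: wint_ge0 => //; exact: bfun2_slice.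
- have M0 : 0 <= M by exact: le_trans (fM 0 0).
  exists (knorm k * M) => x; rewrite -(wint_cst kok M0).
  by apply: wint_le => //; [exact: bfun2_slice|exact: bfun_cst].
Qed.

Lemma wint_tonelli k1 k2 f : kerOK k1 -> kerOK k2 -> bfun2 f ->
  wint k1 (fun x => wint k2 (f x)) = wint k2 (fun y => wint k1 (fun x => f x y)).
Proof.
move=> ok1 ok2 bf; have [mf f0 _] := bf; have [mk1 k10 kl1] := ok1; have [mk2 k20 kl2] := ok2.
have m2 : mfunT (fun p : RM * RM => (k1 p.1 * k2 p.2 * f p.1 p.2)%:E) by mfun.
have p0 (p : RM * RM) : (0 <= (k1 p.1 * k2 p.2 * f p.1 p.2)%:E)%E by rewrite lee_fin !mulr_ge0.
have := fubini_tonelli (m1 := mu) (m2 := mu) _ m2 p0.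
rewrite /= => E; apply: EFin_inj.
rewrite -(wintE ok1 (bfun_wint ok2 bf)) -(wintE ok2 (bfun_wint ok1 (bfun2_swap bf))).
transitivity (\int[mu]_x \int[mu]_y (k1 x * k2 y * f x y)%:E)%E; last rewrite E.
  apply: eq_integral => x _; rewrite EFinM -(wintE ok2 (bfun2_slice x bf)) -gintZl.
  - by apply: eq_integral => y _; rewrite -EFinM mulrA.
  - by apply: measurable_kw => //; have [] := bfun2_slice x bf.
  - by move=> y; rewrite lee_fin mulr_ge0.
  - exact: k10.
apply: eq_integral => y _; rewrite EFinM -(wintE ok1 (bfun2_slice' y bf)) -gintZl.
- by apply: eq_integral => x _; rewrite -EFinM mulrA (mulrC (k2 y)).
- by apply: measurable_kw => //; have [] := bfun2_slice' y bf.
- by move=> x; rewrite lee_fin mulr_ge0.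
- exact: k20.
Qed.

Lemma bfun2_add w : bfun w -> bfun2 (fun x y => w (x + y)).
Proof.
move=> [mw w0 [M wM]]; split.
- by mfun.
- by move=> x y; exact: w0.
- by exists M => x y; exact: wM.
Qed.

Lemma bfun2_sub w : bfun w -> bfun2 (fun x y => w (x - y)).
Proof.
move=> [mw w0 [M wM]]; split.
- by mfun.
- by move=> x y; exact: w0.
- by exists M => x y; exact: wM.
Qed.

Lemma bfun2_fst w : bfun w -> bfun2 (fun x y => w x).
Proof.
move=> [mw w0 [M wM]]; split.
- by mfun.
- by move=> x y; exact: w0.
- by exists M => x y; exact: wM.
Qed.

Lemma bfun2M (f g : R -> R -> R) : bfun2 f -> bfun2 g -> bfun2 (fun x y => f x y * g x y).
Proof.
move=> [m1 p1 [M1 q1]] [m2 p2 [M2 q2]]; split.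
- by mfun.
- by move=> x y; exact: mulr_ge0.
- by exists (M1 * M2) => x y; exact: ler_pM.
Qed.

Definition cvl k w t : R := wint k (fun r => w (t - r)).
Definition corr k w t : R := wint k (fun r => w (t + r)).

Lemma bfun_cvl k w : kerOK k -> bfun w -> bfun (cvl k w).
Proof. by move=> kok bw; apply: (bfun_wint kok (f := fun x y => w (x - y))); exact: bfun2_sub. Qed.

Lemma bfun_corr k w : kerOK k -> bfun w -> bfun (corr k w).
Proof. by move=> kok bw; apply: (bfun_wint kok (f := fun x y => w (x + y))); exact: bfun2_add. Qed.

Lemma wint_shift k w a : kerOK k -> bfun w ->
  wint k w = wint (fun r => k (r + a)) (fun r => w (r + a)).
Proof.
move=> [mk k0 kl] [mw w0 _]; rewrite /wint -(@ge0_integral_shift R a (fun r => (k r * w r)%:E))//.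
- by mfun.
- by move=> r; rewrite lee_fin mulr_ge0.
Qed.

Lemma wint_opp k w : kerOK k -> bfun w ->
  wint k w = wint (fun r => k (- r)) (fun r => w (- r)).
Proof.
move=> [mk k0 kl] [mw w0 _]; rewrite /wint (@ge0_integral_opp R (fun r => (k r * w r)%:E))//.
- by mfun.
- by move=> r; rewrite lee_fin mulr_ge0.
Qed.

Lemma kerOK_shift k a : kerOK k -> kerOK (fun r => k (r + a)).
Proof.
move=> [mk k0 kl]; split.
- by mfun.
- by move=> t; exact: k0.
- rewrite (@ge0_integral_shift R a (fun r => (k r)%:E))//; exact: measurable_to_EFin.
Qed.

Lemma cvl_corr k w t : kerOK k -> (forall r, k (- r) = k r) -> bfun w -> cvl k w t = corr k w t.
Proof.
move=> kok ke bw; rewrite /cvl (wint_opp kok (bfun_refl t bw)) /corr.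
congr wint; apply/funext => r; [exact: ke|by rewrite opprK].
Qed.

(* With [g] a square root of [k] for composition, the quadratic form of [k] is a sum of squares. *)
Lemma cvl_root k g (C : R) (b : R -> R) t : kerOK k -> kerOK g -> 0 <= C -> bfun b ->
  (forall s, s != 0 -> (\int[mu]_r (g r * g (r - s))%:E = (C * k s)%:E)%E) ->
  C * cvl k b t = cvl g (corr g b) t.
Proof.
move=> kok gok C0 bb root; have [mk k0 kl] := kok; have [mg g0 gl] := gok; have [mb b0 _] := bb.
have mgb : mfunT (fun p : RM * RM => (g p.2 * g (p.2 - p.1) * b (t - p.1))%:E) by mfun.
have p0 (p : RM * RM) : (0 <= (g p.2 * g (p.2 - p.1) * b (t - p.1))%:E)%E.
  by rewrite lee_fin !mulr_ge0.
have E := fubini_tonelli (m1 := mu) (m2 := mu) _ mgb p0.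
have br := bfun_refl t bb; have [mbr br0 _] := br.
have mgs s : mfunT (fun r : R => g (r - s)) by mfun.
apply: EFin_inj; rewrite EFinM -(wintE kok br) -gintZl; first last.
- exact: C0.
- by move=> r; rewrite lee_fin mulr_ge0.
- by mfun.
transitivity (\int[mu]_x \int[mu]_y (g y * g (y - x) * b (t - x))%:E)%E.
  apply: gint_ae_eq.
  - by mfun.
  - exact: (measurable_fun_fubini_tonelli_F _ mgb p0).
  - apply: aeR_imp (ae_neqR 0) => s s0; rewrite -EFinM mulrA EFinM -root// -gintZr.
    + by apply: eq_integral => y _; rewrite -EFinM.
    + by mfun.
    + by move=> y; rewrite lee_fin mulr_ge0.
    + exact: b0.
rewrite [LHS]E -(wintE gok (bfun_refl t (bfun_corr gok bb))).
apply: eq_integral => q _ /=; rewrite EFinM -(wintE gok (bfun_shift (t - q) bb)) -gintZl; first last.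
- exact: g0.
- by move=> y; rewrite lee_fin mulr_ge0.
- by mfun.
have mF : mfunT (fun s : R => (g q)%:E * (g s * b (t - q + s))%:E)%E by mfun.
have F0 s : (0 <= (g q)%:E * (g s * b (t - q + s))%:E)%E by rewrite -EFinM lee_fin !mulr_ge0.
rewrite -(ge0_integral_shift q mF F0) ge0_integral_opp.
- apply: eq_integral => s _; rewrite -EFinM mulrA (addrC (- s)).
  by congr (_ * _ * b _)%:E; ring.
- by mfun.
- by move=> s; exact: F0.
Qed.

Lemma wint_gen2_le k k1 k2 w w1 w2 : kerOK k -> kerOK k1 -> kerOK k2 ->
  bfun w -> bfun w1 -> bfun w2 ->
  (forall r, k r * w r <= k1 r * w1 r + k2 r * w2 r) -> wint k w <= wint k1 w1 + wint k2 w2.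
Proof.
move=> ok ok1 ok2 b b1 b2 h.
have [m p _] := ok; have [m1 p1 _] := ok1; have [m2 p2 _] := ok2.
have [n q _] := b; have [n1 q1 _] := b1; have [n2 q2 _] := b2.
rewrite -lee_fin EFinD -(wintE ok b) -(wintE ok1 b1) -(wintE ok2 b2) -gintD.
- apply: gint_le; first exact: measurable_kw.
  + by move=> r; rewrite lee_fin mulr_ge0.
  + by apply: emeasurable_funD; exact: measurable_kw.
  + by move=> r; rewrite -EFinD lee_fin.
- by mfun.
- by move=> r; rewrite lee_fin mulr_ge0.
- by mfun.
- by move=> r; rewrite lee_fin mulr_ge0.
Qed.

Lemma wint_kerZ k w a : kerOK k -> bfun w -> 0 <= a -> wint (fun r => a * k r) w = a * wint k w.
Proof.
move=> kok bw a0; rewrite -(wintZ kok bw a0) /wint; congr fine.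
by apply: eq_integral => r _; rewrite mulrCA mulrA.
Qed.

Lemma kerOKZ k a : kerOK k -> 0 <= a -> kerOK (fun r => a * k r).
Proof.
move=> [mk k0 kl] a0; split.
- by mfun.
- by move=> t; rewrite mulr_ge0.
- under eq_integral do rewrite EFinM.
  rewrite gintZl; [by apply: lte_mul_pinfty|exact: measurable_to_EFin|by move=> x; rewrite lee_fin|exact: a0].
Qed.

End weighted.

(** * Integrals over a period and quadratic forms *)

Section periodic.
Context {R : realType} (T : R).
Hypothesis T0 : 0 < T.
Local Notation mu := (@lebesgue_measure R).
Implicit Types (k g w : R -> R) (a b c d t : R).

(** Half-open, so that adjacent boxes add up exactly and a period can be cut anywhere. *)
Definition box c d t : R := (c <= t < d)%R%:R.

Lemma box_ker c d : kerOK (box c d).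
Proof.
have E : box c d = \1_(`[c, d[%classic).
  by apply/funext => t; rewrite indicE /box mem_setE in_itv.
split.
- by rewrite E; apply: measurable_indic; exact: measurable_itv.
- by move=> t; rewrite ler0n.
- rewrite (_ : (\int[mu]_t _)%E = \int[mu]_t (\1_(`[c, d[%classic) t)%:E)%E; last by rewrite E.
  rewrite integral_indic ?setIT; [|exact: measurableT|exact: measurable_itv].
  rewrite [X in (X < _)%E](_ : _ = mu `[c, d[%classic)// lebesgue_measure_itv/=.
  by case: ifP => _; rewrite ?ltry.
Qed.

Lemma knorm_box c d : c <= d -> knorm (box c d) = d - c.
Proof.
move=> cd; rewrite /knorm.
have E : box c d = \1_(`[c, d[%classic).
  by apply/funext => t; rewrite indicE /box mem_setE in_itv.
rewrite E integral_indic ?setIT; [|exact: measurableT|exact: measurable_itv].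
rewrite [X in fine X](_ : _ = mu `[c, d[%classic)// lebesgue_measure_itv/= lte_fin.
move: cd; rewrite le_eqVlt => /orP[/eqP ->|cd]; first by rewrite ltxx subrr.
by rewrite cd.
Qed.

Definition per w := wint (box 0 T) w.

Definition bper w := bfun w /\ forall t, w (t + T) = w t.

Lemma kerOKD k1 k2 : kerOK k1 -> kerOK k2 -> kerOK (fun t => k1 t + k2 t).
Proof.
move=> ok1 ok2; have [m1 p1 l1] := ok1; have [m2 p2 l2] := ok2; split.
- exact: measurable_funD.
- by move=> t; exact: addr_ge0.
under eq_integral do rewrite EFinD.
rewrite gintD; [|exact: measurable_to_EFin|by move=> x; rewrite lee_fin|exact: measurable_to_EFin|by move=> x; rewrite lee_fin].
by rewrite (kerOK_norm ok1) (kerOK_norm ok2) -EFinD ltry.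
Qed.

Lemma wint_kerD k1 k2 w : kerOK k1 -> kerOK k2 -> bfun w ->
  wint (fun t => k1 t + k2 t) w = wint k1 w + wint k2 w.
Proof.
move=> ok1 ok2 bw; have [m1 p1 l1] := ok1; have [m2 p2 l2] := ok2; have [mw w0 _] := bw.
have ok := kerOKD ok1 ok2.
apply: EFin_inj; rewrite -(wintE ok bw) EFinD -(wintE ok1 bw) -(wintE ok2 bw) -gintD.
- by apply: eq_integral => x _; rewrite -EFinD mulrDl.
- by mfun.
- by move=> x; rewrite lee_fin mulr_ge0.
- by mfun.
- by move=> x; rewrite lee_fin mulr_ge0.
Qed.

Lemma boxD a c d : a <= c -> c <= d -> (fun t => box a c t + box c d t) = box a d.
Proof.
move=> ac cd; apply/funext => t; rewrite /box -natrD; congr _%:R.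
by case: (leP a t) => h1; case: (ltP t c) => h2; case: (ltP t d) => h3 //=;
  exfalso; lra.
Qed.

Lemma bper_shift w a : bper w -> bper (fun t => w (t + a)).
Proof.
move=> [bw pw]; split; last by move=> t; rewrite addrAC pw.
have := bfun_shift a bw; congr bfun; apply/funext => t; by rewrite addrC.
Qed.

Lemma bper_mulrn w t n : bper w -> w (t + T *+ n) = w t.
Proof.
move=> [_ pw]; elim: n => [|n IH]; first by rewrite mulr0n addr0.
by rewrite mulrSr addrA pw.
Qed.

Lemma per_shift w a : bper w -> per (fun t => w (t + a)) = per w.
Proof.
move=> pw; have [bw hw] := pw.
have small c : 0 <= c -> c <= T -> per (fun t => w (t + c)) = per w.
  move=> c0 cT; rewrite /per.
  have bwc : bfun (fun t => w (t + c)) by have [] := bper_shift c pw.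
  have -> : wint (box 0 T) (fun t => w (t + c)) = wint (box c (T + c)) w.
    rewrite (wint_shift c (box_ker c (T + c)) bw); congr wint; apply/funext => r.
    by rewrite /box lerDr ltrD2r.
  rewrite -(@boxD c T (T + c))//; last by rewrite lerDl.
  rewrite -(@boxD 0 c T)// !wint_kerD//; try exact: box_ker.
  rewrite addrC; congr (_ + _).
  rewrite (wint_shift T (box_ker T (T + c)) bw); congr wint; last exact/funext.
  by apply/funext => r; rewrite /box lerDr [r + T]addrC ltrD2l.
have up c n : per (fun t => w (t + (c + T *+ n))) = per (fun t => w (t + c)).
  by rewrite /per; apply: eq_wint => r; rewrite addrA bper_mulrn.
(* Enough periods are added to make the shift nonnegative, as [truncn] requires; what remains after
   removing whole periods lies between 0 and T. *)
have aT : 0 <= a / T + (Num.truncn (`|a| / T)).+1%:R.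
  have := truncnS_gt (`|a| / T) => h.
  have : - (`|a| / T) <= a / T by rewrite -mulNr ler_pM2r ?invr_gt0// lerNnormlW.
  lra.
set n := (Num.truncn (`|a| / T)).+1 in aT.
set y := a / T + n%:R in aT.
have /andP[m1 m2] := truncn_itv aT; set m := Num.truncn y in m1 m2.
have aE : a + T *+ n = (T * y - T *+ m) + T *+ m.
  by rewrite subrK /y mulrDr mulrC divfK ?gt_eqF// mulr_natr.
rewrite -(up a n) aE up; apply: small.
- by rewrite subr_ge0 -mulr_natr ler_pM2l.
- rewrite -mulr_natr lerBlDr -{2}[T]mulr1 -mulrDr ler_pM2l// addrC natr1; exact: ltW.
Qed.

Lemma bper_cvl k w : kerOK k -> bper w -> bper (cvl k w).
Proof.
move=> kok [bw pw]; split; first exact: bfun_cvl.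
by move=> t; apply: eq_wint => r; rewrite addrAC pw.
Qed.

Lemma bper_corr k w : kerOK k -> bper w -> bper (corr k w).
Proof.
move=> kok [bw pw]; split; first exact: bfun_corr.
by move=> t; apply: eq_wint => r; rewrite addrAC pw.
Qed.

Lemma bperM w1 w2 : bper w1 -> bper w2 -> bper (fun t => w1 t * w2 t).
Proof. by move=> [b1 p1] [b2 p2]; split; [exact: bfunM|move=> t; rewrite p1 p2]. Qed.

Lemma bperZ a w : 0 <= a -> bper w -> bper (fun t => a * w t).
Proof. by move=> a0 [b1 p1]; split; [exact: bfunZ|move=> t; rewrite p1]. Qed.

Lemma bper_powR p w : 0 <= p -> bper w -> bper (fun t => w t `^ p).
Proof. by move=> p0 [b1 p1]; split; [exact: bfun_powR|move=> t; rewrite p1]. Qed.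

(** Tonelli, and translation by q inside the period integral, move the kernel from one factor to the
    other as a correlation. *)
Lemma per_adjoint g (a w : R -> R) : kerOK g -> bper a -> bper w ->
  per (fun t => a t * cvl g w t) = per (fun t => corr g a t * w t).
Proof.
move=> gok pa pw; have [ba ha] := pa; have [bw hw] := pw.
have Jok := box_ker 0 T.
have b1 : bfun2 (fun t q => a t * w (t - q)) by apply: bfun2M; [exact: bfun2_fst|exact: bfun2_sub].
have b2 : bfun2 (fun t q => a (t + q) * w t) by apply: bfun2M; [exact: bfun2_add|exact: bfun2_fst].
transitivity (per (fun t => wint g (fun q => a t * w (t - q)))).
  apply: eq_wint => t; rewrite wintZ//; first exact: bfun_refl.
  by have [_ a0 _] := ba.
transitivity (per (fun t => wint g (fun q => a (t + q) * w t))); last first.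
  apply: eq_wint => t; rewrite mulrC -wintZ//; first by apply: eq_wint => q; rewrite mulrC.
    exact: bfun_shift.
  by have [_ w0 _] := bw.
rewrite /per (wint_tonelli Jok gok b1) (wint_tonelli Jok gok b2).
apply: eq_wint => q.
have pq : bper (fun t => a (t + q) * w t) by apply: bperM => //; exact: bper_shift.
rewrite -[RHS](per_shift (- q) pq); apply: eq_wint => t.
by rewrite subrK.
Qed.

Definition qform k (a b : R -> R) := per (fun t => a t * cvl k b t).

Lemma qform_root k g (C : R) (a b : R -> R) : kerOK k -> kerOK g -> 0 <= C -> bper a -> bper b ->
  (forall s, s != 0 -> (\int[mu]_r (g r * g (r - s))%:E = (C * k s)%:E)%E) ->
  C * qform k a b = per (fun t => corr g a t * corr g b t).
Proof.
move=> kok gok C0 pa pb root; have [ba _] := pa; have [bb _] := pb.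
rewrite /qform /per -wintZ//; first last.
- by apply: bfunM => //; exact: bfun_cvl.
- exact: box_ker.
rewrite -/(per _) -/(per _) -(per_adjoint gok pa (bper_corr gok pb)); apply: eq_wint => t.
by rewrite mulrCA (cvl_root t kok gok C0 bb root).
Qed.

Lemma per_le w1 w2 : bfun w1 -> bfun w2 -> (forall t, w1 t <= w2 t) -> per w1 <= per w2.
Proof. by move=> *; apply: wint_le => //; exact: box_ker. Qed.

Lemma per_ge0 w : bfun w -> 0 <= per w.
Proof. by move=> *; apply: wint_ge0 => //; exact: box_ker. Qed.

Lemma qform_ge0 k (a b : R -> R) : kerOK k -> bper a -> bper b -> 0 <= qform k a b.
Proof. by move=> kok [ba _] [bb _]; apply: per_ge0; apply: bfunM => //; exact: bfun_cvl. Qed.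

(** Moving the centre of the exponential weight by s in [0, T) changes it by a factor at most
    e^(cT). Averaging over s and exchanging the integrals leaves the integral of w over one period,
    so no periodised kernel is needed. *)
Lemma cvl_expd_le c w t : 0 <= c -> kerOK (expd c) -> bper w ->
  cvl (expd c) w t <= T^-1 * expR (c * T) * knorm (expd c) * per w.
Proof.
move=> c0 eok pw; have [bw hw] := pw.
have ee r : expd c (- r) = expd c r :> R by rewrite /expd normrN.
rewrite cvl_corr// /corr; set w' := fun r => w (t + r).
have pw' : bper w'.
  by have := bper_shift t pw; congr bper; apply/funext => r; rewrite addrC.
have <- : per w' = per w.
  by rewrite -(per_shift t pw); apply: eq_wint => r; rewrite /w' addrC.
move: w' pw' => v pv; have [bv hv] := pv; have [mv v0 [M vM]] := bv.
have Jok := box_ker 0 T; have [mE E0 El] := eok.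
have b2 : bfun2 (fun s r => v (r + s)) by apply: (bfun2_swap (f := fun r s => v (r + s))); exact: bfun2_add.
have H : wint (box 0 T) (fun s => wint (expd c) (fun r => v (r + s))) = knorm (expd c) * per v.
  rewrite (wint_tonelli Jok eok b2) -(wint_cst eok (per_ge0 bv)).
  apply: eq_wint => r /=; rewrite -[RHS](per_shift r pv).
  by apply: eq_wint => s; rewrite addrC.
rewrite -!mulrA mulrCA -H [leRHS]mulrCA ler_pdivlMl//.
rewrite -(wintZ Jok _ (expR_ge0 _)); last exact: (bfun_wint eok b2).
rewrite -[X in X * wint (expd c) v]subr0 -(knorm_box (ltW T0)) -(wint_cst Jok (wint_ge0 eok bv)).
have eT0 := expR_ge0 (c * T).
rewrite -[leRHS]mul1r; apply: wint_gen_le => //.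
- exact: (bfun_cst (wint_ge0 eok bv)).
- by apply: bfunZ => //; exact: (bfun_wint eok b2).
move=> s; rewrite mul1r /box; case: (boolP (0 <= s < T)) => [/andP[s0 sT]|_]; last by rewrite !mul0r.
rewrite !mul1r /=.
have okE : kerOK (fun r => expd c (r - s)).
  have := kerOK_shift (- s) eok; exact.
have -> : wint (expd c) (fun r => v (r + s)) = wint (fun r => expd c (r - s)) v.
  rewrite (wint_shift s okE bv); congr (wint _ _).
  by apply/funext => r; rewrite addrK.
apply: wint_gen_le => // r; rewrite mulrA ler_wpM2r// /expd -expRD ler_expR.
have hs : `|r - s| <= `|r| + T.
  by apply: le_trans (ler_normB _ _) _; rewrite lerD2l ger0_norm// ltW.
by have := ler_wpM2l c0 hs; rewrite mulrDr !mulNr; clear; lra.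
Qed.

End periodic.

Opaque wint knorm box.

(** * Young's inequality for singular kernels *)

Section bounds.
Context {R : realType} (T : R).
Hypothesis T0 : 0 < T.
Implicit Types (k g w : R -> R) (c t : R).
Local Notation per := (per T).
Local Notation bper := (bper T).
Local Notation qform := (qform T).

Lemma goodk_ker kap c k : goodk kap c k -> kap < 1 -> kerOK k.
Proof.
move=> gk k1; split; [exact: gk_meas gk|exact: gk_ge0 gk|].
have := gk_int gk (lexx 1); rewrite mul1r => /(_ k1).
rewrite subrr; congr (_ < _)%E; apply: eq_integral => t _.
by rewrite powRr0 mulr1 powRr1//; exact: gk_ge0 gk _.
Qed.

Lemma expd_gt0 c t : 0 < expd c t.
Proof. exact: expR_gt0. Qed.

Lemma expd_ker c : 0 < c -> kerOK (expd c : R -> R).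
Proof.
move=> c0; split.
- by mfun.
- by move=> t; exact: ltW (expd_gt0 c t).
- exact: integral_expRN_norm.
Qed.

Lemma qform_sym kap c k a b : goodk kap c k -> kap < 1 -> bper a -> bper b ->
  qform k a b = qform k b a.
Proof.
move=> gk k1 pa pb; have kok := goodk_ker gk k1.
have [g [C [mg g0 gl C0 root]]] := gk_root gk.
have gok : kerOK g by split.
have Cn : C != 0 by rewrite gt_eqF.
apply: (mulfI Cn); rewrite (qform_root T0 kok gok (ltW C0) pa pb root).
rewrite (qform_root T0 kok gok (ltW C0) pb pa root).
by apply: eq_wint => t; rewrite mulrC.
Qed.

(** Kept as AM-GM rather than Cauchy-Schwarz: no square roots appear, and rescaling one argument
    recovers the latter where it is wanted. *)
Lemma qform_amgm kap c k a b : goodk kap c k -> kap < 1 -> bper a -> bper b ->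
  2 * qform k a b <= qform k a a + qform k b b.
Proof.
move=> gk k1 pa pb; have kok := goodk_ker gk k1.
have [g [C [mg g0 gl C0 root]]] := gk_root gk.
have gok : kerOK g by split.
have [ca _] := bper_corr gok pa; have [cb _] := bper_corr gok pb.
have Jok := box_ker (0 : R) T.
have E1 := qform_root T0 kok gok (ltW C0) pa pb root.
have E2 := qform_root T0 kok gok (ltW C0) pa pa root.
have E3 := qform_root T0 kok gok (ltW C0) pb pb root.
rewrite -(ler_pM2l C0) mulrCA mulrDr E1 E2 E3.
have ba := bfunM ca ca; have bb := bfunM cb cb; have bab := bfunM ca cb.
have := @wint_lin_le R (box 0 T) _ _ _ _ 2 0 1 1 Jok (And4 bab bab ba bb).
rewrite /per; set q1 := wint _ _; set q2 := wint _ _; set q3 := wint _ _ => H.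
suff : 2 * q1 + 0 * q1 <= 1 * q2 + 1 * q3.
  by move: q1 q2 q3 {H}; clear => x y z; lra.
apply: H; first by split.
move=> r; rewrite !mul1r mul0r addr0; have := sqr_ge0 (corr g a r - corr g b r).
by move: (corr _ _ _) (corr _ _ _) => x y; clear; rewrite sqrrB; lra.
Qed.

(* Split according to whether [G <= E x y]. *)
Lemma young_dichotomy (G E x y m : R) : 2 <= m -> 0 <= G -> 0 < E -> 0 <= x -> 0 <= y ->
  G * (x `^ (m - 1) * y `^ (m - 1)) <= E * (x `^ m * y `^ m) +
    2^-1 * (G `^ (m / 2) * E `^ (1 - m / 2)) * (x `^ m + y `^ m).
Proof.
move=> m2 G0 E0 x0 y0.
have xy0 : 0 <= x * y by rewrite mulr_ge0.
have GE0 : 0 <= G `^ (m / 2) * E `^ (1 - m / 2) by rewrite mulr_ge0 ?powR_ge0.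
have sum0 : 0 <= x `^ m + y `^ m by rewrite addr_ge0 ?powR_ge0.
rewrite -!powRM//.
have [h|h] := leP G (E * (x * y)).
  apply: (@le_trans _ _ (E * (x * y) `^ m)); last by rewrite lerDl mulr_ge0// mulr_ge0.
  have [->|xyn] := eqVneq (x * y) 0.
    by rewrite powR0 ?mulr0 ?mulr_ge0 ?powR_ge0 ?(ltW E0)//; lra.
  have xyp : 0 < x * y by rewrite lt_def xyn.
  have -> : (x * y) `^ m = (x * y) * (x * y) `^ (m - 1).
    rewrite -{2}[x * y]powRr1// -powRD ?xyn ?implybT//; congr (_ `^ _); ring.
  by rewrite mulrA ler_wpM2r ?powR_ge0.
apply: ler_wpDl; first by rewrite mulr_ge0 ?powR_ge0 ?(ltW E0).
have amgm : (x * y) `^ (m / 2) <= 2^-1 * (x `^ m + y `^ m).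
  rewrite powRM//.
  have sq z : 0 <= z -> z `^ m = (z `^ (m / 2)) ^+ 2.
    move=> z0; rewrite -powR_mulrn ?powR_ge0// -powRrM; congr (_ `^ _); lra.
  rewrite (sq x)// (sq y)//; have := sqr_ge0 (x `^ (m / 2) - y `^ (m / 2)).
  by move: (x `^ _) (y `^ _) => a b; rewrite sqrrB; lra.
have split_m : (x * y) `^ (m - 1) = (x * y) `^ (m / 2) * (x * y) `^ (m / 2 - 1).
  have [->|xyn] := eqVneq (x * y) 0.
    by rewrite (@powR0 _ (m - 1)) ?(@powR0 _ (m / 2)) ?mul0r// gt_eqF//; lra.
  rewrite -powRD ?xyn ?implybT//; congr (_ `^ _); lra.
have G1 : 0 < G by apply: le_lt_trans h; rewrite mulr_ge0// ltW.
have q0 : 0 <= m / 2 - 1 by lra.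
have h2 : (x * y) `^ (m / 2 - 1) <= G `^ (m / 2 - 1) * E `^ (1 - m / 2).
  have -> : 1 - m / 2 = - (m / 2 - 1) by ring.
  rewrite -(mulN1r (m / 2 - 1)) (powRrM E) powR_inv1 ?(ltW E0)//.
  rewrite -powRM ?invr_ge0 ?(ltW E0)//; apply: ge0_ler_powR => //.
  - by rewrite nnegrE mulr_ge0// invr_ge0 ltW.
  - by rewrite ler_pdivlMr// mulrC ltW.
have G2 : G `^ (m / 2) = G * G `^ (m / 2 - 1).
  rewrite -{2}[G]powRr1// -powRD ?(gt_eqF G1) ?implybT//; congr (_ `^ _); ring.
rewrite split_m G2.
move: amgm h2 (powR_ge0 (x * y) (m / 2)) (powR_ge0 (x * y) (m / 2 - 1)) sum0.
move: (_ `^ (m / 2)) (_ `^ (m / 2 - 1)) (_ `^ (m / 2 - 1)) (E `^ _) (_ + _ : R) => A B D F S h1 h2 A0 D0 S0.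
have -> : 2^-1 * (G * B * F) * S = G * ((2^-1 * S) * (B * F)) by ring.
by rewrite ler_wpM2l//; apply: ler_pM.
Qed.

(** Young's inequality by cases. If k <= E w^(m - x), the first term dominates; otherwise w^(m - x)
    < k / E, and w^x is bounded by the power x / (m - x) of k / E. *)
Lemma singular_dichotomy (k E w m x : R) : 0 <= k -> 0 < E -> 0 <= w -> 0 <= x -> x < m ->
  k * w `^ x <= E * w `^ m + k `^ (m / (m - x)) * E `^ (1 - m / (m - x)).
Proof.
move=> k0 E0 w0 x0 xm.
have mx : 0 < m - x by rewrite subr_gt0.
have m0 : 0 < m by lra.
have [h|h] := leP k (E * w `^ (m - x)).
  apply: ler_wpDr; first by rewrite mulr_ge0 ?powR_ge0.
  apply: le_trans (ler_wpM2r (powR_ge0 _ _) h) _; rewrite -mulrA ler_wpM2l ?(ltW E0)//.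
  have [->|wn] := eqVneq w 0; first by rewrite powR0 ?mul0r ?powR_ge0// gt_eqF.
  by rewrite -powRD ?wn ?implybT// subrK.
apply: ler_wpDl; first by rewrite mulr_ge0 ?powR_ge0 ?(ltW E0).
have k1 : 0 < k by apply: le_lt_trans h; rewrite mulr_ge0 ?powR_ge0 ?(ltW E0).
have e1 : m / (m - x) = 1 + x / (m - x) by field; rewrite gt_eqF.
have -> : 1 - m / (m - x) = - (x / (m - x)) by rewrite e1; ring.
rewrite e1 powRD ?(gt_eqF k1) ?implybT// powRr1// -mulrA ler_wpM2l//.
have y0 : 0 <= x / (m - x) by rewrite divr_ge0// ltW.
rewrite -(mulN1r (x / (m - x))) (powRrM E) powR_inv1 ?(ltW E0)// -powRM ?invr_ge0 ?(ltW E0) ?(ltW k1)//.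
apply: (@le_trans _ _ ((w `^ (m - x)) `^ (x / (m - x)))).
  by rewrite -powRrM mulrC divfK ?gt_eqF.
apply: ge0_ler_powR => //; first by rewrite nnegrE powR_ge0.
- by rewrite nnegrE mulr_ge0// invr_ge0 ltW.
- by rewrite ler_pdivlMr// mulrC ltW.
Qed.

Lemma cvl_le k w1 w2 t : kerOK k -> bfun w1 -> bfun w2 -> (forall r, w1 r <= w2 r) ->
  cvl k w1 t <= cvl k w2 t.
Proof. by move=> kok h1 h2 h; apply: wint_le => //; exact: bfun_refl. Qed.

Lemma cvl_cst k a t : kerOK k -> 0 <= a -> cvl k (cst a) t = knorm k * a.
Proof. by move=> kok a0; rewrite -(wint_cst kok a0). Qed.

Lemma cvlZ k a w t : kerOK k -> bfun w -> 0 <= a -> cvl k (fun r => a * w r) t = a * cvl k w t.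
Proof. by move=> kok h a0; rewrite /cvl wintZ//; exact: bfun_refl. Qed.

Lemma cvlD k w1 w2 t : kerOK k -> bfun w1 -> bfun w2 ->
  cvl k (fun r => w1 r + w2 r) t = cvl k w1 t + cvl k w2 t.
Proof. by move=> kok h1 h2; rewrite /cvl wintD//; exact: bfun_refl. Qed.

(* [(k / E) ^ A * E] for the exponential [E]: the kernels produced by Young's inequality. *)
Definition youngk (A d c : R) (k : R -> R) (t : R) : R := k t `^ A * (d * expd c t) `^ (1 - A).

Lemma youngk_ker kap c k A d : goodk kap c k -> 0 < d -> 1 <= A -> A * kap < 1 ->
  kerOK (youngk A d c k).
Proof.
move=> gk d0 A1 Ak.
have mk : mfunT (fun t => k t `^ A * expd c t `^ (1 - A)).
  apply: measurable_funM; apply: measurable_powR_comp; [exact: gk_meas gk|exact: measurable_expd].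
have E : youngk A d c k = fun t => d `^ (1 - A) * (k t `^ A * expd c t `^ (1 - A)).
  apply/funext => t; rewrite /youngk powRM ?(ltW d0) ?(ltW (expd_gt0 _ _))//; ring.
rewrite E; split.
- exact: measurable_funM.
- by move=> t; rewrite !mulr_ge0 ?powR_ge0.
- under eq_integral do rewrite EFinM.
  rewrite gintZl.
  + apply: lte_mul_pinfty => //; [by rewrite lee_fin powR_ge0|exact: (gk_int gk)].
  + exact: measurable_to_EFin.
  + by move=> t; rewrite lee_fin mulr_ge0 ?powR_ge0.
  + exact: powR_ge0.
Qed.

Lemma perZ a w : bfun w -> 0 <= a -> per (fun t => a * w t) = a * per w.
Proof. by move=> bw a0; rewrite /per wintZ//; exact: box_ker. Qed.

Lemma perD w1 w2 : bfun w1 -> bfun w2 -> per (fun t => w1 t + w2 t) = per w1 + per w2.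
Proof. by move=> b1 b2; rewrite /per wintD//; exact: box_ker. Qed.

Lemma per_cvl_mass k w : kerOK k -> (forall r, k (- r) = k r) -> bper w ->
  per (cvl k w) = knorm k * per w.
Proof.
move=> kok ke pw; have [bw hw] := pw.
have p1 : bper (cst 1 : R -> R) by split => //; exact: bfun_cst.
transitivity (per (fun t => cst 1 t * cvl k w t)); first by apply: eq_wint => t; rewrite mul1r.
rewrite (per_adjoint T0 kok p1 pw) -(perZ bw (knorm_ge0 kok)); apply: eq_wint => t.
by rewrite -(mulr1 (knorm k)) -(wint_cst kok ler01).
Qed.

(** Pointwise Young leaves an exponential weight against w^m, bounded by [cvl_expd_le], and a kernel
    integrable when kap m / (m - x) < 1, which is the condition x < m (1 - kap). *)
Lemma cvl_singular kap c k m x w t : goodk kap c k -> kap < 1 -> 0 < c -> 0 <= x ->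
  0 < m -> x < m * (1 - kap) -> 0 <= kap -> bper w ->
  cvl k (fun r => w r `^ x) t <=
    T^-1 * expR (c * T) * knorm (expd c) * per (fun r => w r `^ m) + knorm (youngk (m / (m - x)) 1 c k).
Proof.
move=> gk k1 c0 x0 m0 xm kap0 pw; have [bw _] := pw; have [mw w0 _] := bw.
have kok := goodk_ker gk k1.
have xm' : x < m by apply: lt_le_trans xm _; rewrite ler_piMr ?(ltW m0)//; lra.
have mx : 0 < m - x by rewrite subr_gt0.
have A1 : 1 <= m / (m - x) by rewrite ler_pdivlMr//; lra.
have Ak : m / (m - x) * kap < 1.
  by rewrite mulrAC ltr_pdivrMr//; lra.
have yok := youngk_ker gk ltr01 A1 Ak.
apply: le_trans (lerD (cvl_expd_le T0 t (ltW c0) (expd_ker c0) (bper_powR (ltW m0) pw)) (lexx _)).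
rewrite -[X in _ <= _ + X]mulr1 -(wint_cst yok ler01).
apply: wint_gen2_le => //.
- exact: expd_ker.
- by apply: (bfun_powR x0); exact: bfun_refl.
- by apply: (bfun_powR (ltW m0)); exact: bfun_refl.
- exact: bfun_cst.
move=> r; rewrite mulr1 /youngk mul1r.
apply: singular_dichotomy => //; [exact: gk_ge0 gk _|exact: expd_gt0].
Qed.

Lemma eq_per w1 w2 : (forall r, w1 r = w2 r) -> per w1 = per w2.
Proof. exact: eq_wint. Qed.

Lemma per_lin4 (w z : R -> R) (d e K N : R) : bfun w -> bfun z -> 0 <= d -> 0 <= e -> 0 <= K -> 0 <= N ->
  per (fun t => d * (w t * K) + e * (N * w t + z t)) = d * (per w * K) + e * (N * per w + per z).
Proof.
move=> bw bz d0 e0 K0 N0.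
have B1 := bfunZ K0 bw; have B2 := bfunZ N0 bw.
transitivity (per (fun t => d * (K * w t) + e * (N * w t + z t))).
  by apply: eq_per => t; rewrite (mulrC (w t)).
rewrite (perD (bfunZ d0 B1) (bfunZ e0 (bfunD B2 bz))) (perZ B1 d0) (perZ bw K0) (perZ (bfunD B2 bz) e0).
by rewrite (perD B2 bz) (perZ bw N0) (mulrC K).
Qed.

Lemma cvl_gen2_le k k1 k2 (a b : R -> R) (x y d e t : R) : kerOK k -> kerOK k1 -> kerOK k2 ->
  bfun a -> bfun b -> 0 <= x -> 0 <= y -> 0 <= d -> 0 <= e ->
  (forall r, k r * (x * a (t - r)) <= d * k1 r * (y * b (t - r)) + e * k2 r * (y + b (t - r))) ->
  x * cvl k a t <= d * (y * cvl k1 b t) + e * (knorm k2 * y + cvl k2 b t).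
Proof.
move=> ok ok1 ok2 ba bb x0 y0 d0 e0 h.
have b1 := bfun_refl t ba; have b2 := bfun_refl t bb.
rewrite -(wintZ ok b1 x0) -(wintZ ok1 b2 y0) -(wint_kerZ ok1 (bfunZ y0 b2) d0).
rewrite -(wint_cst ok2 y0) -(wintD ok2 (bfun_cst y0) b2).
rewrite -(wint_kerZ ok2 (bfunD (bfun_cst y0) b2) e0).
exact: (wint_gen2_le ok (kerOKZ ok1 d0) (kerOKZ ok2 e0) (bfunZ x0 b1) (bfunZ y0 b2) (bfunD (bfun_cst y0) b2)).
Qed.

End bounds.

Opaque per cvl.

(** * Uniform L^m bound for normalised densities *)

Section mass_bound.
Context {R : realType} (T : R).
Hypothesis T0 : 0 < T.
Implicit Types (k g w : R -> R) (c t : R).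
Local Notation per := (per T).
Local Notation bper := (bper T).
Local Notation qform := (qform T).

Lemma absorb_half (i y ct d : R) : 0 < i -> d * ct <= 2^-1 ->
  i ^+ 2 <= d * (i * (ct * i)) + y * i -> i <= 2 * y.
Proof.
move=> i0 dct h; have h1 : i * i <= (2^-1 + 0) * i * i + y * i.
  rewrite -expr2; apply: le_trans h _; rewrite lerD2r addr0.
  have -> : d * (i * (ct * i)) = (d * ct) * (i * i) by ring.
  by rewrite -[leRHS]mulrA ler_wpM2r// mulr_ge0// ltW.
have : i * i <= (2^-1 * i + y) * i by rewrite mulrDl; rewrite addr0 in h1.
by rewrite ler_pM2r//; lra.
Qed.

(** Let v = k * psi, I the integral of v^m and a = v^(m - 1). Then I = <a, k * psi>, and the
    normalisation of psi gives I^2 <= <a, k * a>. By [young_dichotomy] this is at most a small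
    multiple of I^2 plus a multiple of I, the second kernel being integrable because kap m / 2 < 1.
    The bound obtained does not depend on psi. *)
Lemma Lm_bound kap c k m : goodk kap c k -> kap < 1 -> 0 < c -> 2 <= m -> m / 2 * kap < 1 ->
  exists2 I, 0 <= I & forall psi, bper psi -> qform k psi psi = 1 ->
    per (fun t => cvl k psi t `^ m) <= I.
Proof.
move=> gk k1 c0 m2 mk; have kok := goodk_ker gk k1; have eok := expd_ker c0.
have dbl (x u : R) : u + 2^-1 * (x + x) <= u + x by lra.
have hd (z : R) : 0 <= z -> 2^-1 / (z + 1) * z <= 2^-1.
  by move=> z0; rewrite -mulrA ler_piMr// mulrC ler_pdivrMr; lra.
have m0 : 0 < m by lra.
set CT := T^-1 * expR (c * T) * knorm (expd c).
have CT0 : 0 <= CT by rewrite !mulr_ge0 ?invr_ge0 ?expR_ge0 ?knorm_ge0 ?(ltW T0).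
(* Makes d CT <= 1/2, so that the term in I^2 is absorbed on the left. *)
pose d := 2^-1 / (CT + 1).
have d0 : 0 < d by rewrite divr_gt0//; lra.
have A1 : 1 <= m / 2 by lra.
have yok := youngk_ker gk d0 A1 mk.
set Y := youngk (m / 2) d c k in yok.
exists (2 * knorm Y); first by rewrite mulr_ge0 ?knorm_ge0.
move=> psi pp qp; have pv := bper_cvl kok pp.
set v := cvl k psi in pv *.
have [bv _] := pv; have [mv v0 _] := bv; have [bp _] := pp.
set I := per (fun t => v t `^ m).
pose a := fun t => v t `^ (m - 1).
have m1 : 0 <= m - 1 by lra.
have pa : bper a by exact: bper_powR m1 pv.
have pm : bper (fun t => v t `^ m) by apply: bper_powR => //; exact: ltW.
have [ba _] := pa; have [bm _] := pm.
have I0 : 0 <= I by exact: per_ge0.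
have IE : I = qform k a psi.
  apply: eq_per => t; rewrite /a -/(v t).
  have [->|vn] := eqVneq (v t) 0; first by rewrite mulr0 powR0// gt_eqF.
  by rewrite -{3}[v t]powRr1// -powRD ?vn ?implybT// subrK.
(* AM-GM for a and I psi: 2 I <a, k * psi> = 2 I^2 is at most <a, k * a> + I^2. *)
have step1 : I ^+ 2 <= qform k a a.
  have := qform_amgm T0 gk k1 pa (bperZ I0 pp).
  have -> : qform k a (fun t => I * psi t) = I * I.
    rewrite {3}IE -(perZ T (bfunM ba (bfun_cvl kok bp)) I0).
    by apply: eq_per => t; rewrite (cvlZ t kok bp I0); exact: mulrCA.
  have -> : qform k (fun t => I * psi t) (fun t => I * psi t) = I ^+ 2.
    rewrite -[RHS]mulr1 -qp -(perZ T (bfunM bp bv) (sqr_ge0 I)).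
    apply: eq_per => t; rewrite (cvlZ t kok bp I0).
    by rewrite mulrACA -expr2.
  by rewrite -expr2; move: (I ^+ 2) (qform _ _ _); clear => J q; lra.
have pt t r : k r * (a t * a (t - r)) <=
    d * expd c r * (v t `^ m * v (t - r) `^ m) + 2^-1 * Y r * (v t `^ m + v (t - r) `^ m).
  apply: young_dichotomy => //; [exact: gk_ge0 gk _|by rewrite mulr_gt0// expd_gt0].
have h2 : 0 <= 2^-1 :> R by rewrite invr_ge0.
have step2 t : a t * cvl k a t <= d * (v t `^ m * cvl (expd c) (fun s => v s `^ m) t) +
    2^-1 * (knorm Y * v t `^ m + cvl Y (fun s => v s `^ m) t).
  have [ma a0 _] := ba.
  exact: (cvl_gen2_le kok eok yok ba bm (a0 t) (powR_ge0 _ _) (ltW d0) h2 (pt t)).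
have step3 : qform k a a <= d * (I * (CT * I)) + knorm Y * I.
  have pE := bper_cvl eok pm; have pY := bper_cvl yok pm.
  have [bE _] := pE; have [bY _] := pY.
  have Yeven r : Y (- r) = Y r.
    by rewrite /Y /youngk (gk_even gk) /expd normrN.
  have massY := per_cvl_mass T0 yok Yeven pm.
  apply: (@le_trans _ _ (per (fun t => d * (v t `^ m * (CT * I)) +
      2^-1 * (knorm Y * v t `^ m + cvl Y (fun s => v s `^ m) t)))).
    have K0 : 0 <= CT * I by rewrite mulr_ge0.
    apply: per_le.
    - exact: (bfunM ba (bfun_cvl kok ba)).
    - exact: (bfunD (bfunZ (ltW d0) (bfunM bm (bfun_cst K0)))
               (bfunZ h2 (bfunD (bfunZ (knorm_ge0 yok) bm) bY))).
    move=> t; apply: le_trans (step2 t) _; rewrite lerD2r.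
    have := cvl_expd_le T0 t (ltW c0) eok pm; rewrite -/CT -/I => h.
    exact: (ler_wpM2l (ltW d0) (ler_wpM2l (powR_ge0 _ _) h)).
  have K0 : 0 <= CT * I by rewrite mulr_ge0.
  rewrite (per_lin4 T bm bY (ltW d0) h2 K0 (knorm_ge0 yok)) massY -/I.
  exact: dbl.
have dCT : d * CT <= 2^-1.
  exact: hd.
have [I1|I1] := leP I 0; first by apply: le_trans I1 _; rewrite mulr_ge0 ?knorm_ge0.
exact: absorb_half I1 dCT (le_trans step1 step3).
Qed.

End mass_bound.

Lemma qformE (R : realType) (T : R) (k a b : R -> R) :
  qform T k a b = per T (fun t => a t * cvl k b t).
Proof. by []. Qed.

Lemma bper_bfun (R : realType) (T : R) (v : R -> R) : bper T v -> bfun v. Proof. by case. Qed.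

Lemma bper_ge0 (R : realType) (T : R) (v : R -> R) t : bper T v -> 0 <= v t. Proof. by case=> -[]. Qed.

Lemma le_sqrt_of_amgm (R : realType) (D q : R) : 0 < D -> 0 <= q -> 2 * 1 <= D^-1 * D^-1 * q + 1 -> D <= Num.sqrt q.
Proof.
move=> D0 q0 h; rewrite -[D]ger0_norm ?(ltW D0)// -sqrtr_sqr ler_wsqrtr//.
have h1 : 1 <= (D * D)^-1 * q by rewrite invfM; lra.
by rewrite expr2 -[leLHS]mulr1 -ler_pdivlMl ?mulr_gt0.
Qed.

Lemma energy_increment (R : realType) (q D' D N p : R) :
  2 * q <= D' + D -> p * N - (p - 1) * D <= q -> D + 2 * p * (N - D) <= D'.
Proof. by move=> h1 h2; lra. Qed.

Lemma tangent_mul (R : realType) (p x y z u h : R) : 0 <= h -> p * u * z - (p - 1) * y <= x ->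
  p * (u * (h * z)) <= x * h + (p - 1) * (y * h).
Proof. by move=> h0 tg; have := ler_wpM2r h0 tg; lra. Qed.

Definition Fop (R : realType) (H : R -> R) (p : R) v t : R := cvl H (fun s => v s `^ p) t * v t `^ (p - 1).

Lemma FopE (R : realType) (H : R -> R) (p : R) v t : Fop H p v t = cvl H (fun s => v s `^ p) t * v t `^ (p - 1).
Proof. by []. Qed.

Opaque qform Fop.

(** * Monotonicity of the energy *)

Section iteration_step.
Context {R : realType} (T : R).
Hypothesis T0 : 0 < T.
Variables (H G : R -> R) (kapH cH kapG cG p : R).
Hypotheses (gH : goodk kapH cH H) (kH1 : kapH < 1) (gG : goodk kapG cG G) (kG1 : kapG < 1) (p1 : 1 < p).
Implicit Types (v psi w : R -> R) (t : R).
Local Notation per := (per T).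
Local Notation bper := (bper T).
Local Notation qform := (qform T).
Local Notation okH := (goodk_ker gH kH1).
Local Notation okG := (goodk_ker gG kG1).

Local Notation F := (Fop H p).

Definition energy v : R := qform H (fun t => v t `^ p) (fun t => v t `^ p).

Lemma p_ge0 : 0 <= p. Proof. by have := p1; lra. Qed.
Lemma p1_ge0 : 0 <= p - 1. Proof. by have := p1; lra. Qed.
Lemma p_neq0 : p != 0. Proof. by rewrite gt_eqF//; have := p1; lra. Qed.
Lemma p1_neq0 : p - 1 != 0. Proof. by rewrite gt_eqF//; have := p1; lra. Qed.

Lemma bper_pow v : bper v -> bper (fun t => v t `^ p).
Proof. by move=> h; apply: bper_powR => //; exact: p_ge0. Qed.

Lemma bper_Fop v : bper v -> bper (F v).
Proof.
move=> h; exact: (bperM (bper_cvl okH (bper_pow h)) (bper_powR p1_ge0 h)).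
Qed.

Lemma energy_point (x h : R) : 0 <= x -> x * (h * x `^ (p - 1)) = x `^ p * h.
Proof.
move=> x0; rewrite mulrCA [RHS]mulrC; congr (_ * _).
have [->|xn] := eqVneq x 0; first by rewrite mul0r powR0// p_neq0.
by rewrite -{1}[x]powRr1// -powRD ?xn ?implybT// addrC subrK.
Qed.

Lemma energyE v : bper v -> energy v = per (fun t => v t * F v t).
Proof.
move=> h; rewrite /energy qformE; apply: eq_per => t; rewrite FopE.
by rewrite energy_point//; exact: bper_ge0 h.
Qed.

Lemma qform_amgm_energy v v' : bper (fun t => v' t `^ p) -> bper (fun t => v t `^ p) ->
  2 * qform H (fun t => v' t `^ p) (fun t => v t `^ p) <= energy v' + energy v.
Proof. by move=> h h'; exact: (qform_amgm T0 gH kH1 h h'). Qed.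

Lemma qformZ k (a b : R) w z : kerOK k -> bper w -> bper z -> 0 <= a -> 0 <= b ->
  qform k (fun t => a * w t) (fun t => b * z t) = a * b * qform k w z.
Proof.
move=> kok pw pz a0 b0; have bz := bper_bfun pz; have bw := bper_bfun pw.
rewrite !qformE -(perZ T (bfunM bw (bfun_cvl kok bz)) (mulr_ge0 a0 b0)).
by apply: eq_per => t; rewrite (cvlZ t kok bz b0) mulrACA.
Qed.

Lemma qform_eq k (a b a' b' : R -> R) : (forall t, a t = a' t) -> (forall t, b t = b' t) ->
  qform k a b = qform k a' b'.
Proof. by move=> /funext -> /funext ->. Qed.

Lemma tangent_powR (x y : R) : 0 <= x -> 0 <= y -> p * y * x `^ (p - 1) - (p - 1) * x `^ p <= y `^ p.
Proof.
move=> x0 y0; have [->|xn] := eqVneq x 0.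
  by rewrite (powR0 p_neq0) (powR0 p1_neq0) !mulr0 subr0 powR_ge0.
have xp : 0 < x by rewrite lt_def xn.
have -> : y `^ p = x `^ p * (y / x) `^ p.
  by rewrite -powRM// ?divr_ge0// mulrC divfK.
have -> : x `^ (p - 1) = x `^ p / x by rewrite powRB ?powRr1 ?(negbTE xn) ?implybT//.
have -> : p * y * (x `^ p / x) - (p - 1) * x `^ p = x `^ p * (p * (y / x) - (p - 1)) by field.
rewrite ler_wpM2l ?powR_ge0//; set r := y / x.
have r0 : 0 <= r by rewrite divr_ge0.
have [->|rn] := eqVneq r 0; first by rewrite (powR0 p_neq0); have := p1; lra.
have rp : 0 < r by rewrite lt_def rn.
have -> : r `^ p = expR (p * ln r) by rewrite -expR_powR lnK.
(* Convexity of the exponential in the form [e^(pl) - 1 >= p (e^l - 1)] *)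
have e1 := @expR_ge1Dx R ((p - 1) * ln r).
have -> : p * ln r = ln r + (p - 1) * ln r by ring.
rewrite expRD lnK//.
have l1 : 1 - r^-1 <= ln r.
  by have := @expR_ge1Dx R (- ln r); rewrite expRN lnK ?posrE//; lra.
have : r * (1 + (p - 1) * ln r) <= r * expR ((p - 1) * ln r) by rewrite ler_pM2l.
apply: le_trans.
have : (p - 1) * (r * (1 - r^-1)) <= (p - 1) * (r * ln r).
  by rewrite ler_wpM2l ?p1_ge0// ler_pM2l.
rewrite mulrBr mulr1 mulfV//; lra.
Qed.

Lemma energy_qform v psi : bper v -> (forall t, v t = cvl G psi t) -> energy v = qform G (F v) psi.
Proof. by move=> pv vE; rewrite (energyE pv) qformE; apply: eq_per => t; rewrite mulrC vE. Qed.

Lemma qformZl k (a : R) w z : kerOK k -> bper w -> bper z -> 0 <= a ->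
  qform k (fun t => a * w t) z = a * qform k w z.
Proof.
move=> kok pw pz a0; rewrite -[a in RHS]mulr1 -(qformZ kok pw pz a0 ler01).
by apply: qform_eq => t; rewrite ?mul1r.
Qed.

Opaque energy.

(** The energy is <F(v), G * psi> and psi has norm one, so this is Cauchy-Schwarz; it comes from
    AM-GM for F(v) divided by the energy and psi. *)
Lemma energy_le_norm psi v : bper psi -> qform G psi psi = 1 -> bper v ->
  (forall t, v t = cvl G psi t) -> 0 < energy v ->
  energy v <= Num.sqrt (qform G (F v) (F v)).
Proof.
move=> pp qp pv vE; rewrite (energy_qform pv vE) => D0; have pF := bper_Fop pv.
have Di : 0 <= (qform G (F v) psi)^-1 by rewrite invr_ge0 ltW.
have := qform_amgm T0 gG kG1 (bperZ Di pF) pp.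
rewrite (qformZ okG pF pF Di Di) qp (qformZl okG pF pp Di).
rewrite mulVf; last by rewrite gt_eqF.
exact: le_sqrt_of_amgm D0 (qform_ge0 okG pF pF).
Qed.

(** By the choice of psi' the product <v', F(v)> equals N. Convexity of the p-th power bounds p N -
    (p - 1) E(v) by <v'^p, H * v^p>, and positivity of the form of H bounds twice the latter by
    E(v') + E(v). Together E(v') >= E(v) + 2p (N - E(v)). *)
Lemma step psi v psi' v' (N : R) : bper psi -> qform G psi psi = 1 -> bper v ->
  (forall t, v t = cvl G psi t) -> 0 < N -> N ^+ 2 = qform G (F v) (F v) ->
  (forall t, psi' t = N^-1 * F v t) -> bper v' -> (forall t, v' t = cvl G psi' t) ->
  [/\ bper psi', qform G psi' psi' = 1, energy v = N * qform G psi' psi &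
      energy v + 2 * p * (N - energy v) <= energy v'].
Proof.
move=> pp qp pv vE N0 NE /funext psiE pv' v'E.
have pF := bper_Fop pv; have Ni : 0 <= N^-1 by rewrite invr_ge0 ltW.
have Nn : N != 0 by rewrite gt_eqF.
have pn : bper psi' by rewrite psiE; exact: bperZ.
split; first exact: pn.
- rewrite psiE (qformZ okG pF pF Ni Ni) -NE -invfM expr2 mulVf//.
  by rewrite mulf_neq0.
- by rewrite psiE (qformZl okG pF pp Ni) -(energy_qform pv vE) mulrA mulfV// mul1r.
have vF : per (fun t => v' t * F v t) = N.
  transitivity (qform G psi' (F v)).
    rewrite (qform_sym T0 gG kG1 pn pF) qformE; apply: eq_per => t.
    by rewrite v'E mulrC.
  by rewrite psiE (qformZl okG pF pF Ni) -NE expr2 mulrA mulVf// mul1r.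
have pw := bper_pow pv; have pw' := bper_pow pv'.
have bH := bfun_cvl okH (bper_bfun pw).
have bF := bper_bfun pF; have bv' := bper_bfun pv'.
have bw := bfunM (bper_bfun pw) bH; have bw' := bfunM (bper_bfun pw') bH.
have EE : energy v = per (fun t => v t `^ p * cvl H (fun s => v s `^ p) t).
  by rewrite (energyE pv); apply: eq_per => t; rewrite FopE; exact: energy_point (bper_ge0 t pv).
apply: energy_increment (qform_amgm_energy pw' pw) _.
rewrite lerBlDr -vF -(perZ T (bfunM bv' bF) p_ge0) EE -(perZ T bw p1_ge0) qformE.
rewrite -(perD T bw' (bfunZ p1_ge0 bw)).
apply: per_le; [exact: (bfunZ p_ge0 (bfunM bv' bF))|exact: (bfunD bw' (bfunZ p1_ge0 bw))|].
move=> t; rewrite FopE; apply: tangent_mul; first by have [_ + _] := bH; exact.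
exact: tangent_powR (bper_ge0 t pv) (bper_ge0 t pv').
Qed.

End iteration_step.

(** * Sup bounds from L^m bounds *)

Section sup_bounds.
Context {R : realType} (T : R).
Hypothesis T0 : 0 < T.
Implicit Types (k v w : R -> R) (t : R).
Local Notation per := (per T).
Local Notation bper := (bper T).

Lemma powR_split_bound (v M q x th : R) : 0 <= v -> v <= M -> 1 <= M -> 0 < q -> 0 <= x -> 0 <= th ->
  q <= x + th -> v `^ q <= M `^ th * (1 + v `^ x).
Proof.
move=> v0 vM M1 q0 x0 th0 qx.
have Mth : 1 <= M `^ th by rewrite -[leLHS](powRr0 M) ler_powR.
have [v1|v1] := leP v 1.
  have h1 : v `^ q <= 1.
    by have := @ge0_ler_powR R q (ltW q0) v 1 v0 ler01 v1; rewrite powR1.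
  apply: le_trans h1 _; rewrite -[leLHS]mulr1; apply: ler_pM => //.
  by rewrite lerDl powR_ge0.
apply: (@le_trans _ _ (v `^ (x + th))); first by rewrite ler_powR// ltW.
rewrite powRD; last by rewrite gt_eqF ?implybT//; lra.
rewrite mulrC; apply: ler_pM; rewrite ?powR_ge0 ?lerDr//.
by apply: ge0_ler_powR => //; rewrite nnegrE; lra.
Qed.

Lemma cvl_bound k w M t : kerOK k -> bfun w -> (forall s, w s <= M) -> cvl k w t <= knorm k * M.
Proof.
move=> ok bw wM; have M0 : 0 <= M by have [_ w0 _] := bw; exact: le_trans (w0 0) (wM 0).
by rewrite -(cvl_cst t ok M0); exact: (cvl_le t ok bw (bfun_cst M0)).
Qed.

Lemma cvl_ge0 k w t : kerOK k -> bfun w -> 0 <= cvl k w t.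
Proof. by move=> ok bw; have [_ + _] := bfun_cvl ok bw; exact. Qed.

(** Of the exponent q the part x is paid by the L^m bound through [cvl_singular], and only the
    excess th by the sup norm M. *)
Lemma cvl_powR_bound kap c k m I q x th : goodk kap c k -> kap < 1 -> 0 <= kap -> 0 < c -> 0 < m ->
  0 <= I -> 0 < q -> 0 <= x -> x < m * (1 - kap) -> 0 <= th -> q <= x + th ->
  exists2 C, 0 <= C & forall v M t, bper v -> per (fun s => v s `^ m) <= I ->
    (forall s, v s <= M) -> 1 <= M -> cvl k (fun s => v s `^ q) t <= C * M `^ th.
Proof.
move=> gk k1 k0 c0 m0 I0 q0 x0 xm th0 qx; have ok := goodk_ker gk k1.
have eok := expd_ker c0.
exists (knorm k + (T^-1 * expR (c * T) * knorm (expd c) * I + `|knorm (youngk (m / (m - x)) 1 c k)|)).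
  by rewrite addr_ge0 ?knorm_ge0// addr_ge0// !mulr_ge0 ?expR_ge0 ?knorm_ge0 ?invr_ge0 ?(ltW T0).
move=> v M t pv vI vM M1; have bv := bper_bfun pv; have bx := bfun_powR x0 bv.
have Mt0 : 0 <= M `^ th by exact: powR_ge0.
apply: (@le_trans _ _ (cvl k (fun s => M `^ th * (1 + v s `^ x)) t)).
  apply: (cvl_le t ok (bfun_powR (ltW q0) bv) (bfunZ Mt0 (bfunD (bfun_cst ler01) bx))).
  by move=> s; apply: powR_split_bound => //; exact: bper_ge0 pv.
rewrite (cvlZ t ok (bfunD (bfun_cst ler01) bx) Mt0) (cvlD t ok (bfun_cst ler01) bx).
rewrite (cvl_cst t ok ler01) mulr1 [leRHS]mulrC.
apply: (ler_wpM2l Mt0); rewrite lerD2l.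
apply: le_trans (cvl_singular T0 t gk k1 c0 x0 m0 xm k0 pv) _.
apply: lerD; last exact: ler_norm.
by rewrite ler_wpM2l// !mulr_ge0 ?expR_ge0 ?knorm_ge0 ?invr_ge0 ?(ltW T0).
Qed.

Lemma cvl_comm k1 k2 w t : kerOK k1 -> kerOK k2 -> bfun w ->
  cvl k1 (cvl k2 w) t = cvl k2 (cvl k1 w) t.
Proof.
move=> ok1 ok2 bw.
have b2 : bfun2 (fun x y => w (t - x - y)).
  have := bfun2_sub bw; move=> [mw w0 [M wM]]; split.
  - have [mw' _ _] := bw.
    have m1 : mfunT (fun p : measurableTypeR R * measurableTypeR R => (t - p.1 - p.2 : R)).
      by mfun.
    by have := measurableT_comp mw' m1; exact.
  - by move=> x y; exact: w0.
  - by exists M => x y; exact: wM.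
have := wint_tonelli ok1 ok2 b2.
Transparent cvl.
rewrite /cvl => ->; apply: eq_wint => y; apply: eq_wint => x.
Opaque cvl.
by rewrite addrAC.
Qed.

(* The exponents for which the sup norm of an iterate is controlled by a power less than one of the previous sup norm. *)
Definition subcritical (kapH kapG p : R) := exists m th : R,
  [/\ 2 <= m, m / 2 * kapG < 1, 0 <= th, th < 1 &
   (exists x, [/\ 0 <= x, x < m * (1 - kapG) & 2 * p - 1 <= x + th]) \/
   (exists x y th1 th2, [/\ 0 <= x, x < m * (1 - kapH), 0 <= y, y < m * (1 - kapG) &
     [/\ p <= x + th1, p - 1 <= y + th2, 0 <= th1, 0 <= th2 & th1 + th2 = th]])].

Variables (H G : R -> R) (kapH cH kapG cG p : R).
Hypotheses (gH : goodk kapH cH H) (kH1 : kapH < 1) (kH0 : 0 <= kapH) (cH0 : 0 < cH).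
Hypotheses (gG : goodk kapG cG G) (kG1 : kapG < 1) (kG0 : 0 <= kapG) (cG0 : 0 < cG) (p1 : 1 < p).
Local Notation okH := (goodk_ker gH kH1).
Local Notation okG := (goodk_ker gG kG1).
Local Notation F := (Fop H p).
Local Notation p0 := (p_ge0 p1).
Local Notation p10 := (p1_ge0 p1).

Lemma powR_mixed_le (a b : R) : 0 <= a -> 0 <= b -> a `^ p * b `^ (p - 1) <= a `^ (2 * p - 1) + b `^ (2 * p - 1).
Proof.
move=> a0 b0; have pp := p1.
have H1 x y : 0 <= x -> 0 <= y -> x <= y -> x `^ p * y `^ (p - 1) <= y `^ (2 * p - 1) /\ y `^ p * x `^ (p - 1) <= y `^ (2 * p - 1).
  move=> x0 y0 xy.
  have -> : y `^ (2 * p - 1) = y `^ p * y `^ (p - 1).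
    have [->|yn] := eqVneq y 0; first by rewrite !powR0 ?mul0r// gt_eqF//; lra.
    rewrite -powRD ?yn ?implybT//; congr (_ `^ _); ring.
  split.
    by rewrite ler_wpM2r ?powR_ge0//; apply: ge0_ler_powR => //; exact: p0.
  by rewrite ler_wpM2l ?powR_ge0//; apply: ge0_ler_powR => //; exact: p10.
have [ab|/ltW ab] := leP a b.
  by apply: le_trans (H1 a b a0 b0 ab).1 _; rewrite lerDr powR_ge0.
by apply: le_trans (H1 b a b0 a0 ab).2 _; rewrite lerDl powR_ge0.
Qed.

(** The mixed product of v(t - r)^p and v(t)^(p - 1) is split into pure powers of exponent 2p - 1,
    so that afterwards only the kernel G has to meet this power. *)
Lemma Fop_le_mixed v t : bper v ->
  F v t <= cvl H (fun s => v s `^ (2 * p - 1)) t + knorm H * v t `^ (2 * p - 1).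
Proof.
move=> pv; have bv := bper_bfun pv; have v0 s := bper_ge0 s pv.
have q0 : 0 <= 2 * p - 1 by have := p1; lra.
rewrite FopE mulrC -(cvlZ t okH (bfun_powR p0 bv) (powR_ge0 _ _)).
have bq := bfun_powR q0 bv; have c0 := bfun_cst (powR_ge0 (v t) (2 * p - 1)).
rewrite -(cvl_cst t okH (powR_ge0 (v t) (2 * p - 1))) -(cvlD t okH bq c0).
apply: (cvl_le t okH (bfunZ (powR_ge0 _ _) (bfun_powR p0 bv)) (bfunD bq c0)) => s.
by rewrite mulrC; exact: powR_mixed_le.
Qed.

(** Two ways to spend the exponents. In the first, [Fop_le_mixed] and the commutation of G with H
    reduce everything to G * v^(2p-1), and only the singularity of G counts. In the second, H * v^p
    and G * v^(p-1) are bounded separately, with excesses th1 and th2. *)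
Lemma cvl_Fop_bound m I th : 2 <= m -> m / 2 * kapG < 1 -> 0 <= th -> 0 <= I ->
   ((exists x, [/\ 0 <= x, x < m * (1 - kapG) & 2 * p - 1 <= x + th]) \/
   (exists x y th1 th2, [/\ 0 <= x, x < m * (1 - kapH), 0 <= y, y < m * (1 - kapG) &
     [/\ p <= x + th1, p - 1 <= y + th2, 0 <= th1, 0 <= th2 & th1 + th2 = th]])) ->
  exists2 C, 0 <= C & forall v M t, bper v -> per (fun s => v s `^ m) <= I ->
    (forall s, v s <= M) -> 1 <= M -> cvl G (F v) t <= C * M `^ th.
Proof.
move=> m2 mk th0 I0; have m0 : 0 < m by lra.
have p0' := p0; have p10' : 0 < p - 1 by have := p1; lra.
case=> [[x [x0 xm qx]]|[x [y [th1 [th2 [x0 xm y0 ym [px py t10 t20 tE]]]]]]].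
  have q0 : 0 < 2 * p - 1 by lra.
  have [C C0 HC] := cvl_powR_bound gG kG1 kG0 cG0 m0 I0 q0 x0 xm th0 qx.
  exists (2 * knorm H * C); first by rewrite !mulr_ge0 ?(knorm_ge0 okH).
  move=> v M t pv vI vM M1; have bv := bper_bfun pv.
  have bq := bfun_powR (ltW q0) bv; have kn := knorm_ge0 okH.
  have bF := bper_bfun (bper_Fop gH kH1 p1 pv).
  have b1 := bfun_cvl okH bq; have b2 := bfunZ kn bq.
  apply: le_trans (cvl_le t okG bF (bfunD b1 b2) (fun r => Fop_le_mixed r pv)) _.
  rewrite (cvlD t okG b1 b2) (cvlZ t okG bq kn) (cvl_comm t okG okH bq).
  have h1 := HC v M t pv vI vM M1.
  have h2 := cvl_bound t okH (bfun_cvl okG bq) (fun s => HC v M s pv vI vM M1).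
  have h3 := ler_wpM2l kn h1.
  apply: le_trans (lerD h2 h3) _; rewrite -!mulrA -mulr2n mulr_natl; exact: lexx.
have [C C0 HC] := cvl_powR_bound gH kH1 kH0 cH0 m0 I0 (lt_trans ltr01 p1) x0 xm t10 px.
have [D D0 HD] := cvl_powR_bound gG kG1 kG0 cG0 m0 I0 p10' y0 ym t20 py.
exists (C * D); first exact: mulr_ge0.
move=> v M t pv vI vM M1; have bv := bper_bfun pv.
have bq := bfun_powR (ltW p10') bv; have bF := bper_bfun (bper_Fop gH kH1 p1 pv).
have CM0 : 0 <= C * M `^ th1 by rewrite mulr_ge0 ?powR_ge0.
have le1 r : F v r <= (C * M `^ th1) * v r `^ (p - 1).
  by rewrite FopE ler_wpM2r ?powR_ge0//; exact: HC.
apply: le_trans (cvl_le t okG bF (bfunZ CM0 bq) le1) _.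
rewrite (cvlZ t okG bq CM0); apply: le_trans (ler_wpM2l CM0 (HD v M t pv vI vM M1)) _.
rewrite mulrACA -powRD ?tE;[exact: lexx|]; by rewrite (gt_eqF (lt_le_trans ltr01 M1)) implybT.
Qed.

End sup_bounds.

Transparent box.
Lemma boxE (R : realType) (c d t : R) : box c d t = (c <= t < d)%R%:R.
Proof. by []. Qed.
Opaque box.

(** * Stability under uniform perturbation *)

Section lipschitz.
Context {R : realType}.
Implicit Types (v w : R -> R) (t p : R).

Lemma powR_lipschitz p (m M : R) : 0 < m -> m <= M -> exists2 L, 0 <= L &
  forall a b, m <= a <= M -> m <= b <= M -> `|b `^ p - a `^ p| <= L * `|b - a|.
Proof.
move=> m0 mM; have [K K0 HK] := powR_taylor p m0 mM.
pose A := `|p| * (M `^ (p - 1) + m `^ (p - 1)).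
have A0 : 0 <= A by rewrite mulr_ge0// addr_ge0 ?powR_ge0.
exists (K * (M - m) + A); first by rewrite addr_ge0// mulr_ge0// subr_ge0.
move=> a b ha hb; have h := HK a b ha hb; have /andP[ma aM] := ha; have /andP[mb bM] := hb.
have a0 : 0 < a by exact: lt_le_trans ma.
have ap : a `^ (p - 1) <= M `^ (p - 1) + m `^ (p - 1).
  have [q0|/ltW q0] := leP 0 (p - 1).
    have : a `^ (p - 1) <= M `^ (p - 1).
      by apply: ge0_ler_powR => //; rewrite nnegrE; lra.
    by have := powR_ge0 m (p - 1); lra.
  have : a `^ (p - 1) <= m `^ (p - 1) by rewrite -[p - 1]opprK ler_powRN// oppr_ge0.
  by have := powR_ge0 M (p - 1); lra.
have d : `|b - a| <= M - m by rewrite ler_norml; lra.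
have h1 : K * (b - a) ^+ 2 <= K * (M - m) * `|b - a|.
  by rewrite -mulrA ler_wpM2l// -real_normK ?num_real// expr2 ler_wpM2r.
have h2 : `|p * a `^ (p - 1) * (b - a)| <= A * `|b - a|.
  by rewrite !normrM (ger0_norm (powR_ge0 _ _)) ler_wpM2r// ler_wpM2l.
have : `|b `^ p - a `^ p| <= `|b `^ p - a `^ p - p * a `^ (p - 1) * (b - a)| + `|p * a `^ (p - 1) * (b - a)|.
  by rewrite -[X in `|X| <= _](subrK (p * a `^ (p - 1) * (b - a))) ler_normD.
by rewrite mulrDl; lra.
Qed.

Lemma cvl_dist k v w t e : kerOK k -> bfun v -> bfun w -> (forall r, `|v r - w r| <= e) ->
  `|cvl k v t - cvl k w t| <= knorm k * e.
Proof.
Transparent cvl.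
by move=> ok bv bw h; apply: wint_dist => //; exact: bfun_refl.
Opaque cvl.
Qed.

Lemma per_dist T v w e : 0 < T -> bfun v -> bfun w -> (forall r, `|v r - w r| <= e) ->
  `|per T v - per T w| <= T * e.
Proof.
Transparent per.
move=> T0 bv bw h; rewrite -[T in T * e]subr0 -(knorm_box (ltW T0)).
by apply: wint_dist => //; exact: box_ker.
Opaque per.
Qed.

Lemma mul_dist (a b c d e f M N : R) : `|a - c| <= e -> `|b - d| <= f -> `|b| <= N -> `|c| <= M ->
  `|a * b - c * d| <= e * N + M * f.
Proof.
move=> h1 h2 hb hc; rewrite (_ : a * b - c * d = (a - c) * b + c * (b - d)); last by ring.
apply: le_trans (ler_normD _ _) _; rewrite !normrM.
by apply: lerD; apply: ler_pM.
Qed.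

Lemma qform_dist T k (M : R) : 0 < T -> kerOK k -> 0 <= M -> exists2 C, 0 <= C &
  forall a b a' b' e, bper T a -> bper T b -> bper T a' -> bper T b' ->
  (forall t, a t <= M) -> (forall t, b t <= M) -> (forall t, a' t <= M) -> (forall t, b' t <= M) ->
  (forall t, `|a t - a' t| <= e) -> (forall t, `|b t - b' t| <= e) ->
  `|qform T k a b - qform T k a' b'| <= C * e.
Proof.
move=> T0 ok M0; have kn := knorm_ge0 ok.
exists (T * (2 * knorm k * M)); first by rewrite !mulr_ge0// ltW.
move=> a b a' b' e pa pb pa' pb' aM bM a'M b'M ha hb.
have bb := bper_bfun pb; have bb' := bper_bfun pb'.
have ba := bper_bfun pa; have ba' := bper_bfun pa'.
rewrite !qformE -mulrA; apply: (per_dist T0 (bfunM ba (bfun_cvl ok bb)) (bfunM ba' (bfun_cvl ok bb'))) => t.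
have h := cvl_dist t ok bb bb' hb.
have b0 : `|cvl k b t| <= knorm k * M.
  by rewrite ger0_norm; [exact: cvl_bound|exact: cvl_ge0].
have a0 : `|a' t| <= M by rewrite ger0_norm//; exact: bper_ge0 pa'.
apply: le_trans (mul_dist (ha t) h b0 a0) _.
by rewrite (_ : 2 * knorm k * M * e = e * (knorm k * M) + M * (knorm k * e))//; ring.
Qed.

Lemma Fop_dist T H p (m M : R) : kerOK H -> 1 < p -> 0 < m -> m <= M -> exists2 C, 0 <= C &
  forall v w e, bper T v -> bper T w -> (forall t, m <= v t <= M) -> (forall t, m <= w t <= M) ->
  (forall t, `|v t - w t| <= e) -> forall t, `|Fop H p v t - Fop H p w t| <= C * e.
Proof.
move=> ok p1 m0 mM; have kn := knorm_ge0 ok; have M0 : 0 <= M by lra.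
have [L L0 HL] := powR_lipschitz p m0 mM.
have [K K0 HK] := powR_lipschitz (p - 1) m0 mM.
exists (knorm H * L * M `^ (p - 1) + knorm H * M `^ p * K).
  by rewrite addr_ge0// !mulr_ge0// powR_ge0.
move=> v w e pv pw vm wm h t; rewrite !FopE.
have p0 : 0 <= p by lra.
have p10 : 0 <= p - 1 by lra.
have bv := bfun_powR p0 (bper_bfun pv); have bw := bfun_powR p0 (bper_bfun pw).
have h1 r : `|v r `^ p - w r `^ p| <= L * e.
  by apply: le_trans (HL _ _ (wm r) (vm r)) _; rewrite ler_wpM2l.
have h2 : `|v t `^ (p - 1) - w t `^ (p - 1)| <= K * e.
  by apply: le_trans (HK _ _ (wm t) (vm t)) _; rewrite ler_wpM2l.
have up (x : R) (q : R) : 0 <= q -> m <= x <= M -> x `^ q <= M `^ q.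
  by move=> q0 /andP[mx xM]; apply: ge0_ler_powR => //; rewrite nnegrE; lra.
have h3 := cvl_dist t ok bv bw h1.
have n1 : `|v t `^ (p - 1)| <= M `^ (p - 1) by rewrite ger0_norm ?powR_ge0//; exact: up.
have n2 : `|cvl H (fun s => w s `^ p) t| <= knorm H * M `^ p.
  rewrite ger0_norm; last exact: (cvl_ge0 t ok bw).
  by apply: (cvl_bound t ok bw) => s; exact: up.
apply: le_trans (mul_dist h3 h2 n1 n2) _; rewrite mulrDl.
by apply: lerD; rewrite ?mulrA// -!mulrA ?(mulrC e)// mulrCA.
Qed.

Lemma Fop_bound T H p (M : R) v t : kerOK H -> 1 < p -> bper T v -> (forall t, v t <= M) ->
  Fop H p v t <= knorm H * M `^ p * M `^ (p - 1).
Proof.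
move=> ok p1 pv vM; rewrite FopE; have p0 : 0 <= p by lra.
have p10 : 0 <= p - 1 by lra.
have v0 s := bper_ge0 s pv; have M0 : 0 <= M by exact: le_trans (v0 0) (vM 0).
have up s (q : R) : 0 <= q -> v s `^ q <= M `^ q.
  by move=> q0; apply: ge0_ler_powR => //; rewrite nnegrE.
have bv := bfun_powR p0 (bper_bfun pv).
apply: ler_pM; [exact: (cvl_ge0 t ok bv)|exact: powR_ge0| |exact: up].
by apply: (cvl_bound t ok bv) => s; exact: up.
Qed.

(** The kernel is bounded below on the interval of radius T, so a convolution at any point sees a
    full period of w. *)
Lemma cvl_low T kap c k : 0 < T -> goodk kap c k -> kap < 1 -> exists2 del, 0 < del &
  forall w t, bper T w -> del * per T w <= cvl k w t.
Proof.
move=> T0 gk k1; have ok := goodk_ker gk k1; have [del d0 Hd] := gk_low gk T.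
exists del => // w t pw; have [bw _] := pw; have [mw w0 _] := bw.
rewrite (cvl_corr t ok (gk_even gk) bw) -(per_shift T0 t pw).
Transparent per.
rewrite /per /corr -(wintZ (box_ker 0 T) _ (ltW d0)); last first.
  by have [] := bper_shift t pw.
Opaque per.
have bs := bfun_shift t bw; have [ms s0 _] := bs; have [mk k0 _] := ok.
have Jok := box_ker (0 : R) T; have [mJ J0 _] := Jok.
have bs' : bfun (fun r => del * w (r + t)) by apply: bfunZ; [exact: ltW|have [] := bper_shift t pw].
rewrite -lee_fin -(wintE Jok bs') -(wintE ok bs).
apply: ae_ge0_le_integral => //.
- by move=> r _; rewrite lee_fin mulr_ge0// mulr_ge0// ltW.
- by mfun.
- by move=> r _; rewrite lee_fin mulr_ge0.
- by mfun.
apply: aeR_imp (ae_neqR 0) => r r0 _; rewrite lee_fin mulrA (addrC r).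
apply: ler_wpM2r => //; rewrite boxE.
case: (boolP (0 <= r < T)) => [/andP[r1 r2]|_]; last by rewrite mul0r.
by rewrite mul1r; apply: Hd => //; rewrite ger0_norm// ltW.
Qed.

(** Convolving z^2 with the everywhere positive exponential carries its vanishing from one period to
    almost every point of the line; the convolution of z with k then vanishes at every point. *)
Lemma per_sqr0_cvl T k z t : 0 < T -> kerOK k -> bper T z -> per T (fun s => z s * z s) = 0 -> cvl k z t = 0.
Proof.
move=> T0 ok pz pz0; have pzz := bperM pz pz; have [bzz _] := pzz; have [bz _] := pz.
have eok := expd_ker (@ltr01 R).
have E0 : cvl (expd 1) (fun s => z s * z s) t = 0.
  apply/eqP; rewrite eq_le (cvl_ge0 t eok bzz) andbT.
  by apply: le_trans (cvl_expd_le T0 t ler01 eok pzz) _; rewrite pz0 mulr0.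
have bzr := bfun_refl t bz; have bzzr := bfun_refl t bzz.
Transparent cvl.
have := congr1 EFin E0; rewrite /cvl -(wintE eok bzzr) => {}E0.
Opaque cvl.
apply: EFin_inj; rewrite -(wintE ok bzr).
have [me e0 _] := eok; have [mz z0 _] := bzr; have [mzz zz0 _] := bzzr; have [mk k0 _] := ok.
have mm : mfunT (fun r : R => (expd 1 r * (z (t - r) * z (t - r)))%:E) by exact: measurable_kw.
have /(ae_eq_integral_abs lebesgue_measure measurableT mm) ae0 :
    (\int[lebesgue_measure]_r `|(expd 1 r * (z (t - r) * z (t - r)))%:E| = 0)%E.
  by rewrite -[RHS]E0; apply: eq_integral => r _; rewrite gee0_abs// lee_fin mulr_ge0.
transitivity (\int[@lebesgue_measure R]_r (cst 0%E r : \bar R))%E; last exact: integral0.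
apply: gint_ae_eq; [exact: measurable_kw|exact: measurable_cst|].
apply: aeR_imp ae0 => r /(_ I) [] /eqP; rewrite mulf_eq0 gt_eqF ?expd_gt0//= mulf_eq0 orbb => /eqP ->.
by rewrite mulr0.
Qed.

End lipschitz.

(** X is a level that the recursion M -> C M^th, th < 1, cannot cross from below: any X of at least
    C^(1/(1-th)) will do. *)
Lemma sublinear_cap (R : realType) (C M0 th : R) : 0 <= th -> th < 1 -> 0 <= C ->
  exists X, [/\ 1 <= X, M0 <= X & C * X `^ th <= X].
Proof.
move=> th0 th1 C0; pose Y := Num.max C 1.
have Y1 : 1 <= Y by rewrite le_max lexx orbT.
have YC : C <= Y by rewrite le_max lexx.
have e0 : 0 < 1 - th by lra.
pose X := Num.max M0 (Num.max 1 (Y `^ (1 - th)^-1)).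
have X1 : 1 <= X by rewrite !le_max lexx orbT.
have XY : Y `^ (1 - th)^-1 <= X by rewrite !le_max lexx !orbT.
exists X; split => //; first by rewrite le_max lexx.
have h : Y <= X `^ (1 - th).
  have -> : Y = (Y `^ (1 - th)^-1) `^ (1 - th).
    by rewrite -powRrM mulVf ?gt_eqF// powRr1//; lra.
  by apply: ge0_ler_powR => //; rewrite ?nnegrE ?powR_ge0//; lra.
have XE : X `^ (1 - th) * X `^ th = X.
  rewrite -powRD; last by rewrite gt_eqF ?implybT//; lra.
  by rewrite subrK powRr1//; lra.
by rewrite -[leRHS]XE ler_wpM2r ?powR_ge0//; exact: le_trans YC h.
Qed.

Lemma excess_le (R : realType) (p N e e' : R) : 1 < p -> e <= N -> e + 2 * p * (N - e) <= e' -> N - e <= e' - e.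
Proof.
move=> p1 eN h; have : N - e <= 2 * p * (N - e) by rewrite ler_peMl ?subr_ge0//; lra.
lra.
Qed.

Lemma overlap_le (R : realType) (N q D0 e : R) : 0 < N -> 0 < D0 -> D0 <= N -> 0 <= e -> N * q <= N ->
  N - N * q <= e * D0 -> `|q - 1| <= e.
Proof.
move=> n0 d0 dn e0 h d.
have q1 : q <= 1 by rewrite -(ler_pM2l n0) mulr1.
rewrite ler0_norm ?subr_le0// opprB.
have : N * (1 - q) <= N * e.
  by rewrite mulrBr mulr1; apply: le_trans d _; rewrite mulrC ler_wpM2r.
by rewrite ler_pM2l.
Qed.

Lemma excess_bound (R : realType) (N e e' E : R) : 0 <= e -> N - e <= e' - e -> e' <= E -> e <= E -> N <= 2 * E.
Proof. lra. Qed.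

Lemma excess_small (R : realType) (N a b c s x : R) : c <= a -> b <= s -> s - x < c -> N - a <= b - a -> N - a <= x.
Proof. lra. Qed.

Transparent per.
Lemma per_cst (R : realType) (T a : R) : 0 < T -> 0 <= a -> per T (cst a) = T * a.
Proof.
by move=> T0 a0; rewrite /per (wint_cst (box_ker 0 T) a0) knorm_box ?(ltW T0)// subr0.
Qed.
Opaque per.

Transparent energy.
Lemma energy_unfold (R : realType) (T : R) (H : R -> R) p v :
  energy T H p v = qform T H (fun t => v t `^ p) (fun t => v t `^ p).
Proof. by []. Qed.
Opaque energy.

(** * The iteration and its uniform bounds *)

Section iterates.
Context {R : realType} (T : R).
Hypothesis T0 : 0 < T.
Implicit Types (k v w psi : R -> R) (t : R).
Local Notation bper := (bper T).
Local Notation qform := (qform T).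
Variables (H G : R -> R) (kapH cH kapG cG p : R).
Hypotheses (gH : goodk kapH cH H) (kH1 : kapH < 1) (kH0 : 0 <= kapH) (cH0 : 0 < cH).
Hypotheses (gG : goodk kapG cG G) (kG1 : kapG < 1) (kG0 : 0 <= kapG) (cG0 : 0 < cG) (p1 : 1 < p).
Local Notation okH := (goodk_ker gH kH1).
Local Notation okG := (goodk_ker gG kG1).
Local Notation F := (Fop H p).
Local Notation energy := (energy T H p).
Local Notation p0 := (p_ge0 p1).

Variables (D0 : R) (psi0 : R -> R).
Hypotheses (D00 : 0 < D0).

Definition admissible D psi := [/\ bper psi, qform G psi psi = 1 & D <= energy (cvl G psi)].

Definition nrm v : R := Num.sqrt (qform G (F v) (F v)).

Definition nxt psi : R -> R := fun t => (nrm (cvl G psi))^-1 * F (cvl G psi) t.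

Lemma nxt_admissible psi : admissible D0 psi ->
  [/\ admissible D0 (nxt psi), D0 <= nrm (cvl G psi),
      energy (cvl G psi) = nrm (cvl G psi) * qform G (nxt psi) psi &
      energy (cvl G psi) + 2 * p * (nrm (cvl G psi) - energy (cvl G psi)) <= energy (cvl G (nxt psi))].
Proof.
move=> [pp qp De]; have pv := bper_cvl okG pp.
have e0 : 0 < energy (cvl G psi) by exact: lt_le_trans De.
have le1 : energy (cvl G psi) <= nrm (cvl G psi).
  exact: (energy_le_norm T0 gH kH1 gG kG1 p1 pp qp pv (fun t => erefl) e0).
have n0 : 0 < nrm (cvl G psi) by exact: lt_le_trans le1.
have pF := bper_Fop gH kH1 p1 pv.
have nE : nrm (cvl G psi) ^+ 2 = qform G (F (cvl G psi)) (F (cvl G psi)).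
  by rewrite sqr_sqrtr; [reflexivity|exact: (qform_ge0 okG pF pF)].
have pn : bper (nxt psi) by apply: bperZ => //; rewrite invr_ge0 ltW.
have pv' := bper_cvl okG pn.
have [_ q1 eE inc] := step T0 gH kH1 gG kG1 p1 pp qp pv (fun t => erefl) n0 nE (fun t => erefl) pv' (fun t => erefl).
split; [split|exact: le_trans le1|exact: eE|exact: inc].
- exact: pn.
- exact: q1.
- apply: le_trans De (le_trans _ inc); rewrite lerDl mulr_ge0 ?subr_ge0//.
  by rewrite mulr_ge0// p0.
Qed.

Hypothesis adm0 : admissible D0 psi0.

Definition psis (j : nat) : R -> R := iter j nxt psi0.
Definition vs (j : nat) : R -> R := cvl G (psis j).

Lemma psis_admissible j : admissible D0 (psis j).
Proof.
elim: j => [|j IH]; first exact: adm0.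
by have [h _ _ _] := nxt_admissible IH; exact: h.
Qed.

Lemma bper_psis j : bper (psis j). Proof. by have [] := psis_admissible j. Qed.
Lemma bper_vs j : bper (vs j). Proof. exact: (bper_cvl okG (bper_psis j)). Qed.
Lemma nrm_ge j : D0 <= nrm (vs j). Proof. by have [] := nxt_admissible (psis_admissible j). Qed.
Lemma nrm_gt0 j : 0 < nrm (vs j). Proof. exact: lt_le_trans D00 (nrm_ge j). Qed.
Lemma psisS j t : psis j.+1 t = (nrm (vs j))^-1 * F (vs j) t. Proof. by []. Qed.

Lemma vsS j t : vs j.+1 t = (nrm (vs j))^-1 * cvl G (F (vs j)) t.
Proof.
have bF := bper_bfun (bper_Fop gH kH1 p1 (bper_vs j)).
by rewrite -(cvlZ t okG bF)// invr_ge0 (ltW (nrm_gt0 j)).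
Qed.

Hypothesis sub : subcritical kapH kapG p.

Lemma vsE j t : vs j t = cvl G (psis j) t. Proof. by []. Qed.

Opaque vs psis nrm.

(** [Lm_bound] holds for every iterate with the same constant. Since N >= D0, the sup of the next
    iterate is at most C M^th / D0, and [sublinear_cap] provides a level preserved by induction. *)
Lemma vs_bounded : exists2 X, 1 <= X & forall j t, vs j t <= X.
Proof.
have [m [th [m2 mk th0 th1 cases]]] := sub.
have [I I0 HI] := Lm_bound T0 gG kG1 cG0 m2 mk.
have [C C0 HC] := cvl_Fop_bound T0 gH kH1 kH0 cH0 gG kG1 kG0 cG0 p1 m2 mk th0 I0 cases.
have [M0 M00 HM0] := bfun_bound (bper_bfun (bper_vs 0)).
have CD0 : 0 <= D0^-1 * C by rewrite mulr_ge0// invr_ge0 ltW.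
have [X [X1 XM XC]] := sublinear_cap M0 th0 th1 CD0.
exists X => //; elim=> [|j IH] t; first exact: le_trans (HM0 t) XM.
rewrite vsS; apply: le_trans XC; rewrite -mulrA.
have [pp qp _] := psis_admissible j.
have vI := HI _ pp qp; rewrite -(eq_per T (fun s => congr1 (fun x => x `^ m) (vsE j s))) in vI.
have h := HC (vs j) X t (bper_vs j) vI IH X1.
apply: ler_pM => //.
- by rewrite invr_ge0 (ltW (nrm_gt0 j)).
- by apply: (cvl_ge0 t okG); exact: bper_bfun (bper_Fop gH kH1 p1 (bper_vs j)).
- by rewrite lef_pV2 ?posrE ?nrm_gt0 ?nrm_ge.
Qed.

(** From 1 = <psi, v> <= X times the integral of psi, the density psi has mass at least 1/X over a
    period, and [cvl_low] turns mass into a pointwise lower bound. *)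
Lemma vs_low X : 1 <= X -> (forall j t, vs j t <= X) -> exists2 m0, 0 < m0 & forall j t, m0 <= vs j t.
Proof.
move=> X1 vX; have [del d0 Hd] := cvl_low T0 gG kG1.
exists (del * X^-1); first by rewrite mulr_gt0// invr_gt0; lra.
move=> j t; rewrite vsE; apply: le_trans (Hd _ t (bper_psis j)); rewrite ler_pM2l//.
have [pp qp _] := psis_admissible j; have X0 : 0 <= X by lra.
rewrite -[leLHS]mul1r ler_pdivrMr; last by lra.
rewrite mulrC -(perZ T (bper_bfun pp) X0) -qp qformE -(eq_per T (fun s => congr1 (fun x => psis j s * x) (vsE j s))).
apply: per_le.
- exact: (bfunM (bper_bfun pp) (bper_bfun (bper_vs j))).
- exact: (bfunZ X0 (bper_bfun pp)).
move=> s; rewrite mulrC; apply: ler_wpM2r; [exact: bper_ge0 pp|exact: vX].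
Qed.

Lemma psis_bounded X : 1 <= X -> (forall j t, vs j t <= X) -> exists2 P, 0 <= P & forall j t, psis j t <= P.
Proof.
move=> X1 vX; have [M0 M00 HM0] := bfun_bound (bper_bfun (bper_psis 0)).
pose K := D0^-1 * (knorm H * X `^ p * X `^ (p - 1)).
exists (Num.max M0 K); first by rewrite le_max M00.
case=> [|j] t; first by rewrite le_max HM0.
rewrite le_max psisS; apply/orP; right; apply: ler_pM.
- by rewrite invr_ge0 (ltW (nrm_gt0 j)).
- exact: bper_ge0 (bper_Fop gH kH1 p1 (bper_vs j)).
- by rewrite lef_pV2 ?posrE ?nrm_gt0 ?nrm_ge.
- exact: (Fop_bound t okH p1 (bper_vs j)).
Qed.

Lemma energy_bounded X : 1 <= X -> (forall j t, vs j t <= X) -> exists E, forall j, energy (vs j) <= E.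
Proof.
move=> X1 vX; have X0 : 0 <= X by lra.
exists (T * (X `^ p * (knorm H * X `^ p))) => j.
have pw := bper_pow p1 (bper_vs j); have bw := bper_bfun pw.
rewrite energy_unfold qformE.
have wX s : vs j s `^ p <= X `^ p.
  by apply: ge0_ler_powR; rewrite ?nnegrE ?p0//; exact: bper_ge0 (bper_vs j).
have K0 : 0 <= X `^ p * (knorm H * X `^ p) by rewrite !mulr_ge0 ?powR_ge0 ?(knorm_ge0 okH).
have bc := bfun_cst K0; have bww := bfunM bw (bfun_cvl okH bw).
rewrite -(per_cst T0 K0).
apply: (per_le T bww bc) => s.
apply: ler_pM; [exact: powR_ge0|exact: (cvl_ge0 s okH bw)|exact: wX|exact: (cvl_bound s okH bw wX)].
Qed.

Lemma nrm_energy j : [/\ energy (vs j) <= nrm (vs j),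
  energy (vs j) + 2 * p * (nrm (vs j) - energy (vs j)) <= energy (vs j.+1),
  D0 <= energy (vs j) & energy (vs j) = nrm (vs j) * qform G (psis j.+1) (psis j)].
Proof.
Transparent vs psis nrm.
have [_ _ eE inc] := nxt_admissible (psis_admissible j).
have [pp qp De] := psis_admissible j.
split; [|exact: inc|exact: De|exact: eE].
exact: (energy_le_norm T0 gH kH1 gG kG1 p1 pp qp (bper_vs j) (fun t => erefl) (lt_le_trans D00 De)).
Opaque vs psis nrm.
Qed.

Lemma energy_incr j : energy (vs j) <= energy (vs j.+1).
Proof.
have [h1 h2 _ _] := nrm_energy j; apply: le_trans h2.
rewrite lerDl; apply: mulr_ge0; last by rewrite subr_ge0.
by apply: mulr_ge0; [exact: ler0n|exact: p0].
Qed.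

Lemma nrm_bounded E : (forall j, energy (vs j) <= E) -> forall j, nrm (vs j) <= 2 * E.
Proof.
move=> HE j; have [h1 h2 h3 _] := nrm_energy j; have := HE j; have := HE j.+1.
have h4 := le_trans (ltW D00) h3; move=> h5 h6.
exact: excess_bound h4 (excess_le p1 h1 h2) h5 h6.
Qed.

(** The energies increase to a finite supremum. Each increment dominates N - E, so N - E tends to 0,
    and the overlap of consecutive densities is E / N with N bounded below by D0. *)
Lemma overlap_cvg E : (forall j, energy (vs j) <= E) -> forall e, 0 < e ->
  exists K, forall j, (K <= j)%N -> `|qform G (psis j.+1) (psis j) - 1| <= e.
Proof.
move=> HE e e0.
have hs : has_sup (range (fun j => energy (vs j))).
  split; first by exists (energy (vs 0)); exists 0%N.
  by exists E => _ [j _ <-].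
have eD : 0 < e * D0 by rewrite mulr_gt0.
have [_ [K _ <-] HK] := sup_adherent eD hs.
exists K => j Kj.
have mono : energy (vs K) <= energy (vs j).
  elim: j Kj => [|j IH]; first by rewrite leqn0 => /eqP ->; exact: lexx.
  rewrite leq_eqVlt => /orP[/eqP ->|h]; first exact: lexx.
  exact: le_trans (IH h) (energy_incr j).
have ub : energy (vs j.+1) <= sup (range (fun j => energy (vs j))).
  by apply: ub_le_sup; [have [] := hs|exists j.+1].
have [h1 h2 _ eE] := nrm_energy j; have n0 := nrm_gt0 j; have nD := nrm_ge j.
apply: (overlap_le n0 D00 nD (ltW e0)); rewrite -eE; first exact: h1.
exact: excess_small mono ub HK (excess_le p1 h1 h2).
Qed.

End iterates.

Lemma dist_add (R : realType) (x y z u A B : R) : `|x - z| <= A -> `|y - u| <= B -> `|x + y - (z + u)| <= B + A.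
Proof. by rewrite !ler_norml => /andP[? ?] /andP[? ?]; apply/andP; split; lra. Qed.

Lemma dist_add2 (R : realType) (x y z a b u A B : R) : `|x + y - 2 * z| <= A -> `|a + b - 2 * u| <= B ->
  `|x + a + (y + b) - 2 * (z + u)| <= B + A.
Proof. by rewrite !ler_norml => /andP[? ?] /andP[? ?]; apply/andP; split; lra. Qed.

(** * Smoothing by convolution *)

Section smoothing.
Context {R : realType}.
Implicit Types (k w psi : R -> R) (t h : R).

Transparent cvl.
Lemma cvlE k w t : cvl k w t = wint k (fun r => w (t - r)).
Proof. by []. Qed.
Opaque cvl.

Lemma wint_ae k1 k2 w : kerOK k1 -> kerOK k2 -> bfun w -> (forall r, r != 0 -> k1 r = k2 r) ->
  wint k1 w = wint k2 w.
Proof.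
move=> ok1 ok2 bw e12; have [m1 _ _] := ok1; have [m2 _ _] := ok2; have [mw _ _] := bw.
apply: EFin_inj; rewrite -(wintE ok1 bw) -(wintE ok2 bw).
apply: gint_ae_eq; [exact: measurable_kw|exact: measurable_kw|].
by apply: aeR_imp (ae_neqR 0) => r r0; rewrite e12.
Qed.

Lemma kerOK_le k1 k2 : mfunT k1 -> (forall r, 0 <= k1 r) -> kerOK k2 ->
  (forall r, r != 0 -> k1 r <= k2 r) -> kerOK k1.
Proof.
move=> m1 p1 [m2 p2 l2] h; split; [exact: m1|exact: p1|].
exact: (integral_neq0_lty m1 m2 p1 p2 h l2).
Qed.

(** A shift of the convolution is moved onto the kernel, whose differences are bounded relative to
    the kernel itself; no regularity of w is needed. *)
Lemma shift_bounds (k w : R -> R) (L P : R) t : kerOK k -> bfun w -> (forall s, w s <= P) -> 0 <= L ->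
  (forall t h, `|h| <= 1 -> `|k (t + h) - k t| <= L * `|h| * k t /\
       `|k (t + h) + k (t - h) - 2 * k t| <= L * h ^+ 2 * k t) ->
  forall h, `|h| <= 1 ->
    `|cvl k w (t + h) - cvl k w t| <= L * `|h| * (knorm k * P) /\
    `|cvl k w (t + h) + cvl k w (t - h) - 2 * cvl k w t| <= L * h ^+ 2 * (knorm k * P).
Proof.
move=> ok bw wP L0 Hk h h1.
have br := bfun_refl t bw; have kP := cvl_bound t ok bw wP.
have c0 := cvl_ge0 t ok bw.
have sh a : cvl k w (t + a) = wint (fun r => k (r + a)) (fun r => w (t - r)).
  rewrite cvlE (wint_shift a ok (bfun_refl (t + a) bw)); apply: eq_wint => r.
  by congr w; ring.
have oka a := kerOK_shift a ok.
have [mw w0 _] := br.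
have Lh0 : 0 <= L * `|h| by rewrite mulr_ge0.
have Lh20 : 0 <= L * h ^+ 2 by rewrite mulr_ge0 ?sqr_ge0.
have kp r : 0 <= k r by have [_ + _] := ok; exact.
have E1 : wint (fun r => k (r + h)) (fun r => w (t - r)) <= (1 + L * `|h|) * cvl k w t.
  rewrite cvlE; apply: (wint_gen_le (oka h) ok br br); first by rewrite addr_ge0.
  move=> r; rewrite mulrA; apply: ler_wpM2r => //.
  by have [+ _] := Hk r h h1; rewrite ler_norml mulrDl mul1r => /andP[_]; lra.
have E2 : cvl k w t <= wint (fun r => k (r + h)) (fun r => w (t - r)) + (L * `|h|) * cvl k w t.
  rewrite {2}cvlE -(wint_kerZ ok br Lh0) cvlE.
  apply: (wint_gen2_le ok (oka h) (kerOKZ ok Lh0) br br br) => r; rewrite -mulrDl.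
  apply: ler_wpM2r => //.
  by have [+ _] := Hk r h h1; rewrite ler_norml => /andP[+ _]; lra.
have ok2 := oka h; have ok3 := oka (- h).
have E3 : wint (fun r => k (r + h)) (fun r => w (t - r)) + wint (fun r => k (r - h)) (fun r => w (t - r))
    <= (2 + L * h ^+ 2) * cvl k w t.
  rewrite -(wint_kerD ok2 ok3 br) cvlE; apply: wint_gen_le => //.
  - exact: kerOKD.
  - by rewrite addr_ge0.
  - move=> r; rewrite mulrA; apply: ler_wpM2r => //.
    by have [_] := Hk r h h1; rewrite ler_norml mulrDl => /andP[_]; lra.
have h20 : 0 <= 2 :> R by [].
have E4 : 2 * cvl k w t <= wint (fun r => k (r + h)) (fun r => w (t - r)) + wint (fun r => k (r - h)) (fun r => w (t - r))
    + (L * h ^+ 2) * cvl k w t.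
  (* The comparison of kernels needs 2 - L h^2 nonnegative; beyond that range the error term alone
     exceeds the left side. *)
  have [q|/ltW q] := leP (L * h ^+ 2) 2; last first.
    have := wint_ge0 ok2 br; have := wint_ge0 ok3 br; have := ler_wpM2r c0 q.
    by move: (wint _ _) (wint _ _) (cvl _ _ _) => x y z; lra.
  have q0 : 0 <= 2 - L * h ^+ 2 by rewrite subr_ge0.
  have : wint (fun r => (2 - L * h ^+ 2) * k r) (fun r => w (t - r)) <=
      wint (fun r => k (r + h)) (fun r => w (t - r)) + wint (fun r => k (r - h)) (fun r => w (t - r)).
    apply: (wint_gen2_le (kerOKZ ok q0) ok2 ok3 br br br) => r; rewrite -mulrDl.
    apply: ler_wpM2r => //.
    by have [_] := Hk r h h1; rewrite ler_norml mulrBl => /andP[+ _]; lra.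
  rewrite (wint_kerZ ok br q0) -cvlE mulrBl; move: (wint _ _) (wint _ _) (cvl _ _ _) => x y z; lra.
have b1 := ler_wpM2l Lh0 kP; have b2 := ler_wpM2l Lh20 kP.
rewrite !sh !ler_norml; move: E1 E2 E3 E4 b1 b2.
move: (wint _ _) (wint _ _) (cvl _ _ _) (knorm k * P) (L * `|h|) (L * h ^+ 2).
by move=> x y z u a b *; split; apply/andP; split; lra.
Qed.

(** Split k into its regularisation and the rest. The regularisation gives differences controlled by
    the sup of psi. The rest has L1 norm at most e and multiplies only the modulus of psi; this
    small factor is what later permits absorption. *)
Lemma cvl_smooth kap c k e : goodk kap c k -> kap < 1 -> 0 < e -> exists2 K, 0 <= K &
  forall psi P, bfun psi -> (forall s, psi s <= P) -> forall h, `|h| <= 1 ->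
  (forall om, (forall t, `|psi (t + h) - psi t| <= om) ->
     forall t, `|cvl k psi (t + h) - cvl k psi t| <= e * om + K * `|h| * P) /\
  (forall om, (forall t, `|psi (t + h) + psi (t - h) - 2 * psi t| <= om) ->
     forall t, `|cvl k psi (t + h) + cvl k psi (t - h) - 2 * cvl k psi t| <= e * om + K * h ^+ 2 * P).
Proof.
move=> gk k1 e0; have ok := goodk_ker gk k1.
have [k2 [L [mk2 k20 k2k near [L0 HL]]]] := gk_smooth gk e0.
have ok2 := kerOK_le mk2 k20 ok k2k.
have [mk kk0 kl] := ok.
have okk : kerOK (fun r => `|k r - k2 r|).
  split; [|by move=> r; exact: normr_ge0|exact: le_lt_trans near (ltry _)].
  by mfun.
have nkk : knorm (fun r => `|k r - k2 r|) <= e by rewrite -lee_fin -(kerOK_norm okk).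
have okD := kerOKD ok2 okk.
have dec w t : bfun w -> cvl k w t = cvl k2 w t + cvl (fun r => `|k r - k2 r|) w t.
  move=> bw; have br := bfun_refl t bw; rewrite !cvlE -(wint_kerD ok2 okk br).
  apply: (wint_ae ok okD br) => r r0; rewrite ger0_norm ?subr_ge0 ?k2k//.
  by rewrite addrC subrK.
exists (L * knorm k2); first by rewrite mulr_ge0// (knorm_ge0 ok2).
move=> psi P bp pP h h1; split=> om Hom t; rewrite !(dec psi _ bp).
  have [S1 _] := shift_bounds t ok2 bp pP L0 HL h1.
  have om0 : 0 <= om by exact: le_trans (Hom 0).
  have S2 : `|cvl (fun r => `|k r - k2 r|) psi (t + h) - cvl (fun r => `|k r - k2 r|) psi t| <= e * om.
    apply: le_trans (ler_wpM2r om0 nkk); rewrite !cvlE.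
    apply: (wint_dist okk (bfun_refl _ bp) (bfun_refl _ bp)) => r.
    by rewrite addrAC; exact: Hom.
  apply: le_trans (dist_add S1 S2) _; rewrite lerD2l.
  by rewrite (_ : L * knorm k2 * `|h| * P = L * `|h| * (knorm k2 * P))//; ring.
have [_ S1] := shift_bounds t ok2 bp pP L0 HL h1.
have om0 : 0 <= om by exact: le_trans (Hom 0).
have S2 : `|(cvl (fun r => `|k r - k2 r|) psi (t + h) + cvl (fun r => `|k r - k2 r|) psi (t - h)) - 2 * cvl (fun r => `|k r - k2 r|) psi t| <= e * om.
  apply: le_trans (ler_wpM2r om0 nkk); rewrite !cvlE.
  have b1 := bfun_refl (t + h) bp; have b2 := bfun_refl (t - h) bp; have b3 := bfun_refl t bp.
  rewrite -(wintD okk b1 b2) -(wintZ okk b3 (ler0n _ 2)).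
  apply: (wint_dist okk (bfunD b1 b2) (bfunZ (ler0n _ 2) b3)) => r.
  by rewrite (addrAC t h) (addrAC t (- h)); exact: Hom.
apply: le_trans (dist_add2 S1 S2) _; rewrite lerD2l.
by rewrite (_ : L * knorm k2 * h ^+ 2 * P = L * h ^+ 2 * (knorm k2 * P))//; ring.
Qed.

Lemma cvl_equicontinuous kap c k P e : goodk kap c k -> kap < 1 -> 0 <= P -> 0 < e ->
  exists2 d, 0 < d & forall psi, bfun psi -> (forall s, psi s <= P) ->
  forall t h, `|h| <= d -> `|cvl k psi (t + h) - cvl k psi t| <= e.
Proof.
(* One half of e pays for the oscillation of psi, which is at most P, the other half for the smooth
   part. *)
move=> gk k1 P0 e0; pose e' := e / (2 * (P + 1)).
have e'0 : 0 < e' by rewrite divr_gt0// mulr_gt0//; lra.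
have [K K0 HK] := cvl_smooth gk k1 e'0.
have KP : 0 <= K * P by rewrite mulr_ge0.
exists (Num.min 1 (e / (2 * (K * P + 1)))).
  by rewrite lt_min ltr01 divr_gt0// mulr_gt0//; lra.
move=> psi bp pP t h; rewrite le_min => /andP[h1 h2].
have [H1 _] := HK psi P bp pP h h1.
have [_ p0 _] := bp.
have d s : `|psi (s + h) - psi s| <= P.
  by have := p0 s; have := p0 (s + h); have := pP s; have := pP (s + h); rewrite ler_norml; lra.
apply: le_trans (H1 P d t) _.
have a1 : e' * P <= e / 2.
  rewrite /e' -mulrA ler_pM2l// invfM -mulrA ler_piMr// mulrC ler_pdivrMr; lra.
have a2 : K * `|h| * P <= e / 2.
  rewrite mulrAC; apply: le_trans (ler_wpM2l KP h2) _.
  rewrite mulrCA ler_pM2l// invfM mulrCA ler_piMr// ler_pdivrMr; lra.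
lra.
Qed.

End smoothing.

(** * Compactness along an ultrafilter *)

Section ultralimits.
Context {R : realType}.
Variables (U : set_system nat) (UU : UltraFilter U).
Implicit Types (t h e : R).

(** The limit is the supremum of the levels x with x <= u_j for U-many j: an ultrafilter decides
    every level set, so values above the supremum are excluded for U-many j. No subsequence is
    extracted. *)
Lemma ultra_limit (u : nat -> R) (m M : R) : (forall j, m <= u j <= M) ->
  exists2 l, m <= l <= M & forall e, 0 < e -> U [set j | `|u j - l| <= e].
Proof.
move=> um; have PU : ProperFilter U by exact: ultra_proper.
pose A := [set x : R | U [set j | x <= u j]].
have Am : A m by apply: filterS filterT => j _ /=; have /andP[] := um j.
have Aub : ubound A M.
  move=> x Ax; rewrite leNgt; apply/negP => Mx.
  have := filter_ex Ax; case=> j /= xu; have /andP[_ uM] := um j.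
  by move: (lt_le_trans Mx (le_trans xu uM)); rewrite ltxx.
have hs : has_sup A by split; [exists m|exists M].
exists (sup A).
  apply/andP; split; first exact: (ub_le_sup hs.2).
  by apply: ge_sup => //; exists m.
move=> e e0; have [x Ax xe] := sup_adherent e0 hs.
have B : U [set j | u j < sup A + e].
  have [//|B] := in_ultra_setVsetC [set j | u j < sup A + e] UU.
  have : A (sup A + e).
    by apply: filterS B => j /= /negP; rewrite -leNgt.
  move=> /(ub_le_sup hs.2); rewrite gerDl leNgt e0 => //.
apply: filterS2 Ax B => j /= h1 h2; rewrite ler_norml.
by apply/andP; split; lra.
Qed.

Lemma bper_reduce (T : R) t : 0 < T -> exists2 s, 0 <= s < T & forall w, bper T w -> w t = w s.
Proof.
move=> T0.
have aT : 0 <= t / T + (Num.truncn (`|t| / T)).+1%:R.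
  have := truncnS_gt (`|t| / T) => h.
  have : - (`|t| / T) <= t / T by rewrite -mulNr ler_pM2r ?invr_gt0// lerNnormlW.
  lra.
set n := (Num.truncn (`|t| / T)).+1 in aT.
set y := t / T + n%:R in aT.
have /andP[m1 m2] := truncn_itv aT; set m := Num.truncn y in m1 m2.
have aE : t + T *+ n = (T * y - T *+ m) + T *+ m.
  by rewrite subrK /y mulrDr mulrC divfK ?gt_eqF// mulr_natr.
exists (T * y - T *+ m).
  rewrite subr_ge0 -mulr_natr ler_pM2l// m1/= ltrBlDr -{2}[T]mulr1 -mulrDr ltr_pM2l//.
  by rewrite addrC natr1.
by move=> w pw; rewrite -(bper_mulrn t n pw) aE bper_mulrn.
Qed.

Lemma ultra_finite (n : nat) (P : nat -> nat -> Prop) : (forall i, U [set j | P i j]) ->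
  U [set j | forall i, (i <= n)%N -> P i j].
Proof.
move=> HP; have PU : ProperFilter U by exact: ultra_proper.
elim: n => [|n IH].
  by apply: filterS (HP 0%N) => j /= h i; rewrite leqn0 => /eqP ->.
apply: filterS2 IH (HP n.+1) => j /= h1 h2 i; rewrite leq_eqVlt => /orP[/eqP ->//|].
exact: h1.
Qed.

(** The theorem of Arzela and Ascoli: limits are taken pointwise along U, equicontinuity passes to
    the limit, and closeness on a finite grid of one period spreads to all points. *)
Lemma ultra_limit_unif (T m X : R) (w : nat -> R -> R) : 0 < T -> 0 <= m -> (forall j, bper T (w j)) ->
  (forall j t, m <= w j t <= X) ->
  (forall e, 0 < e -> exists2 d, 0 < d & forall j t h, `|h| <= d -> `|w j (t + h) - w j t| <= e) ->
  exists a, [/\ bper T a, forall t, m <= a t <= X &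
    forall e, 0 < e -> U [set j | forall t, `|w j t - a t| <= e]].
Proof.
move=> T0 m0 pw wm eqc; have PU : ProperFilter U by exact: ultra_proper.
have /choice[a Ha] : forall t, exists l, m <= l <= X /\ forall e, 0 < e -> U [set j | `|w j t - l| <= e].
  by move=> t; have [l l1 l2] := ultra_limit (fun j => wm j t); exists l.
have am t : m <= a t <= X by have [] := Ha t.
have aU t e : 0 < e -> U [set j | `|w j t - a t| <= e] by have [_ h] := Ha t; exact: h.
have tri (x y z u e : R) : `|x - y| <= e -> `|z - u| <= e -> `|x - z| <= e -> `|y - u| <= 3 * e.
  by rewrite !ler_norml => /andP[? ?] /andP[? ?] /andP[? ?]; apply/andP; split; lra.
have aeq e : 0 < e -> exists2 d, 0 < d & forall t h, `|h| <= d -> `|a (t + h) - a t| <= 3 * e.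
  move=> e0; have [d d0 Hd] := eqc e e0; exists d => // t h hd.
  have [j [/= h1 h2]] := filter_ex (filterI (aU t e e0) (aU (t + h) e e0)).
  exact: tri h2 h1 (Hd j t h hd).
have pa : forall t, a (t + T) = a t.
  move=> t; apply/eqP; rewrite -subr_eq0 -normr_le0; apply/ler_addgt0Pl => e e0; rewrite addr0.
  have e3 : 0 < e / 3 by rewrite divr_gt0.
  have [j [/= h1 h2]] := filter_ex (filterI (aU t _ e3) (aU (t + T) _ e3)).
  have h3 : `|w j (t + T) - w j t| <= e / 3.
    by have [_ ->] := pw j; rewrite subrr normr0 ltW.
  by apply: le_trans (tri _ _ _ _ _ h2 h1 h3) _; rewrite mulrC divfK.
have ca : continuous a.
  move=> t; apply/cvgrPdist_le => e e0; have e3 : 0 < e / 3 by rewrite divr_gt0.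
  have [d d0 Hd] := aeq _ e3; near=> s; rewrite distrC -[s](subrKC t).
  apply: le_trans (Hd t (s - t) _) _; last by rewrite mulrC divfK.
  by near: s; exists d => //= s; rewrite /ball_/= distrC => /ltW.
exists a; split => //.
  split => //; split; first exact: continuous_measurable_fun.
  - by move=> t; have /andP[h _] := am t; exact: le_trans h.
  - by exists X => t; have /andP[] := am t.
move=> e e0; have e3 : 0 < e / 5 by rewrite divr_gt0.
have [d1 d10 Hd1] := aeq _ e3; have [d2 d20 Hd2] := eqc _ e3.
pose d := Num.min d1 d2; have d0 : 0 < d by rewrite lt_min d10.
(* The grid of multiples of d up to T is finite, so an ultrafilter handles all its points at
   once. *)
pose n := Num.truncn (T / d).
have := @ultra_finite n (fun i j => `|w j (i%:R * d) - a (i%:R * d)| <= e / 5) (fun i => aU _ _ e3).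
apply: filterS => j /= Hj t.
have [s /andP[s0 sT] sE] := bper_reduce t T0.
have pa' : bper T a.
  split => //; split; first exact: continuous_measurable_fun.
  - by move=> r; have /andP[h _] := am r; exact: le_trans h.
  - by exists X => r; have /andP[] := am r.
rewrite (sE _ (pw j)) (sE _ pa').
pose i := Num.truncn (s / d).
have sd : 0 <= s / d by rewrite divr_ge0// ltW.
have /andP[i1 i2] := truncn_itv sd.
have ii : (i <= n)%N by apply: le_truncn; rewrite ler_pM2r ?invr_gt0// ltW.
have h0 := Hj i ii.
have hs : `|s - i%:R * d| <= d.
  rewrite ger0_norm; last by rewrite subr_ge0 -ler_pdivlMr.
  by rewrite lerBlDr (_ : d + i%:R * d = i.+1%:R * d); [by rewrite -ler_pdivrMr// ltW|rewrite -natr1; ring].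
have [hs1 hs2] : `|s - i%:R * d| <= d1 /\ `|s - i%:R * d| <= d2.
  by move: hs; rewrite le_min => /andP[].
have := Hd1 (i%:R * d) _ hs1; have := Hd2 j (i%:R * d) _ hs2; rewrite subrKC.
move: h0; rewrite !ler_norml => /andP[? ?] /andP[? ?] /andP[? ?].
by apply/andP; split; lra.
Unshelve. all: by end_near.
Qed.

End ultralimits.

Lemma lim_eq0 (R : realType) (x C : R) : (forall e, 0 < e -> `|x| <= C * e) -> x = 0.
Proof.
move=> h; apply/eqP; rewrite -normr_le0; apply/ler_addgt0Pl => e e0; rewrite addr0.
have C1 : 0 < `|C| + 1 by have := normr_ge0 C; lra.
have e1 : 0 < e / (`|C| + 1) by rewrite divr_gt0.
apply: le_trans (h _ e1) _; rewrite mulrCA ler_piMr ?(ltW e0)// ler_pdivrMr//.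
by have := ler_norm C; lra.
Qed.

Lemma inv_dist (R : realType) (x y D e : R) : 0 < D -> D <= x -> D <= y -> `|x - y| <= e ->
  `|x^-1 - y^-1| <= D^-1 * D^-1 * e.
Proof.
move=> D0 Dx Dy h; have x0 : 0 < x by exact: lt_le_trans Dx.
have y0 : 0 < y by exact: lt_le_trans Dy.
rewrite (_ : x^-1 - y^-1 = x^-1 * y^-1 * (y - x)); last by field; rewrite !gt_eqF.
rewrite normrM ger0_norm; last by rewrite mulr_ge0 ?invr_ge0 ?ltW.
rewrite distrC; apply: ler_pM => //; first by rewrite mulr_ge0 ?invr_ge0 ?ltW.
by apply: ler_pM; rewrite ?invr_ge0 ?(ltW x0) ?(ltW y0)// lef_pV2.
Qed.

Lemma double_cancel (R : realType) (c x : R) : c + c = x + 2 * c -> x = 0.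
Proof. lra. Qed.

(** * Existence of periodic solutions *)

Section solution.
Context {R : realType} (T : R).
Hypothesis T0 : 0 < T.
Local Notation per := (per T).
Local Notation bper := (bper T).
Local Notation qform := (qform T).
Variables (H G : R -> R) (kapH cH kapG cG p : R).
Hypotheses (gH : goodk kapH cH H) (kH1 : kapH < 1) (kH0 : 0 <= kapH) (cH0 : 0 < cH).
Hypotheses (gG : goodk kapG cG G) (kG1 : kapG < 1) (kG0 : 0 <= kapG) (cG0 : 0 < cG) (p1 : 1 < p).
Local Notation okH := (goodk_ker gH kH1).
Local Notation okG := (goodk_ker gG kG1).
Local Notation F := (Fop H p).
Variables (D0 : R) (psi0 : R -> R).
Hypotheses (D00 : 0 < D0) (adm0 : admissible T H G p D0 psi0) (sub : subcritical kapH kapG p).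

(** For two unit densities with product one the squared norm of the difference is 1 + 1 - 2 = 0.
    Hence their correlations with the square root g agree almost everywhere, and one further
    convolution with g gives equality of the potentials at every point. *)
Lemma cvl_eq_of_overlap a b : bper a -> bper b -> qform G a a = 1 -> qform G b b = 1 ->
  qform G b a = 1 -> forall t, cvl G a t = cvl G b t.
Proof.
move=> pa pb qa qb qab t.
have [g [C [mg g0 gl C0 root]]] := gk_root gG.
have gok : kerOK g by split.
have xa := bper_corr gok pa; have xb := bper_corr gok pb.
have bxa := bper_bfun xa; have bxb := bper_bfun xb.
have ra := qform_root T0 okG gok (ltW C0) pa pa root.
have rb := qform_root T0 okG gok (ltW C0) pb pb root.
have rab := qform_root T0 okG gok (ltW C0) pb pa root.
rewrite qa in ra; rewrite qb in rb; rewrite qab in rab.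
(* The absolute value keeps the difference within the nonnegative functions to which the integrals
   are restricted. *)
pose z s := `|corr g a s - corr g b s|.
have pz : bper z.
  have [[ma a0 [Ma aM]] ha] := xa; have [[mb b0 [Mb bM]] hb] := xb.
  split; last by move=> s; rewrite /z ha hb.
  split; first by apply: measurableT_comp => //; exact: measurable_funB.
  - by move=> s; exact: normr_ge0.
  - exists (Ma + Mb) => s; apply: le_trans (ler_normB _ _) _.
    by rewrite !ger0_norm// lerD.
have z0 : per (fun s => z s * z s) = 0.
  have b1 := bfunM bxa bxa; have b2 := bfunM bxb bxb; have b3 := bfunM bxb bxa.
  have bz := bper_bfun (bperM pz pz).
  have E : per (fun s => corr g a s * corr g a s + corr g b s * corr g b s) =
      per (fun s => z s * z s + 2 * (corr g b s * corr g a s)).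
    apply: eq_per => s; rewrite (_ : z s * z s = z s ^+ 2)// real_normK ?num_real//.
    by move: (corr _ _ _) (corr _ _ _) => x y; ring.
  move: E; rewrite (perD T b1 b2) (perD T bz (bfunZ (ler0n _ 2) b3)) (perZ T b3 (ler0n _ 2)).
  by rewrite -ra -rb -rab => E; apply: (@double_cancel _ (C * 1)).
apply: (mulfI (lt0r_neq0 C0)).
rewrite (cvl_root t okG gok (ltW C0) (bper_bfun pa) root).
rewrite (cvl_root t okG gok (ltW C0) (bper_bfun pb) root).
apply/eqP; rewrite -subr_eq0 -normr_le0.
have gz := per_sqr0_cvl t T0 gok pz z0.
have bz := bper_bfun pz.
have le1 u v : bfun u -> bfun v -> (forall s, u s <= v s + z s) -> cvl g u t <= cvl g v t.
  move=> bu bv uv; have := cvl_le t gok bu (bfunD bv bz) uv.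
  by rewrite (cvlD t gok bv bz) gz addr0.
rewrite normr_le0 subr_eq0 eq_le; apply/andP; split; apply: le1 => // s.
  by rewrite -lerBlDl; exact: ler_norm.
by rewrite -lerBlDl /z distrC; exact: ler_norm.
Qed.

(** Let a and b be the limits of V_j and V_(j+1), with N and N' the limits of the norms, and put psi
    = F(a)/N, psi' = F(b)/N'. Passing to the limit gives b = G * psi and unit norms. The overlaps
    tend to one, so [cvl_eq_of_overlap] yields G * psi = G * psi', and b solves the equation with
    constant N'. *)
Lemma limit_solution (ps V : nat -> R -> R) (n : nat -> R) (X m P E : R) :
  (forall j, bper (ps j)) -> (forall j, qform G (ps j) (ps j) = 1) ->
  (forall j t, V j t = cvl G (ps j) t) -> (forall j, bper (V j)) -> (forall j, D0 <= n j <= E) ->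
  (forall j t, ps j.+1 t = (n j)^-1 * F (V j) t) -> 0 < m -> (forall j t, m <= V j t <= X) ->
  (forall j t, ps j t <= P) ->
  (forall e, 0 < e -> exists K, forall j, (K <= j)%N -> `|qform G (ps j.+1) (ps j) - 1| <= e) ->
  exists v N, [/\ bper v, forall t, m <= v t <= X, D0 <= N &
  (forall t, v t = N^-1 * cvl G (F v) t) /\
  qform G (fun t => N^-1 * F v t) (fun t => N^-1 * F v t) = 1].
Proof.
move=> pps qps VE pV nb psE m0 Vb psP ov.
have mX : m <= X by have /andP[a b] := Vb 0%N 0; exact: le_trans b.
have P0 : 0 <= P by exact: le_trans (bper_ge0 0 (pps 0%N)) (psP 0%N 0).
(* U refines the filter of cofinal indices, so the asymptotic statement on overlaps holds along
   it. *)
have [U [UU sU]] := @ultraFilterLemma nat \oo _.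
have PU : ProperFilter U by exact: ultra_proper.
have eqc e : 0 < e -> exists2 d, 0 < d & forall j t h, `|h| <= d -> `|V j (t + h) - V j t| <= e.
  move=> e0; have [d d0 Hd] := cvl_equicontinuous gG kG1 P0 e0; exists d => // j t h hd.
  by rewrite !VE; apply: Hd => //; exact: bper_bfun.
have eqcS e : 0 < e -> exists2 d, 0 < d & forall j t h, `|h| <= d -> `|V j.+1 (t + h) - V j.+1 t| <= e.
  by move=> e0; have [d d0 Hd] := eqc e e0; exists d => // j; exact: Hd.
have [a [pa am aU]] := ultra_limit_unif UU T0 (ltW m0) pV Vb eqc.
have [b [pb bm bU]] := ultra_limit_unif UU T0 (ltW m0) (fun j => pV j.+1) (fun j => Vb j.+1) eqcS.
have [N /andP[ND NE] NU] := ultra_limit UU nb.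
have [N' /andP[N'D N'E] N'U] := ultra_limit UU (fun j => nb j.+1).
have N0 : 0 < N by exact: lt_le_trans ND.
have N'0 : 0 < N' by exact: lt_le_trans N'D.
have pFa := bper_Fop gH kH1 p1 pa; have pFb := bper_Fop gH kH1 p1 pb.
have Ni : 0 <= N^-1 by rewrite invr_ge0 ltW.
have N'i : 0 <= N'^-1 by rewrite invr_ge0 ltW.
have ppsi := bperZ Ni pFa; have ppsi' := bperZ N'i pFb.
have [CF CF0 HF] := Fop_dist T okH p1 m0 mX.
pose FM := knorm H * X `^ p * X `^ (p - 1).
have FMle v : bper v -> (forall t, m <= v t <= X) -> forall t, F v t <= FM.
  move=> pv vm t; apply: (Fop_bound t okH p1 pv) => s; by have /andP[] := vm s.
pose C1 := D0^-1 * D0^-1 * FM + D0^-1 * CF.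
have close v w x y e : bper v -> bper w -> (forall t, m <= v t <= X) -> (forall t, m <= w t <= X) ->
    D0 <= x -> D0 <= y -> `|x - y| <= e -> (forall t, `|v t - w t| <= e) ->
    forall t, `|x^-1 * F v t - y^-1 * F w t| <= C1 * e.
  move=> pv pw vm wm Dx Dy xy vw t.
  have i1 := inv_dist D00 Dx Dy xy; have i2 := HF v w e pv pw vm wm vw t.
  have f0 : `|F v t| <= FM by rewrite ger0_norm; [exact: FMle|exact: bper_ge0 (bper_Fop gH kH1 p1 pv)].
  have y0 : `|y^-1| <= D0^-1.
    have yp : 0 < y by exact: lt_le_trans Dy.
    by rewrite ger0_norm ?invr_ge0 ?(ltW yp)// lef_pV2.
  apply: le_trans (mul_dist i1 i2 f0 y0) _.
  by rewrite /C1 (_ : D0^-1 / D0 * e * FM + D0^-1 * (CF * e) = (D0^-1 / D0 * FM + D0^-1 * CF) * e)//; ring.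
pose M := Num.max P (D0^-1 * FM).
have PM : P <= M by rewrite le_max lexx.
have psM v x : bper v -> (forall t, m <= v t <= X) -> D0 <= x -> forall t, x^-1 * F v t <= M.
  move=> pv vm Dx t; rewrite le_max; apply/orP; right.
  have xp : 0 < x by exact: lt_le_trans Dx.
  apply: ler_pM; [by rewrite invr_ge0 ltW|exact: bper_ge0 (bper_Fop gH kH1 p1 pv)|by rewrite lef_pV2|exact: FMle].
have M0 : 0 <= M by exact: le_trans P0 PM.
have [CQ CQ0 HQ] := qform_dist T0 okG M0.
have psM' j t : ps j t <= M by exact: le_trans (psP j t) PM.
pose psi t := N^-1 * F a t; pose psi' t := N'^-1 * F b t.
have evt e : 0 < e -> exists j, [/\ forall t, `|V j t - a t| <= e, forall t, `|V j.+1 t - b t| <= e,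
    `|n j - N| <= e, `|n j.+1 - N'| <= e & `|qform G (ps j.+2) (ps j.+1) - 1| <= e].
  move=> e0; have [K HK] := ov e e0.
  have UK : U [set j | (K <= j)%N] by apply: sU; exists K.
  have [j [[h1 h2] [[h3 h4] h5]]] :=
    filter_ex (filterI (filterI (aU e e0) (bU e e0)) (filterI (filterI (NU e e0) (N'U e e0)) UK)).
  exists j; split => //.
  by apply: HK; exact: leqW.
have c1 e j : (forall t, `|V j t - a t| <= e) -> `|n j - N| <= e -> forall t, `|ps j.+1 t - psi t| <= C1 * e.
  move=> h1 h2 t; rewrite psE; have /andP[nD _] := nb j.
  exact: (close _ _ _ _ e (pV j) pa (Vb j) am nD ND h2 h1).
have c2 e j : (forall t, `|V j.+1 t - b t| <= e) -> `|n j.+1 - N'| <= e -> forall t, `|ps j.+2 t - psi' t| <= C1 * e.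
  move=> h1 h2 t; rewrite psE; have /andP[nD _] := nb j.+1.
  exact: (close _ _ _ _ e (pV j.+1) pb (Vb j.+1) bm nD N'D h2 h1).
have psiM := psM a N pa am ND; have psi'M := psM b N' pb bm N'D.
have bE t : b t = cvl G psi t.
  apply/eqP; rewrite -subr_eq0; apply/eqP; apply: (@lim_eq0 _ _ (1 + knorm G * C1)) => e e0.
  have [j [h1 h2 h3 h4 h5]] := evt e e0.
  have h6 := cvl_dist t okG (bper_bfun (pps j.+1)) (bper_bfun ppsi) (c1 e j h1 h3).
  rewrite -VE in h6; have := h2 t; rewrite distrC => h7.
  rewrite (_ : b t - cvl G psi t = (b t - V j.+1 t) + (V j.+1 t - cvl G psi t)); last by ring.
  apply: le_trans (ler_normD _ _) _; rewrite mulrDl mul1r -mulrA.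
  exact: lerD h7 h6.
have q1 : qform G psi psi = 1.
  apply/eqP; rewrite -subr_eq0; apply/eqP; apply: (@lim_eq0 _ _ (CQ * C1)) => e e0.
  have [j [h1 h2 h3 h4 h5]] := evt e e0; have h := c1 e j h1 h3.
  rewrite -[1 in X in `|X| <= _](qps j.+1) distrC -mulrA.
  exact: (HQ _ _ _ _ (C1 * e) (pps j.+1) (pps j.+1) ppsi ppsi (psM' _) (psM' _) psiM psiM h h).
have q2 : qform G psi' psi' = 1.
  apply/eqP; rewrite -subr_eq0; apply/eqP; apply: (@lim_eq0 _ _ (CQ * C1)) => e e0.
  have [j [h1 h2 h3 h4 h5]] := evt e e0; have h := c2 e j h2 h4.
  rewrite -[1 in X in `|X| <= _](qps j.+2) distrC -mulrA.
  exact: (HQ _ _ _ _ (C1 * e) (pps j.+2) (pps j.+2) ppsi' ppsi' (psM' _) (psM' _) psi'M psi'M h h).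
have q3 : qform G psi' psi = 1.
  apply/eqP; rewrite -subr_eq0; apply/eqP; apply: (@lim_eq0 _ _ (CQ * C1 + 1)) => e e0.
  have [j [h1 h2 h3 h4 h5]] := evt e e0; have h := c2 e j h2 h4; have h' := c1 e j h1 h3.
  have h6 := HQ _ _ _ _ (C1 * e) (pps j.+2) (pps j.+1) ppsi' ppsi (psM' _) (psM' _) psi'M psiM h h'.
  rewrite distrC in h6; rewrite mulrDl mul1r -mulrA.
  rewrite (_ : qform G psi' psi - 1 = (qform G psi' psi - qform G (ps j.+2) (ps j.+1)) + (qform G (ps j.+2) (ps j.+1) - 1)); last by ring.
  apply: le_trans (ler_normD _ _) _; exact: lerD h6 h5.
exists b, N'; split; [exact: pb|exact: bm|exact: N'D|split; last exact: q2].
move=> t; rewrite bE (cvl_eq_of_overlap ppsi ppsi' q1 q2 q3).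
by rewrite (cvlZ t okG (bper_bfun pFb) N'i).
Qed.

Theorem periodic_solution : exists v N X m, [/\ bper v, 0 < m, forall t, m <= v t <= X, D0 <= N &
  (forall t, v t = N^-1 * cvl G (F v) t) /\
  qform G (fun t => N^-1 * F v t) (fun t => N^-1 * F v t) = 1].
Proof.
have [X X1 VX] := vs_bounded T0 gH kH1 kH0 cH0 gG kG1 kG0 cG0 p1 D00 adm0 sub.
have [m m0 Vm] := vs_low T0 gH kH1 gG kG1 p1 D00 adm0 X1 VX.
have [P0 P00 psP] := psis_bounded T0 gH kH1 gG kG1 p1 D00 adm0 X1 VX.
have [E HE] := energy_bounded T0 gH kH1 gG kG1 p1 D00 adm0 X1 VX.
have nE := nrm_bounded T0 gH kH1 gG kG1 p1 D00 adm0 HE.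
have nD := nrm_ge T0 gH kH1 gG kG1 p1 D00 adm0.
have ov := overlap_cvg T0 gH kH1 gG kG1 p1 D00 adm0 HE.
have pps := bper_psis T0 gH kH1 gG kG1 p1 D00 adm0.
have pV := bper_vs T0 gH kH1 gG kG1 p1 D00 adm0.
have qps j : qform G (psis T H G p psi0 j) (psis T H G p psi0 j) = 1.
  by have [] := psis_admissible T0 gH kH1 gG kG1 p1 D00 adm0 j.
have nb j : D0 <= nrm T H G p (vs T H G p psi0 j) <= 2 * E by rewrite nD nE.
have Vb j t : m <= vs T H G p psi0 j t <= X by rewrite Vm VX.
have [v [N [pv vm ND [vE q1]]]] :=
  limit_solution pps qps (vsE T H G p psi0) pV nb (psisS T H G p psi0) m0 Vb psP ov.
by exists v, N, X, m.
Qed.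

End solution.

Lemma half_weight (R : realType) (N C w : R) : 0 < N -> 0 <= C -> 0 <= w ->
  N^-1 * (N / (2 * (C + 1)) * (C * w)) <= w / 2.
Proof.
move=> N0 C0 w0; rewrite (_ : N^-1 * (N / (2 * (C + 1)) * (C * w)) = (C / (C + 1)) * (w / 2)); last first.
  by field; rewrite !gt_eqF//; lra.
by rewrite ler_piMl ?divr_ge0// ler_pdivrMr; lra.
Qed.

(** * First and second differences of the profile *)

Section regularity.
Context {R : realType}.
Implicit Types (v w f : R -> R) (t h : R).

(** The supremum S satisfies S <= S/2 + c; the crude bound w0 serves only to make S finite. *)
Lemma absorb (f : R -> R) (w0 c : R) : (forall t, f t <= w0) ->
  (forall x : R, (forall t, f t <= x) -> forall t, f t <= x / 2 + c) -> forall t, f t <= 2 * c.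
Proof.
move=> fw H t.
have hs : has_sup (range f).
  by split; [exists (f 0); exists 0|exists w0 => _ [s _ <-]].
have fS s : f s <= sup (range f) by apply: (ub_le_sup hs.2); exists s.
have : sup (range f) <= sup (range f) / 2 + c.
  by apply: ge_sup; [case: hs|move=> _ [s _ <-]; exact: H].
by have := fS t; move: (sup _) => S; lra.
Qed.

Lemma cvl_shift k w t h : cvl k w (t + h) = cvl k (fun s => w (s + h)) t.
Proof. by rewrite !cvlE; apply: eq_wint => r; rewrite addrAC. Qed.

Lemma Fop_shift H p v t h : Fop H p v (t + h) = Fop H p (fun s => v (s + h)) t.
Proof. by rewrite !FopE cvl_shift. Qed.

Lemma powR_second_diff p (m M : R) : 0 < m -> m <= M -> exists2 K, 0 <= K &
  forall a b c, m <= a <= M -> m <= b <= M -> m <= c <= M ->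
  `|b `^ p + c `^ p - 2 * a `^ p| <= K * (`|b + c - 2 * a| + (b - a) ^+ 2 + (c - a) ^+ 2).
Proof.
move=> m0 mM; have [K K0 HK] := powR_taylor p m0 mM.
pose A := `|p| * (M `^ (p - 1) + m `^ (p - 1)).
have A0 : 0 <= A by rewrite mulr_ge0// addr_ge0 ?powR_ge0.
exists (K + A); first by rewrite addr_ge0.
move=> a b c ha hb hc; have h1 := HK a b ha hb; have h2 := HK a c ha hc.
have /andP[ma aM] := ha; have a0 : 0 < a by exact: lt_le_trans ma.
have ap : a `^ (p - 1) <= M `^ (p - 1) + m `^ (p - 1).
  have [q0|/ltW q0] := leP 0 (p - 1).
    have : a `^ (p - 1) <= M `^ (p - 1).
      by apply: ge0_ler_powR => //; rewrite nnegrE; lra.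
    by have := powR_ge0 m (p - 1); lra.
  have : a `^ (p - 1) <= m `^ (p - 1) by rewrite -[p - 1]opprK ler_powRN// oppr_ge0.
  by have := powR_ge0 M (p - 1); lra.
have h3 : `|p * a `^ (p - 1) * (b + c - 2 * a)| <= A * `|b + c - 2 * a|.
  by rewrite !normrM (ger0_norm (powR_ge0 _ _)) ler_wpM2r// ler_wpM2l.
have n1 := normr_ge0 (b + c - 2 * a); have n2 := sqr_ge0 (b - a); have n3 := sqr_ge0 (c - a).
have e1 : b `^ p + c `^ p - 2 * a `^ p = (b `^ p - a `^ p - p * a `^ (p - 1) * (b - a)) +
   (c `^ p - a `^ p - p * a `^ (p - 1) * (c - a)) + p * a `^ (p - 1) * (b + c - 2 * a) by ring.
rewrite e1; apply: le_trans (ler_normD _ _) _; apply: le_trans (lerD (ler_normD _ _) (lexx _)) _.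
apply: le_trans (lerD (lerD h1 h2) h3) _.
move: (`|b + c - 2 * a|) ((b - a) ^+ 2) ((c - a) ^+ 2) n1 n2 n3 => x y z x0 y0 z0.
have := mulr_ge0 K0 x0; have := mulr_ge0 A0 y0; have := mulr_ge0 A0 z0; lra.
Qed.

Lemma second_diff_mul (f g f1 g1 f2 g2 a b c d N M : R) :
  `|f1 + f2 - 2 * f| <= a -> `|g1 + g2 - 2 * g| <= b -> `|g| <= N -> `|f| <= M ->
  `|f1 - f| <= c -> `|f2 - f| <= c -> `|g1 - g| <= d -> `|g2 - g| <= d ->
  `|f1 * g1 + f2 * g2 - 2 * (f * g)| <= a * N + M * b + 2 * (c * d).
Proof.
move=> h1 h2 h3 h4 h5 h6 h7 h8.
have -> : f1 * g1 + f2 * g2 - 2 * (f * g) = (f1 + f2 - 2 * f) * g + f * (g1 + g2 - 2 * g) +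
  ((f1 - f) * (g1 - g) + (f2 - f) * (g2 - g)) by ring.
apply: le_trans (ler_normD _ _) _; apply: lerD.
  by apply: le_trans (ler_normD _ _) _; rewrite !normrM; apply: lerD; apply: ler_pM.
apply: le_trans (ler_normD _ _) _; rewrite !normrM mulr_natl mulr2n.
by apply: lerD; apply: ler_pM.
Qed.

Variables (T : R) (H G : R -> R) (kapH cH kapG cG p : R).
Hypotheses (T0 : 0 < T) (gH : goodk kapH cH H) (kH1 : kapH < 1) (gG : goodk kapG cG G) (kG1 : kapG < 1) (p1 : 1 < p).
Local Notation okH := (goodk_ker gH kH1).
Local Notation F := (Fop H p).
Local Notation bper := (bper T).
Variables (v : R -> R) (N X m : R).
Hypotheses (pv : bper v) (m0 : 0 < m) (vm : forall t, m <= v t <= X) (N0 : 0 < N).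
Hypothesis vE : forall t, v t = N^-1 * cvl G (F v) t.

(** If w bounds the difference of v at step h, then CF w bounds that of F(v), and [cvl_smooth]
    returns at most w/2 plus a multiple of |h|. The bound w improves itself until w is of order
    |h|. *)
Lemma solution_lipschitz : exists2 C, 0 <= C & forall h, `|h| <= 1 -> forall t, `|v (t + h) - v t| <= C * `|h|.
Proof.
have mX : m <= X by have /andP[a b] := vm 0; exact: le_trans b.
have [CF CF0 HF] := Fop_dist T okH p1 m0 mX.
have bF := bper_bfun (bper_Fop gH kH1 p1 pv).
have [FM FM0 HFM] := bfun_bound bF.
(* Chosen so that e CF / N <= 1/2, the factor needed by [absorb]. *)
pose e := N / (2 * (CF + 1)); have e0 : 0 < e by rewrite divr_gt0// mulr_gt0//; lra.
have [K K0 HK] := cvl_smooth gG kG1 e0.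
exists (2 * (N^-1 * K * FM)); first by rewrite !mulr_ge0// invr_ge0 ltW.
move=> h h1 t; have [H1 _] := HK (F v) FM bF HFM h h1.
rewrite -(mulrA 2); apply: (@absorb (fun t => `|v (t + h) - v t|) X _ _ _ t) => [s|w Hw s].
  by have /andP[? ?] := vm s; have /andP[? ?] := vm (s + h); rewrite ler_norml; have := m0; lra.
have Fw r : `|F v (r + h) - F v r| <= CF * w.
  rewrite Fop_shift; apply: (HF (fun s => v (s + h)) v w (bper_shift h pv) pv) => //.
have := H1 _ Fw s => h2.
rewrite (vE (s + h)) (vE s) -mulrBr normrM gtr0_norm ?invr_gt0//.
have Ni : 0 <= N^-1 by rewrite invr_ge0 ltW.
apply: le_trans (ler_wpM2l Ni h2) _; rewrite mulrDr; apply: lerD.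
  have w0 : 0 <= w by exact: le_trans (Hw 0).
  exact: half_weight.
by rewrite (_ : N^-1 * K * FM * `|h| = N^-1 * (K * `|h| * FM))//; ring.
Qed.

(** The same absorption for second differences. The nonlinearity also produces squares of first
    differences, which [solution_lipschitz] has already made of order h^2. *)
Lemma solution_second_diff : exists2 C, 0 <= C & forall h, `|h| <= 1 -> forall t,
  `|v (t + h) - v t| <= C * `|h| /\ `|v (t + h) + v (t - h) - 2 * v t| <= C * h ^+ 2.
Proof.
have [L L0 HL] := solution_lipschitz.
have mX : m <= X by have /andP[a b] := vm 0; exact: le_trans b.
have X0 : 0 < X by exact: lt_le_trans mX.
have [A A0 HA] := powR_second_diff p m0 mX.
have [B B0 HB] := powR_second_diff (p - 1) m0 mX.
have [A' A'0 HA'] := powR_lipschitz p m0 mX.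
have [B' B'0 HB'] := powR_lipschitz (p - 1) m0 mX.
have kn := knorm_ge0 okH.
have bF := bper_bfun (bper_Fop gH kH1 p1 pv).
have [FM FM0 HFM] := bfun_bound bF.
have p0' := p_ge0 p1; have p10' := p1_ge0 p1.
(* CA multiplies the second difference being absorbed; CB collects the terms quadratic in first
   differences. *)
pose CA := knorm H * A * X `^ (p - 1) + knorm H * X `^ p * B.
have CA0 : 0 <= CA by rewrite addr_ge0// !mulr_ge0 ?powR_ge0.
pose CB := CA * (2 * L ^+ 2) + 2 * (knorm H * (A' * L) * (B' * L)).
have CB0 : 0 <= CB.
  by rewrite addr_ge0 ?mulr_ge0 ?sqr_ge0.
pose e := N / (2 * (CA + 1)); have e0 : 0 < e by rewrite divr_gt0// mulr_gt0//; lra.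
have [K K0 HK] := cvl_smooth gG kG1 e0.
have Ni : 0 <= N^-1 by rewrite invr_ge0 ltW.
pose C2 := N^-1 * (e * CB + K * FM).
have C20 : 0 <= C2 by exact: mulr_ge0 Ni (addr_ge0 (mulr_ge0 (ltW e0) CB0) (mulr_ge0 K0 FM0)).
exists (Num.max L (2 * C2)); first by rewrite le_max L0.
move=> h h1 t; split.
  by apply: le_trans (HL h h1 t) _; rewrite ler_wpM2r// le_max lexx.
apply: (@le_trans _ _ (2 * C2 * h ^+ 2)); last by rewrite ler_wpM2r ?sqr_ge0// le_max lexx orbT.
have hN : `|- h| <= 1 by rewrite normrN.
have [_ H2] := HK (F v) FM bF HFM h h1.
have bv := bper_bfun pv; have bvp := bfun_powR p0' bv.
have up (x q : R) : 0 <= q -> m <= x <= X -> x `^ q <= X `^ q.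
  by move=> q0 /andP[mx xM]; apply: ge0_ler_powR => //; rewrite nnegrE; have := m0; lra.
have h20 := sqr_ge0 h.
have hh : `|h| ^+ 2 = h ^+ 2 by rewrite real_normK ?num_real.
have d1 s : (v (s + h) - v s) ^+ 2 <= L ^+ 2 * h ^+ 2.
  rewrite -[leLHS]real_normK ?num_real// -hh -exprMn ler_pXn2r ?nnegrE ?mulr_ge0//; exact: HL.
have d2 s : (v (s - h) - v s) ^+ 2 <= L ^+ 2 * h ^+ 2.
  rewrite -[leLHS]real_normK ?num_real// -hh -exprMn ler_pXn2r ?nnegrE ?mulr_ge0//.
  by have := HL _ hN s; rewrite normrN.
rewrite -(mulrA 2); apply: (@absorb (fun t => `|v (t + h) + v (t - h) - 2 * v t|) (4 * X) _ _ _ t) => [s|w Hw s].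
  have /andP[? ?] := vm s; have /andP[? ?] := vm (s + h); have /andP[? ?] := vm (s - h).
  by rewrite ler_norml; have := m0; lra.
have w0 : 0 <= w by exact: le_trans (Hw 0).
have S1 r : `|v (r + h) `^ p + v (r - h) `^ p - 2 * v r `^ p| <= A * (w + 2 * L ^+ 2 * h ^+ 2).
  apply: le_trans (HA _ _ _ (vm r) (vm (r + h)) (vm (r - h))) _; rewrite ler_wpM2l//.
  by have := Hw r; have := d1 r; have := d2 r; lra.
have S2 r : `|v (r + h) `^ (p - 1) + v (r - h) `^ (p - 1) - 2 * v r `^ (p - 1)| <= B * (w + 2 * L ^+ 2 * h ^+ 2).
  apply: le_trans (HB _ _ _ (vm r) (vm (r + h)) (vm (r - h))) _; rewrite ler_wpM2l//.
  by have := Hw r; have := d1 r; have := d2 r; lra.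
have D1 h' r : `|h'| <= 1 -> `|v (r + h') `^ p - v r `^ p| <= A' * (L * `|h'|).
  by move=> h'1; apply: le_trans (HA' _ _ (vm _) (vm _)) _; rewrite ler_wpM2l// HL.
have D2 h' r : `|h'| <= 1 -> `|v (r + h') `^ (p - 1) - v r `^ (p - 1)| <= B' * (L * `|h'|).
  by move=> h'1; apply: le_trans (HB' _ _ (vm _) (vm _)) _; rewrite ler_wpM2l// HL.
have bs h' : bfun (fun s => v (s + h') `^ p) by apply: (bfun_powR p0'); have [] := bper_shift h' pv.
have Fw r : `|F v (r + h) + F v (r - h) - 2 * F v r| <= CA * w + CB * h ^+ 2.
  rewrite !FopE.
  have c1 : `|cvl H (fun s => v s `^ p) (r + h) + cvl H (fun s => v s `^ p) (r - h) - 2 * cvl H (fun s => v s `^ p) r|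
      <= knorm H * (A * (w + 2 * L ^+ 2 * h ^+ 2)).
    rewrite !cvl_shift -(cvlD r okH (bs h) (bs (- h))) -(cvlZ r okH bvp (ler0n _ 2)).
    exact: (cvl_dist r okH (bfunD (bs h) (bs (- h))) (bfunZ (ler0n _ 2) bvp) S1).
  have c2 h' : `|h'| <= 1 -> `|cvl H (fun s => v s `^ p) (r + h') - cvl H (fun s => v s `^ p) r| <= knorm H * (A' * (L * `|h'|)).
    by move=> h'1; rewrite cvl_shift; exact: (cvl_dist r okH (bs h') bvp (fun s => D1 h' s h'1)).
  have n1 : `|v r `^ (p - 1)| <= X `^ (p - 1) by rewrite ger0_norm ?powR_ge0//; exact: up.
  have n2 : `|cvl H (fun s => v s `^ p) r| <= knorm H * X `^ p.
    rewrite ger0_norm; last exact: (cvl_ge0 r okH bvp).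
    by apply: (cvl_bound r okH bvp) => z; exact: up.
  have c2N := c2 _ hN; have D2N := D2 _ r hN; rewrite normrN in c2N D2N.
  apply: le_trans (second_diff_mul c1 (S2 r) n1 n2 (c2 h h1) c2N (D2 h r h1) D2N) _.
  by rewrite le_eqVlt; apply/orP; left; apply/eqP; rewrite /CB /CA -hh; ring.
have := H2 _ Fw s => h3.
rewrite (vE (s + h)) (vE (s - h)) (vE s) (mulrCA 2) -mulrDr -mulrBr normrM gtr0_norm ?invr_gt0//.
apply: le_trans (ler_wpM2l Ni h3) _.
have -> : N^-1 * (e * (CA * w + CB * h ^+ 2) + K * h ^+ 2 * FM) = N^-1 * (e * (CA * w)) + C2 * h ^+ 2.
  by rewrite /C2; ring.
rewrite lerD2r.
exact: half_weight.
Qed.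

End regularity.

(** * Initial profile and nonconstancy *)

Section initial_data.
Context {R : realType}.
Implicit Types (k w : R -> R) (t T : R).

Lemma wint_ae_le k1 k2 w1 w2 (C : R) : kerOK k1 -> kerOK k2 -> bfun w1 -> bfun w2 -> 0 <= C ->
  (forall r, r != 0 -> k1 r * w1 r <= C * (k2 r * w2 r)) -> wint k1 w1 <= C * wint k2 w2.
Proof.
move=> ok1 ok2 b1 b2 C0 h; have [m1 p1 _] := ok1; have [m2 p2 _] := ok2.
have [n1 q1 _] := b1; have [n2 q2 _] := b2.
rewrite -lee_fin EFinM -(wintE ok1 b1) -(wintE ok2 b2) -gintZl; first last.
- exact: C0.
- by move=> r; rewrite lee_fin mulr_ge0.
- by mfun.
apply: ae_ge0_le_integral => //.
- by move=> r _; rewrite lee_fin mulr_ge0.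
- by mfun.
- by move=> r _; rewrite -EFinM lee_fin mulr_ge0// mulr_ge0.
- by mfun.
by apply: aeR_imp (ae_neqR 0) => r r0 _; rewrite -EFinM lee_fin h.
Qed.

(** One unit interval in each period. For T >= 1 the indicator has mass one over a period, so
    estimates for it are uniform in T. *)
Definition teeth T : set R := [set t | exists z : int, z%:~R * T <= t < z%:~R * T + 1].

Definition chi T t : R := \1_(teeth T) t.

Lemma measurable_teeth T : measurable (teeth T).
Proof.
rewrite (_ : teeth T = \bigcup_(z in [set: int]) `[z%:~R * T, z%:~R * T + 1[%classic).
  by apply: countable_bigcupT_measurable => [|z]; [exact: countableP|exact: measurable_itv].
apply/seteqP; split => t /=.
  by move=> [z hz]; exists z => //=; rewrite in_itv.
by move=> [z _ /=]; rewrite in_itv/= => hz; exists z.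
Qed.

Lemma chiP T t : chi T t = 0 \/ (chi T t = 1 /\ teeth T t).
Proof.
rewrite /chi indicE; case: (boolP (t \in teeth T)) => h; [right|left] => //.
by split => //; rewrite inE in h.
Qed.

Lemma bper_chi T : bper T (chi T).
Proof.
split; first split.
- by apply: measurable_indic; exact: measurable_teeth.
- by move=> t; rewrite /chi.
- by exists 1 => t; case: (chiP T t) => [->|[-> _]].
- move=> t; rewrite /chi !indicE; congr (nat_of_bool _)%:R.
  apply/idP/idP; rewrite !inE => -[z hz].
    by exists (z - 1); move: hz; rewrite intrB mulrBl mul1r; lra.
  by exists (z + 1); move: hz; rewrite intrD mulrDl mul1r; lra.
Qed.

Lemma per_chi T : 1 <= T -> per T (chi T) = 1.
Proof.
move=> T1; have T0 : 0 < T by lra.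
have J01 := box_ker (0 : R) 1; have J0T := box_ker (0 : R) T.
have bc := bper_bfun (bper_chi T); have b1 := bfun_cst (@ler01 R).
have E r : box 0 T r * chi T r = box 0 1 r * cst 1 r.
  rewrite !boxE mulr1; case: (boolP (0 <= r < T)) => [/andP[r0 rT]|h]; last first.
    rewrite mul0r; case: (boolP (0 <= r < 1)) => // /andP[r0 r1]; exfalso; move/negP: h; apply.
    by apply/andP; split; lra.
  rewrite mul1r; case: (boolP (0 <= r < 1)) => h.
    rewrite /chi indicE mem_set//; exists 0; rewrite mul0r add0r; exact: h.
  case: (chiP T r) => [->//|[_ [z /andP[z1 z2]]]]; exfalso.
  have [z0|z0] := leP 1 z.
    have : 1 <= z%:~R :> R by rewrite (ler_int _ 1).
    by move=> z0'; have := ler_wpM2r (ltW T0) z0'; lra.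
  have [z3|z3] := leP 0 z.
    have z4 : z = 0 by lia.
    by move/negP: h; apply; rewrite z4 mul0r in z1 z2; apply/andP; split; lra.
  have : z%:~R <= -1 :> R by rewrite (ler_int _ _ (-1)); lia.
  by move=> z0'; have := ler_wpM2r (ltW T0) z0'; lra.
Transparent per.
rewrite /per; apply/eqP; rewrite eq_le; apply/andP; split.
Opaque per.
  have := wint_gen_le J0T J01 bc b1 (@ler01 R) (fun r => ltac:(by rewrite mul1r E)).
  by rewrite mul1r (wint_cst J01 ler01) knorm_box// subr0 mulr1.
have := wint_gen_le J01 J0T b1 bc (@ler01 R) (fun r => ltac:(by rewrite mul1r E)).
by rewrite mul1r (wint_cst J01 ler01) knorm_box// subr0 mulr1.
Qed.

(** A point of a tooth is within distance one of the whole tooth, where the kernel is bounded below;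
    [del] therefore does not depend on T. *)
Lemma cvl_chi_low kap c k : goodk kap c k -> kap < 1 -> exists2 del, 0 < del &
  forall T t, del * chi T t <= cvl k (chi T) t.
Proof.
move=> gk k1; have ok := goodk_ker gk k1; have [del d0 Hd] := gk_low gk 1.
exists del => // T t; have bc := bper_bfun (bper_chi T).
case: (chiP T t) => [->|[-> [z /andP[z1 z2]]]]; first by rewrite mulr0; exact: cvl_ge0.
rewrite mulr1 (cvl_corr t ok (gk_even gk) bc).
have bs := bfun_shift t bc.
have Jok := box_ker (z%:~R * T - t) (z%:~R * T + 1 - t).
have bd := bfun_cst (ltW d0).
have := wint_ae_le Jok ok bd bs (@ler01 R).
rewrite (wint_cst Jok (ltW d0)) knorm_box; last by lra.
rewrite (_ : z%:~R * T + 1 - t - (z%:~R * T - t) = 1); last by ring.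
rewrite !mul1r; apply => r r0; rewrite boxE mul1r.
have [_ k0 _] := ok; have [_ c0 _] := bs.
case: (boolP (_ <= r < _)) => [/andP[h1 h2]|_]; last by rewrite mul0r mulr_ge0.
rewrite mul1r [chi _ _]/chi indicE mem_set; last by exists z; apply/andP; split; lra.
by rewrite mulr1; apply: Hd => //; rewrite ler_norml; apply/andP; split; lra.
Qed.

Section initial_profile.
Variables (H G : R -> R) (kapH cH kapG cG p : R).
Hypotheses (gH : goodk kapH cH H) (kH1 : kapH < 1).
Hypotheses (gG : goodk kapG cG G) (kG1 : kapG < 1) (p1 : 1 < p).
Local Notation okH := (goodk_ker gH kH1).
Local Notation okG := (goodk_ker gG kG1).

Lemma chi_sqr T t : chi T t * chi T t = chi T t.
Proof. by case: (chiP T t) => [->|[-> _]]; rewrite ?mul0r ?mulr1. Qed.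

Lemma chi_powR T t : chi T t `^ p = chi T t.
Proof. by case: (chiP T t) => [->|[-> _]]; [rewrite powR0// gt_eqF//; have := p1; lra|rewrite powR1]. Qed.

Lemma chi_ge0 T t : 0 <= chi T t.
Proof. exact: bper_ge0 (bper_chi T). Qed.

Lemma qform_chi_low k del T : kerOK k -> 0 < del -> 1 <= T ->
  (forall t, del * chi T t <= cvl k (chi T) t) -> del <= qform T k (chi T) (chi T).
Proof.
move=> ok d0 T1 h; have bc := bper_bfun (bper_chi T).
rewrite qformE -[leLHS]mulr1 -(per_chi T1) -(perZ T bc (ltW d0)).
apply: (per_le T (bfunZ (ltW d0) bc) (bfunM bc (bfun_cvl ok bc))) => t.
by rewrite -{1}chi_sqr mulrCA; apply: ler_wpM2l; [exact: chi_ge0|exact: h].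
Qed.

Lemma qform_chi_up T k : kerOK k -> 1 <= T -> qform T k (chi T) (chi T) <= knorm k.
Proof.
move=> ok T1; have bc := bper_bfun (bper_chi T).
rewrite qformE -[leRHS]mulr1 -(per_chi T1) -(perZ T bc (knorm_ge0 ok)).
apply: (per_le T (bfunM bc (bfun_cvl ok bc)) (bfunZ (knorm_ge0 ok) bc)) => t.
rewrite mulrC; apply: ler_wpM2r; first exact: chi_ge0.
rewrite -[leRHS]mulr1; apply: (cvl_bound t ok bc) => s.
by case: (chiP T s) => [->|[-> _]].
Qed.

Lemma inv_sqrt_bounds (q K : R) : 0 < q -> q <= K ->
  [/\ 0 < (Num.sqrt K)^-1, (Num.sqrt K)^-1 <= (Num.sqrt q)^-1 &
    (Num.sqrt q)^-1 * (Num.sqrt q)^-1 * q = 1].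
Proof.
move=> q0 qK; have K0 : 0 < K by exact: lt_le_trans qK.
have sq : 0 < Num.sqrt q by rewrite sqrtr_gt0.
have sK : 0 < Num.sqrt K by rewrite sqrtr_gt0.
split; first by rewrite invr_gt0.
  by rewrite lef_pV2 ?posrE//; exact: ler_wsqrtr.
rewrite -[X in _ * X](sqr_sqrtr (ltW q0)) expr2 mulrACA mulVf ?gt_eqF// mulr1 //.
Qed.

(** The form of G at the indicator lies between dG and [knorm G]. The upper bound keeps the
    normalising factor away from zero, hence also the energy, by a constant D0 independent of T. *)
Lemma initial_profile : exists2 D0, 0 < D0 & forall T, 1 <= T ->
  exists psi, admissible T H G p D0 psi.
Proof.
have [dG dG0 lowG] := cvl_chi_low gG kG1; have [dH dH0 lowH] := cvl_chi_low gH kH1.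
have p0 := p_ge0 p1.
exists (((Num.sqrt (knorm G))^-1 * dG) `^ p * ((Num.sqrt (knorm G))^-1 * dG) `^ p * dH).
  have kG0 : 0 < knorm G.
    exact: lt_le_trans dG0 (le_trans (qform_chi_low okG dG0 (lexx 1) (lowG 1)) (qform_chi_up okG (lexx 1))).
  have h : 0 < (Num.sqrt (knorm G))^-1 * dG by rewrite mulr_gt0// invr_gt0 sqrtr_gt0.
  by apply: mulr_gt0 => //; apply: mulr_gt0; exact: powR_gt0.
move=> T T1.
have bc := bper_chi T; have fc := bper_bfun bc.
have q1 := qform_chi_low okG dG0 T1 (lowG T); have q2 := qform_chi_up okG T1.
have [c0 cq qE] := inv_sqrt_bounds (lt_le_trans dG0 q1) q2.
have c1 : 0 <= (Num.sqrt (qform T G (chi T) (chi T)))^-1 by rewrite invr_ge0 sqrtr_ge0.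
have bpsi := bperZ c1 bc.
exists (fun t => (Num.sqrt (qform T G (chi T) (chi T)))^-1 * chi T t); split; first exact: bpsi.
  by rewrite (qformZ okG bc bc c1 c1).
have a0 : 0 <= ((Num.sqrt (knorm G))^-1 * dG) `^ p by exact: powR_ge0.
have bv := bper_cvl okG bpsi.
have bw := bperZ a0 bc; have bvp := bper_powR p0 bv.
have vw t : ((Num.sqrt (knorm G))^-1 * dG) `^ p * chi T t <=
    cvl G (fun t => (Num.sqrt (qform T G (chi T) (chi T)))^-1 * chi T t) t `^ p.
  rewrite -[X in _ * X]chi_powR -powRM; [|by rewrite mulr_ge0// ltW|exact: chi_ge0].
  apply: ge0_ler_powR; first exact: p0.
  - by rewrite nnegrE; apply: mulr_ge0; [rewrite mulr_ge0// ltW|exact: chi_ge0].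
  - by rewrite nnegrE; exact: bper_ge0 bv.
  rewrite (cvlZ t okG fc c1) -mulrA.
  exact: (ler_pM (ltW c0) (mulr_ge0 (ltW dG0) (chi_ge0 T t)) cq (lowG T t)).
apply: (@le_trans _ _ (qform T H (fun t => ((Num.sqrt (knorm G))^-1 * dG) `^ p * chi T t)
    (fun t => ((Num.sqrt (knorm G))^-1 * dG) `^ p * chi T t))).
  rewrite (qformZ okH bc bc a0 a0); apply: ler_wpM2l; first exact: mulr_ge0.
  exact: qform_chi_low okH dH0 T1 (lowH T).
rewrite energy_unfold !qformE.
apply: (per_le T (bper_bfun (bperM bw (bper_cvl okH bw))) (bper_bfun (bperM bvp (bper_cvl okH bvp)))) => t.
apply: ler_pM; [exact: bper_ge0 bw|exact: bper_ge0 (bper_cvl okH bw)|exact: vw|].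
exact: (cvl_le t okH (bper_bfun bw) (bper_bfun bvp) vw).
Qed.

(** For a constant profile b and density c, the relations b = KG c and T c b = 1 give b^2 = KG / T,
    and the equation gives N = KH KG b^(2(p-1)). *)
Lemma cst_solution_eq (N KG KH b c T : R) : 0 < N -> 0 < T -> 0 < b -> 0 <= KG -> 0 <= KH ->
  b = KG * c -> T * (c * (KG * c)) = 1 -> N * c = KH * b `^ p * b `^ (p - 1) ->
  N = KH * KG * (KG / T) `^ (p - 1).
Proof.
move=> N0 T0 b0 KG0 KH0 bE Tc NE.
have K1 : KG != 0 by apply/eqP => K0; move: bE b0; rewrite K0 mul0r => ->; rewrite ltxx.
have b2 : KG / T = b * b.
  rewrite bE; apply: (mulIf (lt0r_neq0 T0)); rewrite divfK ?gt_eqF//.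
  by rewrite -[LHS]mulr1 -Tc; ring.
rewrite b2 powRM ?ltW//.
have bp : b `^ p = b * b `^ (p - 1).
  by rewrite -{2}[b]powRr1 ?ltW// -powRD; [congr (_ `^ _); ring|rewrite (gt_eqF b0) implybT].
have cE : c = b / KG by rewrite bE mulrC mulKf.
apply: (mulIf (lt0r_neq0 b0)); move: NE; rewrite cE bp => NE.
have -> : N * b = KG * (N * (b / KG)) by rewrite mulrCA [KG * _]mulrC divfK// mulrC mulrC.
by rewrite NE; ring.
Qed.

Lemma small_energy (KG K D : R) : 0 <= KG -> 0 <= K -> 0 < D ->
  exists T1, forall T, 0 < T -> T1 <= T -> K * (KG / T) `^ (p - 1) < D.
Proof.
move=> KG0 K0 D0; have q0 : 0 < p - 1 by have := p1; lra.
have r0 : 0 < D / (K + 1) by apply: divr_gt0 => //; lra.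
have s0 : 0 < (D / (K + 1)) `^ (p - 1)^-1 by exact: powR_gt0.
exists (KG / (D / (K + 1)) `^ (p - 1)^-1) => T T0 T1.
apply: (@le_lt_trans _ _ (K * (D / (K + 1)))).
  apply: ler_wpM2l => //.
  have rE : D / (K + 1) = ((D / (K + 1)) `^ (p - 1)^-1) `^ (p - 1).
    by rewrite -powRrM mulVf ?gt_eqF// powRr1// ltW.
  rewrite [leRHS]rE; apply: ge0_ler_powR; first exact: ltW.
  - by rewrite nnegrE divr_ge0// ltW.
  - by rewrite nnegrE ltW.
  by rewrite ler_pdivrMr// mulrC -ler_pdivrMr.
rewrite mulrCA -{2}[D]mulr1 ltr_pM2l// ltr_pdivrMr; lra.
Qed.

(** N is at least D0 for every T, whereas a constant profile would have N = KH KG (KG / T)^(p-1). T1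
    is a period beyond which this value is below D0. *)
Theorem delaunay_profiles (kH0 : 0 <= kapH) (cH0 : 0 < cH) (kG0 : 0 <= kapG) (cG0 : 0 < cG) :
  subcritical kapH kapG p -> exists T1, forall T, 1 <= T ->
  exists v N C m, [/\ bper T v, 0 < m, forall t, m <= v t, 0 < N &
    [/\ forall t, N * v t = cvl G (Fop H p v) t, 0 <= C,
        forall h, `|h| <= 1 -> forall t, `|v (t + h) - v t| <= C * `|h| /\
          `|v (t + h) + v (t - h) - 2 * v t| <= C * h ^+ 2 &
        T1 <= T -> ~ exists c, forall t, v t = c]].
Proof.
move=> sub; have [D0 D00 Hadm] := initial_profile.
have [T1 HT1] := small_energy (knorm_ge0 okG)
  (mulr_ge0 (knorm_ge0 okH) (knorm_ge0 okG)) D00.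
exists T1 => T T1'; have T0 : 0 < T by lra.
have [psi0 adm0] := Hadm T T1'.
have [v [N [X [m [pv m0 vm DN [vE q1]]]]]] :=
  periodic_solution T0 gH kH1 kH0 cH0 gG kG1 kG0 cG0 p1 D00 adm0 sub.
have N0 : 0 < N by exact: lt_le_trans DN.
have [C C0 HC] := solution_second_diff gH kH1 gG kG1 p1 pv m0 vm N0 vE.
exists v, N, C, m; split => //; first by move=> t; have /andP[] := vm t.
split => //; first by move=> t; rewrite vE mulVKf// gt_eqF.
move=> TT [b vb]; have vbE : v = cst b by apply/funext => t; rewrite vb.
have b0 : 0 < b by have /andP[+ _] := vm 0; rewrite vb; exact: lt_le_trans.
have p0 := p_ge0 p1.
have bp0 : 0 <= b `^ p by exact: powR_ge0.
have FE : Fop H p v = cst (knorm H * b `^ p * b `^ (p - 1)).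
  apply/funext => t; rewrite FopE vb; congr (_ * _).
  by rewrite -(cvl_cst t okH bp0); congr (cvl H _ t); apply/funext => s; rewrite vb.
have f0 : 0 <= knorm H * b `^ p * b `^ (p - 1).
  by apply: mulr_ge0; [apply: mulr_ge0 => //; exact: knorm_ge0 okH|exact: powR_ge0].
have c0 : 0 <= N^-1 * (knorm H * b `^ p * b `^ (p - 1)) by rewrite mulr_ge0// invr_ge0 ltW.
have := HT1 T T0 TT; apply/negP; rewrite -leNgt.
rewrite -(@cst_solution_eq N (knorm G) (knorm H) b (N^-1 * (knorm H * b `^ p * b `^ (p - 1))) T) //.
- exact: knorm_ge0 okG.
- exact: knorm_ge0 okH.
- by rewrite -[LHS](vb 0) vE FE (cvl_cst 0 okG f0) mulrCA.
- rewrite -[RHS]q1 FE qformE.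
  have c1 : 0 <= N^-1 * (knorm H * b `^ p * b `^ (p - 1)) *
      (knorm G * (N^-1 * (knorm H * b `^ p * b `^ (p - 1)))).
    by apply: mulr_ge0 => //; apply: mulr_ge0 => //; exact: knorm_ge0 okG.
  rewrite -(per_cst T0 c1); apply: eq_per => t.
  by rewrite (cvl_cst t okG c0).
- by rewrite mulVKf// gt_eqF.
Qed.

End initial_profile.

End initial_data.

(** * Regularity of radial functions *)

Section second_difference_regularity.
Context {R : realType}.

Lemma nbhs_dist_le (t r : R) : 0 < r -> \forall x \near t, `|t - x| <= r.
Proof. by move=> r0; apply/nbhs_ballP; exists r => // x /ltW. Qed.

Lemma expansion_is_derive (f : R -> R) (t l K d : R) : 0 < d ->
  (forall h, `|h| <= d -> `|f (t + h) - f t - l * h| <= K * h ^+ 2) ->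
  is_derive (t : R) (1 : R) f l.
Proof.
move=> d0 fl.
have H : (fun h : R => h^-1 *: (f (h *: (1 : R) + t) - f t)) @ 0^' --> l.
  apply/cvgrPdist_le => e e0.
  have K1 : 0 < `|K| + 1 by rewrite ltr_pwDr.
  have r0 : 0 < Num.min d (e / (`|K| + 1)) by rewrite lt_min d0 divr_gt0.
  near=> h.
  have h0 : h != 0 by near: h; exact: nbhs_dnbhs_neq.
  have : `|0 - h| <= Num.min d (e / (`|K| + 1)).
    by near: h; apply: nbhs_dnbhs; exact: nbhs_dist_le.
  rewrite sub0r normrN le_min => /andP[h1 h2].
  rewrite /GRing.scale/= mulr1 [h + t]addrC distrC.
  have -> : h^-1 * (f (t + h) - f t) - l = h^-1 * (f (t + h) - f t - l * h).
    by field.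
  have hn : 0 < `|h| by rewrite normr_gt0.
  rewrite normrM normfV mulrC ler_pdivrMr//.
  apply: le_trans (fl h h1) _.
  have -> : h ^+ 2 = `|h| * `|h| by rewrite -expr2 real_normK ?num_real.
  rewrite mulrA; apply: ler_wpM2r; first exact: ltW.
  have h3 : K * `|h| <= (`|K| + 1) * `|h|.
    by apply: ler_wpM2r; [exact: ltW|have := ler_norm K; lra].
  by apply: le_trans h3 _; rewrite mulrC -ler_pdivlMr.
by apply: DeriveDef; [exact: cvgP H|exact: cvg_lim H].
Unshelve. all: by end_near. Qed.

(** Subtract the chord. If the difference had a positive maximum, necessarily interior, the two
    symmetric points at the distance of the nearer endpoint would violate strict midpoint convexity
    there. *)
Lemma midpoint_convex_chord (f : R -> R) a b t : continuous f ->
  (forall x d, 0 < d -> a <= x - d -> x + d <= b -> 0 < f (x + d) + f (x - d) - 2 * f x) ->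
  a < t -> t < b -> (f t - f a) * (b - a) <= (f b - f a) * (t - a).
Proof.
move=> cf hf at_ tb; have ab : a < b by exact: lt_trans tb.
pose g x := (f x - f a) * (b - a) - (f b - f a) * (x - a).
have cg : {within `[a, b], continuous g}.
  apply: continuous_subspaceT => x.
  apply: cvgB; apply: cvgM; try exact: cvg_cst.
    by apply: cvgB; [exact: cf|exact: cvg_cst].
  by apply: cvgB; [exact: cvg_id|exact: cvg_cst].
have [x xI xmax] := EVT_max (ltW ab) cg.
have ga : g a = 0 by rewrite /g !subrr mulr0 mul0r subrr.
have gb : g b = 0 by rewrite /g subrr.
suff gx : g x <= 0.
  have tI : t \in `[a, b] by rewrite in_itv/= !ltW.
  by have := le_trans (xmax t tI) gx; rewrite /g subr_le0.
rewrite leNgt; apply/negP => gx.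
move: xI; rewrite in_itv/= => /andP[ax xb].
have ax' : a < x by rewrite lt_neqAle ax andbT; apply: contraTneq gx => <-; rewrite ga ltxx.
have xb' : x < b by rewrite lt_neqAle xb andbT; apply: contraTneq gx => ->; rewrite gb ltxx.
pose d := Num.min (x - a) (b - x).
have d0 : 0 < d by rewrite lt_min !subr_gt0 ax' xb'.
have dx : d <= x - a by rewrite /d ge_min lexx.
have db : d <= b - x by rewrite /d ge_min lexx orbT.
have m1 : x + d \in `[a, b] by rewrite in_itv/=; apply/andP; split; lra.
have m2 : x - d \in `[a, b] by rewrite in_itv/=; apply/andP; split; lra.
have h1 := xmax _ m1; have h2 := xmax _ m2.
have ax2 : a <= x - d by lra.
have xb2 : x + d <= b by lra.
have := hf x d d0 ax2 xb2; rewrite -(pmulr_lgt0 _ (_ : 0 < b - a)); last by lra.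
have E : g (x + d) + g (x - d) - 2 * g x = (f (x + d) + f (x - d) - 2 * f x) * (b - a).
  by rewrite /g; ring.
by rewrite -E; lra.
Qed.

Variables (v : R -> R) (C : R).
Hypothesis (C0 : 0 <= C).
Hypothesis (v1 : forall h, `|h| <= 1 -> forall t, `|v (t + h) - v t| <= C * `|h|).
Hypothesis (v2 : forall h, `|h| <= 1 -> forall t, `|v (t + h) + v (t - h) - 2 * v t| <= C * h ^+ 2).

Lemma lipschitz_continuous : continuous v.
Proof.
move=> t; apply/cvgrPdist_le => e e0.
have d0 : 0 < Num.min 1 (e / (C + 1)).
  by rewrite lt_min ltr01 divr_gt0//; have := C0; lra.
near=> x; have : `|t - x| <= Num.min 1 (e / (C + 1)).
  near: x; exact: nbhs_dist_le.
rewrite le_min => /andP[h1 h2]; rewrite distrC.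
have h1' : `|x - t| <= 1 by rewrite distrC.
have := v1 h1' t; rewrite (_ : t + (x - t) = x); last by ring.
move=> /le_trans; apply; rewrite distrC.
move: h2; rewrite ler_pdivlMr; last by have := C0; lra.
by have := normr_ge0 (t - x); lra.
Unshelve. all: by end_near. Qed.

Definition quot t h : R := (v (t + h) - v t) / h.

(** For K > C the function sg v + K (x - t)^2 has positive second differences, so its difference
    quotients from t increase. K is then lowered to C. The sign sg treats v and -v together. *)
Lemma quot_mono (sg : R) t h h' : `|sg| = 1 -> 0 < h' -> h' < h -> h <= 1 ->
  sg * quot t h' + C * h' <= sg * quot t h + C * h.
Proof.
move=> sg1 h0 hh h1.
have main (K : R) : C < K -> sg * quot t h' + K * h' <= sg * quot t h + K * h.
  move=> CK; have K0 : 0 < K by exact: le_lt_trans C0 CK.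
  have cf : continuous (fun x => sg * v x + K * ((x - t) * (x - t))).
    move=> x; apply: cvgD; apply: cvgM; try exact: cvg_cst.
      exact: lipschitz_continuous.
    by apply: cvgM; (apply: cvgB; [exact: cvg_id|exact: cvg_cst]).
  have := @midpoint_convex_chord _ t (t + h) (t + h') cf.
  rewrite (_ : t + h - t = h); last by ring.
  rewrite (_ : t + h' - t = h'); last by ring.
  have hs x d : 0 < d -> t <= x - d -> x + d <= t + h ->
    0 < sg * v (x + d) + K * ((x + d - t) * (x + d - t)) +
    (sg * v (x - d) + K * ((x - d - t) * (x - d - t))) -
    2 * (sg * v x + K * ((x - t) * (x - t))).
    move=> d0 dx xd.
    have d1 : `|d| <= 1 by rewrite gtr0_norm//; lra.
    have h2 := v2 d1 x.
    have -> : sg * v (x + d) + K * ((x + d - t) * (x + d - t)) +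
      (sg * v (x - d) + K * ((x - d - t) * (x - d - t))) -
      2 * (sg * v x + K * ((x - t) * (x - t))) =
      sg * (v (x + d) + v (x - d) - 2 * v x) + K * d ^+ 2 + K * d ^+ 2 by ring.
    have h3 : - (C * d ^+ 2) <= sg * (v (x + d) + v (x - d) - 2 * v x).
      by apply: lerNnormlW; rewrite normrM sg1 mul1r.
    have h4 : C * d ^+ 2 <= K * d ^+ 2 by rewrite ler_wpM2r// ?sqr_ge0// ltW.
    have h5 : 0 < K * d ^+ 2 by rewrite mulr_gt0// exprn_gt0.
    by lra.
  move=> /(_ hs); rewrite ltrDl ltrD2l => /(_ h0 hh).
  rewrite subrr !mulr0 addr0 => h6.
  have h'0 : 0 < h by exact: lt_trans hh.
  rewrite -(ler_pM2r (mulr_gt0 h0 h'0)) /quot.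
  have -> : (sg * ((v (t + h') - v t) / h') + K * h') * (h' * h) =
     (sg * v (t + h') + K * (h' * h') - sg * v t) * h.
    by rewrite mulrDl; have -> : sg * ((v (t + h') - v t) / h') * (h' * h) =
      sg * (v (t + h') - v t) * h; [field; rewrite gt_eqF|ring].
  have -> : (sg * ((v (t + h) - v t) / h) + K * h) * (h' * h) =
     (sg * v (t + h) + K * (h * h) - sg * v t) * h'.
    by rewrite mulrDl; have -> : sg * ((v (t + h) - v t) / h) * (h' * h) =
      sg * (v (t + h) - v t) * h'; [field; rewrite gt_eqF|ring].
  by [].
apply/ler_addgt0Pr => e e0.
have := main (C + e); rewrite ltrDl => /(_ e0).
have : e * h <= e by rewrite ger_pMr//.
have : 0 <= e * h' by rewrite mulr_ge0 ?ltW.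
by lra.
Qed.

Lemma quot_lipschitz t h h' : 0 < h' -> h' <= h -> h <= 1 -> `|quot t h - quot t h'| <= C * (h - h').
Proof.
move=> h0; rewrite le_eqVlt => /orP[/eqP-> _|hh h1]; first by rewrite !subrr normr0 mulr0.
have a := @quot_mono 1 t h h' (normr1 _) h0 hh h1.
have b := @quot_mono (-1) t h h' (normrN1 _) h0 hh h1.
by rewrite ler_norml; apply/andP; split; lra.
Qed.

(** The right derivative: on (0, 1] the expression [quot t h - C * h] decreases in h, so its
    supremum is its limit at 0. *)
Definition slope t : R := sup [set r | exists2 h, 0 < h <= 1 & r = quot t h - C * h].

Lemma quot_slope_pos t h : 0 < h -> h <= 1 -> `|quot t h - slope t| <= C * h.
Proof.
move=> h0 h1.
have key h' : 0 < h' <= 1 -> quot t h' - C * h' <= quot t h + C * h.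
  move=> /andP[h'0 h'1]; have a : 0 <= C * h by exact: (mulr_ge0 C0 (ltW h0)).
  have b : 0 <= C * h' by exact: (mulr_ge0 C0 (ltW h'0)).
  have [l|/ltW l] := leP h' h.
    by have := quot_lipschitz t h'0 l h1; rewrite ler_norml => /andP[? ?]; lra.
  by have := quot_lipschitz t h0 l h'1; rewrite ler_norml => /andP[? ?]; lra.
have ub : ubound [set r | exists2 h, 0 < h <= 1 & r = quot t h - C * h] (quot t h + C * h).
  by move=> _ [h' h'h ->]; exact: key.
have in_ : [set r | exists2 h, 0 < h <= 1 & r = quot t h - C * h] (quot t h - C * h).
  by exists h => //; rewrite h0.
have s1 : slope t <= quot t h + C * h by apply: ge_sup => //; exists (quot t h - C * h).
have s2 : quot t h - C * h <= slope t.
  by apply: ub_le_sup => //; exists (quot t h + C * h).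
by rewrite ler_norml; apply/andP; split; lra.
Qed.

(** For h > 0 this is [quot_slope_pos]; a negative h is reduced to -h through the second difference,
    which costs the factor two. *)
Lemma slope_expansion t h : `|h| <= 1 -> `|v (t + h) - v t - slope t * h| <= 2 * C * h ^+ 2.
Proof.
move=> h1; have [h0|h0|->] := ltgtP h 0; last first.
- by rewrite addr0 subrr mulr0 subr0 normr0 expr0n/= mulr0.
- rewrite gtr0_norm// in h1.
  have -> : v (t + h) - v t - slope t * h = (quot t h - slope t) * h.
    by rewrite /quot mulrBl divfK// gt_eqF.
  have := quot_slope_pos t h0 h1; rewrite normrM [`|h|]gtr0_norm// => /(ler_wpM2r (ltW h0)) h2.
  have : 0 <= C * h ^+ 2 by rewrite mulr_ge0// sqr_ge0.
  by move: h2; rewrite expr2 mulrA; lra.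
have k0 : 0 < - h by rewrite oppr_gt0.
rewrite ltr0_norm// in h1.
have e1 := quot_slope_pos t k0 h1.
have h2 : `|h| <= 1 by rewrite ltr0_norm.
have e2 := v2 h2 t.
have e3 : `|v (t - h) - v t - slope t * (- h)| <= C * h ^+ 2.
  have -> : v (t - h) - v t - slope t * (- h) = (quot t (- h) - slope t) * (- h).
    by rewrite /quot mulrBl divfK// gt_eqF.
  rewrite normrM (gtr0_norm k0); have := ler_wpM2r (ltW k0) e1.
  by rewrite -mulrA mulrNN -expr2.
have -> : v (t + h) - v t - slope t * h =
  (v (t + h) + v (t - h) - 2 * v t) - (v (t - h) - v t - slope t * (- h)) by ring.
by apply: le_trans (ler_normB _ _) _; lra.
Qed.

(** Adding the expansions from t to t + h and back cancels v and leaves h times the difference of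
    slopes. *)
Lemma slope_lipschitz t h : `|h| <= 1 -> `|slope (t + h) - slope t| <= 4 * C * `|h|.
Proof.
have [->|h0] := eqVneq h 0; first by rewrite addr0 subrr normr0 mulr0.
move=> h1; have e1 := slope_expansion t h1.
have h2 : `|- h| <= 1 by rewrite normrN.
have := slope_expansion (t + h) h2; rewrite addrK sqrrN => e2.
have h3 : 0 < `|h| by rewrite normr_gt0.
rewrite -(ler_pM2r h3) -normrM -[leRHS]mulrA -[`|h| * `|h|]expr2 real_normK ?num_real//.
have -> : (slope (t + h) - slope t) * h = (v (t + h) - v t - slope t * h) +
  (v t - v (t + h) - slope (t + h) * (- h)) by ring.
by apply: le_trans (ler_normD _ _) _; lra.
Qed.

Lemma slope_bound t : `|slope t| <= 2 * C.
Proof.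
have e1 := quot_slope_pos t ltr01 (lexx 1).
have := v1 (_ : `|1| <= 1) t; rewrite normr1 => /(_ (lexx _)); rewrite mulr1 => e2.
have -> : slope t = (v (t + 1) - v t) - (quot t 1 - slope t) by rewrite /quot divr1; ring.
by apply: le_trans (ler_normB _ _) _; lra.
Qed.

End second_difference_regularity.

(** * Profiles as functions of the squared radius *)

Section radial_profile.
Context {R : realType}.
Variables (v : R -> R) (C X a : R).
Hypothesis (C0 : 0 <= C).
Hypothesis (v1 : forall h, `|h| <= 1 -> forall t, `|v (t + h) - v t| <= C * `|h|).
Hypothesis (v2 : forall h, `|h| <= 1 -> forall t, `|v (t + h) + v (t - h) - 2 * v t| <= C * h ^+ 2).
Hypothesis (vX : forall t, `|v t| <= X).

(** The variable q is |x|^2, a polynomial in x, so the composition with it needs no derivative of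
    the norm; [a] is half the exponent of |x|. *)
Definition rprof q : R := q `^ (- a) * v (ln q / 2).
Definition rprof' q : R := q `^ (- a - 1) * (slope v C (ln q / 2) / 2 - a * v (ln q / 2)).

Lemma is_derive_rprof q : 0 < q -> is_derive (q : R) (1 : R) rprof (rprof' q).
Proof.
move=> q0.
have ds := expansion_is_derive ltr01 (slope_expansion C0 v1 v2 (ln q / 2)).
have dl : is_derive (q : R) (1 : R) (fun q => ln q / 2) (q^-1 / 2).
  have dln := is_derive1_ln q0.
  have H := is_deriveM dln (is_derive_cst (2^-1 : R) (q : R) (1 : R)).
  by apply: (is_derive_eq H); rewrite /= scaler0 add0r /GRing.scale/= mulrC.
have dv := @is_derive1_comp _ v (fun q => ln q / 2) q _ _ ds dl.
have dp := is_derive1_powR (- a) q0.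
have H := is_deriveM dp dv.
apply: (is_derive_eq H).
rewrite /rprof' /GRing.scale/=.
have -> : q `^ (- a) = q `^ (- a - 1) * q.
  by rewrite -{3}(powRr1 (ltW q0)) -powRD ?subrK// (gt_eqF q0) implybT.
by field; rewrite gt_eqF.
Qed.

Lemma ln_half_lipschitz (q0 q q' : R) : 0 < q0 -> `|q - q0| <= q0 / 4 -> `|q' - q0| <= q0 / 4 ->
  `|ln q / 2 - ln q' / 2| <= q0^-1 * `|q - q'| /\ `|ln q / 2 - ln q' / 2| <= 1.
Proof.
move=> q00; rewrite !ler_norml => /andP[a1 a2] /andP[b1 b2].
have key x y : 3 * q0 / 4 <= y -> y <= x -> x <= 5 * q0 / 4 -> 0 <= ln x / 2 - ln y / 2 <= q0^-1 * (x - y).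
  move=> hy xy hx; have y0 : 0 < y by lra.
  have x0 : 0 < x by lra.
  have r0 : 0 < x / y by rewrite divr_gt0.
  have /andP[e _] := ln_taylor2 r0.
  have h : 0 <= ln x - ln y by rewrite subr_ge0 ler_ln.
  have -> : ln x = ln (x / y) + ln y by rewrite -lnM ?posrE// divfK// gt_eqF.
  apply/andP; split.
      have E : ln (x / y) = ln x - ln y by rewrite ln_div ?posrE.
    by rewrite E; lra.
  rewrite -(@ler_pM2l _ q0)// mulVKf ?gt_eqF//.
  have e2 : x / y - 1 <= (x - y) / (3 * q0 / 4).
    have -> : x / y - 1 = (x - y) / y by rewrite mulrBl divff// gt_eqF.
    by apply: ler_wpM2l; [lra|rewrite lef_pV2// posrE; lra].
  have e3 : q0 * ((x - y) / (3 * q0 / 4)) = (x - y) * (4 / 3) by field; rewrite gt_eqF.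
  have e4 : q0 * ln (x / y) <= q0 * ((x - y) / (3 * q0 / 4)) by rewrite ler_pM2l//; lra.
  lra.
have lin x y : x - y <= q0 / 2 -> q0^-1 * (x - y) <= 1.
  by move=> h; rewrite mulrC ler_pdivrMr//; lra.
have [l|/ltW l] := leP q' q.
  have /andP[e1 e2] : 0 <= ln q / 2 - ln q' / 2 <= q0^-1 * (q - q') by apply: key; lra.
  rewrite [`|q - q'|]ger0_norm ?subr_ge0//; split; rewrite ?ler_norml; apply/andP; split.
  - by lra.
  - exact: e2.
  - by lra.
  - by apply: le_trans e2 (lin _ _ _); lra.
have /andP[e1 e2] : 0 <= ln q' / 2 - ln q / 2 <= q0^-1 * (q' - q) by apply: key; lra.
rewrite [`|q - q'|]distrC [`|q' - q|]ger0_norm ?subr_ge0//; split; rewrite ?ler_norml; apply/andP; split.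
- by lra.
- by lra.
- have h : q0^-1 * (q' - q) <= 1 by apply: lin; lra.
  by lra.
- by lra.
Qed.

Lemma rprof'_lipschitz (q0 : R) : 0 < q0 -> exists2 L, 0 <= L & forall q q',
  `|q - q0| <= q0 / 4 -> `|q' - q0| <= q0 / 4 -> `|rprof' q - rprof' q'| <= L * `|q - q'|.
Proof.
move=> q00.
have m0 : 0 < 3 * q0 / 4 by lra.
have mM : 3 * q0 / 4 <= 5 * q0 / 4 by lra.
have [L L0 HL] := powR_lipschitz (- a - 1) m0 mM.
have [B B0 HB] : exists2 B, 0 <= B & forall q, `|q - q0| <= q0 / 4 -> q `^ (- a - 1) <= B.
  exists (q0 `^ (- a - 1) + L * (q0 / 4)); first by rewrite addr_ge0 ?powR_ge0// mulr_ge0//; lra.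
  move=> q hq; move: (hq); rewrite ler_norml => /andP[h1 h2].
  have i1 : 3 * q0 / 4 <= q <= 5 * q0 / 4 by apply/andP; split; lra.
  have i0 : 3 * q0 / 4 <= q0 <= 5 * q0 / 4 by apply/andP; split; lra.
  have := HL q0 q i0 i1; have := ler_norm (q `^ (- a - 1) - q0 `^ (- a - 1)).
  by have := ler_wpM2l L0 hq; lra.
have sb := slope_bound C0 v1 v2.
pose S := C + `|a| * X.
have X0 : 0 <= X by exact: le_trans (vX 0).
have S0 : 0 <= S by rewrite /S addr_ge0// mulr_ge0.
have HS t : `|slope v C t / 2 - a * v t| <= S.
  apply: le_trans (ler_normB _ _) _; rewrite lerD//; last by rewrite normrM ler_wpM2l.
  by rewrite normrM [`|2^-1|]gtr0_norm ?invr_gt0//; have := sb t; lra.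
pose K := 2 * C + `|a| * C.
have K0 : 0 <= K by rewrite /K addr_ge0// ?mulr_ge0.
exists (L * S + B * (K * q0^-1)); first by rewrite addr_ge0// mulr_ge0// mulr_ge0// invr_ge0 ltW.
move=> q q' hq hq'.
have [e1 e2] := ln_half_lipschitz q00 hq hq'.
have HK : `|(slope v C (ln q / 2) / 2 - a * v (ln q / 2)) - (slope v C (ln q' / 2) / 2 - a * v (ln q' / 2))|
   <= K * `|ln q / 2 - ln q' / 2|.
  have := slope_lipschitz C0 v1 v2 (ln q' / 2) e2; have := v1 e2 (ln q' / 2).
  rewrite [ln q' / 2 + _]addrC subrK => f1 f2.
  have -> : (slope v C (ln q / 2) / 2 - a * v (ln q / 2)) - (slope v C (ln q' / 2) / 2 - a * v (ln q' / 2))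
    = (slope v C (ln q / 2) - slope v C (ln q' / 2)) / 2 - a * (v (ln q / 2) - v (ln q' / 2)) by ring.
  apply: le_trans (ler_normB _ _) _; rewrite /K [leRHS]mulrDl lerD//.
    by rewrite normrM [`|2^-1|]gtr0_norm ?invr_gt0//; lra.
  by rewrite normrM -mulrA ler_wpM2l.
rewrite /rprof'.
have alg (x y x' y' : R) : `|x * y - x' * y'| <= `|x - x'| * `|y| + `|x'| * `|y - y'|.
  rewrite -!normrM (_ : x * y - x' * y' = (x - x') * y + x' * (y - y')); last by ring.
  exact: ler_normD.
rewrite [leRHS]mulrDl; apply: le_trans (alg _ _ _ _) _; apply: lerD.
  rewrite [leRHS]mulrAC; apply: ler_pM => //.
  apply: HL; first by move: hq'; rewrite ler_norml => /andP[h1 h2]; apply/andP; split; lra.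
  by move: hq; rewrite ler_norml => /andP[h1 h2]; apply/andP; split; lra.
rewrite -[leRHS]mulrA; apply: ler_pM => //; first by rewrite ger0_norm ?powR_ge0//; exact: HB.
apply: le_trans HK _; rewrite -mulrA; exact: ler_wpM2l.
Qed.

Lemma rprof_expansion (q0 : R) : 0 < q0 -> exists2 K, 0 <= K & forall q,
  `|q - q0| <= q0 / 4 -> `|rprof q - rprof q0 - rprof' q0 * (q - q0)| <= K * (q - q0) ^+ 2.
Proof.
move=> q00; have [L L0 HL] := rprof'_lipschitz q00.
exists L => // q hq; have qq : `|q0 - q0| <= q0 / 4 by rewrite subrr normr0; lra.
have [c hc ->] : exists2 c, `|c - q0| <= `|q - q0| & rprof q - rprof q0 = rprof' c * (q - q0).
  move: (hq); rewrite ler_norml => /andP[h1 h2].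
  have cont x y : 0 < x -> {within `[x, y], continuous rprof}.
    move=> x0; apply: continuous_in_subspaceT => z; rewrite inE/= in_itv/= => /andP[xz _].
    have z0 : 0 < z by exact: lt_le_trans xz.
    have [dz _] := is_derive_rprof z0.
    exact/differentiable_continuous/derivable1_diffP.
  have der x y z : 0 < x -> z \in `]x, y[ -> is_derive (z : R) (1 : R) rprof (rprof' z).
    move=> x0; rewrite in_itv/= => /andP[xz _]; apply: is_derive_rprof; exact: lt_trans xz.
  have [l|/ltW l] := leP q0 q.
    have [c + e] := MVT_segment l (fun z => @der q0 q z q00) (cont _ _ q00).
    rewrite in_itv/= => /andP[c1 c2]; exists c => //.
    by rewrite !ger0_norm ?subr_ge0//; lra.
  have q_0 : 0 < q by lra.
  have [c + e] := MVT_segment l (fun z => @der q q0 z q_0) (cont _ _ q_0).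
  rewrite in_itv/= => /andP[c1 c2]; exists c => //.
    by rewrite ![`|_ - q0|]distrC !ger0_norm ?subr_ge0//; lra.
  by rewrite -[LHS]opprB e -mulrN opprB.
have hc' : `|c - q0| <= q0 / 4 by exact: le_trans hc hq.
rewrite -mulrBl normrM -(real_normK (num_real (q - q0))) expr2 mulrA.
apply: ler_wpM2r => //; apply: le_trans (HL _ _ hc' qq) _.
exact: ler_wpM2l.
Qed.

End radial_profile.

(** * Regularity of radial functions away from the origin *)

Section radial_function.
Context {R : realType}.

Lemma mx_norm_le_enorm n (x : 'rV[R]_n) : `|x| <= enorm x.
Proof.
have e0 : 0 <= enorm x by exact: sqrtr_ge0.
have [->|x0] := eqVneq x 0; first by rewrite normr0 enorm0.
have : mx_norm x != 0 by apply: contra x0 => /eqP/mx_norm_eq0 ->.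
by move=> /mx_norm_neq0[i] h; rewrite [leLHS]h ord1; exact: coord_le_enorm.
Qed.

Lemma coord_le_mx_norm n (x : 'rV[R]_n) i : `|x ord0 i| <= `|x|.
Proof.
rewrite [leRHS]mx_normrE; exact: (le_bigmax _ (fun i : 'I_1 * 'I_n => `|x i.1 i.2|) (ord0, i)).
Qed.

Lemma enorm_le_mx_norm n (x : 'rV[R]_n) : enorm x <= n%:R * `|x|.
Proof.
rewrite -(@ler_pXn2r _ 2)// ?nnegrE ?sqrtr_ge0// ?mulr_ge0// sqr_enorm.
apply: (@le_trans _ _ (\sum_(i < n) `|x| ^+ 2)).
  apply: ler_sum => i _; rewrite -expr2 -(real_normK (num_real (x ord0 i))).
  by rewrite ler_pXn2r// ?nnegrE//; exact: coord_le_mx_norm.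
rewrite sumr_const card_ord -[leLHS]mulr_natl exprMn; apply: ler_wpM2r; first exact: sqr_ge0.
by rewrite -natrX ler_nat; case: n {x} => // n; rewrite leq_pmulr.
Qed.

Lemma expansion_is_derive_line n (f : 'rV[R]_n -> R) (x e : 'rV[R]_n) (l K d : R) : 0 < d ->
  (forall h, `|h| <= d -> `|f (x + h *: e) - f x - l * h| <= K * h ^+ 2) -> is_derive x e f l.
Proof.
move=> d0 fl.
have g0 : forall h, `|h| <= d -> `|f (x + (0 + h) *: e) - f (x + 0 *: e) - l * h| <= K * h ^+ 2.
  by move=> h hd; rewrite add0r scale0r addr0; exact: fl.
have [g1 g2] := expansion_is_derive d0 (f := fun h => f (x + h *: e)) g0.
have E : (fun h : R => h^-1 *: ((f \o shift x) (h *: e) - f x)) =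
    (fun h : R => h^-1 *: (((fun h => f (x + h *: e)) \o shift (0 : R)) (h *: (1 : R)) - f (x + 0 *: e))).
  apply/funext => h; congr (_ *: (f _ - f _)); last by rewrite scale0r addr0.
  have -> : shift (0 : R) (h *: (1 : R)) = h by rewrite /shift/= addr0 /GRing.scale/= mulr1.
  by rewrite /shift/= addrC.
apply: DeriveDef; first by rewrite /derivable E; exact: g1.
by rewrite /derive E; exact: g2.
Qed.

Lemma dotr_gt0 n (x : 'rV[R]_n) : x != 0 -> 0 < dotr x x.
Proof. by move=> x0; rewrite -sqr_enorm exprn_gt0// enorm_gt0. Qed.

Lemma dotr_near n (x y : 'rV[R]_n) : enorm (y - x) <= enorm x / 16 ->
  `|dotr y y - dotr x x| <= dotr x x / 4.
Proof.
move=> h; have := sqr_enormD x (y - x); rewrite addrC subrK -!sqr_enorm => ->.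
have := cauchy_schwarz x (y - x).
have e0 : 0 <= enorm x by exact: sqrtr_ge0.
have e1 : 0 <= enorm (y - x) by exact: sqrtr_ge0.
have h1 := ler_wpM2l e0 h; have h2 := ler_pM e1 e1 h h.
rewrite -!expr2 in h2; rewrite ler_norml => /andP[c1 c2].
have h3 : enorm x * (enorm x / 16) = enorm x ^+ 2 / 16 by rewrite expr2 mulrA.
have h4 : (enorm x / 16) ^+ 2 = enorm x ^+ 2 / 256 by field.
rewrite h4 in h2; rewrite h3 in h1; have := sqr_ge0 (enorm x); have := sqr_ge0 (enorm (y - x)).
by rewrite ler_norml => h5 h6; apply/andP; split; lra.
Qed.

Lemma dotr_dist n (y z : 'rV[R]_n) : `|dotr y y - dotr z z| <= enorm (y - z) * enorm (y + z).
Proof.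
have -> : dotr y y - dotr z z = dotr (y - z) (y + z).
  by rewrite dotrDl dotrNl !dotrDr [dotr y z]dotrC; ring.
exact: cauchy_schwarz.
Qed.

Variables (v : R -> R) (C X a : R).
Hypothesis (C0 : 0 <= C).
Hypothesis (v1 : forall h, `|h| <= 1 -> forall t, `|v (t + h) - v t| <= C * `|h|).
Hypothesis (v2 : forall h, `|h| <= 1 -> forall t, `|v (t + h) + v (t - h) - 2 * v t| <= C * h ^+ 2).
Hypothesis (vX : forall t, `|v t| <= X).

Definition rfun n (x : 'rV[R]_n) : R := rprof v a (dotr x x).

Lemma rfunE n (x : 'rV[R]_n) : rfun x = enorm x `^ (- (2 * a)) * v (ln (enorm x)).
Proof.
rewrite /rfun /rprof -sqr_enorm -enorm_powR2; congr (_ * v _).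
have [x0|x0] := ltP 0 (enorm x); first by rewrite lnXn//; field.
by rewrite !ln0 ?mul0r// exprn_even_le0//= (le_anti (introT andP (conj x0 (sqrtr_ge0 _)))).
Qed.

Lemma rfun_expansion n (x : 'rV[R]_n) : x != 0 -> exists2 K, 0 <= K & forall y,
  enorm y <= enorm x / 16 -> `|rfun (x + y) - rfun x - 2 * rprof' v C a (dotr x x) * dotr x y| <= K * enorm y ^+ 2.
Proof.
move=> x0; have q0 := dotr_gt0 x0.
have [K K0 HK] := rprof_expansion a C0 v1 v2 vX q0.
have D0 : 0 <= `|rprof' v C a (dotr x x)| by [].
exists (K * (4 * enorm x) ^+ 2 + `|rprof' v C a (dotr x x)|).
  by rewrite addr_ge0// mulr_ge0// sqr_ge0.
move=> y hy.
have hy' : enorm (x + y - x) <= enorm x / 16 by rewrite addrAC subrr add0r.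
have := HK _ (dotr_near hy'); rewrite -/(rfun _) -/(rfun _).
have E : dotr (x + y) (x + y) - dotr x x = 2 * dotr x y + enorm y ^+ 2.
  by rewrite sqr_enorm dotrDl !dotrDr [dotr y x]dotrC; ring.
rewrite E => h1.
have -> : rfun (x + y) - rfun x - 2 * rprof' v C a (dotr x x) * dotr x y =
  (rfun (x + y) - rfun x - rprof' v C a (dotr x x) * (2 * dotr x y + enorm y ^+ 2)) +
  rprof' v C a (dotr x x) * enorm y ^+ 2 by ring.
apply: le_trans (ler_normD _ _) _; rewrite [leRHS]mulrDl; apply: lerD; last first.
  by rewrite normrM [`|enorm y ^+ 2|]ger0_norm ?sqr_ge0.
apply: le_trans h1 _; rewrite -[leRHS]mulrA; apply: ler_wpM2l => //.
have ex : 0 <= enorm x by exact: sqrtr_ge0.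
have ey : 0 <= enorm y by exact: sqrtr_ge0.
rewrite -exprMn -[leLHS](real_normK (num_real _)) ler_pXn2r ?nnegrE// ?mulr_ge0//.
apply: le_trans (ler_normD _ _) _.
rewrite normrM [`|2|]ger0_norm// [`|enorm y ^+ 2|]ger0_norm ?sqr_ge0//.
have := cauchy_schwarz x y; have := ler_wpM2r ey hy; rewrite expr2.
have := mulr_ge0 ex ey; rewrite mulrAC; lra.
Qed.

Lemma rfun_second_diff n (x : 'rV[R]_n) : x != 0 -> exists2 K, 0 <= K & forall y,
  enorm y <= enorm x / 16 -> `|rfun (x + y) + rfun (x - y) - 2 * rfun x| <= K * enorm y ^+ 2.
Proof.
move=> x0; have [K K0 HK] := rfun_expansion x0; exists (2 * K); first by rewrite mulr_ge0.
move=> y hy; have h1 := HK y hy; have := HK (- y); rewrite enormN => /(_ hy) h2.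
have -> : rfun (x + y) + rfun (x - y) - 2 * rfun x =
  (rfun (x + y) - rfun x - 2 * rprof' v C a (dotr x x) * dotr x y) +
  (rfun (x - y) - rfun x - 2 * rprof' v C a (dotr x x) * dotr x (- y)) by rewrite dotrNr; ring.
by apply: le_trans (ler_normD _ _) _; rewrite -[leRHS]mulrA; lra.
Qed.

Lemma dotr_delta n (x : 'rV[R]_n) i : dotr x (delta_mx ord0 i) = x ord0 i.
Proof.
rewrite /dotr (bigD1 i)//= mxE !eqxx mulr1 big1 ?addr0// => j ji.
by rewrite mxE (negbTE ji) andbF mulr0.
Qed.

Lemma enorm_delta n (i : 'I_n) : enorm (delta_mx ord0 i : 'rV[R]_n) = 1.
Proof.
have h : 0 <= enorm (delta_mx ord0 i : 'rV[R]_n) by exact: sqrtr_ge0.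
by apply/eqP; rewrite -(@eqrXn2 _ 2)// expr1n sqr_enorm dotr_delta mxE !eqxx.
Qed.

Lemma grad_rfun n (x : 'rV[R]_n) : x != 0 -> grad (@rfun n) x = (2 * rprof' v C a (dotr x x)) *: x.
Proof.
move=> x0; have [K K0 HK] := rfun_expansion x0.
apply/rowP => i; rewrite !mxE.
have d0 : 0 < enorm x / 16 by rewrite divr_gt0// enorm_gt0.
have H h : `|h| <= enorm x / 16 -> `|rfun (x + h *: delta_mx ord0 i) - rfun x -
    2 * rprof' v C a (dotr x x) * x ord0 i * h| <= K * h ^+ 2.
  move=> hd; have := HK (h *: delta_mx ord0 i); rewrite enormZ enorm_delta mulr1 => /(_ hd).
  by rewrite dotrZr dotr_delta real_normK ?num_real// [h * _]mulrC mulrA.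
by have [_ ->] := expansion_is_derive_line d0 H.
Qed.

Lemma differentiable_dotr n (x : 'rV[R]_n) : differentiable (fun y : 'rV[R]_n => dotr y y) x.
Proof.
rewrite (_ : (fun y => _) = \sum_(i < n) (fun y : 'rV[R]_n => y ord0 i * y ord0 i)); last first.
  by apply/funext => y; rewrite fct_sumE.
apply: differentiable_sum => i; apply: differentiableM; exact: differentiable_coord.
Qed.

Lemma C11_loc_rfun n : C11_loc [set x : 'rV[R]_n | x != 0] (@rfun n).
Proof.
split=> x /= x0.
  apply: differentiable_comp; first exact: differentiable_dotr.
  by have [h _] := is_derive_rprof a C0 v1 v2 (dotr_gt0 x0); exact/derivable1_diffP.
have ex : 0 < enorm x by rewrite enorm_gt0.
have q0 := dotr_gt0 x0.
exists [set y | enorm (y - x) <= enorm x / 16].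
  apply/nbhs_ballP; exists ((n%:R + 1)^-1 * (enorm x / 16)) => /=.
    by rewrite mulr_gt0 ?divr_gt0// invr_gt0 ltr_pwDr.
  move=> y; rewrite -ball_normE/= distrC => hy.
  apply: le_trans (enorm_le_mx_norm _) _.
  rewrite mulrC ltr_pdivlMr in hy; last by rewrite ltr_pwDr.
  by have := normr_ge0 (y - x); lra.
have [L L0 HL] := rprof'_lipschitz a C0 v1 v2 vX q0.
have qq : `|dotr x x - dotr x x| <= dotr x x / 4 by rewrite subrr normr0 divr_ge0// ltW.
pose B := `|rprof' v C a (dotr x x)| + L * (dotr x x / 4).
have B0 : 0 <= B by rewrite /B addr_ge0// mulr_ge0// divr_ge0// ltW.
(* The last factor converts the Euclidean norm of y - z into the sup norm in which the Lipschitz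
   property is stated. *)
pose M := (2 * (L * (4 * enorm x) * (2 * enorm x) + B)) * n%:R.
have key y z : enorm (y - x) <= enorm x / 16 -> enorm (z - x) <= enorm x / 16 ->
    `|grad (@rfun n) y - grad (@rfun n) z| <= M * `|y - z|.
  move=> hy hz.
  have nx y' : enorm (y' - x) <= enorm x / 16 -> y' != 0 /\ enorm y' <= 2 * enorm x.
    move=> h; split.
      by apply: contraTneq h => ->; rewrite sub0r enormN -ltNge; lra.
    by have := enormD x (y' - x); rewrite addrC subrK; lra.
  have [y0 ey] := nx y hy; have [z0 ez] := nx z hz.
  rewrite !grad_rfun//; apply: le_trans (mx_norm_le_enorm _) _.
  have -> : (2 * rprof' v C a (dotr y y)) *: y - (2 * rprof' v C a (dotr z z)) *: z =
    (2 * (rprof' v C a (dotr y y) - rprof' v C a (dotr z z))) *: y +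
    (2 * rprof' v C a (dotr z z)) *: (y - z).
    by rewrite mulrBr scalerBl scalerBr addrA subrK.
  have N2 (t : R) : `|2 * t| = 2 * `|t| by rewrite normrM [`|2|]ger0_norm.
  apply: le_trans (enormD _ _) _; rewrite !enormZ !N2.
  have e1 := HL _ _ (dotr_near hy) (dotr_near hz).
  have e2 := dotr_dist y z.
  have e3 : enorm (y + z) <= 4 * enorm x by apply: le_trans (enormD _ _) _; lra.
  have e4 : `|rprof' v C a (dotr z z)| <= B.
    have := HL _ _ (dotr_near hz) qq; have := ler_wpM2l L0 (dotr_near hz).
    have := ler_normD (rprof' v C a (dotr z z) - rprof' v C a (dotr x x)) (rprof' v C a (dotr x x)).
    by rewrite subrK /B; lra.
  have ed : 0 <= enorm (y - z) by exact: sqrtr_ge0.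
  have e5 : `|rprof' v C a (dotr y y) - rprof' v C a (dotr z z)| <= L * (enorm (y - z) * (4 * enorm x)).
    apply: le_trans e1 _; apply: ler_wpM2l => //; apply: le_trans e2 _; exact: ler_wpM2l.
  have y_0 : 0 <= enorm y by exact: sqrtr_ge0.
  have e6 := ler_pM (normr_ge0 _) y_0 e5 ey; have e7 := ler_wpM2r ed e4.
  rewrite /M -mulrA; apply: (@le_trans _ _ (2 * (L * (4 * enorm x) * (2 * enorm x) + B) * enorm (y - z))).
    have -> : 2 * (L * (4 * enorm x) * (2 * enorm x) + B) * enorm (y - z) =
      2 * (L * (enorm (y - z) * (4 * enorm x)) * (2 * enorm x) + B * enorm (y - z)) by ring.
    by rewrite -!(mulrA 2) -mulrDr ler_pM2l//; exact: lerD.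
  rewrite -[leRHS]mulrA; apply: ler_wpM2l; last exact: enorm_le_mx_norm.
  by rewrite mulr_ge0// addr_ge0// !mulr_ge0// ltW.
have M0 : 0 <= M by rewrite /M !mulr_ge0// addr_ge0// !mulr_ge0// ltW.
have PF : ProperFilter (globally ([set y | enorm (y - x) <= enorm x / 16] `*`
    [set y | enorm (y - x) <= enorm x / 16])).
  by apply: (@globally_properfilter _ _ (x, x)); split=> /=; rewrite subrr enorm0 divr_ge0// ltW.
apply: (@klipschitzW _ _ _ (M + 1)) => -[y z] /= [hy hz].
apply: le_trans (key y z hy hz) _; apply: ler_wpM2r; [exact: normr_ge0|lra].
Qed.

End radial_function.

(** * Subcriticality *)

Section exponents.
Context {R : realType}.
Implicit Types (N s al r p a e m X Y : R).

Lemma small_pos (l : seq R) : all (fun x => 0 < x) l -> exists2 e, 0 < e & all (fun x => e < x) l.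
Proof.
elim: l => [_|x l IH /= /andP[x0 /IH[e e0 he]]]; first by exists 1.
exists (Num.min e (x / 2)); first by rewrite lt_min e0 divr_gt0.
rewrite gt_min; apply/andP; split; first by apply/orP; right; lra.
by apply: sub_all he => y; apply: le_lt_trans; rewrite ge_min lexx.
Qed.

(** Take x and y just below X and Y, and let th1, th2 be what is missing to r + 1 and r, or 0. If
    both are positive their sum is 2r + 1 - x - y, less than one because 2r < X + Y; the other two
    conditions handle the remaining cases. *)
Lemma split_exponents r X Y : 0 < X -> 0 < Y -> 2 * r < X + Y -> r < X -> r - 1 < Y ->
  exists x y th1 th2 : R, [/\ [/\ 0 <= x, x < X, 0 <= y & y < Y],
    r + 1 <= x + th1, r <= y + th2, 0 <= th1 & 0 <= th2 /\ th1 + th2 < 1].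
Proof.
move=> X0 Y0 h1 h2 h3.
have [|e e0] := @small_pos [:: X; Y; (X + Y - 2 * r) / 2; X - r; Y - r + 1].
  by rewrite /= andbT; apply/and5P; split; lra.
rewrite /= andbT => /and5P[eX eY e1 e2 e3].
exists (X - e), (Y - e), (Num.max 0 (r + 1 - (X - e))), (Num.max 0 (r - (Y - e))).
move: (X - e) (Y - e) (subrK e X) (subrK e Y) => x y xE yE.
clear -h1 h2 h3 e0 e1 e2 e3 eX eY xE yE.
have [u1|u1] := leP 0 (r + 1 - x); have [u2|u2] := leP 0 (r - y).
all: by split; [split| | | |split]; lra.
Qed.

(** The conditions of [kern_bound] for the Riesz potential of order [al], where 2c = N - al and the
    sphere has dimension N - 1, together with an integrable singularity. *)
Definition kap_ok (kap N al : R) := [/\ 0 <= kap, kap < 1, kap <= N - al & N - al - kap < N - 1].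

Lemma kap_okI N b a e : 0 < a -> a <= 1 -> a <= b -> 0 < e -> e < a -> e < N - b - (1 - a) ->
  kap_ok (1 - a + e) N b.
Proof. by move=> *; split; lra. Qed.

Lemma kap_exists N b : 2 <= N -> 0 < b -> b < N -> exists kap, kap_ok kap N b.
Proof.
move=> N2 b0 bN; have [b1|b1] := leP b 1; [exists (1 - b / 2)|exists 0]; split; lra.
Qed.

(** With m slightly below 2/(1 - 2s), the hypotheses of [split_exponents] are those with e = 0
    perturbed by terms of order e; the factor 2r + 10 dominates all of these. *)
Lemma exponent_gaps r a s e m : 0 < r -> 0 < a -> a <= 1 -> 2 * s < 1 -> 0 < e -> e < s -> e < a ->
  m * (1 - 2 * s + e) = 2 * (1 - e) ->
  e * (2 * r + 10) < a + 2 * s - r * (1 - 2 * s) -> e * (2 * r + 10) < 2 * a - r * (1 - 2 * s) ->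
  e * (2 * r + 10) < 4 * s - (r - 1) * (1 - 2 * s) ->
  [/\ 2 * r < m * (a - e) + m * (2 * s - e), r < m * (a - e) & r - 1 < m * (2 * s - e)].
Proof.
move=> r0 a0 a1 s1 e0 es ea mE e1 e2 e3.
have k0 : 0 < 1 - 2 * s + e by lra.
have ee : 0 <= e * e by rewrite mulr_ge0 ?ltW.
have ea0 : 0 <= e * a by rewrite mulr_ge0 ?ltW.
have es1 : e * s <= e * 1 by rewrite ler_pM2l//; lra.
have es0 : 0 <= e * s by rewrite mulr_ge0 ?ltW//; lra.
have ea1 : e * a <= e * 1 by rewrite ler_pM2l.
have re : 0 < r * e by rewrite mulr_gt0.
have XE z : m * z * (1 - 2 * s + e) = 2 * (1 - e) * z by rewrite mulrAC mE.
by split; rewrite -(ltr_pM2r k0) ?[(m * _ + _) * _]mulrDl !XE; lra.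
Qed.

(** For 2s >= 1 the singularity of G can be taken of order e as small as desired. With m = 1/e the
    product m e / 2 is 1/2, and m is so large that the first alternative holds without help from the
    sup norm. *)
Lemma subcritical_large_s N s al r : 2 <= N -> s < 1 -> 0 < al -> al < N -> 0 < r -> 1 <= 2 * s ->
  exists kapH kapG, [/\ kap_ok kapH N al, kap_ok kapG N (2 * s) & subcritical kapH kapG (r + 1)].
Proof.
move=> hN h1 al0 alN r0 hs; have [kapH okH] := kap_exists hN al0 alN.
have [|e e0] := @small_pos [:: N - 2 * s; (2 * r + 4)^-1; 1].
  by rewrite /= invr_gt0 andbT; apply/and3P; split; lra.
rewrite /= andbT => /and3P[e1 elt1 e2].
have e3 : e * (2 * r + 4) < 1 by rewrite -ltr_pdivlMr ?mul1r//; lra.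
have e4 : 2 * r + 4 < e^-1 by rewrite -[ltRHS]mul1r ltr_pdivlMr// mulrC.
exists kapH, e; split => //.
  by split; lra.
exists e^-1, 0; split => //; first lra.
- by rewrite mulrAC mulVf ?gt_eqF// mul1r; lra.
left; exists (2 * r + 1); split; [lra| |lra].
by rewrite mulrBr mulr1 mulVf ?gt_eqF//; lra.
Qed.

(** Here r = p - 1. With m close to 2/(1 - 2s) the first alternative asks for 2r < m (2s - e), which
    in the limit is the hypothesis r (1 - 2s) < 2s. *)
Lemma subcritical_small_rate N s al r : 2 <= N -> 0 < al -> al < N -> 0 < s -> 0 < r -> 2 * s < 1 ->
  r * (1 - 2 * s) < 2 * s ->
  exists kapH kapG, [/\ kap_ok kapH N al, kap_ok kapG N (2 * s) & subcritical kapH kapG (r + 1)].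
Proof.
move=> hN al0 alN s0 r0 hs D1; have [kapH okH] := kap_exists hN al0 alN.
have q0 : 0 < 2 * r + 10 by lra.
have [|e e0] := @small_pos [:: (2 * s - r * (1 - 2 * s)) / (2 * r + 10); s; 1 - 2 * s].
  by rewrite /= divr_gt0 ?andbT//=; [apply/andP; split|]; lra.
rewrite /= andbT ltr_pdivlMr// => /and3P[e1 e2 e3].
have k0 : 0 < 1 - 2 * s + e by lra.
pose m := 2 * (1 - e) / (1 - 2 * s + e).
have mE : m * (1 - 2 * s + e) = 2 * (1 - e) by rewrite /m divfK// gt_eqF.
have rY : 2 * r < m * (2 * s - e).
  have ee : 0 <= e * e by rewrite mulr_ge0 ?ltW.
  have e8 : e * s <= e * 1 by rewrite ler_pM2l//; lra.
  have es : 0 <= e * s by rewrite mulr_ge0 ?ltW.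
  by rewrite -(ltr_pM2r k0) [ltRHS]mulrAC mE; lra.
exists kapH, (1 - 2 * s + e); split => //; first by split; lra.
have YE : m * (1 - (1 - 2 * s + e)) = m * (2 * s - e) by congr (_ * _); lra.
exists m, (Num.max 0 (1 - (m * (2 * s - e) - 2 * r) / 2)).
have h0 : 0 <= Num.max 0 (1 - (m * (2 * s - e) - 2 * r) / 2) by rewrite le_max lexx.
have h2 : 1 - (m * (2 * s - e) - 2 * r) / 2 <= Num.max 0 (1 - (m * (2 * s - e) - 2 * r) / 2) by rewrite le_max lexx orbT.
split => //.
- by rewrite ler_pdivlMr//; lra.
- by rewrite mulrAC mE; lra.
- by rewrite gt_max; apply/andP; split; lra.
by left; exists (2 * r + (m * (2 * s - e) - 2 * r) / 2); rewrite YE; split; lra.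
Qed.

(** These are the three inequalities of [split_exponents] at e = 0 and m = 2/(1 - 2s), multiplied by
    1 - 2s. After multiplication by N - 2s the value of r is eliminated and polynomial inequalities
    in N, s and al remain. *)
Lemma rate_gaps N s al r a : 2 <= N -> 0 < al -> al < N -> 0 < s -> 2 * s < 1 ->
  r * (N - 2 * s) = al + 2 * s -> 2 * s <= r * (1 - 2 * s) -> a = Num.min al 1 ->
  [/\ 0 < a + 2 * s - r * (1 - 2 * s), 0 < 2 * a - r * (1 - 2 * s) & 0 < 4 * s - (r - 1) * (1 - 2 * s)].
Proof.
move=> N2 al0 alN s0 hs rE D1 aE; have nn : 0 < N - 2 * s by lra.
have h3 : s * 2 <= s * N by rewrite ler_pM2l.
have h4 : 0 <= al * s by rewrite mulr_ge0 ?ltW.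
have h5 : (al + 2 * s) * (1 - 2 * s) < (N + 2 * s) * (1 - 2 * s) by rewrite ltr_pM2r; lra.
have h6 : al * 2 <= al * N by rewrite ler_pM2l.
have h7 : 2 * s * (N - 2 * s) <= (al + 2 * s) * (1 - 2 * s).
  by have := ler_wpM2r (ltW nn) D1; rewrite [leRHS]mulrAC rE.
have h8 : 2 * s * (1 - 2 * s) <= al * (1 - 2 * s) by rewrite ler_pM2r; lra.
have h9 : 0 <= s * s by rewrite mulr_ge0 ?ltW.
have h10 : s * s <= s * 1 by rewrite ler_pM2l//; lra.
rewrite !subr_gt0; split; rewrite -(ltr_pM2r nn) ?mulrBl [r * _ * _]mulrAC rE ?aE; try (case: (leP al 1) => h).
all: lra.
Qed.

(** When G alone cannot pay for 2p - 1, the powers p and p - 1 are assigned to H and G separately;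
    the singularities are of order 1 - min(al, 1) + e and 1 - 2s + e. *)
Lemma subcritical_large_rate N s al r : 2 <= N -> 0 < al -> al < N -> 0 < s -> 0 < r -> 2 * s < 1 ->
  r * (N - 2 * s) = al + 2 * s -> 2 * s <= r * (1 - 2 * s) ->
  exists kapH kapG, [/\ kap_ok kapH N al, kap_ok kapG N (2 * s) & subcritical kapH kapG (r + 1)].
Proof.
move=> hN al0 alN s0 r0 hs rE D1; pose a := Num.min al 1.
have [a0 a1 aal aN] : [/\ 0 < a, a <= 1, a <= al & 0 < N - al - (1 - a)].
  by rewrite /a; case: (leP al 1) => h; split; lra.
have [g1 g2 g3] := rate_gaps hN al0 alN s0 hs rE D1 (erefl a).
have q0 : 0 < 2 * r + 10 by lra.
have [|e e0] := @small_pos ([:: s; a; 1 - 2 * s; N - al - (1 - a)] ++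
  [seq x / (2 * r + 10) | x <- [:: a + 2 * s - r * (1 - 2 * s); 2 * a - r * (1 - 2 * s); 4 * s - (r - 1) * (1 - 2 * s)]]).
  by rewrite /= s0 a0 aN !divr_gt0 ?andbT//; lra.
rewrite /= andbT !ltr_pdivlMr// => /and5P[es ea e4 eN /and3P[e1 e2 e3]].
clear g1 g2 g3 rE D1; have k0 : 0 < 1 - 2 * s + e by lra.
pose m := 2 * (1 - e) / (1 - 2 * s + e).
have mE : m * (1 - 2 * s + e) = 2 * (1 - e) by rewrite /m divfK// gt_eqF.
have [S1 S2 S3] := exponent_gaps r0 a0 a1 hs e0 es ea mE e1 e2 e3.
clear e1 e2 e3; have m2 : 2 <= m by rewrite /m ler_pdivlMr//; lra.
have m0 : 0 < m by exact: lt_le_trans m2.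
have X0 : 0 < m * (a - e) by rewrite mulr_gt0// subr_gt0.
have Y0 : 0 < m * (2 * s - e) by rewrite mulr_gt0//; lra.
have [x [y [th1 [th2 [xy p1 p2 t1 [t2 t12]]]]]] := split_exponents X0 Y0 S1 S2 S3.
exists (1 - a + e), (1 - 2 * s + e); split; [by apply: kap_okI|by apply: kap_okI; lra|].
exists m, (th1 + th2); split => //.
- by rewrite mulrAC mE; lra.
- by rewrite addr_ge0.
right; exists x, y, th1, th2.
have -> : 1 - (1 - a + e) = a - e by lra.
have -> : 1 - (1 - 2 * s + e) = 2 * s - e by lra.
by move: xy => [? ? ? ?]; rewrite addrK; split => //; split.
Qed.

Lemma subcritical_exists N s al : 2 <= N -> 0 < s -> s < 1 -> 0 < al -> al < N ->
  exists kapH kapG, [/\ kap_ok kapH N al, kap_ok kapG N (2 * s) &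
    subcritical kapH kapG ((N + al) / (N - 2 * s))].
Proof.
move=> N2 s0 s1 al0 alN; have nn : 0 < N - 2 * s by lra.
have n0 : N - 2 * s != 0 by rewrite gt_eqF.
have rE : (al + 2 * s) / (N - 2 * s) * (N - 2 * s) = al + 2 * s by rewrite divfK.
have r0 : 0 < (al + 2 * s) / (N - 2 * s) by rewrite divr_gt0//; lra.
have -> : (N + al) / (N - 2 * s) = (al + 2 * s) / (N - 2 * s) + 1 by field.
have [h|h] := ltP (2 * s) 1; last exact: subcritical_large_s.
have [D|D] := ltP ((al + 2 * s) / (N - 2 * s) * (1 - 2 * s)) (2 * s).
  exact: subcritical_small_rate.
exact: subcritical_large_rate rE D.
Qed.

End exponents.

(** * The truncated fractional Laplacian of a Riesz potential *)

Section nonneg_integrals.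
Context d (T : measurableType d) (R : realType) (nu : {measure set T -> \bar R}).
Implicit Types f g : T -> R.

Definition nint f := [/\ mfunT f, forall x, 0 <= f x &
  (\int[nu]_x (f x)%:E < +oo)%E].

(** The value of the integral is locked so that unification treats it as an opaque real number. *)
Fact ival_key : unit. Proof. exact: tt. Qed.

Definition ival f : R := locked_with ival_key (fun f => fine (\int[nu]_x (f x)%:E)%E) f.

Lemma ival_def f : ival f = fine (\int[nu]_x (f x)%:E)%E.
Proof. by rewrite /ival unlock. Qed.

Lemma ivalE f : nint f -> (\int[nu]_x (f x)%:E = (ival f)%:E)%E.
Proof.
move=> [mf f0 fl]; rewrite ival_def fineK// ge0_fin_numE//.
by apply: integral_ge0 => x _; rewrite lee_fin.
Qed.

Lemma ival_ge0 f : (forall x, 0 <= f x) -> 0 <= ival f.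
Proof. by move=> f0; rewrite ival_def; apply: fine_ge0; apply: integral_ge0 => x _; rewrite lee_fin. Qed.

Lemma nint_le_ae f g : mfunT f -> (forall x, 0 <= f x) -> nint g ->
  {ae nu, forall x, f x <= g x} -> nint f.
Proof.
move=> mf f0 [mg g0 gl] fg; split => //; apply: le_lt_trans gl.
apply: ae_ge0_le_integral => //; do ?exact/measurable_EFinP.
- by move=> x _; rewrite lee_fin.
- by move=> x _; rewrite lee_fin.
- by apply: filterS fg => x h _; rewrite lee_fin.
Qed.

Lemma nint_le f g : mfunT f -> (forall x, 0 <= f x) -> nint g ->
  (forall x, f x <= g x) -> nint f.
Proof. by move=> mf f0 ng fg; apply: (nint_le_ae mf f0 ng); exact: aeW. Qed.

Lemma ival_le_ae f g : nint f -> nint g -> {ae nu, forall x, f x <= g x} -> ival f <= ival g.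
Proof.
move=> nf ng fg; rewrite -lee_fin -(ivalE nf) -(ivalE ng).
have [mf f0 _] := nf; have [mg g0 _] := ng.
apply: ae_ge0_le_integral => //; do ?exact/measurable_EFinP.
- by move=> x _; rewrite lee_fin.
- by move=> x _; rewrite lee_fin.
- by apply: filterS fg => x h _; rewrite lee_fin.
Qed.

Lemma ival_le f g : nint f -> nint g -> (forall x, f x <= g x) -> ival f <= ival g.
Proof. by move=> nf ng fg; apply: ival_le_ae => //; exact: aeW. Qed.

Lemma ivalD_ f g : nint f -> nint g -> (\int[nu]_x (f x + g x)%:E = (ival f + ival g)%:E)%E.
Proof.
move=> nf ng; rewrite EFinD -(ivalE nf) -(ivalE ng); have [mf f0 _] := nf; have [mg g0 _] := ng.
by rewrite -gintD//; exact/measurable_EFinP.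
Qed.

Lemma nintD f g : nint f -> nint g -> nint (fun x => f x + g x).
Proof.
move=> nf ng; have [mf f0 _] := nf; have [mg g0 _] := ng; split.
- by mfun.
- by move=> x; exact: addr_ge0.
- by rewrite (ivalD_ nf ng) ltry.
Qed.

Lemma ivalD f g : nint f -> nint g -> ival (fun x => f x + g x) = ival f + ival g.
Proof. by move=> nf ng; rewrite [LHS]ival_def (ivalD_ nf ng). Qed.

Lemma ivalZ_ f a : nint f -> 0 <= a -> (\int[nu]_x (a * f x)%:E = (a * ival f)%:E)%E.
Proof.
move=> nf a0; rewrite EFinM -(ivalE nf); have [mf f0 _] := nf.
by rewrite -gintZl//; exact/measurable_EFinP.
Qed.

Lemma nintZ f a : nint f -> 0 <= a -> nint (fun x => a * f x).
Proof.
move=> nf a0; have [mf f0 _] := nf; split.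
- by mfun.
- by move=> x; exact: mulr_ge0.
- by rewrite (ivalZ_ nf a0) ltry.
Qed.

Lemma ivalZ f a : nint f -> 0 <= a -> ival (fun x => a * f x) = a * ival f.
Proof. by move=> nf a0; rewrite [LHS]ival_def (ivalZ_ nf a0). Qed.

Lemma eq_ival f g : (forall x, f x = g x) -> ival f = ival g.
Proof. by move=> fg; congr ival; exact/funext. Qed.

Lemma eq_nint f g : (forall x, f x = g x) -> nint f -> nint g.
Proof. by move=> fg; congr nint; exact/funext. Qed.

(* Signed integrals are avoided: a signed inequality is stated with every term moved to its
   positive side. *)
Lemma ival_le23_ae f1 f2 g1 g2 g3 : nint f1 -> nint f2 -> nint g1 -> nint g2 -> nint g3 ->
  {ae nu, forall x, f1 x + f2 x <= g1 x + g2 x + g3 x} ->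
  ival f1 + ival f2 <= ival g1 + ival g2 + ival g3.
Proof.
move=> n1 n2 m1 m2 m3 h; rewrite -(ivalD n1 n2) -(ivalD m1 m2) -(ivalD (nintD m1 m2) m3).
exact: ival_le_ae (nintD n1 n2) (nintD (nintD m1 m2) m3) h.
Qed.

Lemma ival_le32_ae f1 f2 f3 g1 g2 : nint f1 -> nint f2 -> nint f3 -> nint g1 -> nint g2 ->
  {ae nu, forall x, f1 x + f2 x + f3 x <= g1 x + g2 x} ->
  ival f1 + ival f2 + ival f3 <= ival g1 + ival g2.
Proof.
move=> n1 n2 n3 m1 m2 h; rewrite -(ivalD n1 n2) -(ivalD m1 m2) -(ivalD (nintD n1 n2) n3).
exact: ival_le_ae (nintD (nintD n1 n2) n3) (nintD m1 m2) h.
Qed.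

End nonneg_integrals.

Section rV_integrals.
Context {R : realType} (n : nat).
Local Notation Lb := (@lebesgue_rV R n.+1).
Local Notation V := 'rV[R]_n.+1.
Implicit Types (f g : V -> R).

Lemma ival_shift f (b : V) : mfunT f -> (forall x, 0 <= f x) ->
  ival Lb (fun x => f (x + b)) = ival Lb f.
Proof.
move=> mf f0; by rewrite !ival_def (ge0_integral_rV_shift b (measurable_to_EFin mf)).
Qed.

Lemma nint_shift f (b : V) : nint Lb f -> nint Lb (fun x => f (x + b)).
Proof.
move=> [mf f0 fl]; split.
- by mfun.
- by move=> x; exact: f0.
- by rewrite (ge0_integral_rV_shift b (measurable_to_EFin mf)).
Qed.

Lemma ival_opp f : mfunT f -> (forall x, 0 <= f x) ->
  ival Lb (fun x => f (- x)) = ival Lb f.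
Proof.
move=> mf f0; by rewrite !ival_def (ge0_integral_rV_opp (measurable_to_EFin mf)).
Qed.

Lemma nint_opp f : nint Lb f -> nint Lb (fun x => f (- x)).
Proof.
move=> [mf f0 fl]; split.
- by mfun.
- by move=> x; exact: f0.
- by rewrite (ge0_integral_rV_opp (measurable_to_EFin mf)).
Qed.

Lemma ival_scale f (c : R) : 0 < c -> mfunT f -> (forall x, 0 <= f x) ->
  ival Lb f = c ^+ n.+1 * ival Lb (fun x => f (c *: x)).
Proof.
move=> c0 mf f0; have f0' x : (0 <= (f x)%:E)%E by rewrite lee_fin.
rewrite !ival_def (ge0_integral_rV_scale c0 (measurable_to_EFin mf) f0').
have c1 : 0 < c ^+ n.+1 by exact: exprn_gt0.
case E : (\int[Lb]_x (f (c *: x))%:E)%E => [r| |] //=.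
- by rewrite gt0_muley ?lte_fin//= mulr0.
- by rewrite gt0_muleNy ?lte_fin//= mulr0.
Qed.

Lemma nint_scale f (c : R) : 0 < c -> nint Lb f -> nint Lb (fun x => f (c *: x)).
Proof.
move=> c0 [mf f0 fl]; split.
- by mfun.
- by move=> x; exact: f0.
- have f0' x : (0 <= (f x)%:E)%E by rewrite lee_fin.
  move: fl; rewrite (ge0_integral_rV_scale c0 (measurable_to_EFin mf) f0').
  have c1 : 0 < c ^+ n.+1 by exact: exprn_gt0.
  by case: (\int[Lb]_x (f (c *: x))%:E)%E => [r| |] //; [move=> _; exact: ltry|rewrite gt0_muley ?lte_fin].
Qed.

Lemma ival_isometry f phi : isometry_pres phi -> mfunT f -> (forall x, 0 <= f x) ->
  ival Lb (f \o phi) = ival Lb f.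
Proof.
move=> [mp _ _ pp] mf f0; by rewrite !ival_def (pp (fun x => (f x)%:E))//; exact/measurable_EFinP.
Qed.

Lemma ae_rV_neq (P : V -> Prop) (a : V) : (forall x, x != a -> P x) -> {ae Lb, forall x, P x}.
Proof. by move=> h; apply: filterS (ae_neq a) => x; exact: h. Qed.

Lemma measurable_ival (F : V -> V -> R) : mfunT (fun p : V * V => F p.1 p.2) ->
  (forall x y, 0 <= F x y) -> mfunT (fun x => ival Lb (F x)).
Proof.
move=> mF F0; have mP := measurable_to_EFin mF.
have P0 (p : V * V) : (0 <= (F p.1 p.2)%:E)%E by rewrite lee_fin.
rewrite (_ : (fun x => _) = fun x => fine (\int[Lb]_y (F x y)%:E)%E); last first.
  by apply/funext => x; rewrite ival_def.
have := measurableT_comp (@fine_measurable R setT measurableT) (measurable_fun_fubini_tonelli_F _ mP P0); exact.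
Qed.

Lemma measurable_swap_pair (F : V -> V -> R) : mfunT (fun p : V * V => F p.1 p.2) ->
  mfunT (fun p : V * V => F p.2 p.1).
Proof. by move=> mF; exact: (measurableT_comp mF (@measurable_swap _ _ V V)). Qed.

Lemma tonelli_ival (F : V -> V -> R) : mfunT (fun p : V * V => F p.1 p.2) ->
  (forall x y, 0 <= F x y) -> {ae Lb, forall x, nint Lb (F x)} ->
  {ae Lb, forall y, nint Lb (fun x => F x y)} -> nint Lb (fun x => ival Lb (F x)) ->
  nint Lb (fun y => ival Lb (fun x => F x y)) /\
  ival Lb (fun x => ival Lb (F x)) = ival Lb (fun y => ival Lb (fun x => F x y)).
Proof.
move=> mF F0 n1 n2 nF.
have mP := measurable_to_EFin mF.
have P0 (p : V * V) : (0 <= (F p.1 p.2)%:E)%E by rewrite lee_fin.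
have mF' := measurable_swap_pair mF.
have m1 := measurable_ival mF F0; have m2 := measurable_ival mF' (fun x y => F0 y x).
have E := fubini_tonelli (m1 := Lb) (m2 := Lb) _ mP P0.
have E1 : (\int[Lb]_x \int[Lb]_y (F x y)%:E = \int[Lb]_x (ival Lb (F x))%:E)%E.
  apply: (gint_ae_eq (measurable_fun_fubini_tonelli_F _ mP P0) (measurable_to_EFin m1)).
  by apply: filterS n1 => x; exact: ivalE.
have E2 : (\int[Lb]_y \int[Lb]_x (F x y)%:E = \int[Lb]_y (ival Lb (fun x => F x y))%:E)%E.
  apply: (gint_ae_eq (measurable_fun_fubini_tonelli_G _ mP P0) (measurable_to_EFin m2)).
  by apply: filterS n2 => y; exact: ivalE.
have E3 : (\int[Lb]_x (ival Lb (F x))%:E = \int[Lb]_y (ival Lb (fun x => F x y))%:E)%E.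
  by rewrite -E1 -E2; exact: E.
split; last by rewrite !ival_def E3.
split; first exact: m2.
- by move=> y; apply: ival_ge0 => x; exact: F0.
- by rewrite -E3; have [] := nF.
Qed.

End rV_integrals.

Lemma cauchy_alg (R : realType) (gx i1 i2 i3 t B : R) : 2 * gx * i1 <= i2 + i2 + B ->
  i2 + i2 <= 2 * gx * i1 + B -> 0 <= B -> `|gx * (i1 + i3) - (i2 + t) - (gx * i3 - t)| <= B.
Proof. by move=> *; rewrite ler_norml; apply/andP; split; lra. Qed.

Lemma second_diff_bounds (R : realType) (p m g K : R) : `|p + m - 2 * g| <= K ->
  2 * g <= p + m + K /\ p + m <= 2 * g + K.
Proof. by rewrite ler_norml => /andP[? ?]; split; lra. Qed.

(** * Truncated power kernels *)

Section truncated_kernels.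
Context {R : realType} (n : nat).
Local Notation Lb := (@lebesgue_rV R n.+1).
Local Notation V := 'rV[R]_n.+1.
Local Notation N := (n.+1%:R : R).
Implicit Types (f g : V -> R) (e r m : R).

Definition ballk r m (y : V) : R := (enorm y <= r)%R%:R * enorm y `^ (- m).
Definition tailk e m (y : V) : R := (e < enorm y)%R%:R * enorm y `^ (- m).

Lemma measurable_enorm_bool dd (T : measurableType dd) (f : T -> R) (P : R -> bool) :
  measurable [set x | P x] -> mfunT f -> mfunT (fun y => (P (f y))%:R : R).
Proof.
move=> mP mf; rewrite (_ : (fun y => _) = \1_[set x | P x] \o f); last first.
  apply/funext => y /=; rewrite indicE; case: (boolP (P (f y))) => h.
    by rewrite mem_set.
  by rewrite memNset//; exact/negP.
apply: (measurableT_comp _ mf); exact: measurable_indic.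
Qed.

Lemma measurable_gt_set (r : R) : measurable [set x : R | r < x].
Proof.
rewrite (_ : [set x | _] = `]r, +oo[%classic); first exact: measurable_itv.
by apply/seteqP; split => x /=; rewrite in_itv/= andbT.
Qed.

Lemma measurable_ballk r m : mfunT (ballk r m).
Proof.
apply: measurable_funM; last by apply: measurable_powR_comp; exact: measurable_enorm.
by apply: (@measurable_enorm_bool _ _ _ (fun x => x <= r)); [exact: measurable_le_set|exact: measurable_enorm].
Qed.

Lemma measurable_tailk r m : mfunT (tailk r m).
Proof.
apply: measurable_funM; last by apply: measurable_powR_comp; exact: measurable_enorm.
by apply: (@measurable_enorm_bool _ _ _ (fun x => r < x)); [exact: measurable_gt_set|exact: measurable_enorm].
Qed.

Lemma ballk_ge0 r m y : 0 <= ballk r m y. Proof. by rewrite mulr_ge0// powR_ge0. Qed.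
Lemma tailk_ge0 r m y : 0 <= tailk r m y. Proof. by rewrite mulr_ge0// powR_ge0. Qed.

Lemma nint_ballk r m : m < N -> 0 < r -> nint Lb (ballk r m).
Proof.
move=> mN r0; split; [exact: measurable_ballk|exact: ballk_ge0|].
have := integral_ball_powR (ltn0Sn n) mN r0; congr (_ < _)%E.
apply: eq_integral => y _; congr (_%:E); rewrite /ballk indicE; congr (_ * _).
by case: (boolP (enorm y <= r)) => h; [rewrite mem_set|rewrite memNset//; exact/negP].
Qed.

Lemma nint_tailk e m : N < m -> 0 < e -> nint Lb (tailk e m).
Proof.
move=> mN e0.
have nt : nint Lb (fun y : V => (e <= enorm y)%R%:R * enorm y `^ (- m)).
  split.
  - apply: measurable_funM; last by apply: measurable_powR_comp; exact: measurable_enorm.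
    apply: (@measurable_enorm_bool _ _ _ (fun x => e <= x)); last exact: measurable_enorm.
    exact: measurable_ge_set.
  - by move=> y; rewrite mulr_ge0// powR_ge0.
  have := integral_tail_powR (ltn0Sn n) mN e0; congr (_ < _)%E.
  apply: eq_integral => y _; congr (_%:E); rewrite indicE; congr (_ * _).
  by case: (boolP (e <= enorm y)) => h; [rewrite mem_set|rewrite memNset//; exact/negP].
apply: nint_le nt _; [exact: measurable_tailk|exact: tailk_ge0|] => y.
rewrite /tailk; apply: ler_wpM2r; first exact: powR_ge0.
by case: (ltP e (enorm y)) => [/ltW ->|_]//.
Qed.

Lemma ballkZ c r m y : 0 < c -> ballk (c * r) m (c *: y) = c `^ (- m) * ballk r m y.
Proof.
move=> c0; rewrite /ballk enormZ gtr0_norm// ler_pM2l// (powRM _ (ltW c0) (enorm_ge0 y)).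
exact: mulrCA.
Qed.

Lemma tailkZ c r m y : 0 < c -> tailk (c * r) m (c *: y) = c `^ (- m) * tailk r m y.
Proof.
move=> c0; rewrite /tailk enormZ gtr0_norm// ltr_pM2l// (powRM _ (ltW c0) (enorm_ge0 y)).
exact: mulrCA.
Qed.

Lemma powR_dim c m : 0 < c -> c ^+ n.+1 * c `^ (- m) = c `^ (N - m).
Proof.
move=> c0; rewrite -powR_mulrn ?(ltW c0)// -powRD// (gt_eqF c0); exact: implybT.
Qed.

Lemma ival_ballk r m : m < N -> 0 < r -> ival Lb (ballk r m) = r `^ (N - m) * ival Lb (ballk 1 m).
Proof.
move=> mN r0; rewrite (ival_scale r0 (measurable_ballk r m) (ballk_ge0 r m)).
rewrite -(powR_dim m r0) -mulrA; congr (_ * _).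
rewrite -(ivalZ (nint_ballk mN ltr01) (powR_ge0 r (- m))).
by apply: eq_ival => y; rewrite -ballkZ// mulr1.
Qed.

Lemma ival_tailk r m : N < m -> 0 < r -> ival Lb (tailk r m) = r `^ (N - m) * ival Lb (tailk 1 m).
Proof.
move=> mN r0; rewrite (ival_scale r0 (measurable_tailk r m) (tailk_ge0 r m)).
rewrite -(powR_dim m r0) -mulrA; congr (_ * _).
rewrite -(ivalZ (nint_tailk mN ltr01) (powR_ge0 r (- m))).
by apply: eq_ival => y; rewrite -tailkZ// mulr1.
Qed.

Variables (b d : R).
Hypotheses (b0 : 0 < b) (bN : b < N) (dN : N < d) (dN2 : d < N + 2).

Definition psi (y : V) : R := enorm y `^ (- b).

Lemma measurable_psi : mfunT psi.
Proof. by apply: measurable_powR_comp; exact: measurable_enorm. Qed.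

Lemma psi_ge0 y : 0 <= psi y. Proof. exact: powR_ge0. Qed.

Definition trunc_int e g (x : V) : R := ival Lb (fun y => tailk e d y * g (x + y)).

(** For d = N + 2s this is the fractional Laplacian truncated at distance e, without the factor
    [kappa]; its two nonnegative parts are integrated apart. *)
Definition trunc_lap e g (x : V) : R := g x * ival Lb (tailk e d) - trunc_int e g x.

Definition admissible_at g (x : V) := forall e, 0 < e -> nint Lb (fun y => tailk e d y * g (x + y)).

Lemma measurable_shift g (x : V) : mfunT g -> mfunT (fun y => g (x + y)).
Proof. by intros; mfun. Qed.

Lemma admissible_psi (x : V) : admissible_at psi x.
Proof.
move=> e e0.
have n1 : nint Lb (fun y => ballk 1 b (x + y)).
  have := nint_shift x (nint_ballk bN ltr01); apply: eq_nint => y; by rewrite addrC.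
have n2 := nintZ n1 (powR_ge0 e (- d)).
apply: nint_le (nintD n2 (nint_tailk dN e0)) _.
- apply: measurable_funM; first exact: measurable_tailk.
  exact: measurable_shift measurable_psi.
- by move=> y; rewrite mulr_ge0 ?tailk_ge0// psi_ge0.
move=> y; rewrite /tailk; case: (ltP e (enorm y)) => ey; last first.
  by rewrite !mul0r addr0 mulr_ge0 ?powR_ge0// ballk_ge0.
rewrite !mul1r /ballk /psi; case: (leP (enorm (x + y)) 1) => h; rewrite ?mul1r ?mul0r.
  rewrite -[leLHS]addr0; apply: lerD; last exact: powR_ge0.
  apply: ler_wpM2r; first exact: powR_ge0.
  by apply: ler_powRN => //; [exact: ltW|have := dN; have : 0 <= N by []; lra].
rewrite mulr0 add0r -[leRHS]mulr1; apply: ler_wpM2l; first exact: powR_ge0.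
by have := ler_powRN ltr01 (ltW h) (ltW b0); rewrite powR1.
Qed.

Definition annk e e' m (y : V) : R := (e < enorm y <= e')%R%:R * enorm y `^ (- m).

Lemma tailk_annk e e' m y : e <= e' -> tailk e m y = annk e e' m y + tailk e' m y.
Proof.
move=> ee; rewrite /tailk /annk -mulrDl; congr (_ * _).
case: (ltP e (enorm y)) => h1; case: (leP (enorm y) e') => h2; rewrite ?addr0 ?add0r//.
by exfalso; have := lt_le_trans h2 h1; rewrite ltNge ee.
Qed.

Lemma measurable_annk e e' m : mfunT (annk e e' m).
Proof.
apply: measurable_funM; last by apply: measurable_powR_comp; exact: measurable_enorm.
apply: (@measurable_enorm_bool _ _ _ (fun x => e < x <= e')); last exact: measurable_enorm.
rewrite (_ : [set x | _] = `]e, e']%classic); first exact: measurable_itv.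
by apply/seteqP; split => x /=; rewrite in_itv.
Qed.

Lemma annk_ge0 e e' m y : 0 <= annk e e' m y. Proof. by rewrite mulr_ge0// powR_ge0. Qed.

Lemma annk_le_tailk e e' m y : annk e e' m y <= tailk e m y.
Proof.
by rewrite /annk /tailk; apply: ler_wpM2r; [exact: powR_ge0|case: (e < enorm y); case: (enorm y <= e')].
Qed.

Lemma annk_sqr e e' y : 0 < e -> annk e e' d y * enorm y ^+ 2 <= ballk e' (d - 2) y.
Proof.
move=> e0; rewrite /annk /ballk; case: (ltP e (enorm y)) => h1; last by rewrite !mul0r mulr_ge0// powR_ge0.
case: (leP (enorm y) e') => h2; last by rewrite !mul0r.
have y0 : 0 < enorm y by exact: lt_trans h1.
rewrite /= !mul1r -powR_mulrn ?(ltW y0)// -powRD ?(gt_eqF y0) ?implybT//.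
by rewrite (_ : - d + 2%:R = - (d - 2))//; ring.
Qed.

Lemma trunc_int_split e e' g x : 0 < e -> e <= e' -> (forall y, 0 <= g y) -> mfunT g ->
  admissible_at g x ->
  trunc_int e g x = ival Lb (fun y => annk e e' d y * g (x + y)) + trunc_int e' g x /\
  nint Lb (fun y => annk e e' d y * g (x + y)).
Proof.
move=> e0 ee g0 mg ag.
have na : nint Lb (fun y => annk e e' d y * g (x + y)).
  apply: nint_le (ag e e0) _.
  - by apply: measurable_funM; [exact: measurable_annk|exact: measurable_shift].
  - by move=> y; rewrite mulr_ge0// annk_ge0.
  - by move=> y; apply: ler_wpM2r => //; exact: annk_le_tailk.
split => //; rewrite /trunc_int -(ivalD na (ag e' (lt_le_trans e0 ee))).
by apply: eq_ival => y; rewrite (tailk_annk _ _ ee) mulrDl.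
Qed.

Lemma annkN e e' m y : annk e e' m (- y) = annk e e' m y.
Proof. by rewrite /annk enormN. Qed.

Lemma nint_annk e e' : 0 < e -> nint Lb (annk e e' d).
Proof.
move=> e0; apply: nint_le (nint_tailk dN e0) _; [exact: measurable_annk|exact: annk_ge0|].
exact: annk_le_tailk.
Qed.

(** Over the annulus between e and e', averaging y and -y replaces the increment of g by a second
    difference. Its size M |y|^2 against |y|^(-d) integrates to a multiple of e'^(N + 2 - d). *)
Lemma trunc_lap_cauchy g x (rho M : R) : (forall y, 0 <= g y) -> mfunT g ->
  admissible_at g x -> 0 <= M ->
  (forall y, enorm y <= rho -> `|g (x + y) + g (x - y) - 2 * g x| <= M * enorm y ^+ 2) ->
  forall e e', 0 < e -> e <= e' -> e' <= rho ->
  `|trunc_lap e g x - trunc_lap e' g x| <= M * ival Lb (ballk 1 (d - 2)) * e' `^ (N + 2 - d).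
Proof.
move=> g0 mg ag M0 hg e e' e0 ee er.
have [E na] := trunc_int_split e0 ee g0 mg ag.
have e'0 := lt_le_trans e0 ee.
have nk := nint_annk e' e0.
have Em : ival Lb (tailk e d) = ival Lb (annk e e' d) + ival Lb (tailk e' d).
  by rewrite -(ivalD nk (nint_tailk dN e'0)); apply: eq_ival => y; exact: tailk_annk.
have na' : nint Lb (fun y => annk e e' d y * g (x - y)).
  by have := nint_opp na; apply: eq_nint => y; rewrite annkN.
have Eo : ival Lb (fun y => annk e e' d y * g (x - y)) = ival Lb (fun y => annk e e' d y * g (x + y)).
  have [m1 p1 _] := na; rewrite -(ival_opp m1 p1); apply: eq_ival => y; by rewrite annkN.
have d2N : d - 2 < N by have := dN2; lra.
have nb := nint_ballk d2N e'0.
have nbM := nintZ nb M0.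
have g20 : 0 <= 2 * g x by rewrite mulr_ge0.
have nc := nintZ nk g20.
have key1 : 2 * g x * ival Lb (annk e e' d) <= ival Lb (fun y => annk e e' d y * g (x + y)) +
    ival Lb (fun y => annk e e' d y * g (x - y)) + M * ival Lb (ballk e' (d - 2)).
  rewrite -(ivalZ nk g20) -(ivalZ nb M0) -(ivalD na na') -(ivalD (nintD na na') nbM).
  apply: ival_le nc (nintD (nintD na na') nbM) _ => y.
  rewrite -mulrDr; have [h|h] := leP (enorm y) e'; last first.
    rewrite /annk [(enorm y <= e')%R]leNgt h andbF !mul0r mulr0 add0r mulr_ge0//; exact: ballk_ge0.
  have [h1 h2] := second_diff_bounds (hg y (le_trans h er)).
  have h3 := ler_wpM2l M0 (annk_sqr e' y e0).
  have h4 : annk e e' d y * (2 * g x) <= annk e e' d y * (g (x + y) + g (x - y) + M * enorm y ^+ 2).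
    by apply: ler_wpM2l; [exact: annk_ge0|].
  rewrite [2 * g x * _]mulrC; apply: le_trans h4 _.
  by rewrite [leLHS]mulrDr lerD2l mulrCA.
have key2 : ival Lb (fun y => annk e e' d y * g (x + y)) +
    ival Lb (fun y => annk e e' d y * g (x - y)) <=
    2 * g x * ival Lb (annk e e' d) + M * ival Lb (ballk e' (d - 2)).
  rewrite -(ivalZ nk g20) -(ivalZ nb M0) -(ivalD na na') -(ivalD nc nbM).
  apply: ival_le (nintD na na') (nintD nc nbM) _ => y.
  rewrite -mulrDr; have [h|h] := leP (enorm y) e'; last first.
    rewrite /annk [(enorm y <= e')%R]leNgt h andbF !mul0r mulr0 add0r mulr_ge0//; exact: ballk_ge0.
  have [h1 h2] := second_diff_bounds (hg y (le_trans h er)).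
  have h3 := ler_wpM2l M0 (annk_sqr e' y e0).
  have h4 : annk e e' d y * (g (x + y) + g (x - y)) <= annk e e' d y * (2 * g x + M * enorm y ^+ 2).
    by apply: ler_wpM2l; [exact: annk_ge0|].
  rewrite [2 * g x * _]mulrC; apply: le_trans h4 _.
  by rewrite [leLHS]mulrDr lerD2l mulrCA.
have Eb : ival Lb (ballk e' (d - 2)) = e' `^ (N + 2 - d) * ival Lb (ballk 1 (d - 2)).
  by rewrite (ival_ballk d2N e'0); congr (_ `^ _ * _); ring.
have b00 : 0 <= M * ival Lb (ballk e' (d - 2)).
  by apply: mulr_ge0 => //; apply: ival_ge0 => y; exact: ballk_ge0.
rewrite -mulrA [_ * e' `^ _]mulrC -Eb /trunc_lap Em E.
by apply: cauchy_alg b00; [move: key1|move: key2]; rewrite Eo.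
Qed.

End truncated_kernels.

Hint Extern 0 (measurable_fun _ (@ballk _ _ _ _)) => exact: measurable_ballk : mfun.
Hint Extern 0 (measurable_fun _ (@tailk _ _ _ _)) => exact: measurable_tailk : mfun.
Hint Extern 0 (measurable_fun _ (@psi _ _ _)) => exact: measurable_psi : mfun.
Hint Extern 0 (measurable_fun _ (@annk _ _ _ _ _)) => exact: measurable_annk : mfun.

Lemma far_alg (R : realType) (L a b p q : R) : L <= a * q -> a * q <= a * p -> 0 <= b * p -> 0 <= b * q ->
  L <= (a + b) * p /\ L <= (a + b) * q.
Proof. by move=> *; rewrite !mulrDl; split; lra. Qed.

Lemma near_alg (R : realType) (L a b c p q : R) : L <= b * p -> b * p <= c * p -> b * p <= c * q ->
  0 <= a * p -> 0 <= a * q -> L <= (a + c) * p /\ L <= (a + c) * q.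
Proof. by move=> *; rewrite !mulrDl; split; lra. Qed.

Lemma cauchy_sup (R : realType) (F E : R -> R) (r0 : R) : 0 < r0 ->
  (forall e e', 0 < e -> e <= r0 -> 0 < e' -> e' <= r0 -> `|F e - F e'| <= E e + E e') ->
  exists j, forall e, 0 < e -> e <= r0 -> `|F e - j| <= E e.
Proof.
move=> r00 h; exists (sup [set r | exists2 e, 0 < e <= r0 & r = F e - E e]) => e e0 er.
have ub e1 : 0 < e1 -> e1 <= r0 -> ubound [set r | exists2 e, 0 < e <= r0 & r = F e - E e] (F e1 + E e1).
  move=> e10 e1r _ [e2 /andP[e20 e2r] ->].
  by have := h e2 e1 e20 e2r e10 e1r; rewrite ler_norml => /andP[? ?]; lra.
have inn : [set r | exists2 e, 0 < e <= r0 & r = F e - E e] (F e - E e) by exists e; rewrite ?e0.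
have s1 := ge_sup (ex_intro _ _ inn) (ub e e0 er).
have s2 : F e - E e <= sup [set r | exists2 e, 0 < e <= r0 & r = F e - E e].
  by apply: ub_le_sup => //; exists (F e + E e); exact: ub.
by rewrite ler_norml; apply/andP; split; lra.
Qed.

Lemma ival_eq_ae d (T : measurableType d) (R : realType) (nu : {measure set T -> \bar R}) (f g : T -> R) :
  mfunT f -> mfunT g -> {ae nu, forall x, f x = g x} ->
  ival nu f = ival nu g.
Proof.
move=> mf mg h; rewrite !ival_def; congr fine.
apply: (gint_ae_eq (measurable_to_EFin mf) (measurable_to_EFin mg)).
by apply: filterS h => x ->.
Qed.

Lemma nint_eq_ae d (T : measurableType d) (R : realType) (nu : {measure set T -> \bar R}) (f g : T -> R) :
  mfunT g -> (forall x, 0 <= g x) -> {ae nu, forall x, f x = g x} ->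
  nint nu f -> nint nu g.
Proof. by move=> mg g0 h nf; apply: (nint_le_ae mg g0 nf); apply: filterS h => x ->. Qed.

(** * Truncated Laplacians of the Riesz kernel *)

Section fundamental_solution.
Context {R : realType} (n : nat).
Local Notation Lb := (@lebesgue_rV R n.+1).
Local Notation V := 'rV[R]_n.+1.
Local Notation N := (n.+1%:R : R).
Implicit Types (f g : V -> R) (e r m : R) (w : V).
Variables (b d : R).
Hypotheses (b0 : 0 < b) (bN : b < N) (dN : N < d) (dN2 : d < N + 2) (bd : b + d = 2 * N).
Local Notation psi := (@psi R n b).
Local Notation Tr := (@trunc_int R n d).
Local Notation Lap := (@trunc_lap R n d).

Definition potential f (x : V) : R := ival Lb (fun z => f z * psi (x - z)).

Lemma measurable_potential_pair f : mfunT f ->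
  mfunT (fun p : V * V => f p.2 * psi (p.1 - p.2)).
Proof. by intros; mfun. Qed.

Lemma measurable_potential f : mfunT f -> (forall z, 0 <= f z) ->
  mfunT (potential f).
Proof.
move=> mf f0; apply: (measurable_ival (measurable_potential_pair mf)) => x y.
by rewrite mulr_ge0// psi_ge0.
Qed.

Lemma potential_ge0 f x : (forall z, 0 <= f z) -> 0 <= potential f x.
Proof. by move=> f0; apply: ival_ge0 => z; rewrite mulr_ge0// psi_ge0. Qed.

Lemma measurable_trunc_psi e : mfunT (Tr e psi : V -> R).
Proof.
apply: (measurable_ival (F := fun x y => tailk e d y * psi (x + y))).
  by mfun.
by move=> x y; rewrite mulr_ge0 ?tailk_ge0// psi_ge0.
Qed.

Lemma trunc_psi_ge0 e x : 0 <= Tr e psi x.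
Proof. by apply: ival_ge0 => y; rewrite mulr_ge0 ?tailk_ge0// psi_ge0. Qed.

(** Tonelli and translation move the truncated integral from the potential to the Riesz kernel,
    whose truncated integral is a fixed function independent of f. *)
Lemma trunc_potential f e (x : V) : mfunT f -> (forall z, 0 <= f z) ->
  (forall y, y != 0 -> nint Lb (fun z => f z * psi (y - z))) -> 0 < e ->
  nint Lb (fun y => tailk e d y * potential f (x + y)) ->
  nint Lb (fun z => f z * Tr e psi (x - z)) /\
  Tr e (potential f) x = ival Lb (fun z => f z * Tr e psi (x - z)).
Proof.
move=> mf f0 nf e0 ne.
pose F (y z : V) := tailk e d y * (f z * psi (x + y - z)).
have mF : mfunT (fun p : V * V => F p.1 p.2).
  apply: measurable_funM; first exact: (measurableT_comp (measurable_tailk e d) measurable_fst).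
  by mfun.
have F0 y z : 0 <= F y z by rewrite !mulr_ge0 ?tailk_ge0 ?psi_ge0.
have h1 y : y != - x -> nint Lb (F y) /\ ival Lb (F y) = tailk e d y * potential f (x + y).
  move=> yx; have xy : x + y != 0 by rewrite addrC addr_eq0.
  have nn := nf _ xy; split; first exact: nintZ nn (tailk_ge0 _ _ _).
  exact: ivalZ nn (tailk_ge0 _ _ _).
have n1 : {ae Lb, forall y, nint Lb (F y)} by apply: (ae_rV_neq (a := - x)) => y /h1[].
have e1 : {ae Lb, forall y, ival Lb (F y) = tailk e d y * potential f (x + y)}.
  by apply: (ae_rV_neq (a := - x)) => y /h1[].
have mT : mfunT (fun y => tailk e d y * potential f (x + y)).
  by apply: measurable_funM; [exact: measurable_tailk|exact: (measurable_shift x (measurable_potential mf f0))].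
have mI := measurable_ival mF F0.
have nI : nint Lb (fun y => ival Lb (F y)).
  apply: (nint_eq_ae mI _ _ ne); first by move=> y; exact: ival_ge0.
  by apply: filterS e1 => y ->.
have h2 z : nint Lb (fun y => F y z) /\ ival Lb (fun y => F y z) = f z * Tr e psi (x - z).
  have E : (fun y => F y z) = (fun y => f z * (tailk e d y * psi (x - z + y))).
    by apply/funext => y; rewrite /F mulrCA addrAC.
  have na := admissible_psi b0 bN dN (x - z) e0.
  by rewrite E; split; [exact: nintZ na (f0 z)|exact: ivalZ na (f0 z)].
have n2 : {ae Lb, forall z, nint Lb (fun y => F y z)} by apply: aeW => z; have [] := h2 z.
have [nR ER] := tonelli_ival mF F0 n1 n2 nI.
have E2 : (fun z => ival Lb (fun y => F y z)) = (fun z => f z * Tr e psi (x - z)).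
  by apply/funext => z; have [] := h2 z.
rewrite -E2; split; first exact: nR.
by rewrite -ER; apply/esym; exact: ival_eq_ae mI mT e1.
Qed.

Lemma trunc_psi_radial e w : Tr e psi w = Tr e psi (axis n (enorm w)).
Proof.
have mF (x : V) : mfunT (fun y : V => tailk e d y * psi (x - y)) by mfun.
have F0 (x y : V) : 0 <= tailk e d y * psi (x - y) by rewrite mulr_ge0 ?tailk_ge0 ?psi_ge0.
have E (x : V) : Tr e psi x = ival Lb (fun y => tailk e d y * psi (x - y)).
  rewrite -(ival_opp (mF x) (F0 x)); apply: eq_ival => y.
  by rewrite opprK /tailk enormN.
have [phi ip px] := isometry_align w; have [_ ii p0 _] := ip.
rewrite !E -[axis n _]px -(ival_isometry ip (mF (phi w)) (F0 (phi w))); apply: eq_ival => y /=.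
by rewrite /tailk /psi ii -[phi y]subr0 -p0 ii subr0.
Qed.

Lemma psi_radial w : psi w = psi (axis n (enorm w)).
Proof. by rewrite /psi enorm_axis ger0_norm// enorm_ge0. Qed.

Lemma lap_psi_radial e w : Lap e psi w = Lap e psi (axis n (enorm w)).
Proof. by rewrite /Lap trunc_psi_radial {1}psi_radial. Qed.

Lemma psiZ c w : 0 < c -> psi (c *: w) = c `^ (- b) * psi w.
Proof. by move=> c0; rewrite /psi enormZ gtr0_norm// (powRM _ (ltW c0) (enorm_ge0 w)). Qed.

Lemma scale_exponent c : 0 < c -> c ^+ n.+1 * (c `^ (- d) * c `^ (- b)) = c `^ (- N).
Proof.
move=> c0; rewrite -powR_mulrn ?(ltW c0)// -!powRD ?(gt_eqF c0) ?implybT//.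
by congr (_ `^ _); have := bd; lra.
Qed.

Lemma trunc_psiZ c r w : 0 < c -> 0 < r -> Tr (c * r) psi (c *: w) = c `^ (- N) * Tr r psi w.
Proof.
move=> c0 r0; have na := admissible_psi b0 bN dN w r0.
have [m1 p1 _] := admissible_psi b0 bN dN (c *: w) (mulr_gt0 c0 r0).
rewrite /trunc_int (ival_scale c0 m1 p1) -(scale_exponent c0) -mulrA; congr (_ * _).
have k0 : 0 <= c `^ (- d) * c `^ (- b) by rewrite mulr_ge0 ?powR_ge0.
rewrite -(ivalZ na k0); apply: eq_ival => y.
by rewrite -scalerDr tailkZ// psiZ// mulrACA.
Qed.

(** The relation b + d = 2N makes the homogeneity exactly -N: truncation at e is the L1-normalised
    dilation of truncation at 1, which is the structure of an approximate identity. *)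
Lemma lap_psiZ c r w : 0 < c -> 0 < r -> Lap (c * r) psi (c *: w) = c `^ (- N) * Lap r psi w.
Proof.
move=> c0 r0; rewrite /Lap trunc_psiZ// psiZ// (ival_tailk dN (mulr_gt0 c0 r0)) [in RHS](ival_tailk dN r0).
rewrite (powRM _ (ltW c0) (ltW r0)) mulrBr; congr (_ - _).
have -> : c `^ (- N) = c `^ (- b) * c `^ (N - d).
  by rewrite -powRD ?(gt_eqF c0) ?implybT//; congr (_ `^ _); have := bd; lra.
have alg (a p x y i : R) : (a * p) * ((x * y) * i) = (a * x) * (p * (y * i)) by ring.
exact: alg.
Qed.

Lemma psi_second_diff (x : V) : x != 0 -> exists2 K, 0 <= K & forall y,
  enorm y <= enorm x / 16 -> `|psi (x + y) + psi (x - y) - 2 * psi x| <= K * enorm y ^+ 2.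
Proof.
move=> x0.
have v1 (h : R) : `|h| <= 1 -> forall t : R, `|cst (1 : R) (t + h) - cst 1 t| <= 0 * `|h|.
  by move=> _ t; rewrite /= subrr normr0 mul0r.
have v2 (h : R) : `|h| <= 1 -> forall t : R, `|cst (1 : R) (t + h) + cst 1 (t - h) - 2 * cst 1 t| <= 0 * h ^+ 2.
  by move=> _ t; rewrite /= mulr1 (_ : (1 + 1 - 2 = 0 :> R)) ?normr0 ?mul0r//; lra.
have vX (t : R) : `|cst (1 : R) t| <= 1 by rewrite /= normr1.
have [K K0 HK] := rfun_second_diff (b / 2) (lexx 0) v1 v2 vX x0.
have E (y : V) : psi y = rfun (cst 1) (b / 2) y.
  by rewrite rfunE /psi mulr1; congr (_ `^ _); field.
by exists K => // y hy; rewrite !E; exact: HK.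
Qed.

(** The kernel is smooth near the unit vector, so its truncated Laplacians there are Cauchy. That
    the limit j vanishes is shown only later, by [leading_coef_zero]. *)
Lemma lap_psi_cvg : exists j K : R, 0 <= K /\ forall e, 0 < e -> e <= 16^-1 ->
  `|Lap e psi (axis n 1) - j| <= K * e `^ (N + 2 - d).
Proof.
have a0 : axis n (1 : R) != 0 by rewrite -enorm_gt0 enorm_axis normr1.
have [M M0 HM] := psi_second_diff a0.
have HM' (y : V) : enorm y <= 16^-1 -> `|psi (axis n 1 + y) + psi (axis n 1 - y) - 2 * psi (axis n 1)| <= M * enorm y ^+ 2.
  by move=> hy; apply: HM; rewrite enorm_axis normr1 mul1r.
have i0 : 0 <= ival Lb (ballk 1 (d - 2)) by apply: ival_ge0 => y; exact: ballk_ge0.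
have key := trunc_lap_cauchy dN dN2 (psi_ge0 b) (measurable_psi b) (admissible_psi b0 bN dN (axis n 1)) M0 HM'.
have r0 : 0 < (16 : R)^-1 by rewrite invr_gt0.
have K0 : 0 <= M * ival Lb (ballk 1 (d - 2)) by rewrite mulr_ge0.
have [j Hj] : exists j, forall e : R, 0 < e -> e <= 16^-1 -> `|Lap e psi (axis n 1) - j| <=
    M * ival Lb (ballk 1 (d - 2)) * e `^ (N + 2 - d).
  apply: cauchy_sup => // e e' e0 er e'0 e'r.
  have p1 : 0 <= M * ival Lb (ballk 1 (d - 2)) * e `^ (N + 2 - d) by rewrite mulr_ge0 ?powR_ge0.
  have p2 : 0 <= M * ival Lb (ballk 1 (d - 2)) * e' `^ (N + 2 - d) by rewrite mulr_ge0 ?powR_ge0.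
  have [l|/ltW l] := leP e e'.
    by apply: le_trans (key e e' e0 l e'r) _; rewrite lerDr.
  by rewrite distrC; apply: le_trans (key e' e e'0 l er) _; rewrite lerDl.
by exists j, (M * ival Lb (ballk 1 (d - 2))).
Qed.

(** By homogeneity a distant point w for truncation 1 is the unit vector for truncation 1/|w|, so
    the behaviour at infinity is that of small truncations; 16 comes from the radius |x|/16 of the
    expansions. *)
Lemma lap_psi_far (j K : R) w : 0 <= K -> (forall e, 0 < e -> e <= 16^-1 ->
  `|Lap e psi (axis n 1) - j| <= K * e `^ (N + 2 - d)) -> 16 <= enorm w ->
  `|Lap 1 psi w - j * enorm w `^ (- N)| <= K * enorm w `^ (- (b + 2)).
Proof.
move=> K0 Hj w16; have w0 : 0 < enorm w by apply: lt_le_trans w16.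
have i0 : 0 < (enorm w)^-1 by rewrite invr_gt0.
have -> : Lap 1 psi w = enorm w `^ (- N) * Lap (enorm w)^-1 psi (axis n 1).
  rewrite -(lap_psiZ (axis n 1) w0 i0) (divff (lt0r_neq0 w0)) -axisM mulr1.
  exact: lap_psi_radial.
rewrite [j * _]mulrC -mulrBr normrM (ger0_norm (powR_ge0 _ _)).
have i16 : (enorm w)^-1 <= 16^-1 by rewrite lef_pV2// posrE.
have := ler_wpM2l (powR_ge0 (enorm w) (- N)) (Hj _ i0 i16); move/le_trans; apply.
rewrite mulrCA; apply: ler_wpM2l => //.
have -> : (enorm w)^-1 = enorm w `^ (-1) by rewrite powR_inv1 ?ltW.
rewrite -powRrM -powRD ?(gt_eqF w0) ?implybT//.
by rewrite (_ : - N + -1 * (N + 2 - d) = - (b + 2))//; have := bd; lra.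
Qed.

Lemma trunc_psi_bounded : exists2 Q, 0 <= Q & forall w, Tr 1 psi w <= Q.
Proof.
have i1 : 0 <= ival Lb (ballk 1 b) by apply: ival_ge0 => y; exact: ballk_ge0.
have i2 : 0 <= ival Lb (tailk 1 d) by apply: ival_ge0 => y; exact: tailk_ge0.
exists (ival Lb (ballk 1 b) + ival Lb (tailk 1 d)); first by rewrite addr_ge0.
move=> w; have nb := nint_ballk bN ltr01; have nt := nint_tailk dN ltr01.
have [mb pb _] := nb.
rewrite -(ival_shift w mb pb) -(ivalD (nint_shift w nb) nt).
apply: (ival_le (admissible_psi b0 bN dN w ltr01) (nintD (nint_shift w nb) nt)) => y.
rewrite addrC /tailk; case: (ltP 1 (enorm y)) => ey; last first.
  by rewrite !mul0r addr0 ballk_ge0.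
have e1 : enorm y `^ (- d) <= 1.
  have d0 : 0 <= d by have := dN; have : 0 <= N by []; lra.
  by have := ler_powRN ltr01 (ltW ey) d0; rewrite powR1.
rewrite !mul1r /ballk /psi; case: (leP (enorm (y + w)) 1) => h; rewrite ?mul1r ?mul0r.
  rewrite -[leLHS]addr0; apply: lerD; last exact: powR_ge0.
  by rewrite -[leRHS]mul1r; apply: ler_wpM2r => //; exact: powR_ge0.
rewrite add0r -[leRHS]mulr1; apply: ler_wpM2l; first exact: powR_ge0.
by have := ler_powRN ltr01 (ltW h) (ltW b0); rewrite powR1.
Qed.

(** The first bound is the useful one near the origin, the second at infinity. *)
Definition lap_decay (m : R) := exists2 A, 0 <= A & forall w, w != 0 ->
  `|Lap 1 psi w| <= A * psi w /\ `|Lap 1 psi w| <= A * enorm w `^ (- m).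

Lemma lap_decay_from (m A16 : R) : 0 <= A16 -> b <= m ->
  (forall w, 16 <= enorm w -> `|Lap 1 psi w| <= A16 * enorm w `^ (- m)) -> lap_decay m.
Proof.
move=> A0 bm Hf; have [Q Q0 HQ] := trunc_psi_bounded.
have mm : 0 <= ival Lb (tailk 1 d) by apply: ival_ge0 => y; exact: tailk_ge0.
have m0 : 0 <= m by exact: le_trans (ltW b0) bm.
pose A1 := ival Lb (tailk 1 d) + Q * 16 `^ b.
have A10 : 0 <= A1 by rewrite /A1 addr_ge0// mulr_ge0// powR_ge0.
have sixteen : 1 <= (16 : R) `^ (m - b)
  by rewrite -[leLHS](powRr0 16); apply: ler_powR; [rewrite ler1n|rewrite subr_ge0].
exists (A16 + A1 * 16 `^ (m - b)); first by rewrite addr_ge0// mulr_ge0// powR_ge0.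
move=> w w0; have ew : 0 < enorm w by rewrite enorm_gt0.
have pw : 0 <= enorm w `^ (- m) by exact: powR_ge0.
have [h|h] := leP 16 (enorm w).
  have h1 := Hf w h.
  have h2 : enorm w `^ (- m) <= psi w.
    by rewrite /psi ler_powR ?lerN2//; apply: le_trans h; rewrite ler1n.
  have h3 : A16 * enorm w `^ (- m) <= A16 * psi w by exact: ler_wpM2l.
  have h4 : 0 <= A1 * 16 `^ (m - b) by rewrite mulr_ge0// powR_ge0.
  exact: (far_alg h1 h3 (mulr_ge0 h4 (psi_ge0 b w)) (mulr_ge0 h4 pw)).
have e16 : psi w * 16 `^ b >= 1.
  have p1 := ler_powRN ew (ltW h) (ltW b0).
  have := ler_wpM2r (powR_ge0 16 b) p1; rewrite -powRD ?addNr ?powRr0//.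
  by rewrite pnatr_eq0 implybT.
have hb : `|Lap 1 psi w| <= A1 * psi w.
  have := HQ w; have := trunc_psi_ge0 1 w; have := psi_ge0 b w; have := mulr_ge0 (psi_ge0 b w) mm.
  rewrite /Lap /A1 mulrDl => a1 a2 a3 a4.
  have a5 : Q <= Q * 16 `^ b * psi w.
    by rewrite -mulrA -{1}[Q]mulr1; apply: ler_wpM2l => //; rewrite mulrC.
  by rewrite ler_norml; apply/andP; split; rewrite [ival _ _ * _]mulrC; lra.
have hm : psi w <= 16 `^ (m - b) * enorm w `^ (- m).
  have -> : psi w = enorm w `^ (m - b) * enorm w `^ (- m).
    by rewrite /psi -powRD ?(gt_eqF ew) ?implybT//; congr (_ `^ _); ring.
  apply: ler_wpM2r => //; apply: ge0_ler_powR; rewrite ?nnegrE ?subr_ge0//; exact: ltW.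
have h7 : A1 * psi w <= A1 * 16 `^ (m - b) * psi w.
  by rewrite mulrAC -{1}[A1 * psi w]mulr1; apply: ler_wpM2l => //; rewrite mulr_ge0// psi_ge0.
have h8 : A1 * psi w <= A1 * 16 `^ (m - b) * enorm w `^ (- m).
  by rewrite -mulrA; exact: ler_wpM2l.
exact: (near_alg hb h7 h8 (mulr_ge0 A0 (psi_ge0 b w)) (mulr_ge0 A0 pw)).
Qed.

(** The rate N is the borderline one: it leaves a logarithmic divergence at infinity. It is
    nevertheless enough to prove j = 0, which then improves the rate to b + 2 > N. *)
Lemma lap_decay_dim : lap_decay N.
Proof.
have [j [K [K0 Hj]]] := lap_psi_cvg.
apply: (@lap_decay_from N (`|j| + K)); [by rewrite addr_ge0|exact: ltW|] => w w16.
have w0 : 0 < enorm w by apply: lt_le_trans w16.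
have := lap_psi_far K0 Hj w16 => h.
have h2 : enorm w `^ (- (b + 2)) <= enorm w `^ (- N).
  rewrite ler_powR ?lerN2//; first by apply: le_trans w16; rewrite ler1n.
  by have := bd; have := dN2; lra.
have h3 := ler_wpM2l K0 h2.
have -> : Lap 1 psi w = (Lap 1 psi w - j * enorm w `^ (- N)) + j * enorm w `^ (- N) by rewrite subrK.
apply: le_trans (ler_normD _ _) _; rewrite normrM (ger0_norm (powR_ge0 _ _)) mulrDl; lra.
Qed.

Lemma lap_decay_better (K : R) : 0 <= K -> (forall e, 0 < e -> e <= 16^-1 ->
  `|Lap e psi (axis n 1) - 0| <= K * e `^ (N + 2 - d)) -> lap_decay (b + 2).
Proof.
move=> K0 Hj; apply: (@lap_decay_from (b + 2) K) => //; first by lra.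
by move=> w w16; have := lap_psi_far K0 Hj w16; rewrite mul0r subr0.
Qed.

End fundamental_solution.

Lemma psiE (R : realType) n (b : R) (w : 'rV[R]_n.+1) : psi b w = enorm w `^ (- b).
Proof. by []. Qed.

Lemma ballkE (R : realType) n (r m : R) (w : 'rV[R]_n.+1) :
  ballk r m w = (enorm w <= r)%R%:R * enorm w `^ (- m).
Proof. by []. Qed.

Lemma potentialE (R : realType) n (b : R) (f : 'rV[R]_n.+1 -> R) (x : 'rV[R]_n.+1) :
  potential b f x = ival (lebesgue_rV n.+1) (fun z => f z * psi b (x - z)).
Proof. by []. Qed.

Lemma ballk_in (R : realType) n (r t : R) (w : 'rV[R]_n.+1) : 0 < enorm w -> enorm w <= r ->
  ballk r (t - 1) w = enorm w * enorm w `^ (- t).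
Proof.
move=> ew h; rewrite ballkE h mul1r opprB.
by rewrite powRD; [rewrite powRr1// ltW|rewrite (gt_eqF ew) implybT].
Qed.

Lemma eq_le1 (R : realType) (a c : R) : a = c -> a <= c.
Proof. by move=> ->. Qed.

Lemma near_prod (R : realType) (L x A E T : R) : L * x * (A * E * T) = L * A * E * (x * T).
Proof. by ring. Qed.

Lemma far_prod (R : realType) (F A E r T : R) : F * (A * E * (r * T)) = A * E * r * (F * T).
Proof. by ring. Qed.

Lemma psi_decay (R : realType) n (b m r : R) (w : 'rV[R]_n.+1) : 0 < r -> b <= m -> r <= enorm w ->
  enorm w `^ (- m) <= r `^ (b - m) * psi b w.
Proof.
move=> r0 bm h; have ew : 0 < enorm w by exact: lt_le_trans h.
rewrite psiE; have -> : enorm w `^ (- m) = enorm w `^ (- (m - b)) * enorm w `^ (- b).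
  by rewrite -powRD; [congr (_ `^ _); ring|rewrite (gt_eqF ew) implybT].
apply: ler_wpM2r; first exact: powR_ge0.
by rewrite -[b - m]opprB; apply: ler_powRN => //; rewrite subr_ge0.
Qed.

Lemma scale_invK (R : realType) n (e : R) (w : 'rV[R]_n.+1) : 0 < e -> e *: (e^-1 *: w) = w.
Proof. by move=> e0; rewrite scalerA mulfV ?gt_eqF// scale1r. Qed.

Lemma scale_Kinv (R : realType) n (e : R) (w : 'rV[R]_n.+1) : 0 < e -> e^-1 *: (e *: w) = w.
Proof. by move=> e0; rewrite scalerA mulVf ?gt_eqF// scale1r. Qed.

Lemma mulr_swap24 (R : realType) (a i p m : R) : a * i * (p * m) = a * m * (i * p).
Proof. by ring. Qed.

Lemma mulrAC_swap (R : realType) (a m i : R) : a * m * i = a * (i * m).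
Proof. by ring. Qed.

Lemma mulr_cancel (R : realType) (a c i : R) : a * c = 1 -> a * (c * i) = i.
Proof. by move=> h; rewrite mulrA h mul1r. Qed.

Lemma mulr1' (R : realType) (e : R) : e * 1 = e.
Proof. exact: mulr1. Qed.

Opaque trunc_int psi tailk ballk annk potential.

Lemma product_defect (R : realType) (F P Q I B : R) : `|(F - I) * (P - Q)| <= B ->
  F * P + I * Q <= F * Q + I * P + B /\ F * Q + I * P <= F * P + I * Q + B.
Proof.
rewrite ler_norml => /andP[h1 h2].
have E : (F - I) * (P - Q) = F * P + I * Q - (F * Q + I * P) by ring.
by rewrite E in h1 h2; split; lra.
Qed.

Lemma sum_dist (R : realType) (a1 a2 c1 c2 B1 B2 : R) : a1 + c2 <= a2 + c1 + (B1 + B2) ->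
  a2 + c1 <= a1 + c2 + (B1 + B2) -> `|(a1 - a2) - (c1 - c2)| <= B1 + B2.
Proof. by move=> *; rewrite ler_norml; apply/andP; split; lra. Qed.

Lemma mass_alg (R : realType) (p q i t k : R) : q * t = 1 -> p * i * k = p * q * i * (t * k).
Proof.
move=> qt; have -> : p * q * i * (t * k) = (q * t) * (p * i * k) by ring.
by rewrite qt mul1r.
Qed.

Lemma small_powR (R : realType) (C h eps : R) : 0 <= C -> 0 < h -> 0 < eps ->
  exists2 r, 0 < r & forall e, 0 < e -> e <= r -> C * e `^ h <= eps.
Proof.
move=> C0 h0 e0; have c1 : 0 < C + 1 by lra.
have q0 : 0 < eps / (C + 1) by rewrite divr_gt0.
exists ((eps / (C + 1)) `^ h^-1); first exact: powR_gt0.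
move=> e e1 er; have h1 : e `^ h <= eps / (C + 1).
  have -> : eps / (C + 1) = ((eps / (C + 1)) `^ h^-1) `^ h.
    by rewrite -powRrM mulVf ?gt_eqF// powRr1// ltW.
  by apply: (ge0_ler_powR (ltW h0)) => //; rewrite nnegrE ?powR_ge0// ltW.
rewrite ler_pdivlMr// in h1.
by have := powR_ge0 e h; rewrite mulrDr mulr1 mulrC in h1; lra.
Qed.

(** * Truncated Laplacian of a potential against the approximate identity *)

Section core_estimate.
Context {R : realType} (n : nat).
Local Notation Lb := (@lebesgue_rV R n.+1).
Local Notation V := 'rV[R]_n.+1.
Local Notation N := (n.+1%:R : R).
Implicit Types (e r m : R) (w : V).
Variables (b d : R).
Hypotheses (b0 : 0 < b) (bN : b < N) (dN : N < d) (dN2 : d < N + 2) (bd : b + d = 2 * N).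
Local Notation psi := (@psi R n b).
Local Notation Tr := (@trunc_int R n d).
Local Notation Lap := (@trunc_lap R n d).
Local Notation pot := (potential b).

Lemma nint_refl (g : V -> R) (x : V) : nint Lb g -> nint Lb (fun w => g (x - w)).
Proof.
move=> ng; have := nint_opp (nint_shift x ng); apply: eq_nint => w; by rewrite addrC.
Qed.

Lemma ival_refl (g : V -> R) (x : V) : nint Lb g -> ival Lb (fun w => g (x - w)) = ival Lb g.
Proof.
move=> ng; have [mg g0 _] := ng; have [ms s0 _] := nint_shift x ng.
rewrite -(ival_shift x mg g0) -(ival_opp ms s0); apply: eq_ival => w; by rewrite addrC.
Qed.

Lemma ival_reflE (g g' : V -> R) (x : V) : nint Lb g -> (forall w, g (x - w) = g' w) ->
  ival Lb g = ival Lb g'.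
Proof. by move=> ng h; rewrite -(ival_refl x ng); exact: eq_ival. Qed.

Lemma nint_reflE (g g' : V -> R) (x : V) : nint Lb g -> (forall w, g (x - w) = g' w) -> nint Lb g'.
Proof. by move=> ng h; exact: eq_nint (nint_refl x ng). Qed.

Definition ballI r w : R := (enorm w <= r)%R%:R.

Lemma measurable_ballI r : mfunT (ballI r).
Proof.
by apply: (@measurable_enorm_bool _ _ _ _ (fun x => x <= r)); [exact: measurable_le_set|exact: measurable_enorm].
Qed.

Lemma ballI_ge0 r w : 0 <= ballI r w. Proof. by []. Qed.

Lemma ballI_psi r w : ballI r w * psi w = ballk r b w.
Proof. by rewrite ballkE psiE. Qed.

Lemma nint_ballI_psi r : 0 < r -> nint Lb (fun w => ballI r w * psi w).
Proof. by move=> r0; apply: eq_nint (nint_ballk bN r0) => w; rewrite ballI_psi. Qed.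

Lemma nint_ballI r : 0 < r -> nint Lb (ballI r).
Proof.
move=> r0; apply: eq_nint (nint_ballk (m := 0) _ r0) => [w|]; last by have := b0; have := bN; lra.
by rewrite ballkE oppr0 powRr0 mulr1.
Qed.

Lemma nint_ballI_trunc r : 0 < r -> nint Lb (fun w => ballI r w * Tr 1 psi w).
Proof.
move=> r0; have [Q Q0 HQ] := trunc_psi_bounded b0 bN dN.
apply: nint_le (nintZ (nint_ballI r0) Q0) _.
- by apply: measurable_funM; [exact: measurable_ballI|exact: measurable_trunc_psi].
- by move=> w; rewrite mulr_ge0// trunc_psi_ge0.
- by move=> w; rewrite mulrC; apply: ler_wpM2r; [exact: ballI_ge0|exact: HQ].
Qed.

(** The integral over the ball of radius r of the truncated Laplacian [Lap 1 psi]. *)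
Definition ball_mass r : R :=
  ival Lb (fun w => ballI r w * psi w) * ival Lb (tailk 1 d) - ival Lb (fun w => ballI r w * Tr 1 psi w).

Lemma ballIZ c r w : 0 < c -> ballI (c * r) (c *: w) = ballI r w.
Proof. by move=> c0; rewrite /ballI enormZ gtr0_norm// ler_pM2l. Qed.

(** After dilation by e, the mass over the large ball of radius r / e is the integral of [Lap e psi]
    over the fixed ball of radius r. *)
Lemma ball_mass_scale r e : 0 < r -> 0 < e ->
  nint Lb (fun w => ballI r w * Tr e psi w) /\
  ball_mass (r / e) = ival Lb (fun w => ballI r w * psi w) * ival Lb (tailk e d) -
    ival Lb (fun w => ballI r w * Tr e psi w).
Proof.
move=> r0 e0; have re : 0 < r / e by rewrite divr_gt0.
have rE : r = e * (r / e) by rewrite mulrC divfK// gt_eqF.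
have ie : 0 < e^-1 by rewrite invr_gt0.
have E w : ballI r w * Tr e psi w = e `^ (- N) * (ballI (r / e) (e^-1 *: w) * Tr 1 psi (e^-1 *: w)).
  have H1 := trunc_psiZ b0 bN dN bd (e^-1 *: w) e0 ltr01; rewrite mulr1' (scale_invK w e0) in H1.
  have H2 := ballIZ (r / e) (e^-1 *: w) e0; rewrite -rE (scale_invK w e0) in H2.
  by rewrite H1 H2 mulrCA.
have n1 := nint_scale ie (nint_ballI_trunc re).
have n2 := nintZ n1 (powR_ge0 e (- N)).
have n3 : nint Lb (fun w => ballI r w * Tr e psi w) by apply: eq_nint n2 => w; rewrite E.
split; first exact: n3.
have X1 : ival Lb (fun w => ballI (r / e) w * psi w) * ival Lb (tailk 1 d) =
    ival Lb (fun w => ballI r w * psi w) * ival Lb (tailk e d).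
  have E1 : ival Lb (fun w => ballI (r / e) w * psi w) = (r / e) `^ (N - b) * ival Lb (ballk 1 b).
    by rewrite -(ival_ballk bN re); apply: eq_ival => w; rewrite ballI_psi.
  have E2 : ival Lb (fun w => ballI r w * psi w) = r `^ (N - b) * ival Lb (ballk 1 b).
    by rewrite -(ival_ballk bN r0); apply: eq_ival => w; rewrite ballI_psi.
  rewrite E1 E2 (ival_tailk dN e0).
  have -> : r `^ (N - b) = (r / e) `^ (N - b) * e `^ (N - b).
    by rewrite -powRM ?(ltW re) ?(ltW e0)// divfK// gt_eqF.
  apply: mass_alg; rewrite -powRD ?(gt_eqF e0) ?implybT//.
  by rewrite (_ : N - b + (N - d) = 0) ?powRr0//; have := bd; lra.
have [m3 p3 _] := n3; have nr := nint_ballI_trunc re.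
have X2 : ival Lb (fun w => ballI r w * Tr e psi w) = ival Lb (fun w => ballI (r / e) w * Tr 1 psi w).
  rewrite (ival_scale e0 m3 p3).
  have E3 w : ballI r (e *: w) * Tr e psi (e *: w) = e `^ (- N) * (ballI (r / e) w * Tr 1 psi w).
    by have H1 := E (e *: w); rewrite (scale_Kinv w e0) in H1.
  have E4 := etrans (eq_ival Lb E3) (ivalZ nr (powR_ge0 e (- N))).
  have E5 : e ^+ n.+1 * e `^ (- N) = 1 by rewrite (powR_dim _ _ e0) subrr powRr0.
  exact: (etrans (congr1 (fun i => e ^+ n.+1 * i) E4) (mulr_cancel _ E5)).
by rewrite /ball_mass X1 X2.
Qed.

(** For an exponent t between b and m, the first bound of [lap_decay] implies decay |w|^(-t) inside
    the unit ball and the second outside; dilation inserts the power e^(t - N). *)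
Lemma lap_scaled_bound (A m t : R) : 0 <= A -> b <= t -> t <= m ->
  (forall w, w != 0 -> `|Lap 1 psi w| <= A * psi w /\ `|Lap 1 psi w| <= A * enorm w `^ (- m)) ->
  forall e w, 0 < e -> w != 0 -> `|Lap e psi w| <= A * e `^ (t - N) * enorm w `^ (- t).
Proof.
move=> A0 bt tm HA e w e0 w0; have ie : 0 < e^-1 by rewrite invr_gt0.
have w'0 : e^-1 *: w != 0 by rewrite scaler_eq0 negb_or gt_eqF.
have E : Lap e psi w = e `^ (- N) * Lap 1 psi (e^-1 *: w).
  by have H1 := lap_psiZ b0 bN dN bd (e^-1 *: w) e0 ltr01; rewrite mulr1' (scale_invK w e0) in H1.
have key (x : V) : x != 0 -> `|Lap 1 psi x| <= A * enorm x `^ (- t).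
  move=> x0; have [h1 h2] := HA x x0; have ex : 0 < enorm x by rewrite enorm_gt0.
  have [h|h] := leP 1 (enorm x).
    apply: le_trans h2 _; apply: ler_wpM2l => //; apply: ler_powR => //; by rewrite lerN2.
  apply: le_trans h1 _; apply: ler_wpM2l => //.
  rewrite psiE -[t](subrK b) opprD powRD ?(gt_eqF ex) ?implybT// -[leLHS]mul1r.
  apply: ler_wpM2r; first exact: powR_ge0.
  by have := ler_powRN ex (ltW h) (_ : 0 <= t - b); rewrite powR1; apply; rewrite subr_ge0.
rewrite E normrM (ger0_norm (powR_ge0 _ _)).
have := ler_wpM2l (powR_ge0 e (- N)) (key _ w'0); move/le_trans; apply.
rewrite enormZ gtr0_norm// (powRM _ (ltW ie) (enorm_ge0 w)).
have -> : e^-1 `^ (- t) = e `^ t.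
  by rewrite -(powR_inv1 (ltW e0)) -powRrM mulN1r opprK.
have -> : e `^ (t - N) = e `^ (- N) * e `^ t.
  by rewrite -powRD ?(gt_eqF e0) ?implybT// addrC.
by rewrite le_eqVlt; apply/orP; left; apply/eqP; rewrite mulrCA !mulrA.
Qed.

Variables (f : V -> R).
Hypotheses (mf : mfunT f) (f0 : forall z, 0 <= f z).
Hypothesis (nf : forall y, y != 0 -> nint Lb (fun z => f z * psi (y - z))).

(** The left side is the integral of f(x - w) minus f(x) on the ball of radius rho, against
    [Lap e psi]. Inside the ball the Lipschitz bound of f gains |w|, which makes |w|^(1 - t)
    integrable. Outside, the decay |w|^(-m) is compared with the Riesz kernel, so f is controlled by
    its potential at x. *)
Lemma core_estimate (x : V) (rho L A m t : R) : x != 0 -> 0 < rho -> 0 <= L -> 0 <= A ->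
  b <= t -> t <= m -> t - 1 < N -> admissible_at d (pot f) x ->
  (forall z, enorm (z - x) <= rho -> `|f z - f x| <= L * enorm (z - x)) ->
  (forall w, w != 0 -> `|Lap 1 psi w| <= A * psi w /\ `|Lap 1 psi w| <= A * enorm w `^ (- m)) ->
  forall e, 0 < e -> `|Lap e (pot f) x - f x * ball_mass (rho / e)| <=
    L * A * e `^ (t - N) * ival Lb (ballk rho (t - 1)) + A * e `^ (m - N) * rho `^ (b - m) * pot f x.
Proof.
move=> x0 r0 L0 A0 bt tm t1 ad lipf HA e e0.
have me0 : 0 <= ival Lb (tailk e d) by apply: ival_ge0 => y; exact: tailk_ge0.
have [nq Eq] := trunc_potential b0 bN dN mf f0 nf e0 (ad e e0).
have np := nf x0.
have hp w : f (x - w) * psi (x - (x - w)) = f (x - w) * psi w by rewrite subKr.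
have hq w : f (x - w) * Tr e psi (x - (x - w)) = f (x - w) * Tr e psi w by rewrite subKr.
have np' := nint_reflE np hp.
have Ep : pot f x = ival Lb (fun w => f (x - w) * psi w).
  by rewrite potentialE; exact: ival_reflE np hp.
have nq' := nint_reflE nq hq.
have Eq' := etrans Eq (ival_reflE nq hq).
have [nb Eb] := ball_mass_scale r0 e0.
have na1 : nint Lb (fun w => f (x - w) * (psi w * ival Lb (tailk e d))).
  by apply: eq_nint (nintZ np' me0) => w; rewrite mulrA mulrC.
have Ea1 : ival Lb (fun w => f (x - w) * (psi w * ival Lb (tailk e d))) = pot f x * ival Lb (tailk e d).
  by rewrite Ep mulrC -(ivalZ np' me0); apply: eq_ival => w; rewrite mulrA mulrC.
have fm0 : 0 <= f x * ival Lb (tailk e d) by rewrite mulr_ge0.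
have nc1 : nint Lb (fun w => f x * ballI rho w * (psi w * ival Lb (tailk e d))).
  by apply: eq_nint (nintZ (nint_ballI_psi r0) fm0) => w; exact: (esym (mulr_swap24 _ _ _ _)).
have Ec1 : ival Lb (fun w => f x * ballI rho w * (psi w * ival Lb (tailk e d))) =
    f x * (ival Lb (fun w => ballI rho w * psi w) * ival Lb (tailk e d)).
  transitivity (f x * ival Lb (tailk e d) * ival Lb (fun w => ballI rho w * psi w)).
    rewrite -(ivalZ (nint_ballI_psi r0) fm0); apply: eq_ival => w; exact: mulr_swap24.
  exact: (mulrAC_swap _ _ _).
have nc2 : nint Lb (fun w => f x * ballI rho w * Tr e psi w).
  by apply: eq_nint (nintZ nb (f0 x)) => w; exact: mulrA.
have Ec2 : ival Lb (fun w => f x * ballI rho w * Tr e psi w) =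
    f x * ival Lb (fun w => ballI rho w * Tr e psi w).
  by rewrite -(ivalZ nb (f0 x)); apply: eq_ival => w; exact: (esym (mulrA _ _ _)).
have k1 : 0 <= L * A * e `^ (t - N) by rewrite !mulr_ge0 ?powR_ge0.
have k2 : 0 <= A * e `^ (m - N) * rho `^ (b - m) by rewrite !mulr_ge0 ?powR_ge0.
have nB1 := nintZ (nint_ballk t1 r0) k1.
have nB2 := nintZ np' k2.
have nB := nintD nB1 nB2.
have EB : ival Lb (fun w => L * A * e `^ (t - N) * ballk rho (t - 1) w +
    A * e `^ (m - N) * rho `^ (b - m) * (f (x - w) * psi w)) =
    L * A * e `^ (t - N) * ival Lb (ballk rho (t - 1)) + A * e `^ (m - N) * rho `^ (b - m) * pot f x.
  by rewrite (ivalD nB1 nB2) (ivalZ (nint_ballk t1 r0) k1) (ivalZ np' k2) -Ep.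
have point w : w != 0 -> `|(f (x - w) - f x * ballI rho w) * (psi w * ival Lb (tailk e d) - Tr e psi w)| <=
    L * A * e `^ (t - N) * ballk rho (t - 1) w + A * e `^ (m - N) * rho `^ (b - m) * (f (x - w) * psi w).
  move=> w0; have ew : 0 < enorm w by rewrite enorm_gt0.
  rewrite normrM -/(Lap e psi w).
  have [h|h] := leP (enorm w) rho.
    have -> : ballI rho w = 1 by rewrite /ballI h.
    have -> : ballk rho (t - 1) w = enorm w * enorm w `^ (- t).
      exact: ballk_in.
    rewrite mulr1 -[leLHS]addr0; apply: lerD; last first.
      exact: (mulr_ge0 k2 (mulr_ge0 (f0 _) (psi_ge0 b w))).
    have hx : enorm (x - w - x) <= rho by rewrite addrAC subrr sub0r enormN.
    have := lipf _ hx; rewrite addrAC subrr sub0r enormN => h1.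
    have h2 := lap_scaled_bound A0 bt tm HA e0 w0.
    have := ler_pM (normr_ge0 _) (normr_ge0 _) h1 h2; move/le_trans; apply.
    exact: (eq_le1 (near_prod _ _ _ _ _)).
  have -> : ballI rho w = 0 by rewrite /ballI leNgt h.
  rewrite mulr0 subr0 (ger0_norm (f0 _)) -[leLHS]add0r; apply: lerD.
    exact: (mulr_ge0 k1 (ballk_ge0 _ _ _)).
  have h2 := lap_scaled_bound A0 (le_trans bt tm) (lexx m) HA e0 w0.
  have bm := le_trans bt tm.
  have h3 : enorm w `^ (- m) <= rho `^ (b - m) * psi w.
    exact: psi_decay (ltW h).
  have h4 := ler_wpM2l (mulr_ge0 A0 (powR_ge0 e (m - N))) h3.
  have := ler_wpM2l (f0 (x - w)) (le_trans h2 h4); move/le_trans; apply.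
  exact: (eq_le1 (far_prod _ _ _ _ _)).
rewrite -EB /trunc_lap Eb mulrBr Eq' -Ec1 -Ec2 -Ea1.
rewrite (ivalD nB1 nB2); apply: sum_dist; rewrite -(ivalD nB1 nB2).
  apply: ival_le23_ae na1 nc2 nq' nc1 nB _; apply: (ae_rV_neq (a := 0)) => w w0.
  by have [] := product_defect (point w w0).
apply: ival_le23_ae nq' nc1 na1 nc2 nB _; apply: (ae_rV_neq (a := 0)) => w w0.
by have [] := product_defect (point w w0).
Qed.

End core_estimate.

Lemma annulus_gain (R : realType) (P Q c z : R) (b1 b2 : bool) : (b1 -> b2) -> 0 <= P -> 0 <= Q ->
  (~~ b1 -> b2 -> c * z <= P - Q) ->
  b1%:R * P + b2%:R * Q + c * ((~~ b1 && b2)%:R * z) <= b2%:R * P + b1%:R * Q.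
Proof.
by case: b1; case: b2 => //= h P0 Q0 hc; rewrite ?mul1r ?mul0r ?mulr0 ?addr0 ?add0r//;
  [exfalso; have := h isT|have := hc isT isT; lra].
Qed.

Lemma growth_alg (R : realType) (M p1 p2 q1 q2 c : R) : M * p1 + q2 + c <= M * p2 + q1 ->
  p1 * M - q1 + c <= p2 * M - q2.
Proof. by move=> *; lra. Qed.

Lemma decay_alg (R : realType) (M p1 p2 q1 q2 c : R) : q1 + M * p2 + c <= q2 + M * p1 ->
  p2 * M - q2 <= p1 * M - q1 - c.
Proof. by move=> *; lra. Qed.

Lemma far_low_pos (R : realType) (j z L : R) : 0 <= j -> `|L - j * z| <= `|j| / 2 * z -> `|j| / 2 * z <= L.
Proof. by move=> j0; rewrite (ger0_norm j0) ler_norml => /andP[? ?]; lra. Qed.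

Lemma far_low_neg (R : realType) (j z L : R) : j < 0 -> `|L - j * z| <= `|j| / 2 * z -> `|j| / 2 * z <= - L.
Proof. by move=> j0; rewrite (ltr0_norm j0) ler_norml => /andP[? ?]; lra. Qed.

(** * Vanishing of the leading coefficient at infinity *)

Section fundamental_constant.
Context {R : realType} (n : nat).
Local Notation Lb := (@lebesgue_rV R n.+1).
Local Notation V := 'rV[R]_n.+1.
Local Notation N := (n.+1%:R : R).
Implicit Types (e r m : R) (w : V).

Lemma annkE e e' m w : annk e e' m w = (e < enorm w <= e')%R%:R * enorm w `^ (- m).
Proof. by []. Qed.

Lemma annk_add r1 r2 r3 m w : r1 <= r2 -> r2 <= r3 -> annk r1 r3 m w = annk r1 r2 m w + annk r2 r3 m w.
Proof.
move=> h1 h2; rewrite !annkE -mulrDl; congr (_ * _).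
case: (ltP r1 (enorm w)) => a1; case: (leP (enorm w) r2) => a2 /=; rewrite ?add0r ?addr0.
- by rewrite (le_trans a2 h2).
- by [].
- by case: (ltP r2 (enorm w)) => // a3; have := lt_le_trans a3 a2; rewrite ltxx.
- by have := lt_le_trans a2 a1; rewrite ltNge h1.
Qed.

Lemma annkZ c r r' m w : 0 < c -> annk (c * r) (c * r') m (c *: w) = c `^ (- m) * annk r r' m w.
Proof.
move=> c0; rewrite !annkE enormZ gtr0_norm// ltr_pM2l// ler_pM2l// (powRM _ (ltW c0) (enorm_ge0 w)).
exact: mulrCA.
Qed.

Lemma nint_annk_gen r r' m : 0 < r -> 0 <= m -> nint Lb (annk r r' m).
Proof.
move=> r0 m0; have [r'0|r'0] := ltP 0 r'; last first.
  split; [exact: measurable_annk|exact: annk_ge0|].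
  rewrite (_ : (fun w => _) = cst 0%E) ?integral0 ?ltry//.
  apply/funext => w; rewrite annkE; case: (ltP r (enorm w)) => h1; rewrite ?mul0r//=.
  by rewrite leNgt (le_lt_trans r'0 (lt_trans r0 h1)) mul0r.
have N0 : (0 : R) < N by rewrite ltr0n.
apply: nint_le (nintZ (nint_ballk (n := n) (m := 0) N0 r'0) (powR_ge0 r (- m))) _.
- by mfun.
- exact: annk_ge0.
move=> w; rewrite annkE ballkE oppr0 powRr0 mulr1 mulrC.
case: (ltP r (enorm w)) => h1 /=; last first.
  by rewrite mulr0; apply: mulr_ge0 => //; exact: powR_ge0.
apply: ler_wpM2r => //; exact: ler_powRN (ltW h1) m0.
Qed.

Lemma annk_log_scale r r' c : 0 < c -> 0 < r -> ival Lb (annk (c * r) (c * r') N) = ival Lb (annk r r' N).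
Proof.
move=> c0 r0; have N0 : (0 : R) <= N by [].
have nr := nint_annk_gen r' r0 N0.
rewrite (ival_scale c0 (measurable_annk _ _ _) (annk_ge0 _ _ _)).
have E := etrans (eq_ival Lb (fun w => annkZ r r' N w c0)) (ivalZ nr (powR_ge0 c (- N))).
have E5 : c ^+ n.+1 * c `^ (- N) = 1 by rewrite (powR_dim _ _ c0) subrr powRr0.
exact: (etrans (congr1 (fun i => c ^+ n.+1 * i) E) (mulr_cancel _ E5)).
Qed.

(** The inner radius 1/2 makes the annulus, open on the inside, contain the one carrying [sphw],
    which is closed at 1. *)
Lemma annk_log_pos : 0 < ival Lb (annk 2^-1 (expR 1) N).
Proof.
have [s0 sl] := @sphw_total R n.
have h0 : (0 : R) < 2^-1 by rewrite invr_gt0.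
have N0 : (0 : R) <= N by [].
have ns : nint Lb (fun z : V => sphw z).
  by split; [exact: measurable_sphw|exact: sphw_ge0|exact: sl].
have s1 : 0 < ival Lb (fun z : V => sphw z) by rewrite ival_def.
apply: lt_le_trans s1 _; apply: (ival_le ns (nint_annk_gen (expR 1) h0 N0)) => z.
rewrite sphwE annkE indicE /annulus.
case: (boolP (z \in _)) => [|_]; last by rewrite mul0r mulr_ge0// powR_ge0.
rewrite inE/= => /andP[h1 h2]; rewrite mul1r.
have z0 : 0 < enorm z by apply: lt_le_trans h1.
have -> : (2^-1 < enorm z <= expR 1)%R.
  by rewrite (ltW h2) andbT; apply: lt_le_trans h1; rewrite invf_lt1// ltr1n.
by rewrite mul1r -{2}(lnK z0) expR_powR.
Qed.

(** The weight |w|^(-N) is invariant under dilation, so geometrically growing annuli carry equal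
    mass; q is the ratio e / (1/2) of the reference annulus. *)
Lemma annk_log_unbounded r (B : R) : 0 < r -> exists2 r', r <= r' & B <= ival Lb (annk r r' N).
Proof.
move=> r0; pose q : R := 2 * expR 1.
have N0 : (0 : R) <= N by [].
have e1 : (1 : R) <= expR 1 by rewrite -expR0 ler_expR.
have q1 : 1 <= q by rewrite /q; have := e1; lra.
have q0 : 0 < q by exact: lt_le_trans q1.
have step (r1 : R) : 0 < r1 -> ival Lb (annk r1 (q * r1) N) = ival Lb (annk 2^-1 (expR 1) N).
  move=> r10; have c0 : 0 < 2 * r1 by rewrite mulr_gt0.
  have h0 : (0 : R) < 2^-1 by rewrite invr_gt0.
  rewrite -(annk_log_scale (expR 1) c0 h0); congr (ival _ (annk _ _ _)); first by field.
  by rewrite /q; ring.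
have iter_ k : ival Lb (annk r (q ^+ k * r) N) = k%:R * ival Lb (annk 2^-1 (expR 1) N).
  elim: k => [|k IH].
    rewrite expr0 mul1r mul0r -[RHS](mul0r (ival Lb (annk 1 2 N))).
    have n1 := nint_annk_gen 2 ltr01 N0.
    rewrite -(ivalZ n1 (lexx 0)); apply: eq_ival => w; rewrite mul0r annkE.
    by case: (ltP r (enorm w)) => h; rewrite /= mul0r.
  have qk : 0 < q ^+ k * r by rewrite mulr_gt0// exprn_gt0.
  have h1 : r <= q ^+ k * r by rewrite ler_peMl ?(ltW r0)// exprn_ege1.
  have h2 : q ^+ k * r <= q ^+ k.+1 * r by rewrite exprS -mulrA ler_peMl// ltW.
  have n1 := nint_annk_gen (q ^+ k * r) r0 N0; have n2 := nint_annk_gen (q ^+ k.+1 * r) qk N0.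
  rewrite (eq_ival Lb (fun w => annk_add N w h1 h2)) (ivalD n1 n2) IH exprS -mulrA (step _ qk).
  by rewrite -[in RHS]natr1 mulrDl mul1r.
have A0 := annk_log_pos.
pose k := Num.bound `|B / ival Lb (annk 2^-1 (expR 1) N)|.
exists (q ^+ k * r); first by rewrite ler_peMl ?(ltW r0)// exprn_ege1.
rewrite iter_ -ler_pdivrMr//; apply: le_trans (ler_norm _) (ltW _).
exact: (archi_boundP (normr_ge0 _)).
Qed.

Variables (b d : R).
Hypotheses (b0 : 0 < b) (bN : b < N) (dN : N < d) (dN2 : d < N + 2) (bd : b + d = 2 * N).
Local Notation psi := (@psi R n b).
Local Notation Tr := (@trunc_int R n d).
Local Notation Lap := (@trunc_lap R n d).
Local Notation J := (ball_mass n b d).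

Lemma lap_psiE e w : Lap e psi w = psi w * ival Lb (tailk e d) - Tr e psi w.
Proof. by []. Qed.

Lemma ball_mass_growth (c r r' : R) : 0 <= c -> 0 < r -> r <= r' ->
  (forall w, r < enorm w -> c * enorm w `^ (- N) <= Lap 1 psi w) ->
  J r + c * ival Lb (annk r r' N) <= J r'.
Proof.
move=> c0 r0 rr hc; have r'0 := lt_le_trans r0 rr.
have m0 : 0 <= ival Lb (tailk 1 d) by apply: ival_ge0 => y; exact: tailk_ge0.
have N0 : (0 : R) <= N by [].
have p1 := nint_ballI_psi bN r0; have p2 := nint_ballI_psi bN r'0.
have q1 := nint_ballI_trunc b0 bN dN r0; have q2 := nint_ballI_trunc b0 bN dN r'0.
have na := nint_annk_gen r' r0 N0.
have h : {ae Lb, forall w, ival Lb (tailk 1 d) * (ballI r w * psi w) + ballI r' w * Tr 1 psi w +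
    c * annk r r' N w <= ival Lb (tailk 1 d) * (ballI r' w * psi w) + ballI r w * Tr 1 psi w}.
  apply: aeW => w; rewrite !(mulrCA (ival Lb (tailk 1 d))) annkE ltNge.
  apply: (annulus_gain (fun hh => le_trans hh rr) (mulr_ge0 m0 (psi_ge0 b w)) (trunc_psi_ge0 b d 1 w)).
  by rewrite -ltNge => h1 _; have := hc w h1; rewrite lap_psiE [psi w * _]mulrC.
have := ival_le32_ae (nintZ p1 m0) q2 (nintZ na c0) (nintZ p2 m0) q1 h.
rewrite (ivalZ p1 m0) (ivalZ p2 m0) (ivalZ na c0) => key.
exact: (growth_alg key).
Qed.

Lemma ball_mass_decay (c r r' : R) : 0 <= c -> 0 < r -> r <= r' ->
  (forall w, r < enorm w -> c * enorm w `^ (- N) <= - Lap 1 psi w) ->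
  J r' <= J r - c * ival Lb (annk r r' N).
Proof.
move=> c0 r0 rr hc; have r'0 := lt_le_trans r0 rr.
have m0 : 0 <= ival Lb (tailk 1 d) by apply: ival_ge0 => y; exact: tailk_ge0.
have N0 : (0 : R) <= N by [].
have p1 := nint_ballI_psi bN r0; have p2 := nint_ballI_psi bN r'0.
have q1 := nint_ballI_trunc b0 bN dN r0; have q2 := nint_ballI_trunc b0 bN dN r'0.
have na := nint_annk_gen r' r0 N0.
have h : {ae Lb, forall w, ballI r w * Tr 1 psi w + ival Lb (tailk 1 d) * (ballI r' w * psi w) +
    c * annk r r' N w <= ballI r' w * Tr 1 psi w + ival Lb (tailk 1 d) * (ballI r w * psi w)}.
  apply: aeW => w; rewrite !(mulrCA (ival Lb (tailk 1 d))) annkE ltNge.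
  apply: (annulus_gain (fun hh => le_trans hh rr) (trunc_psi_ge0 b d 1 w) (mulr_ge0 m0 (psi_ge0 b w))).
  by rewrite -ltNge => h1 _; have := hc w h1; rewrite lap_psiE [psi w * _]mulrC opprB.
have := ival_le32_ae q1 (nintZ p2 m0) (nintZ na c0) q2 (nintZ p1 m0) h.
rewrite (ivalZ p1 m0) (ivalZ p2 m0) (ivalZ na c0) => key.
exact: (decay_alg key).
Qed.

(** If j were not zero, [Lap 1 psi] would keep the sign of j and the size |j| |w|^(-N) / 2 far away,
    because the correction decays like |w|^(-(b + 2)) with b + 2 > N. The ball masses would then
    diverge logarithmically, against the bound B. *)
Lemma leading_coef_zero (j K r0 B : R) : 0 <= K -> (forall e, 0 < e -> e <= 16^-1 ->
  `|Lap e psi (axis n 1) - j| <= K * e `^ (N + 2 - d)) ->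
  (forall r, r0 <= r -> `|J r| <= B) -> j = 0.
Proof.
move=> K0 Hj HB; apply/eqP; apply: contraT => j0.
have h0 : 0 < b + 2 - N by have := bd; have := dN2; lra.
have j1 : 0 < `|j| by rewrite normr_gt0.
have [s s0 Hs] := small_powR K0 h0 (divr_gt0 j1 (ltr0Sn R 1)).
have s1 : 0 < s^-1 by rewrite invr_gt0.
pose r1 := Num.max 16 (Num.max r0 s^-1).
have r16 : 16 <= r1 by rewrite /r1 le_max lexx.
have rr0 : r0 <= r1 by rewrite /r1 !le_max lexx orbT.
have rs : s^-1 <= r1 by rewrite /r1 !le_max lexx !orbT.
have r10 : 0 < r1 by apply: lt_le_trans r16.
have c0 : 0 <= `|j| / 2 by rewrite divr_ge0.
have N0 : (0 : R) <= N by [].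
have far w : r1 < enorm w -> `|Lap 1 psi w - j * enorm w `^ (- N)| <= `|j| / 2 * enorm w `^ (- N).
  move=> hw; have w0 : 0 < enorm w by exact: lt_trans hw.
  apply: le_trans (lap_psi_far b0 bN dN bd K0 Hj (le_trans r16 (ltW hw))) _.
  have -> : enorm w `^ (- (b + 2)) = (enorm w)^-1 `^ (b + 2 - N) * enorm w `^ (- N).
    rewrite -(powR_inv1 (ltW w0)) -powRrM -powRD; last by rewrite (gt_eqF w0) implybT.
    by congr (_ `^ _); ring.
  rewrite mulrA; apply: ler_wpM2r; first exact: powR_ge0.
  apply: Hs; first by rewrite invr_gt0.
  by rewrite -[s]invrK lef_pV2 ?posrE//; exact: le_trans rs (ltW hw).
have B0 : 0 <= B by exact: le_trans (HB r1 rr0).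
have [r2 r12 Hr2] := annk_log_unbounded ((2 * B + 1) / (`|j| / 2)) r10.
rewrite ler_pdivrMr ?divr_gt0// in Hr2; rewrite mulrC in Hr2.
have b1 := HB r1 rr0; have b2 := HB r2 (le_trans rr0 r12).
have [jn|jp] := leP 0 j.
  have g w : r1 < enorm w -> `|j| / 2 * enorm w `^ (- N) <= Lap 1 psi w.
    by move=> hw; apply: far_low_pos jn (far w hw).
  have := ball_mass_growth c0 r10 r12 g; move: b1 b2; rewrite !ler_norml => /andP[? ?] /andP[? ?] ?.
  by exfalso; lra.
have g w : r1 < enorm w -> `|j| / 2 * enorm w `^ (- N) <= - Lap 1 psi w.
  by move=> hw; apply: far_low_neg jp (far w hw).
have := ball_mass_decay c0 r10 r12 g; move: b1 b2; rewrite !ler_norml => /andP[? ?] /andP[? ?] ?.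
by exfalso; lra.
Qed.

End fundamental_constant.

Lemma layer_cake (R : realType) (p : R) (b1 b2 : bool) : (b1 -> 1 <= p) -> (~~ b1 -> p <= 1) ->
  p * b2%:R + b1%:R <= p * b1%:R + b2%:R.
Proof.
by case: b1; case: b2 => /= h1 h2; rewrite ?mulr1 ?mulr0 ?add0r ?addr0//; [exact: h1|exact: h2].
Qed.

Lemma tail_alg (R : realType) (u0 z U : R) (b1 b2 : bool) : (b2 -> b1) -> 0 <= z -> U <= u0 -> 0 <= U ->
  (b2 -> U <= u0 / 2) -> b1%:R * z * U + u0 / 2 * (b2%:R * z) <= u0 * (b1%:R * z).
Proof.
move=> h z0 Uu U0 h2; have u00 : 0 <= u0 by exact: le_trans Uu.
case: b2 h h2 => h h2.
  rewrite h//; rewrite !mul1r; have := ler_wpM2r z0 (h2 isT); lra.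
rewrite mul0r mulr0 addr0; case: b1 {h} => /=; last by rewrite !mul0r mulr0.
by rewrite !mul1r mulrC; exact: ler_wpM2r.
Qed.

(** * Positivity of the mass at infinity *)

Section lower_bound.
Context {R : realType} (n : nat).
Local Notation Lb := (@lebesgue_rV R n.+1).
Local Notation V := 'rV[R]_n.+1.
Local Notation N := (n.+1%:R : R).
Implicit Types (e r m : R) (w : V).
Variables (b d : R).
Hypotheses (b0 : 0 < b) (bN : b < N) (dN : N < d) (dN2 : d < N + 2) (bd : b + d = 2 * N).
Local Notation psi := (@psi R n b).
Local Notation Tr := (@trunc_int R n d).
Local Notation J := (ball_mass n b d).
Local Notation U := (potential b (@ballI R n 1)).

Lemma tailkE e m w : tailk e m w = (e < enorm w)%R%:R * enorm w `^ (- m).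
Proof. Transparent tailk. by []. Opaque tailk. Qed.

Lemma trunc_intE e (g : V -> R) x : Tr e g x = ival Lb (fun y => tailk e d y * g (x + y)).
Proof. Transparent trunc_int. by []. Opaque trunc_int. Qed.

Lemma ballIE r w : ballI r w = (enorm w <= r)%R%:R.
Proof. by []. Qed.

Lemma psiN w : psi (- w) = psi w. Proof. by rewrite !psiE enormN. Qed.

Lemma nint_unit_pot y : nint Lb (fun z => ballI 1 z * psi (y - z)).
Proof.
have y1 : 0 < enorm y + 1 by rewrite ltr_pwDr// enorm_ge0.
apply: nint_le (nint_refl y (nint_ballk bN y1)) _.
- apply: measurable_funM; first exact: measurable_ballI.
  by mfun.
- by move=> z; rewrite mulr_ge0 ?psi_ge0.
move=> z; rewrite ballkE ballIE psiE; case: (leP (enorm z) 1) => h.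
  have -> : (enorm (y - z) <= enorm y + 1)%R.
    by apply: le_trans (enormD _ _) _; rewrite enormN lerD2l.
  by rewrite !mul1r.
by rewrite mul0r mulr_ge0// powR_ge0.
Qed.

Lemma psi_ge1 w : w != 0 -> enorm w <= 1 -> 1 <= psi w.
Proof.
by move=> w0 h; have ew : 0 < enorm w; [rewrite enorm_gt0|have := ler_powRN ew h (ltW b0); rewrite powR1 psiE].
Qed.

Lemma psi_le1 w : 1 <= enorm w -> psi w <= 1.
Proof. by move=> h; have := ler_powRN ltr01 h (ltW b0); rewrite powR1 psiE. Qed.

Lemma unit_pot0 : U 0 = ival Lb (fun z => ballI 1 z * psi z).
Proof. by rewrite potentialE; apply: eq_ival => z; rewrite sub0r psiN. Qed.

(** The Riesz kernel is at least 1 in the unit ball and at most 1 outside. So (psi - 1) times the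
    difference of the indicators of the ball and of its translate is nonnegative, and the volumes of
    the two balls cancel. *)
Lemma unit_pot_max y : U y <= U 0.
Proof.
have n1 := nint_ballI_psi bN (@ltr01 R); have n2 := nint_ballI b0 bN (@ltr01 R).
have n3 := nint_refl y n2; have n4 := nint_unit_pot y.
have n5 : nint Lb (fun z => psi z * ballI 1 (y - z)).
  by apply: (nint_reflE (x := y) n4) => w; rewrite subKr mulrC.
have E5 : U y = ival Lb (fun z => psi z * ballI 1 (y - z)).
  by rewrite potentialE; apply: (ival_reflE (x := y) n4) => w; rewrite subKr mulrC.
have n1' : nint Lb (fun z => psi z * ballI 1 z) by apply: eq_nint n1 => w; exact: mulrC.
have E1 : U 0 = ival Lb (fun z => psi z * ballI 1 z).
  by rewrite unit_pot0; apply: eq_ival => w; exact: mulrC.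
have h : {ae Lb, forall z, psi z * ballI 1 (y - z) + ballI 1 z <= psi z * ballI 1 z + ballI 1 (y - z)}.
  apply: (ae_rV_neq (a := 0)) => z z0; rewrite !ballIE; apply: layer_cake.
    by move=> hz; exact: psi_ge1.
  by rewrite -ltNge => /ltW hz; exact: psi_le1.
have := ival_le_ae (nintD n5 n2) (nintD n1' n3) h.
by rewrite (ivalD n5 n2) (ivalD n1' n3) -E5 -E1 (ival_refl y n2) lerD2r.
Qed.

Lemma ball_volume : 0 < ival Lb (@ballI R n 1).
Proof.
have e0 : 0 < (expR 1)^-1 :> R by rewrite invr_gt0 expR_gt0.
have h0 : (0 : R) < 2^-1 by rewrite invr_gt0.
have r0 : 0 < (expR 1)^-1 / 2 :> R by rewrite divr_gt0.
have N0 : (0 : R) <= N by [].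
have na := nint_annk_gen n 1 r0 N0.
have E : 0 < ival Lb (annk ((expR 1)^-1 / 2) 1 N).
  have := annk_log_scale n (expR 1) e0 h0; rewrite mulVf ?gt_eqF ?expR_gt0// => ->.
  exact: annk_log_pos.
have k0 : 0 <= ((expR 1)^-1 / 2) `^ N :> R by exact: powR_ge0.
apply: (@lt_le_trans _ _ (((expR 1)^-1 / 2) `^ N * ival Lb (annk ((expR 1)^-1 / 2) 1 N))).
  by rewrite mulr_gt0// powR_gt0.
rewrite -(ivalZ na k0); apply: (ival_le (nintZ na k0) (nint_ballI b0 bN (@ltr01 R))) => w.
rewrite annkE ballIE; case: (ltP ((expR 1)^-1 / 2) (enorm w)) => h /=; last by rewrite mul0r mulr0.
case: (leP (enorm w) 1) => h2; last by rewrite mul0r mulr0.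
have := ler_powRN r0 (ltW h) N0; rewrite mul1r => h3.
have := ler_wpM2l k0 h3; rewrite -powRD ?subrr ?powRr0//.
by rewrite (gt_eqF r0) implybT.
Qed.

Lemma unit_pot_ge : ival Lb (@ballI R n 1) <= U 0.
Proof.
rewrite unit_pot0; apply: ival_le_ae (nint_ballI b0 bN (@ltr01 R)) (nint_ballI_psi bN (@ltr01 R)) _.
apply: (ae_rV_neq (a := 0)) => z z0; rewrite ballIE.
by case: (leP (enorm z) 1) => h; rewrite ?mul0r// mul1r; exact: psi_ge1.
Qed.

(** At distance 2^(1/b) or more the Riesz kernel is at most 1/2, and the volume of the ball is at
    most U(0). *)
Lemma unit_pot_far : exists2 r, 0 < r & forall y, r < enorm y -> U y <= U 0 / 2.
Proof.
have t0 : 0 < (2 : R) `^ b^-1 by exact: powR_gt0.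
exists (1 + 2 `^ b^-1); first by rewrite addr_gt0.
move=> y hy; have n2 := nint_ballI b0 bN (@ltr01 R).
have half : (0 : R) <= 2^-1 by rewrite invr_ge0.
apply: (@le_trans _ _ (2^-1 * ival Lb (@ballI R n 1))); last first.
  by rewrite mulrC; apply: ler_wpM2r => //; exact: unit_pot_ge.
rewrite potentialE -(ivalZ n2 half); apply: (ival_le (nint_unit_pot y) (nintZ n2 half)) => z.
rewrite ballIE; case: (leP (enorm z) 1) => h; last by rewrite mul0r mulr0.
rewrite mul1r mulr1 psiE.
have hz : 2 `^ b^-1 <= enorm (y - z).
  by have := enorm_lb y (- z); rewrite enormN; lra.
apply: le_trans (ler_powRN t0 hz (ltW b0)) _.
by rewrite -powRrM mulrN mulVf ?gt_eqF// powR_inv1.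
Qed.

(** By scaling and Tonelli, the mass over the ball of radius 1/e is the truncated Laplacian at the
    origin of the potential U of the unit ball. It integrates U(0) - U(y), which is nonnegative
    everywhere and at least U(0)/2 for |y| > r1, so it is bounded below as e tends to 0. *)
Lemma ball_mass_ge : exists2 c, 0 < c & exists2 r0, 0 < r0 & forall r, r0 <= r -> c <= J r.
Proof.
have [r1 r10 Hr1] := unit_pot_far.
have U0 : 0 < U 0 by exact: lt_le_trans ball_volume unit_pot_ge.
have mpos : 0 < ival Lb (tailk r1 d).
  have [r' rr Hr'] := annk_log_unbounded n 1 r10.
  have r'0 := lt_le_trans r10 rr.
  have N0 : (0 : R) <= N by [].
  have k0 : 0 <= r' `^ (N - d) by exact: powR_ge0.
  have na := nint_annk_gen n r' r10 N0.
  apply: (@lt_le_trans _ _ (r' `^ (N - d) * ival Lb (annk r1 r' N))).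
    by apply: mulr_gt0; [exact: powR_gt0|exact: lt_le_trans Hr'].
  rewrite -(ivalZ na k0); apply: (ival_le (nintZ na k0) (nint_tailk dN r10)) => w.
  rewrite annkE tailkE; case: (ltP r1 (enorm w)) => h /=; last by rewrite !mul0r mulr0.
  case: (leP (enorm w) r') => h2; last by rewrite mul0r mulr0 mul1r powR_ge0.
  have w0 := lt_trans r10 h.
  rewrite !mul1r; have -> : enorm w `^ (- d) = enorm w `^ (N - d) * enorm w `^ (- N).
    by rewrite -powRD; [congr (_ `^ _); ring|rewrite (gt_eqF w0) implybT].
  apply: ler_wpM2r; first exact: powR_ge0.
  rewrite -opprB; apply: ler_powRN => //; by have := dN; lra.
exists (U 0 / 2 * ival Lb (tailk r1 d)); first by rewrite mulr_gt0// divr_gt0.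
exists r1^-1; first by rewrite invr_gt0.
move=> r hr; have r0 : 0 < r by apply: lt_le_trans hr; rewrite invr_gt0.
pose e := r^-1; have e0 : 0 < e by rewrite invr_gt0.
have er : e <= r1 by rewrite /e -[r1]invrK lef_pV2 ?posrE// invr_gt0.
have -> : r = 1 / e by rewrite /e div1r invrK.
have [_ ->] := ball_mass_scale b0 bN dN bd (@ltr01 R) e0.
have mU : mfunT U by apply: measurable_potential => //; exact: measurable_ballI.
have U_0 y : 0 <= U y by apply: potential_ge0.
have nt := nint_tailk (n := n) dN e0.
have ne : nint Lb (fun y => tailk e d y * U (0 + y)).
  apply: nint_le (nintZ nt (ltW U0)) _.
  - apply: measurable_funM; first exact: measurable_tailk.
    exact: measurable_shift.
  - by move=> y; exact: (mulr_ge0 (tailk_ge0 _ _ _) (U_0 _)).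
  - by move=> y; rewrite mulrC; apply: ler_wpM2r; [exact: tailk_ge0|exact: unit_pot_max].
have [nq Eq] := trunc_potential b0 bN dN (measurable_ballI 1) (ballI_ge0 1) (fun y _ => nint_unit_pot y) e0 ne.
(* The truncated integral of the Riesz kernel is radial, so the reflection in the potential at 0
   does not matter. *)
have E2 : ival Lb (fun w => ballI 1 w * Tr e psi w) = Tr e U 0.
  rewrite Eq; apply: eq_ival => z; congr (_ * _).
  by rewrite sub0r trunc_psi_radial [RHS]trunc_psi_radial enormN.
have half : 0 <= U 0 / 2 by rewrite divr_ge0// ltW.
have nt1 := nint_tailk (n := n) dN r10.
have := ival_le (nintD ne (nintZ nt1 half)) (nintZ nt (ltW U0)).
rewrite (ivalD ne (nintZ nt1 half)) (ivalZ nt1 half) (ivalZ nt (ltW U0)) -trunc_intE -E2 -unit_pot0.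
move=> key; rewrite lerBrDl; apply: key => y.
rewrite add0r !tailkE.
exact: (tail_alg (fun h => le_lt_trans er h) (powR_ge0 _ _) (unit_pot_max y) (U_0 y) (Hr1 y)).
Qed.

End lower_bound.

Opaque trunc_lap ball_mass.

Lemma bounded_from (R : realType) (F J L0 C K : R) : 0 < F -> `|L0 - F * J| <= C -> `|L0| <= K ->
  `|J| <= (C + K) / F.
Proof.
move=> F0 h1 h2; rewrite ler_pdivlMr// -{1}(ger0_norm (ltW F0)) -normrM mulrC.
have -> : F * J = L0 - (L0 - F * J) by ring.
by apply: le_trans (ler_normB _ _) _; lra.
Qed.

Lemma mass_cauchy (R : realType) (F J J' L0 L1 C K : R) (E E' : R) : 0 < F -> `|L0 - F * J| <= C * E ->
  `|L1 - F * J'| <= C * E' -> `|L0 - L1| <= K * E + K * E' ->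
  `|J - J'| <= (K + C) / F * E + (K + C) / F * E'.
Proof.
move=> F0 h1 h2 h3.
have -> : (K + C) / F * E + (K + C) / F * E' = ((K + C) * E + (K + C) * E') / F by field; rewrite gt_eqF.
rewrite ler_pdivlMr// -{1}(ger0_norm (ltW F0)) -normrM.
have -> : (J - J') * F = (L0 - L1) - (L0 - F * J) + (L1 - F * J') by ring.
apply: le_trans (ler_normD _ _) _; have := ler_normB (L0 - L1) (L0 - F * J); lra.
Qed.

Lemma limit_dist (R : realType) (F J c L0 e1 e2 eps : R) : 0 < F -> `|L0 - F * J| <= e1 ->
  `|J - c| <= e2 -> e1 <= eps / 2 -> F * e2 <= eps / 2 -> `|L0 - c * F| <= eps.
Proof.
move=> F0 h1 h2 h3 h4; have -> : L0 - c * F = (L0 - F * J) + F * (J - c) by ring.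
apply: le_trans (ler_normD _ _) _; rewrite normrM (ger0_norm (ltW F0)).
by have := ler_wpM2l (ltW F0) h2; lra.
Qed.

Lemma norm_chain (R : realType) (a b c M : R) : a <= b + c -> b <= M -> a <= M + c.
Proof. by move=> *; lra. Qed.

Lemma core_alg (R : realType) (L A E1 E2 I k u : R) : 0 <= A * k * u -> E2 <= E1 ->
  L * A * E1 * I + A * E2 * k * u <= (L * A * I + A * k * u) * E1.
Proof.
move=> h1 h2; have := ler_wpM2l h1 h2; lra.
Qed.

(** * Inversion of the Riesz potential *)

Section riesz_inverse.
Context {R : realType} (n : nat).
Local Notation Lb := (@lebesgue_rV R n.+1).
Local Notation V := 'rV[R]_n.+1.
Local Notation N := (n.+1%:R : R).
Implicit Types (e r m : R) (w x : V).
Variables (b d : R).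
Hypotheses (b0 : 0 < b) (bN : b < N) (dN : N < d) (dN2 : d < N + 2) (bd : b + d = 2 * N).
Local Notation psi := (@psi R n b).
Local Notation Lap := (@trunc_lap R n d).
Local Notation J := (ball_mass n b d).

Variables (f : V -> R).
Hypotheses (mf : mfunT f) (f0 : forall z, 0 <= f z).
Hypothesis (nf : forall y, y != 0 -> nint Lb (fun z => f z * psi (y - z))).
Hypothesis (fpos : forall x, x != 0 -> 0 < f x).
Hypothesis (ad : forall x, x != 0 -> admissible_at d (potential b f) x).
Hypothesis (sd : forall x, x != 0 -> exists rho M, [/\ 0 < rho, 0 <= M &
  forall y, enorm y <= rho -> `|potential b f (x + y) + potential b f (x - y) - 2 * potential b f x| <= M * enorm y ^+ 2]).
Hypothesis (lip : forall x, x != 0 -> exists rho L, [/\ 0 < rho, 0 <= L &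
  forall z, enorm (z - x) <= rho -> `|f z - f x| <= L * enorm (z - x)]).
Local Notation u := (potential b f).

Lemma lap_cauchy x : x != 0 -> exists rho K, [/\ 0 < rho, 0 <= K & forall e e', 0 < e -> e <= e' -> e' <= rho ->
  `|Lap e u x - Lap e' u x| <= K * e' `^ (N + 2 - d)].
Proof.
move=> x0; have [rho [M [r0 M0 HM]]] := sd x0.
have i0 : 0 <= ival Lb (ballk 1 (d - 2)) by apply: ival_ge0 => y; exact: ballk_ge0.
exists rho, (M * ival Lb (ballk 1 (d - 2))); split => //; first exact: mulr_ge0.
exact: (trunc_lap_cauchy dN dN2 (fun y => potential_ge0 b y f0) (measurable_potential b mf f0) (ad x0) M0 HM).
Qed.

Lemma axis1_neq0 : axis n (1 : R) != 0.
Proof. by rewrite -enorm_gt0 enorm_axis normr1. Qed.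

(** The borderline rate N in [core_estimate] gives a bounded error. At the unit vector the truncated
    Laplacians of u are bounded by [lap_cauchy], and f is positive there, so the ball masses stay
    bounded and [leading_coef_zero] applies. *)
Lemma improved_decay : lap_decay n b d (b + 2).
Proof.
have [j [K [K0 Hj]]] := lap_psi_cvg b0 bN dN dN2.
have x0 := axis1_neq0.
have [rho [M [r0 M0 HM]]] := lap_cauchy x0.
have [rho' [L [r'0 L0 HL]]] := lip x0.
have [A A0 HA] := lap_decay_dim b0 bN dN dN2 bd.
have tN : N - 1 < N by rewrite gtrBl.
have core := core_estimate b0 bN dN bd mf f0 nf x0 r'0 L0 A0 (ltW bN) (lexx N) tN (ad x0) HL HA.
have h0 : 0 <= N + 2 - d by have := dN2; lra.
suff j0 : j = 0 by move: Hj; rewrite j0; exact: (lap_decay_better b0 bN dN bd K0).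
have [B HB] : exists B, forall r, rho' / rho <= r -> `|J r| <= B.
  exists ((L * A * ival Lb (ballk rho' (N - 1)) + A * rho' `^ (b - N) * u (axis n 1) +
    (M * rho `^ (N + 2 - d) + `|Lap rho u (axis n 1)|)) / f (axis n 1)).
  move=> r hr; have rr : 0 < rho' / rho by rewrite divr_gt0.
  have rpos := lt_le_trans rr hr.
  have e0 : 0 < rho' / r by rewrite divr_gt0.
  have er : rho' / r <= rho by rewrite ler_pdivrMr// mulrC -ler_pdivrMr.
  have rE : r = rho' / (rho' / r) by rewrite invf_div mulrC divfK// gt_eqF.
  apply: (@bounded_from R (f (axis n 1)) (J r) (Lap (rho' / r) u (axis n 1))).
  - exact: fpos.
  - have := core (rho' / r) e0; rewrite -rE subrr !powRr0 !mulr1; exact.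
  - have := HM _ _ e0 er (lexx rho); have := ler_normD (Lap (rho' / r) u (axis n 1) - Lap rho u (axis n 1)) (Lap rho u (axis n 1)).
    by rewrite subrK; exact: norm_chain.
exact: (leading_coef_zero b0 bN dN dN2 bd K0 Hj HB).
Qed.

(** With the rate b + 2 = N + (N + 2 - d) available, the inner and outer errors both carry a
    positive power of e. *)
Lemma sharp_estimate x : x != 0 -> exists rho C, [/\ 0 < rho, 0 <= C & forall e, 0 < e -> e <= 1 ->
  `|Lap e u x - f x * J (rho / e)| <= C * e `^ ((N + 2 - d) / 2)].
Proof.
move=> x0; have [rho [L [r0 L0 HL]]] := lip x0; have [A A0 HA] := improved_decay.
(* The exponent t is taken halfway between N and b + 2: above N to gain a power of e, and below N +
   1 for the Lipschitz term to be integrable. *)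
have t1 : N + (N + 2 - d) / 2 - 1 < N by have := dN; lra.
have bt : b <= N + (N + 2 - d) / 2 by have := bN; have := dN2; lra.
have tm : N + (N + 2 - d) / 2 <= b + 2 by have := bd; have := dN2; lra.
have core := core_estimate b0 bN dN bd mf f0 nf x0 r0 L0 A0 bt tm t1 (ad x0) HL HA.
have i1 : 0 <= ival Lb (ballk rho (N + (N + 2 - d) / 2 - 1)) by apply: ival_ge0 => y; exact: ballk_ge0.
have u0 : 0 <= u x := potential_ge0 b x f0.
have k2 : 0 <= A * rho `^ (b - (b + 2)) * u x by rewrite mulr_ge0// mulr_ge0// powR_ge0.
exists rho, (L * A * ival Lb (ballk rho (N + (N + 2 - d) / 2 - 1)) + A * rho `^ (b - (b + 2)) * u x); split => //.
  exact: (addr_ge0 (mulr_ge0 (mulr_ge0 L0 A0) i1) k2).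
move=> e e0 e1; apply: le_trans (core e e0) _.
rewrite [N + _ - N]addrAC subrr add0r; apply: core_alg k2 _.
have -> : b + 2 - N = N + 2 - d by have := bd; lra.
have h0 : 0 < N + 2 - d by have := dN2; lra.
by apply: ger_powR; [rewrite e0|lra].
Qed.

(** At the unit vector the truncated Laplacians of u are Cauchy and f is positive, so
    [sharp_estimate] makes the ball masses converge to some c. These masses do not involve the
    point, so the same c serves at every x. *)
Theorem riesz_inverse : exists2 c, 0 < c & forall x, x != 0 ->
  forall eps, 0 < eps -> exists2 r, 0 < r & forall e, 0 < e -> e <= r -> `|Lap e u x - c * f x| <= eps.
Proof.
have h0 : 0 < (N + 2 - d) / 2 by have := dN2; lra.
have x0 := axis1_neq0; have F0 := fpos x0.
have [rho [C [r0 C0 HC]]] := sharp_estimate x0.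
have [rho' [K [r'0 K0 HK]]] := lap_cauchy x0.
have s0 : 0 < Num.min 1 rho' by rewrite lt_min ltr01.
have KC0 : 0 <= (K + C) / f (axis n 1) by apply: divr_ge0; [exact: addr_ge0|exact: ltW].
have hK e e' : 0 < e -> e <= e' -> e' <= Num.min 1 rho' ->
    `|Lap e u (axis n 1) - Lap e' u (axis n 1)| <= K * e' `^ ((N + 2 - d) / 2).
  move=> e0 ee; rewrite le_min => /andP[e1 er]; apply: le_trans (HK e e' e0 ee er) _.
  apply: ler_wpM2l => //; apply: ger_powR; first by rewrite (lt_le_trans e0 ee).
  by lra.
have [c Hc] : exists c, forall e, 0 < e -> e <= Num.min 1 rho' ->
    `|J (rho / e) - c| <= (K + C) / f (axis n 1) * e `^ ((N + 2 - d) / 2).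
  apply: cauchy_sup => // e e' e0 er e'0 e'r.
  have e1 : e <= 1 by move: er; rewrite le_min => /andP[].
  have e'1 : e' <= 1 by move: e'r; rewrite le_min => /andP[].
  apply: mass_cauchy F0 (HC e e0 e1) (HC e' e'0 e'1) _.
  have p1 := mulr_ge0 K0 (powR_ge0 e ((N + 2 - d) / 2)); have p2 := mulr_ge0 K0 (powR_ge0 e' ((N + 2 - d) / 2)).
  have [l|/ltW l] := leP e e'.
    by apply: le_trans (hK e e' e0 l e'r) _; rewrite lerDr.
  by rewrite distrC; apply: le_trans (hK e' e e'0 l er) _; rewrite lerDl.
have Jlim eps : 0 < eps -> exists2 r, 0 < r & forall r', r <= r' -> `|J r' - c| <= eps.
  move=> e0; have [r1 r10 Hr1] := small_powR KC0 h0 e0.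
  have m0 : 0 < Num.min r1 (Num.min 1 rho') by rewrite lt_min r10.
  exists (rho / Num.min r1 (Num.min 1 rho')); first by rewrite divr_gt0.
  move=> r' hr; have r'pos : 0 < r' by apply: lt_le_trans hr; rewrite divr_gt0.
  have q0 : 0 < rho / r' by rewrite divr_gt0.
  have : rho / r' <= Num.min r1 (Num.min 1 rho').
    by rewrite ler_pdivrMr// mulrC -ler_pdivrMr.
  rewrite le_min => /andP[q1 q2].
  have rE : r' = rho / (rho / r') by rewrite invf_div mulrC divfK// gt_eqF.
  by rewrite rE; apply: le_trans (Hc _ q0 q2) _; exact: Hr1.
exists c.
  (* The limit inherits the positive lower bound of the masses over large balls. *)
  have [k k0 [r1 r10 Hk]] := ball_mass_ge b0 bN dN bd.
  have k2 : 0 < k / 2 by rewrite divr_gt0.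
  have [r2 r20 H2] := Jlim _ k2.
  have := Hk (Num.max r1 r2); rewrite le_max lexx => /(_ isT) a1.
  have := H2 (Num.max r1 r2); rewrite le_max lexx orbT => /(_ isT); rewrite ler_norml => /andP[a2 a3].
  lra.
move=> x x_0 eps e0; have [rx [Cx [rx0 Cx0 HCx]]] := sharp_estimate x_0.
have fx := fpos x_0; have e2 : 0 < eps / 2 by rewrite divr_gt0.
have [r1 r10 Hr1] := small_powR Cx0 h0 e2.
have e3 : 0 < eps / 2 / f x by rewrite divr_gt0.
have [r2 r20 Hr2] := Jlim _ e3.
have q : 0 < rx / r2 by rewrite divr_gt0.
exists (Num.min 1 (Num.min r1 (rx / r2))); first by rewrite !lt_min ltr01 r10.
move=> e ep; rewrite !le_min => /and3P[e1 er1 er2].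
apply: (limit_dist fx (HCx e ep e1) (Hr2 (rx / e) _) (Hr1 e ep er1)).
  by rewrite ler_pdivlMr// mulrC -ler_pdivlMr.
by rewrite [leLHS]mulrC (divfK (lt0r_neq0 fx)).
Qed.

End riesz_inverse.

(** * From profiles to solutions *)

Section gamma.
Context {R : realType}.
Local Notation mu := (@lebesgue_measure R).

Lemma powR_le_expR (m t : R) : 0 < m -> 0 < t -> t `^ m <= m `^ m * expR t.
Proof.
move=> m0 t0; have r0 : 0 < t / m by rewrite divr_gt0.
have tE : t = m * (t / m) by rewrite mulrC divfK// gt_eqF.
rewrite {1}tE (powRM _ (ltW m0) (ltW r0)); apply: ler_wpM2l; first exact: powR_ge0.
rewrite -{1}(lnK r0) expR_powR ler_expR.
have /andP[h _] := ln_taylor2 r0.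
have h2 := ler_wpM2l (ltW m0) h; rewrite mulr0 !mulrBr -tE mulr1 in h2; lra.
Qed.

Lemma gamma_integrand_bound (x t : R) : 0 < x -> 0 < t ->
  t `^ (x - 1) * expR (- t) <= ((t <= 1)%R%:R * t `^ (- (1 - x))) +
    (x + 1) `^ (x + 1) * ((1 < t)%R%:R * t `^ (- 2)).
Proof.
move=> x0 t0; have e0 : 0 <= expR (- t) by exact: expR_ge0.
case: (leP t 1) => h.
  rewrite mul0r mulr0 addr0 mul1r opprB -[leRHS]mulr1; apply: ler_wpM2l; first exact: powR_ge0.
  by rewrite -expR0 ler_expR oppr_le0 ltW.
rewrite mul0r add0r mul1r; have x1 : 0 < x + 1 by lra.
have := powR_le_expR x1 t0.
have -> : t `^ (x - 1) = t `^ (x + 1) * t `^ (- 2).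
  by rewrite -powRD; [congr (_ `^ _); ring|rewrite (gt_eqF t0) implybT].
move=> hb; rewrite mulrAC; apply: ler_wpM2r; first exact: powR_ge0.
by have := ler_wpM2r e0 hb; rewrite -mulrA -expRD subrr expR0 mulr1.
Qed.

(** As a real number the integral would be 0 if it diverged, so finiteness must precede positivity.
    The dominating function is a ball kernel plus a tail kernel in dimension one. *)
Lemma gamma_gt0 (x : R) : 0 < x -> 0 < Gamma x.
Proof.
move=> x0; rewrite /Gamma /Rintegral integral_mkcond.
pose g (t : R) := \1_(`]0, +oo[%classic : set R) t * (t `^ (x - 1) * expR (- t)).
have g0 t : 0 <= g t by rewrite mulr_ge0// mulr_ge0 ?powR_ge0 ?expR_ge0.
have mg : mfunT g.
  apply: measurable_funM; first by apply: measurable_indic; exact: measurable_itv.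
  by mfun.
rewrite (_ : (_ \_ _) = EFin \o g); last first.
  apply/funext => t; rewrite patchE /= /g indicE; case: ifP => h.
    by rewrite mul1r.
  by rewrite mul0r.
have nb : nint (@lebesgue_rV R 1) (fun y => ballk 1 (1 - x) y + (x + 1) `^ (x + 1) * tailk 1 2 y).
  apply: nintD; first by apply: nint_ballk => //; lra.
  by apply: nintZ (powR_ge0 _ _); apply: nint_tailk => //; rewrite ltr1n.
have fin : (\int[mu]_t (g t)%:E < +oo)%E.
  have [_ _] := nb; apply: le_lt_trans.
  pose h (t : R) := ((t <= 1)%R%:R * t `^ (- (1 - x))) + (x + 1) `^ (x + 1) * ((1 < t)%R%:R * t `^ (- 2)).
  have mh : mfunT h.
    apply: measurable_funD.
      apply: measurable_funM; last exact: measurable_powR.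
      by apply: (@measurable_enorm_bool R _ _ id (fun t => t <= 1)); [exact: measurable_le_set|exact: measurable_id].
    apply: measurable_funM => //; apply: measurable_funM; last exact: measurable_powR.
    by apply: (@measurable_enorm_bool R _ _ id (fun t => 1 < t)); [exact: measurable_gt_set|exact: measurable_id].
  have h0 t : 0 <= h t by rewrite addr_ge0 ?mulr_ge0 ?powR_ge0// mulr_ge0// powR_ge0.
  have := @ge0_integral_rV1 R (EFin \o h) (measurable_to_EFin mh) (fun t => h0 t).
  rewrite /= => E.
  rewrite (_ : (\int[_]_y (_ + _)%:E = \int[@lebesgue_rV R 1]_y (h (enorm y))%:E)%E); last first.
    by apply: eq_integral => y _; rewrite ballkE tailkE.
  rewrite E; apply: gint_le => //; first exact: measurable_to_EFin.
  - by mfun.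
  move=> t; rewrite lee_fin /g indicE; case: (boolP (_ \in _)) => [|_]; last by rewrite mul0r.
  by rewrite inE/= in_itv/= andbT => t0; rewrite mul1r gtr0_norm//; exact: gamma_integrand_bound.
have pos : 0 < fine (\int[mu]_t (g t)%:E)%E; last exact: pos.
rewrite fine_gt0// fin andbT.
(* A lower bound of the integrand on [1, 2]; the minimum covers both signs of x - 1. *)
pose c := Num.min 1 (2 `^ (x - 1)) * expR (- 2).
have c0 : 0 < c by rewrite /c mulr_gt0 ?expR_gt0// lt_min ltr01 powR_gt0.
apply: (@lt_le_trans _ _ (\int[mu]_t (c * \1_(`[1, 2]%classic : set R) t)%:E)%E).
  rewrite (_ : (fun t => _) = (fun t => c%:E * (\1_(`[1, 2]%classic : set R) t)%:E)%E); last first.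
    by apply/funext => t; rewrite EFinM.
  rewrite gintZl//; first last.
  - exact: ltW.
  - by apply: measurable_to_EFin; apply: measurable_indic; exact: measurable_itv.
  rewrite integral_indic//.
  rewrite setIT; have m1 : mu (`[1, 2]%classic : set R) = 1%:E.
    by rewrite lebesgue_measure_itv/= lte_fin ltr1n -EFinD; congr (_%:E); lra.
  by apply: (eq_ind_r (fun z => 0%:E < c%:E * z)%E _ m1); rewrite mule1 lte_fin.
apply: gint_le => //.
- apply: measurable_to_EFin; apply: measurable_funM => //; apply: measurable_indic; exact: measurable_itv.
- by move=> t; rewrite lee_fin mulr_ge0// ltW.
- by mfun.
move=> t; rewrite lee_fin indicE; case: (boolP (_ \in _)) => [|_]; last by rewrite mulr0.
rewrite inE/= in_itv/= => /andP[t1 t2]; rewrite mulr1.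
have t0 : 0 < t by lra.
rewrite /g indicE mem_set ?mul1r; last by rewrite /= in_itv/= andbT.
rewrite /c; apply: ler_pM => //.
- rewrite ge_min; have [h|h] := leP 1 x.
    by have h1 : 0 <= x - 1 := (ltac:(lra)); have := ler_powR t1 h1; rewrite powRr0 => ->.
  apply/orP; right.
  have h1 : 0 <= 1 - x by lra.
  by have := ler_powRN t0 t2 h1; rewrite opprB.
- by rewrite ler_expR lerN2.
Qed.

Lemma kappa_gt0 n (s : R) : (0 < n)%N -> 0 < s -> s < 1 -> 0 < kappa n s.
Proof.
move=> n0 s0 s1; have N0 : (0 : R) < n%:R by rewrite ltr0n.
rewrite /kappa; apply: mulr_gt0 => //; apply: mulr_gt0; first by rewrite mulr_gt0 ?powR_gt0// pi_gt0.
by apply: divr_gt0; apply: gamma_gt0; lra.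
Qed.

End gamma.

Lemma kern_exponent (R : realType) (N c s t W k : R) :
  expR (N * s - c * (s + t)) * (expR (- (N - c) * s) * W) * k = expR (- c * t) * (k * W).
Proof.
rewrite mulrA -expRD (_ : N * s - c * (s + t) + - (N - c) * s = - c * t); last by ring.
by rewrite -mulrA (mulrC W).
Qed.

Lemma integral_reflected_cvl (R : realType) (k W : R -> R) (t : R) : kerOK k -> bfun W ->
  mfunT (fun s : R => k (t - s) * W s) /\
  (\int[@lebesgue_measure R]_s (k (t - s) * W s)%:E = (cvl k W t)%:E)%E.
Proof.
move=> ok bW; have [mk k0 _] := ok; have [mW W0 _] := bW.
have mts : mfunT (fun s : R => t - s) by mfun.
have mg : mfunT (fun s : R => k (t - s) * W s) by mfun.
split; first exact: mg.
have p0 (s : R) : (0 <= (k (t - s) * W s)%:E)%E by rewrite lee_fin mulr_ge0.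
rewrite (@ge0_integral_opp R _ (measurable_to_EFin mg) p0).
have mg' : mfunT (fun s : R => k (t - (- s)) * W (- s)).
  exact: (measurableT_comp mg (@oppr_measurable R setT)).
rewrite -(@ge0_integral_shift R (- t) _ (measurable_to_EFin mg') (fun s => p0 (- s))).
rewrite cvlE -(wintE ok (bfun_refl t bW)); apply: eq_integral => s _.
by congr (k _ * W _)%:E; ring.
Qed.

(** * Potentials and function spaces for power-weighted profiles *)

Section log_radial.
Context {R : realType} (n : nat).
Hypothesis n0 : (0 < n)%N.
Local Notation mu := (@lebesgue_measure R).
Local Notation Lb := (@lebesgue_rV R n.+1).
Local Notation V := 'rV[R]_n.+1.
Local Notation N := (n.+1%:R : R).

Implicit Types (W : R -> R) (x y : V).

Definition powfun (a : R) (W : R -> R) (x : V) : R := enorm x `^ (- a) * W (ln (enorm x)).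

Lemma measurable_ln_enorm : mfunT (fun y : V => ln (enorm y)).
Proof. by apply: (measurableT_comp (@measurable_ln R)); exact: measurable_enorm. Qed.

Lemma measurable_powfun a W : mfunT W -> mfunT (powfun a W).
Proof.
move=> mW; apply: measurable_funM; first by apply: measurable_powR_comp; exact: measurable_enorm.
by mfun.
Qed.

Lemma powfun_ge0 a W x : (forall t, 0 <= W t) -> 0 <= powfun a W x.
Proof. by move=> W0; rewrite mulr_ge0// powR_ge0. Qed.

Lemma powfun_le a W X x : (forall t, W t <= X) -> powfun a W x <= X * psi a x.
Proof. by move=> WX; rewrite /powfun psiE [X * _]mulrC; apply: ler_wpM2l => //; exact: powR_ge0. Qed.

(** The weight |y|^(-(N - c)) is the one for which all exponentials in the integration variable
    cancel in [riesz_radial], leaving a pure convolution and the outer factor |x|^(-c). *)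
Lemma riesz_power c k W (x : V) : x != 0 -> 0 <= k -> k <= 2 * c -> 2 * c - k < n%:R ->
  kerOK (kern n c 0) -> bfun W ->
  (\int[Lb]_y (enorm (x - y) `^ (- (2 * c)) * powfun (N - c) W y)%:E =
   (enorm x `^ (- c) * cvl (kern n c 0) W (ln (enorm x)))%:E)%E.
Proof.
move=> x0 k0 kc ck ok bW; have [mW W0 _] := bW; have [mk kk0 _] := ok.
pose f (s : R) := (expR (- (N - c) * s) * W s)%:E.
have mfr : mfunT (fun s => expR (- (N - c) * s) * W s) by mfun.
have f_0 s : (0 <= f s)%E by rewrite lee_fin mulr_ge0// expR_ge0.
have mx : mfunT (fun y : V => enorm (x - y) `^ (- (2 * c))) by mfun.
transitivity (\int[Lb]_y ((enorm (x - y) `^ (- (2 * c)))%:E * f (ln (enorm y))))%E.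
  apply: gint_ae_eq.
  - by apply: measurable_to_EFin; apply: measurable_funM => //; exact: measurable_powfun.
  - apply: emeasurable_funM; first exact: measurable_to_EFin.
    exact: (measurableT_comp (measurable_to_EFin mfr) measurable_ln_enorm).
  apply: (ae_rV_neq (a := 0)) => y y0; have ey : 0 < enorm y by rewrite enorm_gt0.
  by rewrite EFinM; congr (_ * _%:E)%E; rewrite /powfun -[in LHS](lnK ey) expRK expR_powR.
rewrite (riesz_radial _ x0 (measurable_to_EFin mfr) f_0).
set t := ln (enorm x).
have ex : enorm x = expR t by rewrite /t lnK// posrE enorm_gt0.
have [mg Eg] := integral_reflected_cvl t ok bW.
transitivity (\int[mu]_s (expR (- c * t) * (kern n c 0 (t - s) * W s))%:E)%E.
  apply: gint_ae_eq.
  - apply: emeasurable_funM; first apply: emeasurable_funM.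
    + apply: measurable_to_EFin; apply: (measurableT_comp (@measurable_expR R)).
      apply: measurable_funB; first exact: measurable_funM.
      by mfun.
    + by mfun.
    + by mfun.
  - by mfun.
  apply: aeR_imp (ae_neqR t) => s st.
  have ts : t - s != 0 by rewrite subr_eq0 eq_sym.
  by rewrite (kernE_fin n0 k0 kc ck ts) /f -!EFinM kern_exponent.
have g0 s : (0 <= (kern n c 0 (t - s) * W s)%:E)%E.
  by rewrite lee_fin; exact: (mulr_ge0 (kk0 _) (W0 _)).
transitivity (\int[mu]_s ((expR (- c * t))%:E * (kern n c 0 (t - s) * W s)%:E))%E.
  by apply: eq_integral => s _; rewrite EFinM.
rewrite (gintZl mu (measurable_to_EFin mg) g0 (expR_ge0 _)) Eg -EFinM.
by rewrite ex expR_powR.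
Qed.

Lemma nint_integrable (F : V -> R) : nint Lb F -> Lb.-integrable setT (EFin \o F).
Proof.
move=> [mF F0 Fl]; apply/integrableP; split; first exact: measurable_to_EFin.
by apply: le_lt_trans Fl; rewrite le_eqVlt; apply/orP; left; apply/eqP; apply: eq_integral => y _ /=; rewrite ger0_norm.
Qed.

Lemma in_L_powfun (s a X : R) W : 0 < s -> 0 < a -> a < N -> mfunT W -> (forall t, 0 <= W t) ->
  (forall t, W t <= X) -> in_L s (powfun a W).
Proof.
move=> s0 a0 aN mW W0 WX; have X0 : 0 <= X by exact: le_trans (W0 0) (WX 0).
have d0 : N < N + 2 * s by lra.
have e0 (y : V) : 0 <= enorm y `^ (N + 2 * s) by exact: powR_ge0.
have pos (y : V) : 0 < 1 + enorm y `^ (N + 2 * s) by have := e0 y; lra.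
have nb := nintZ (nintD (nint_ballk aN ltr01) (nint_tailk d0 ltr01)) X0.
have := nint_le (f := fun y : V => `|powfun a W y| / (1 + enorm y `^ (N + 2 * s))) _ _ nb _.
move=> H; apply: nint_integrable; apply: H.
- apply: measurable_funM.
    by apply: (measurableT_comp (@normr_measurable R setT)); exact: measurable_powfun.
  by mfun.
- by move=> y; rewrite divr_ge0// ltW.
move=> y; rewrite (ger0_norm (powfun_ge0 _ _ W0)) ler_pdivrMr//.
apply: le_trans (powfun_le a y WX) _; rewrite -mulrA; apply: ler_wpM2l => //.
rewrite psiE ballkE tailkE; case: (leP (enorm y) 1) => h.
  rewrite mul1r mul0r addr0 -{1}[enorm y `^ _]mulr1; apply: ler_wpM2l; first exact: powR_ge0.
  by have := e0 y; lra.
have y0 : 0 < enorm y by exact: lt_trans h.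
rewrite mul0r add0r mul1r mulrDr mulr1 -powRD ?addNr ?powRr0; last by rewrite (gt_eqF y0) implybT.
have h1 := ler_powRN ltr01 (ltW h) (ltW a0); rewrite powR1 in h1.
by have := powR_ge0 (enorm y) (- (N + 2 * s)); lra.
Qed.

(** Neither K nor the integrands are assumed measurable, so the comparison is made on the simple
    functions that define the integrals. *)
Lemma integral_subset_ge0 (K : set V) (f g : V -> \bar R) : (forall y, (0 <= f y)%E) -> (forall y, (0 <= g y)%E) ->
  (forall y, K y -> (f y <= g y)%E) -> (\int[Lb]_(y in K) f y <= \int[Lb]_y g y)%E.
Proof.
move=> f0 g0 fg; rewrite integral_mkcond.
have p0 y : (0 <= (f \_ K) y)%E by rewrite patchE; case: ifP.
rewrite !ge0_integralTE//; apply: le_ereal_sup => _ [h hf <-]; exists h => // y.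
apply: le_trans (hf y) _; rewrite patchE; case: ifPn => [|_]; last exact: g0.
by rewrite inE; exact: fg.
Qed.

Lemma L1_loc_powfun (a X : R) W : 0 < a -> a < N -> mfunT W -> (forall t, 0 <= W t) ->
  (forall t, W t <= X) -> L1_loc (powfun a W).
Proof.
move=> a0 aN mW W0 WX K cK; have X0 : 0 <= X by exact: le_trans (W0 0) (WX 0).
have [M [_ HM]] := compact_bounded cK.
pose r := N * (`|M| + 1).
have r0 : 0 < r by rewrite mulr_gt0// ltr_pwDr.
have Kr y : K y -> enorm y <= r.
  move=> Ky; apply: le_trans (enorm_le_mx_norm y) _; apply: ler_wpM2l => //.
  by apply: HM => //; have := ler_norm M; lra.
have nb := nintZ (nint_ballk aN r0) X0; have [mb pb lb] := nb.
apply/integrableP; split.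
  by apply: measurable_funTS; apply: measurable_to_EFin; exact: measurable_powfun.
apply: le_lt_trans lb; apply: integral_subset_ge0.
- by move=> y; exact: abse_ge0.
- by move=> y; rewrite lee_fin.
move=> y Ky /=; rewrite lee_fin (ger0_norm (powfun_ge0 _ _ W0)).
by apply: le_trans (powfun_le a y WX) _; rewrite psiE ballkE (Kr y Ky) mul1r.
Qed.

Lemma admissible_powfun (a d X : R) W (x : V) : 0 < a -> a < N -> N < d -> mfunT W ->
  (forall t, 0 <= W t) -> (forall t, W t <= X) -> admissible_at d (powfun a W) x.
Proof.
move=> a0 aN dN mW W0 WX e e0; have X0 : 0 <= X by exact: le_trans (W0 0) (WX 0).
apply: nint_le (nintZ (admissible_psi a0 aN dN x e0) X0) _.
- apply: measurable_funM; first exact: measurable_tailk.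
  exact: (measurable_shift x (measurable_powfun a mW)).
- by move=> y; exact: (mulr_ge0 (tailk_ge0 _ _ _) (powfun_ge0 _ _ W0)).
move=> y; have := ler_wpM2l (tailk_ge0 e d y) (powfun_le a (x + y) WX).
by rewrite [X in _ <= X -> _]mulrCA.
Qed.

Lemma frac_laplacian_truncE (s : R) (u : V -> R) (x : V) (e : R) : 0 < s -> 0 < e ->
  (forall y, 0 <= u y) -> admissible_at (N + 2 * s) u x ->
  frac_laplacian_trunc s u x e = (kappa n.+1 s * trunc_lap (N + 2 * s) e u x)%:E.
Proof.
move=> s0 e0 u0 ad; have dN : N < N + 2 * s by lra.
have n1 := nintZ (nint_tailk (n := n) dN e0) (u0 x); have n2 := ad e e0.
rewrite /frac_laplacian_trunc [RHS]EFinM; congr (_ * _)%E.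
rewrite integral_mkcond.
transitivity (\int[Lb]_y ((u x * tailk e (N + 2 * s) y)%:E - (tailk e (N + 2 * s) y * u (x + y))%:E))%E.
  apply: eq_integral => y _; rewrite patchE tailkE powRN.
  have [h|h] := ltP e (enorm y).
    by rewrite mem_set// !mul1r -EFinB; congr EFin; rewrite mulrBl [_^-1 * _]mulrC.
  rewrite memNset; last by rewrite /=; apply/negP; rewrite -leNgt.
  by rewrite !mul0r mulr0 -EFinB subr0.
rewrite (integralB_EFin measurableT (nint_integrable n1) (nint_integrable n2)).
rewrite (ivalE n1) (ivalE n2) (ivalZ (nint_tailk (n := n) dN e0) (u0 x)) -EFinB.
Transparent trunc_lap.
by rewrite /trunc_lap trunc_intE.
Opaque trunc_lap.
Qed.

End log_radial.

Opaque Gamma kappa.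

Lemma powfunE (R : realType) n (a : R) (W : R -> R) (x : 'rV[R]_n.+1) :
  powfun a W x = enorm x `^ (- a) * W (ln (enorm x)).
Proof. by []. Qed.

Lemma trunc_lapE (R : realType) n (d e : R) (g : 'rV[R]_n.+1 -> R) x :
  trunc_lap d e g x = g x * ival (lebesgue_rV n.+1) (tailk e d) - trunc_int d e g x.
Proof. Transparent trunc_lap. by []. Opaque trunc_lap. Qed.

(** The proportionality may fail at the origin, where the potential of f is not evaluated; a single
    point does not change the integral. *)
Lemma trunc_lapZ (R : realType) n (d e a : R) (g h : 'rV[R]_n.+1 -> R) x : 0 <= a -> 0 < e ->
  admissible_at d g x -> mfunT h -> (forall y, h y = a * g y \/ y = 0) -> h x = a * g x ->
  trunc_lap d e h x = a * trunc_lap d e g x.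
Proof.
move=> a0 e0 ad mh hg hx; rewrite !trunc_lapE hx mulrBr mulrA; congr (_ - _).
have na := ad e e0; have nz := nintZ na a0.
rewrite !trunc_intE -(ivalZ na a0); apply: ival_eq_ae.
- by mfun.
- by have [] := nz.
apply: (ae_rV_neq (a := - x)) => y yx.
have [->|xy] := hg (x + y); first exact: mulrCA.
by move/eqP: xy; rewrite addrC addr_eq0 (negbTE yx).
Qed.

Lemma fine_prod_alg (R : realType) (lp lq A B K V : R) : A * (lp * K) * (lq * (B * V)) = lp * lq * (A * B * (K * V)).
Proof. by ring. Qed.

Lemma powR_exponent_split (R : realType) (l p : R) : 0 < l ->
  l `^ p * l `^ (p - 1) = l * l `^ (2 * p - 2).
Proof.
move=> l0; have ln : l == 0 = false by exact: gt_eqF.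
rewrite -[in X in _ = X * _](powRr1 (ltW l0)) -!powRD ?ln ?implybT//; congr (_ `^ _); lra.
Qed.

(** * The solution built from a periodic profile *)

Section profile_to_solution.
Context {R : realType} (n : nat).
Local Notation Lb := (@lebesgue_rV R n.+1).
Local Notation V := 'rV[R]_n.+1.
Local Notation N := (n.+1%:R : R).
Variables (s al kapH kapG p T N0 C m X : R) (v : R -> R).
Hypotheses (n0 : (0 < n)%N) (s0 : 0 < s) (s1 : s < 1).
Hypotheses (okapH : kap_ok kapH N al) (okapG : kap_ok kapG N (2 * s)).
Hypotheses (p1 : 1 < p) (pb : p * (N - 2 * s) = N + al).
Local Notation b := (N - 2 * s).
Local Notation d := (N + 2 * s).
Local Notation H := (kern n ((N - al) / 2) 0 : R -> R).
Local Notation G := (kern n ((N - 2 * s) / 2) 0 : R -> R).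
Hypotheses (gH : goodk kapH ((N - al) / 2) H) (gG : goodk kapG ((N - 2 * s) / 2) G).
Hypotheses (T0 : 0 < T) (pv : bper T v) (m0 : 0 < m) (mv : forall t, m <= v t) (vX : forall t, v t <= X).
Hypotheses (N00 : 0 < N0) (C0 : 0 <= C) (vE : forall t, N0 * v t = cvl G (Fop H p v) t).
Hypothesis (v12 : forall h, `|h| <= 1 -> forall t, `|v (t + h) - v t| <= C * `|h| /\
  `|v (t + h) + v (t - h) - 2 * v t| <= C * h ^+ 2).

Lemma dim_ge2 : 2 <= N. Proof. by rewrite ler_nat ltnS. Qed.
Lemma b_gt0 : 0 < b. Proof. by have := dim_ge2; have := s1; lra. Qed.
Lemma b_ltN : b < N. Proof. by have := s0; lra. Qed.
Lemma d_gtN : N < d. Proof. by have := s0; lra. Qed.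
Lemma d_ltN2 : d < N + 2. Proof. by have := s1; lra. Qed.
Lemma bd_sum : b + d = 2 * N. Proof. by ring. Qed.


Lemma H_ker : kerOK H. Proof. by have [_ h _ _] := okapH; exact: goodk_ker gH h. Qed.
Lemma G_ker : kerOK G. Proof. by have [_ h _ _] := okapG; exact: goodk_ker gG h. Qed.

Local Notation W := (Fop H p v).
Local Notation f := (@powfun R n (d / 2) W).
Local Notation U := (@powfun R n (b / 2) v).

Lemma bper_W : bper T W.
Proof. by have [_ h _ _] := okapH; exact: (bper_Fop gH h p1 pv). Qed.

Lemma bfun_v : bfun v. Proof. exact: bper_bfun pv. Qed.
Lemma measurable_v : mfunT v. Proof. by have [] := bfun_v. Qed.
Lemma v_ge0 t : 0 <= v t. Proof. exact: bper_ge0 pv. Qed.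
Lemma measurable_W : mfunT W. Proof. by have [] := bper_bfun bper_W. Qed.
Lemma W_ge0 t : 0 <= W t. Proof. exact: bper_ge0 bper_W. Qed.

Lemma W_gt0 t : 0 < W t.
Proof.
have [_ h _ _] := okapH; have [del d0 Hd] := cvl_low T0 gH h.
have pp : 0 <= p by have := p1; lra.
have bp := bper_powR pp pv.
rewrite FopE; apply: mulr_gt0; last by apply: powR_gt0; exact: lt_le_trans (mv t).
apply: lt_le_trans (Hd _ t bp); apply: mulr_gt0 => //.
have mp0 : 0 <= m `^ p by exact: powR_ge0.
apply: (@lt_le_trans _ _ (per T (cst (m `^ p)))); first by rewrite per_cst// mulr_gt0// powR_gt0.
apply: (per_le T (bfun_cst mp0) (bper_bfun bp)) => r.
by apply: (ge0_ler_powR pp) => //; rewrite nnegrE ?v_ge0// ltW.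
Qed.

(** With 2c = N - 2s, [riesz_power] turns the equation N0 v = G * F(v) into the statement that N0 U
    is the Riesz potential of order 2s of f. *)
Lemma potential_integral x : x != 0 ->
  nint Lb (fun z => f z * psi b (x - z)) /\ potential b f x = N0 * U x.
Proof.
move=> x0; have [k0 k1 k2 k3] := okapG.
have kc : kapG <= 2 * ((N - 2 * s) / 2) by lra.
have ck : 2 * ((N - 2 * s) / 2) - kapG < n%:R by have := natr1 n (R := R); lra.
have := riesz_power n0 x0 k0 kc ck G_ker (bper_bfun bper_W).
have -> : N - (N - 2 * s) / 2 = d / 2 by lra.
have -> : 2 * ((N - 2 * s) / 2) = b by lra.
rewrite -vE => E.
have E2 : (\int[Lb]_z (f z * psi b (x - z))%:E = (N0 * U x)%:E)%E.
  rewrite [U x]powfunE [N0 * _]mulrCA -E; apply: eq_integral => z _; by rewrite psiE mulrC.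
split; last by rewrite potentialE ival_def E2.
split.
- apply: measurable_funM; first exact: measurable_powfun measurable_W.
  by mfun.
- by move=> z; exact: (mulr_ge0 (powfun_ge0 _ _ W_ge0) (psi_ge0 _ _)).
- by rewrite E2 ltry.
Qed.

Lemma admissible_U x : admissible_at d U x.
Proof.
have b2 : 0 < b / 2 by have := b_gt0; lra.
have b2N : b / 2 < N by have := b_ltN; have := b_gt0; lra.
exact: (admissible_powfun x b2 b2N d_gtN measurable_v v_ge0 vX).
Qed.

Lemma measurable_f : mfunT f.
Proof. exact: measurable_powfun measurable_W. Qed.

Lemma f_ge0 z : 0 <= f z. Proof. exact: powfun_ge0 W_ge0. Qed.

Lemma measurable_pot : mfunT (potential b f).
Proof. exact: measurable_potential measurable_f f_ge0. Qed.

Lemma pot_or y : potential b f y = N0 * U y \/ y = 0.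
Proof.
by have [->|y0] := eqVneq y 0; [right|left; have [] := potential_integral y0].
Qed.

Lemma admissible_pot x : admissible_at d (potential b f) x.
Proof.
move=> e e0; have nz := nintZ (admissible_U x e0) (ltW N00).
apply: nint_eq_ae nz.
- by apply: measurable_funM; [exact: measurable_tailk|exact: (measurable_shift x measurable_pot)].
- by move=> y; exact: (mulr_ge0 (tailk_ge0 _ _ _) (potential_ge0 b _ f_ge0)).
apply: (ae_rV_neq (a := - x)) => y yx.
have [->|xy] := pot_or (x + y); first exact: mulrCA.
by move/eqP: xy; rewrite addrC addr_eq0 (negbTE yx).
Qed.

Lemma v_diff1 h : `|h| <= 1 -> forall t, `|v (t + h) - v t| <= C * `|h|.
Proof. by move=> h1 t; have [] := v12 h1 t. Qed.

Lemma v_diff2 h : `|h| <= 1 -> forall t, `|v (t + h) + v (t - h) - 2 * v t| <= C * h ^+ 2.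
Proof. by move=> h1 t; have [] := v12 h1 t. Qed.

Lemma v_norm t : `|v t| <= X.
Proof. by rewrite ger0_norm ?v_ge0. Qed.

Lemma rfun_powfun (w : R -> R) (x : V) : rfun w (b / 4) x = powfun (b / 2) w x.
Proof. by rewrite rfunE powfunE; congr (_ `^ _ * _); lra. Qed.

Lemma pot_second_diff x : x != 0 -> exists rho M, [/\ 0 < rho, 0 <= M &
  forall y, enorm y <= rho -> `|potential b f (x + y) + potential b f (x - y) - 2 * potential b f x| <= M * enorm y ^+ 2].
Proof.
move=> x0; have [K K0 HK] := rfun_second_diff (b / 4) C0 v_diff1 v_diff2 v_norm x0.
have ex : 0 < enorm x by rewrite enorm_gt0.
exists (enorm x / 16), (N0 * K); split; [by rewrite divr_gt0|by rewrite mulr_ge0// ltW|].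
move=> y hy; have h := HK y hy.
have ne (z : V) : enorm z <= enorm x / 16 -> x + z != 0.
  by move=> hz; rewrite -enorm_gt0; have := enorm_lb x z; lra.
have [_ ->] := potential_integral x0.
have [_ ->] := potential_integral (ne y hy).
have hyN : enorm (- y) <= enorm x / 16 by rewrite enormN.
have [_ ->] := potential_integral (ne (- y) hyN).
rewrite !rfun_powfun in h.
have -> : N0 * U (x + y) + N0 * U (x - y) - 2 * (N0 * U x) = N0 * (U (x + y) + U (x - y) - 2 * U x) by ring.
by rewrite normrM (gtr0_norm N00) -mulrA ler_pM2l.
Qed.

Lemma W_lipschitz : exists2 L, 0 <= L & forall h, `|h| <= 1 -> forall t, `|W (t + h) - W t| <= L * `|h|.
Proof.
have mX : m <= X by exact: le_trans (mv 0) (vX 0).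
have [D D0 HD] := Fop_dist T H_ker p1 m0 mX.
exists (D * C); first exact: mulr_ge0.
move=> h h1 t; rewrite Fop_shift -mulrA.
apply: HD (bper_shift h pv) pv _ _ (v_diff1 h1) t => r; by rewrite mv vX.
Qed.

(** Near x the power of |z| and the logarithm are Lipschitz, and W is Lipschitz by the stability of
    [Fop] applied to v and its translate. *)
Lemma f_lipschitz x : x != 0 -> exists rho L, [/\ 0 < rho, 0 <= L &
  forall z, enorm (z - x) <= rho -> `|f z - f x| <= L * enorm (z - x)].
Proof.
move=> x0; have ex : 0 < enorm x by rewrite enorm_gt0.
have [L L0 HL] := W_lipschitz.
have q0 : 0 < 3 * enorm x / 4 by lra.
have qq : 3 * enorm x / 4 <= 5 * enorm x / 4 by lra.
have [K K0 HK] := powR_lipschitz (- (d / 2)) q0 qq.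
have xb : 3 * enorm x / 4 <= enorm x <= 5 * enorm x / 4 by apply/andP; split; lra.
have A0 : 0 <= enorm x `^ (- (d / 2)) by exact: powR_ge0.
have [B B0 HB] := bfun_bound (bper_bfun bper_W).
exists (enorm x / 4), (K * B + enorm x `^ (- (d / 2)) * (L * (2 * (enorm x)^-1))); split.
- by rewrite divr_gt0.
- by rewrite addr_ge0 ?mulr_ge0// invr_ge0 ltW.
move=> z hz.
have hn : `|enorm z - enorm x| <= enorm (z - x).
  rewrite ler_norml; apply/andP; split.
    by have := enormB z x; have := enormD z (x - z); rewrite [z + (x - z)]addrC subrK; lra.
  by have := enormD x (z - x); rewrite [x + _]addrC subrK; lra.
have hn4 : `|enorm z - enorm x| <= enorm x / 4 by exact: le_trans hz.
have xx4 : `|enorm x - enorm x| <= enorm x / 4 by rewrite subrr normr0; lra.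
have [l1 l2] := ln_half_lipschitz ex hn4 xx4.
have zb : 3 * enorm x / 4 <= enorm z <= 5 * enorm x / 4.
  by move: hn4; rewrite ler_norml => /andP[? ?]; apply/andP; split; lra.
have k1 := HK _ _ xb zb.
have lnE : ln (enorm z) = ln (enorm x) + (ln (enorm z) - ln (enorm x)) by ring.
have half (a c : R) : a / 2 - c / 2 = (a - c) / 2 by ring.
rewrite half normrM [`|2^-1|]gtr0_norm ?invr_gt0// in l1.
have ln1 : `|ln (enorm z) - ln (enorm x)| <= 2 * (enorm x)^-1 * enorm (z - x).
  have ix : 0 <= (enorm x)^-1 by rewrite invr_ge0 ltW.
  by have := ler_wpM2l ix hn; rewrite -mulrA; lra.
have ln2 : `|ln (enorm z) - ln (enorm x)| <= 1.
  have := ler_wpM2l (_ : 0 <= 2 * (enorm x)^-1) hz.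
  have -> : 2 * (enorm x)^-1 * (enorm x / 4) = 2^-1 by field; rewrite gt_eqF.
  by move=> hh; have := hh (ltac:(by rewrite mulr_ge0// invr_ge0 ltW)); lra.
have w1 := HL _ ln2 (ln (enorm x)); rewrite -lnE in w1.
have w2 : `|W (ln (enorm z)) - W (ln (enorm x))| <= L * (2 * (enorm x)^-1) * enorm (z - x).
  by apply: le_trans w1 _; rewrite -mulrA; exact: ler_wpM2l.
rewrite !powfunE.
have alg (a a' w w' : R) : `|a * w - a' * w'| <= `|a - a'| * `|w| + `|a'| * `|w - w'|.
  rewrite -!normrM (_ : a * w - a' * w' = (a - a') * w + a' * (w - w')); last by ring.
  exact: ler_normD.
apply: le_trans (alg _ _ _ _) _; rewrite [leRHS]mulrDl; apply: lerD.
  rewrite [leRHS]mulrAC; apply: ler_pM => //.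
    by apply: le_trans k1 _; exact: ler_wpM2l.
  by rewrite ger0_norm ?W_ge0.
by rewrite (ger0_norm A0) -[leRHS]mulrA; exact: ler_wpM2l.
Qed.

Lemma lap_limit : exists2 c, 0 < c & forall x, x != 0 ->
  forall eps, 0 < eps -> exists2 r, 0 < r & forall e, 0 < e -> e <= r ->
    `|trunc_lap d e U x - c * f x| <= eps.
Proof.
have nf y : y != 0 -> nint Lb (fun z => f z * psi b (y - z)) by move=> /potential_integral[].
have fp (x : V) : x != 0 -> 0 < f x.
  by move=> x0; rewrite powfunE; apply: mulr_gt0; [apply: powR_gt0; rewrite enorm_gt0|exact: W_gt0].
have [c c0 Hc] := riesz_inverse b_gt0 b_ltN d_gtN d_ltN2 bd_sum measurable_f f_ge0 nf fp
  (fun x _ => admissible_pot x) pot_second_diff f_lipschitz.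
exists (c / N0); first by rewrite divr_gt0.
move=> x x0 eps e0; have e1 : 0 < N0 * eps by rewrite mulr_gt0.
have [r r0 Hr] := Hc x x0 _ e1; exists r => // e ep er.
have := Hr e ep er.
have [_ px] := potential_integral x0.
rewrite (trunc_lapZ (ltW N00) ep (admissible_U x) measurable_pot pot_or px).
have -> : N0 * trunc_lap d e U x - c * f x = N0 * (trunc_lap d e U x - c / N0 * f x).
  by field; rewrite gt_eqF.
by rewrite normrM (gtr0_norm N00) ler_pM2l.
Qed.

Lemma scaled_solution : exists2 lam, 0 < lam &
  hartree_solution s al (@powfun R n (b / 2) (fun t => lam * v t)).
Proof.
have [c c0 Hc] := lap_limit.
have k0 : 0 < kappa n.+1 s by exact: kappa_gt0.
have q0 : 0 < 2 * p - 2 by have := p1; lra.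
have kc0 : 0 < kappa n.+1 s * c by exact: mulr_gt0.
(* The left side of the equation has degree 1 in u and the right side degree 2p - 1; lam^(2p - 2)
   absorbs the constants of the fractional Laplacian. *)
pose lam := (kappa n.+1 s * c) `^ (2 * p - 2)^-1.
have l0 : 0 < lam by exact: powR_gt0.
have lE : lam `^ (2 * p - 2) = kappa n.+1 s * c.
  by rewrite /lam -powRrM mulVf ?gt_eqF// powRr1// ltW.
have b2 : 0 < b / 2 by have := b_gt0; lra.
have b2N : b / 2 < N by have := b_ltN; have := b_gt0; lra.
have mlv : mfunT (fun t => lam * v t).
  by apply: measurable_funM; [exact: measurable_cst|exact: measurable_v].
have lv0 t : 0 <= lam * v t by exact: (mulr_ge0 (ltW l0) (v_ge0 t)).
have lvX t : lam * v t <= lam * X by rewrite ler_pM2l.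
have uE (x : V) : powfun (b / 2) (fun t => lam * v t) x = lam * U x.
  by rewrite !powfunE mulrCA.
exists lam => //; split.
- have -> : @powfun R n (b / 2) (fun t => lam * v t) = @rfun R (fun t => lam * v t) (b / 4) n.+1.
    by apply/funext => x; rewrite rfun_powfun.
  have lC0 : 0 <= lam * C by rewrite mulr_ge0// ltW.
  apply: (C11_loc_rfun (X := lam * X) (b / 4) lC0).
  + move=> h h1 t; rewrite -mulrBr normrM (gtr0_norm l0) -mulrA ler_pM2l//; exact: v_diff1.
  + move=> h h1 t; have -> : lam * v (t + h) + lam * v (t - h) - 2 * (lam * v t) =
      lam * (v (t + h) + v (t - h) - 2 * v t) by ring.
    by rewrite normrM (gtr0_norm l0) -mulrA ler_pM2l//; exact: v_diff2.
  + by move=> t; rewrite ger0_norm.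
- exact: in_L_powfun s0 b2 b2N mlv lv0 lvX.
- exact: L1_loc_powfun b2 b2N mlv lv0 lvX.
move=> x x0.
have pp : 0 <= p by have := p1; lra.
have pE : p_star n.+1 s al = p.
  by rewrite /p_star -pb mulfK// gt_eqF//; exact: b_gt0.
have Wp : bfun (fun t => lam `^ p * v t `^ p).
  exact: bfunZ (powR_ge0 _ _) (bfun_powR pp bfun_v).
have IE : riesz_potential al (fun y => powfun (b / 2) (fun t => lam * v t) y `^ p_star n.+1 s al) x =
    (enorm x `^ (- ((N - al) / 2)) * (lam `^ p * cvl H (fun t => v t `^ p) (ln (enorm x))))%:E.
  have [h0 h1 h2 h3] := okapH.
  have kc : kapH <= 2 * ((N - al) / 2) by lra.
  have ck : 2 * ((N - al) / 2) - kapH < n%:R by have := natr1 n (R := R); lra.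
  have := riesz_power n0 x0 h0 kc ck H_ker Wp.
  rewrite (cvlZ (ln (enorm x)) H_ker (bfun_powR pp bfun_v) (powR_ge0 lam p)) => <-.
  rewrite /riesz_potential; apply: eq_integral => y _; congr (_%:E); congr (_ `^ _ * _); first by lra.
  rewrite pE !powfunE.
  rewrite (powRM _ (powR_ge0 _ _) (lv0 _)) (powRM _ (ltW l0) (v_ge0 _)) -powRrM.
  by congr (_ `^ _ * _); have := pb; lra.
rewrite IE; split=> //.
have uN (y : V) : 0 <= powfun (b / 2) (fun t => lam * v t) y by exact: powfun_ge0.
have adu : admissible_at d (powfun (b / 2) (fun t => lam * v t)) x.
  exact: admissible_powfun b2 b2N d_gtN mlv lv0 lvX.
set l := (X in is_frac_laplacian _ _ _ X).
have lfE : l = lam * (kappa n.+1 s * c) * f x.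
  rewrite /l /= pE [in X in _ * X `^ _]powfunE.
  rewrite (powRM _ (powR_ge0 _ _) (lv0 _)) (powRM _ (ltW l0) (v_ge0 _)) -powRrM.
  rewrite [enorm x `^ _ * (lam `^ (p - 1) * _)]mulrCA.
  rewrite fine_prod_alg -lE [f x]powfunE FopE; congr (_ * (_ * _)).
    exact: powR_exponent_split.
  have ex : 0 < enorm x by rewrite enorm_gt0.
  by rewrite -powRD ?(gt_eqF ex) ?implybT//; congr (_ `^ _); have := pb; lra.
have lim (e : R) : 0 < e -> frac_laplacian_trunc s (powfun (b / 2) (fun t => lam * v t)) x e =
    (kappa n.+1 s * (lam * trunc_lap d e U x))%:E.
  move=> e0; rewrite (frac_laplacian_truncE s0 e0 uN adu); congr (_ * _)%:E.
  have ho y : powfun (b / 2) (fun t => lam * v t) y = lam * U y \/ y = 0 by left; exact: uE.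
  exact: (trunc_lapZ (ltW l0) e0 (admissible_U x) (measurable_powfun _ mlv) ho (uE x)).
rewrite /is_frac_laplacian; apply/fine_cvgP; split.
  near=> e; rewrite lim//; near: e; exact: nbhs_right_gt.
apply/cvgrPdist_le => eps eps0.
have kl : 0 < kappa n.+1 s * lam by exact: mulr_gt0.
have [r r0 Hr] := Hc x x0 _ (divr_gt0 eps0 kl).
near=> e; have e0 : 0 < e by near: e; exact: nbhs_right_gt.
have er : e <= r by near: e; exact: nbhs_right_le.
rewrite /= lim//= lfE distrC.
have -> : kappa n.+1 s * (lam * trunc_lap d e U x) - lam * (kappa n.+1 s * c) * f x =
  kappa n.+1 s * lam * (trunc_lap d e U x - c * f x) by ring.
have := Hr e e0 er; rewrite normrM (gtr0_norm kl) ler_pdivlMr// mulrC; exact.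
Unshelve. all: by end_near. Qed.

End profile_to_solution.

Lemma periodic_solutions (R : realType) n (s al : R) : (0 < n)%N -> 0 < s -> s < 1 ->
  0 < al -> al < n.+1%:R ->
  exists T1, forall T, 1 <= T -> exists v : R -> R,
    [/\ hartree_solution s al (@powfun R n ((n.+1%:R - 2 * s) / 2) v),
        forall t, v (t + T) = v t, forall t, 0 < v t &
        T1 <= T -> ~ exists c, forall t, v t = c].
Proof.
move=> n0 s0 s1 al0 alN; have N2 : 2 <= n.+1%:R :> R by rewrite ler_nat ltnS.
have [kapH [kapG [okH okG sub]]] := subcritical_exists N2 s0 s1 al0 alN.
have nE := natr1 n (R := R).
have [[H0 H1 H2 H3] [G0 G1 G2 G3]] := (okH, okG).
have b0 : 0 < n.+1%:R - 2 * s by lra.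
have cH0 : 0 < (n.+1%:R - al) / 2 by lra.
have cG0 : 0 < (n.+1%:R - 2 * s) / 2 by lra.
have gH : goodk kapH ((n.+1%:R - al) / 2) (kern n ((n.+1%:R - al) / 2) 0).
  by apply: (kern_goodk n0) => //; lra.
have gG : goodk kapG ((n.+1%:R - 2 * s) / 2) (kern n ((n.+1%:R - 2 * s) / 2) 0).
  by apply: (kern_goodk n0) => //; lra.
have pb : (n.+1%:R + al) / (n.+1%:R - 2 * s) * (n.+1%:R - 2 * s) = n.+1%:R + al.
  by rewrite divfK// gt_eqF.
have p1 : 1 < (n.+1%:R + al) / (n.+1%:R - 2 * s) by rewrite ltr_pdivlMr// mul1r; lra.
have [T1 HT1] := delaunay_profiles gH H1 gG G1 p1 H0 cH0 G0 cG0 sub.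
exists T1 => T T1le; have T0 : 0 < T by exact: lt_le_trans T1le.
have [v [K [C [m [pv m0 mv K0 [vE C0 v12 nc]]]]]] := HT1 T T1le.
have [X X0 vX] := bfun_bound (bper_bfun pv).
have [lam l0 sol] := scaled_solution n0 s0 s1 okH okG p1 pb gH gG T0 pv m0 mv vX K0 C0 vE v12.
exists (fun t => lam * v t); split => //.
- by move=> t; case: pv => _ ->.
- by move=> t; apply: (mulr_gt0 l0); exact: lt_le_trans (mv t).
move=> TT [c hc]; apply: (nc TT); exists (lam^-1 * c) => t.
by rewrite -(hc t) mulKf// gt_eqF.
Qed.

Theorem theorem1p2 (R : realType) (n : nat) (s alpha : R) (hn : (2 <= n)%N)
    (hs : 0 < s < 1) (halpha : alpha_star n s < alpha < n%:R) :
  exists (T0 : R) (u : R -> 'rV[R]_n -> R) (v : R -> R -> R),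
    (forall T : R, T0 <= T ->
      [/\ hartree_solution s alpha (u T),
          forall x : 'rV[R]_n, x != 0 -> 0 < u T x,
          forall x : 'rV[R]_n, x != 0 ->
            u T x = enorm x `^ (- ((n%:R - 2 * s) / 2)) * v T (ln (enorm x)) &
          forall t : R, v T (t + T) = v T t /\ 0 < v T t]) /\
    (\forall T \near +oo, ~ exists c : R, forall t : R, v T t = c).
Proof.
case: n hn halpha => [//|n] hn /andP[als alN].
have al0 : 0 < alpha by move: als; rewrite gt_max => /andP[].
have [s0 s1] := andP hs.
have [T1 H] := @periodic_solutions R n s alpha hn s0 s1 al0 alN.
have /choice[v Hv] : forall T : R, exists v : R -> R, 1 <= T ->
    [/\ hartree_solution s alpha (@powfun R n ((n.+1%:R - 2 * s) / 2) v),
        forall t, v (t + T) = v t, forall t, 0 < v t &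
        T1 <= T -> ~ exists c, forall t, v t = c].
  move=> T; have [/H[v ?]|_] := lerP 1 T; first by exists v.
  (* A default value: nothing is required of v for T < 1. *)
  by exists (cst 0).
(* T0 = 1 is the least period for which the unit intervals of the initial profile fit into one
   period each. *)
exists 1, (fun T => powfun ((n.+1%:R - 2 * s) / 2) (v T)), v; split.
  move=> T T1le; have [sol vT v0 _] := Hv T T1le; split => //.
  move=> x x0; rewrite powfunE mulr_gt0// powR_gt0 ?enorm_gt0//.
near=> T; have T1le : 1 <= T by near: T; exact: nbhs_pinfty_ge.
have T1le' : T1 <= T by near: T; apply: nbhs_pinfty_ge; exact: num_real.
by have [_ _ _ nc] := Hv T T1le; exact: nc T1le'.
Unshelve. all: by end_near. Qed.
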